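(* Let $\mathbf{X}: M\to\mathbb{E}^3$ be a non-flat minimal immersion of the oriented surface $M$, with induced metric $g$ and entropy differentials $(P_\ell)_{\ell\geqslant 2}$. Then: (i) for every $\ell\geqslant 2$ the differential $P_\ell$ is holomorphic away from umbilic points and extends meromorphically to all of $M$ with a pole of order $\ell$ at the umbilic points; (ii) for every $\ell\geqslant 2$ the differential $P_\ell$ depends on the induced metric $g$ and its derivatives up to order $\ell+4$ only; in particular, the differentials $(P_\ell)_{\ell\geqslant 2}$ are the same for all members of the associated family of minimal immersions of $\mathbf{X}$; (iii) the differentials $(P_\ell)_{\ell\geqslant 2}$ are invariant under Goursat transforms of the minimal immersion $\mathbf{X}$; (iv) the differentials $(P_\ell)_{\ell\geqslant 2}$ are invariant under (constant) rescaling of $\mathbf{X}$, i.e. $\mathbf{X}$ and $c\mathbf{X}$ have the same differentials for every non-zero real constant $c$.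
   Context: Surfaces are smooth and connected; $\mathbb{E}^3$ is Euclidean $3$-space. Let $\mathbf{X}:M\to\mathbb{E}^3$ be a minimal immersion of an oriented surface, with induced metric $g=d\mathbf{X}\cdot d\mathbf{X}$, Gauss curvature $K\leqslant 0$, and orientation-compatible Gauss map $\mathbf{N}=(\mathbf{N}^1,\mathbf{N}^2,\mathbf{N}^3):M\to S^2$. ''Non-flat'' means $K\not\equiv 0$. $M$ carries the complex structure determined by $g$ and the orientation. The umbilic points are the points where $K=0$; $M'$ denotes the complement of the set of umbilic points. The stereographically projected Gauss map $G=(\mathbf{N}^1+i\mathbf{N}^2)/(1-\mathbf{N}^3):M\to\hat{\mathbb{C}}=\mathbb{C}\cup\{\infty\}$ is meromorphic, and locally injective on $M'$. On $M'$ the metric $g_0=\sqrt{-K}\,g$ is flat. Entropy differentials. Let $L$ be the canonical bundle of $M$, and let $\nabla$ be the Levi-Civita connection of $g_0$. In a local holomorphic coordinate $z$ on $M'$ write $\nabla_{\partial_z}\partial_z=\gamma\,\partial_z$. For a section $\sigma=s\,dz^\ell$ of $L^\ell$ let $\sigma'=(\partial_z s-\ell\gamma s)\,dz^{\ell+1}$, a section of $L^{\ell+1}$ (independent of the coordinate). For a locally injective meromorphic function $f$ set $$\mathrm{S}^\nabla_2(f)=\frac{f'''}{f'}-\frac32\left(\frac{f''}{f'}\right)^2=\left(\{f,z\}+\tfrac12\gamma^2-\partial_z\gamma\right)dz^2,\qquad \{f,z\}=\frac{\partial_z^3f}{\partial_z f}-\frac32\left(\frac{\partial_z^2 f}{\partial_z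 f}\right)^2,$$ where at poles of $f$ one uses $\{f,z\}=\{1/f,z\}$, and $\mathrm{S}^\nabla_{\ell+1}(f)=(\mathrm{S}^\nabla_\ell(f))'$ for $\ell\geqslant 2$. The entropy differentials of $\mathbf{X}$ are $P_\ell=\mathrm{S}^\nabla_\ell(G)$, $\ell\geqslant 2$, defined on $M'$; $P_\ell$ is a differential of degree $\ell$ (a section of $L^\ell$). ''$P_\ell$ depends on $g$ and its derivatives up to order $k$ only'' means: the value of $P_\ell$ at a point $p\in M'$ is determined by the orientation and the values at $p$ of $g$ and its derivatives up to order $k$. Associated family and Goursat transforms. Suppose $\mathbf{X}=\mathrm{Re}(\tilde{\mathbf{X}})$ where $\tilde{\mathbf{X}}:M\to\mathbb{C}^3$ is a holomorphic null immersion, i.e. $\tilde{\mathbf{X}}^*\phi=0$ for the complex bilinear form $\phi(\mathbf{z},\mathbf{w})=z_1w_1+z_2w_2+z_3w_3$ (such $\tilde{\mathbf X}$ always exists if $M$ is simply connected). The members of the associated family of $\mathbf{X}$ are the minimal immersions $\mathrm{Re}(e^{i\theta}\tilde{\mathbf{X}})$, $\theta\in\mathbb{R}$; the Goursat transforms of $\mathbf{X}$ are the minimal immersions $\mathrm{Re}(B\tilde{\mathbf{X}})$, $B\in\mathrm{SO}(3,\mathbb{C})$. *)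

(* Defs.v *)
From mathcomp Require Import all_boot all_order all_algebra.
From mathcomp Require Import all_classical all_reals all_analysis.
From mathcomp Require Import complex.

Set Implicit Arguments.
Unset Strict Implicit.
Unset Printing Implicit Defensive.

Import Order.TTheory GRing.Theory Num.Theory numFieldNormedType.Exports.
Local Open Scope classical_set_scope.
Local Open Scope ring_scope.

Section PlaneCalculus.
Variable R : realType.
Local Notation plane := 'cV[R]_2.
Local Notation C := R[i].
Implicit Types (u v : plane) (a b : 'I_2).

Definition pder a (f : plane -> R) : plane -> R :=
  fun u => 'D_(delta_mx a 0) f u.

Definition pders (s : seq 'I_2) (f : plane -> R) : plane -> R :=
  foldr pder f s.

Definition smooth_on (O : set plane) (f : plane -> R) : Prop :=
  forall (s : seq 'I_2) u, O u ->
    {for u, continuous (pders s f)} /\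
    forall a, derivable (pders s f) u (delta_mx a 0).

Definition jac n (x : plane -> 'cV[R]_n) u : 'M[R]_(n, 2) :=
  \matrix_(k, a) pder a (fun v => x v k 0) u.

(* C is identified with the plane by x + iy <-> (x, y). *)
Definition to_C u : C := (u 0 0 +i* u 1 0)%C.
Definition of_C (w : C) : plane :=
  \col_a (if a == 0 then complex.Re w else complex.Im w).

Definition pderC a (f : plane -> C) : plane -> C := fun u =>
  (pder a (fun v => complex.Re (f v)) u +i*
   pder a (fun v => complex.Im (f v)) u)%C.

Definition jacC n (x : plane -> 'cV[C]_n) u : 'M[C]_(n, 2) :=
  \matrix_(k, a) pderC a (fun v => x v k 0) u.

(* The components of del_z = (del_x - i del_y) / 2. *)
Definition zeta a : C := (if a == 0 then 1 else (0 +i* (-1))%C) / 2%:R.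

Definition del_z (f : plane -> C) : plane -> C := fun u =>
  \sum_(a < 2) zeta a * pderC a f u.

(* R[i]^o is R[i] as a normed module over itself, so that derivability is
   complex differentiability. *)
Definition holomorphic_at (f : plane -> C) u : Prop :=
  derivable ((f \o of_C) : C^o -> C^o) (to_C u) 1.

(* D is the set where f is defined: near u it may miss u only. *)
Definition has_pole (D : set plane) (f : plane -> C) u (n : nat) : Prop :=
  exists h : C^o -> C^o,
    [/\ \forall w \near (to_C u : C^o), derivable h w 1,
        h (to_C u) != 0
      & \forall w \near (to_C u : C^o)^',
          D (of_C w) /\ f (of_C w) = h w / (w - to_C u) ^+ n].

Definition christoffel (g : plane -> 'M[R]_2) (k a b : 'I_2) : plane -> R :=
  fun u => 2%:R^-1 * \sum_(l < 2) invmx (g u) k l *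
    (pder a (fun v => g v b l) u + pder b (fun v => g v a l) u
     - pder l (fun v => g v a b) u).

(* The k-th component of nabla_{del_z} del_z in (del_x, del_y), for the
   Levi-Civita connection of g extended complex bilinearly. *)
Definition nabla_del_del (g : plane -> 'M[R]_2) (k : 'I_2) : plane -> C :=
  fun u => \sum_(a < 2) \sum_(b < 2)
    zeta a * zeta b * (christoffel g k a b u)%:C%C.

(* p del_x + q del_y = (p + i q) del_z + (p - i q) del_zbar. *)
Definition conn_coef (g : plane -> 'M[R]_2) : plane -> C := fun u =>
  nabla_del_del g 0 u + (0 +i* 1)%C * nabla_del_del g 1 u.

(* In [option C], the Riemann sphere, None is the point at infinity. *)
Definition sphere_inv (w : option C) : option C :=
  if w is Some c then (if c == 0 then None else Some c^-1) else Some 0.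

Definition schwarzian (f : plane -> C) : plane -> C := fun u =>
  del_z (del_z (del_z f)) u / del_z f u
  - (3%:R / 2%:R) * (del_z (del_z f) u / del_z f u) ^+ 2.

(* At a pole of f the Schwarzian is that of 1/f. *)
Definition schwarzianS (f : plane -> option C) : plane -> C := fun u =>
  if f u is Some _ then schwarzian (odflt 0 \o f) u
  else schwarzian (odflt 0 \o sphere_inv \o f) u.

(* The coefficient of the covariant derivative of s dz^l. *)
Definition cov_del (gam : plane -> C) (l : nat) (s : plane -> C) : plane -> C :=
  fun u => del_z s u - l%:R * gam u * s u.

(* The coefficient of dz^(n + 2) in the Schwarzian derivative of order n + 2. *)
Fixpoint schwarz_der (gam : plane -> C) (f : plane -> option C) (n : nat) :
    plane -> C :=
  if n is m.+1 then cov_del gam m.+2 (schwarz_der gam f m)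
  else fun u => schwarzianS f u + gam u ^+ 2 / 2%:R - del_z gam u.

End PlaneCalculus.

Section LocalSurface.
Variable R : realType.
Local Notation plane := 'cV[R]_2.
Local Notation E3 := 'cV[R]_3.
Local Notation C := R[i].

Definition dot (p q : E3) : R := \sum_(k < 3) p k 0 * q k 0.

(* Indices are added modulo 3. *)
Definition cross (p q : E3) : E3 :=
  \col_(k < 3) (p (k + 1) 0 * q (k + 2%:R) 0 - p (k + 2%:R) 0 * q (k + 1) 0).

Variable x : plane -> E3.
Implicit Types (u : plane).

Definition metric u : 'M[R]_2 :=
  \matrix_(a, b) dot (col a (jac x u)) (col b (jac x u)).

Definition unit_normal u : E3 :=
  let n := cross (col 0 (jac x u)) (col 1 (jac x u)) in
  (Num.sqrt (dot n n))^-1 *: n.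

Definition second_form u : 'M[R]_2 :=
  \matrix_(a, b) dot (\col_k pder a (pder b (fun v => x v k 0)) u)
                     (unit_normal u).

Definition mean_curvature u : R :=
  \tr (invmx (metric u) *m second_form u) / 2%:R.

Definition gauss_curvature u : R := \det (second_form u) / \det (metric u).

Definition flat_metric u : 'M[R]_2 :=
  Num.sqrt (- gauss_curvature u) *: metric u.

(* Indices 0, 1, 2 are the components 1, 2, 3 of the Gauss map. *)
Definition stereo_gauss u : option C :=
  let N := unit_normal u in
  if N 2%:R 0 == 1 then None
  else Some ((N 0 0 +i* N 1 0)%C / (1 - N 2%:R 0)%:C%C).

(* The coefficient of dz^l in P_l, for l >= 2, when (x, y) are isothermal. *)
Definition entropy (l : nat) : plane -> C :=
  schwarz_der (conn_coef flat_metric) stereo_gauss (l - 2).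

End LocalSurface.

Section Surfaces.
Variable R : realType.
Local Notation plane := 'cV[R]_2.
Local Notation C := R[i].

(* chart_map and chart_inv matter only on chart_dom and on its image. *)
Record chart (M : topologicalType) := Chart {
  chart_dom : set M;
  chart_map : M -> plane;
  chart_inv : plane -> M;
  chart_dom_open : open chart_dom;
  chart_image_open : open (chart_map @` chart_dom);
  chart_map_continuous : forall p, chart_dom p -> {for p, continuous chart_map};
  chart_inv_continuous : forall u, (chart_map @` chart_dom) u ->
    {for u, continuous chart_inv};
  chart_mapK : forall p, chart_dom p -> chart_inv (chart_map p) = p }.

Definition chart_cod (M : topologicalType) (c : chart M) : set plane :=
  chart_map c @` chart_dom c.

Definition oriented_compatible (M : topologicalType) (c d : chart M) : Prop :=
  let O := chart_map c @` (chart_dom c `&` chart_dom d) in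
  let t := chart_map d \o chart_inv c in
  (forall k, smooth_on O (fun u => t u k 0)) /\
  (forall u, O u -> 0 < \det (jac t u)).

(* A connected smooth oriented surface. *)
Record surface := Surface {
  carrier :> topologicalType;
  atlas : set (chart carrier);
  surface_hausdorff : hausdorff_space carrier;
  surface_second_countable : @second_countable carrier;
  surface_connected : connected [set: carrier];
  atlas_cover : forall p : carrier, exists2 c, atlas c & chart_dom c p;
  atlas_compatible : forall c d, atlas c -> atlas d ->
    oriented_compatible c d }.

End Surfaces.

Section Immersions.
Variables (R : realType) (M : surface R).
Local Notation plane := 'cV[R]_2.
Local Notation C := R[i].

Definition oriented_chart (c : chart R M) : Prop :=
  forall d, atlas d -> oriented_compatible c d /\ oriented_compatible d c.

Section OneMap.
Variable X : M -> 'cV[R]_3.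

Definition in_chart (c : chart R M) : plane -> 'cV[R]_3 := X \o chart_inv c.

Definition minimal_immersion : Prop :=
  forall c, oriented_chart c ->
    (forall k, smooth_on (chart_cod c) (fun u => in_chart c u k 0)) /\
    (forall u, chart_cod c u -> \rank (jac (in_chart c) u) = 2%N) /\
    (forall u, chart_cod c u -> mean_curvature (in_chart c) u = 0).

(* For a minimal immersion the umbilics are the zeros of the Gauss curvature. *)
Definition umbilic (p : M) : Prop :=
  forall c, oriented_chart c -> chart_dom c p ->
    gauss_curvature (in_chart c) (chart_map c p) = 0.

Definition nonflat : Prop := exists p, ~ umbilic p.

(* A local holomorphic coordinate of the complex structure determined by the
   induced metric and the orientation: an oriented isothermal chart. *)
Definition hol_coord (z : chart R M) : Prop :=
  oriented_chart z /\
  forall u, chart_cod z u ->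
    metric (in_chart z) u 0 0 = metric (in_chart z) u 1 1 /\
    metric (in_chart z) u 0 1 = 0.

(* The value dz_p(v), where v is a tangent vector
   at p given by its components in the chart c. *)
Definition dcoord (z c : chart R M) (p : M) (v : plane) : C :=
  to_C (jac (chart_map z \o chart_inv c) (chart_map c p) *m v).

(* The value of P_l at p as a homogeneous function on the tangent plane at p:
   (s dz^l)(v) = s(p) dz_p(v)^l. *)
Definition entropy_val (z c : chart R M) (p : M) (l : nat) (v : plane) : C :=
  entropy (in_chart z) l (chart_map z p) * dcoord z c p v ^+ l.

(* Xt is a holomorphic null immersion with real part X; holomorphy refers to
   the complex structure induced by X. *)
Definition holomorphic_null_lift (Xt : M -> 'cV[C]_3) : Prop :=
  [/\ forall p, X p = map_mx (@complex.Re R) (Xt p),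
      forall z, hol_coord z -> forall u, chart_cod z u ->
        forall k, holomorphic_at (fun v => Xt (chart_inv z v) k 0) u,
      forall c, oriented_chart c -> forall u, chart_cod c u ->
        (jacC (Xt \o chart_inv c) u)^T *m jacC (Xt \o chart_inv c) u = 0
    & forall c, oriented_chart c -> forall u, chart_cod c u ->
        forall v : plane,
          jacC (Xt \o chart_inv c) u *m map_mx (real_complex R) v = 0 -> v = 0].

End OneMap.

Definition associated (Xt : M -> 'cV[C]_3) (theta : R) : M -> 'cV[R]_3 :=
  fun p => map_mx (@complex.Re R) ((cos theta +i* sin theta)%C *: Xt p).

Definition goursat (Xt : M -> 'cV[C]_3) (B : 'M[C]_3) : M -> 'cV[R]_3 :=
  fun p => map_mx (@complex.Re R) (B *m Xt p).

End Immersions.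

Section Comparison.
Variable R : realType.
Implicit Types M N : surface R.

(* The tangent planes at p and q are identified through the charts c and d. *)
Definition entropy_agree M N (X : M -> 'cV[R]_3) (Y : N -> 'cV[R]_3)
    (c : chart R M) (d : chart R N) (p : M) (q : N) (l : nat) : Prop :=
  forall z w, hol_coord X z -> chart_dom z p ->
    hol_coord Y w -> chart_dom w q ->
    forall v, entropy_val X z c p l v = entropy_val Y w d q l v.

Definition same_metric_jet M N (X : M -> 'cV[R]_3) (Y : N -> 'cV[R]_3)
    (c : chart R M) (d : chart R N) (p : M) (q : N) (k : nat) : Prop :=
  forall (s : seq 'I_2) (a b : 'I_2), (size s <= k)%N ->
    pders s (fun u => metric (in_chart X c) u a b) (chart_map c p) =
    pders s (fun u => metric (in_chart Y d) u a b) (chart_map d q).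

Definition same_entropy_differentials M (X Y : M -> 'cV[R]_3) : Prop :=
  forall p, (umbilic X p <-> umbilic Y p) /\
    (~ umbilic X p -> forall l, (2 <= l)%N ->
       forall c, oriented_chart c -> chart_dom c p ->
         entropy_agree X Y c c p p l).

End Comparison.

(* Main.v *)
(* In an isothermal parameter z, a minimal X has phi = del_z X holomorphic with phi.phi = 0. Writing
   w = phi'.phi' and s = phi''.phi'', the Gauss map (a quotient of components of phi) has a Schwarzian that is a
   rational expression in s, w and the derivatives of w, and g_0 = 2 |beta| |dz|^2 with beta^2 = w, so that
   gamma = w' / (4 w); hence P_l is an explicit rational expression in s and w. It is holomorphic where w <> 0.
   At an umbilic, beta = z^m k with m >= 1 (unique continuation rules out beta = 0), and induction on l gives
   P_l = H_l / z^l with H_2(0) = - m / 2 - 3 m^2 / 8 and H_(l+1)(0) = - l (1 + m / 2) H_l(0), all nonzero.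

   With mu = K_z / (2 K) and e the conformal factor one finds P_2 = mu_z - gamma mu - mu^2 / 2 and
   gamma = mu + e_z / e. In arbitrary oriented parameters, del_z is proportional to the Beltrami operator of
   the metric, and the unknown factor z_x cancels from these formulas, while K is given by Brioschi's formula:
   P_l therefore depends on the metric alone.

   A Goursat transform, a member of the associated family or a rescaling changes phi to A phi with
   A^T A = c 1, which keeps phi.phi = 0 and multiplies s and w by c; the expression for P_l is homogeneous of
   degree 0 in (s, w).

   Isothermal parameters near a point are obtained from a coordinate function of X and its conjugate, which
   exists because the coordinates of a minimal surface are harmonic. *)

Require Import Defs.
From HB Require Import structures.
From mathcomp Require Import all_boot all_order all_algebra.
From mathcomp Require Import all_classical all_reals all_analysis.
From mathcomp Require Import complex ring lra.
Set Implicit Arguments.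
Unset Strict Implicit.
Unset Printing Implicit Defensive.
Import Order.TTheory GRing.Theory Num.Theory numFieldNormedType.Exports.
Local Open Scope classical_set_scope.
Local Open Scope ring_scope.

(** * Calculus in the plane *)

(** The Gauss map and the Hopf coefficient [beta] involve the unit normal, on which complex linear
    maps of [phi] act in no simple way; [w] and [s] are built from [phi] alone and see [A] only
    through [A^T A]. Conversely, curvature and umbilics are read off from [beta], and the metric
    enters through the conformal factor. The two descriptions are tied together by [beta^2 = w] and
    by the formula [sdotE] for [s].

    Dependence on the metric is invisible in isothermal parameters: two surfaces with the same jet
    at a point have unrelated isothermal coordinates, whose derivatives the jet does not determine.
    In arbitrary parameters [z_x^l P_l] is computed from the metric, and evaluating [dz^l] on a
    tangent vector supplies exactly the factor [z_x^l]. For a single surface the same argument shows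
    that the value of [P_l] does not change with the isothermal coordinate. *)

Section PlaneBasics.
Variable R : realType.
Local Notation plane := 'cV[R]_2.
Implicit Types (u v h : plane) (f g : plane -> R) (a b : 'I_2) (O : set plane).

Local Notation e a := (delta_mx a 0 : plane).

Lemma plane_eqP u v : u 0 0 = v 0 0 -> u 1 0 = v 1 0 -> u = v.
Proof.
move=> h0 h1; apply/matrixP => i j; rewrite ord1.
case: (unliftP ord0 i) => [k|] ->; last by [].
by rewrite ord1 (_ : lift _ _ = 1) //; apply/val_inj.
Qed.

Lemma plane_decomp u : u = u 0 0 *: e 0 + u 1 0 *: e 1.
Proof. by apply: plane_eqP; rewrite !mxE /= ?mulr1 ?mulr0 ?addr0 ?add0r. Qed.

Lemma ord2P (P : 'I_2 -> Prop) : P 0 -> P 1 -> forall a, P a.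
Proof.
move=> P0 P1 i; case: (unliftP ord0 i) => [k|] ->; last by [].
by rewrite ord1 (_ : lift _ _ = 1) //; apply/val_inj.
Qed.

Lemma norm_coord u a : `|u a 0| <= `|u|.
Proof.
rewrite [leRHS]/Num.Def.normr/= mx_normrE.
exact: (le_bigmax _ (fun i : 'I_2 * 'I_1 => `|u i.1 i.2|) (a, 0)).
Qed.

Lemma norm_planeP u (r : R) : 0 <= r ->
  reflect (`|u 0 0| <= r /\ `|u 1 0| <= r) (`|u| <= r).
Proof.
move=> r0; apply: (iffP idP) => [ur|[u0 u1]].
  by split; apply: le_trans (norm_coord _ _) ur.
rewrite /Num.Def.normr/= mx_normrE bigmax_le // => -[i j] _ /=.
by rewrite ord1; elim/ord2P: i.
Qed.

Lemma norm_plane_ltP u (r : R) : 0 < r ->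
  reflect (`|u 0 0| < r /\ `|u 1 0| < r) (`|u| < r).
Proof.
move=> r0; apply: (iffP idP) => [ur|[u0 u1]].
  by split; apply: le_lt_trans (norm_coord _ _) ur.
rewrite /Num.Def.normr/= mx_normrE bigmax_lt // => -[i j] _ /=.
by rewrite ord1; elim/ord2P: i.
Qed.

Lemma norm_e a : `|e a| = 1.
Proof.
apply/eqP; rewrite eq_le; apply/andP; split.
  apply/norm_planeP => //; rewrite !mxE.
  by elim/ord2P: a => /=; rewrite normr0 normr1 lexx ler01.
by apply: le_trans (norm_coord _ a); rewrite mxE !eqxx normr1.
Qed.

Lemma open_ballP O u : open O -> O u ->
  exists2 r : R, 0 < r & forall v, `|v - u| < r -> O v.
Proof.
move=> oO Ou; have /nbhs_ballP[r r0 rO] := open_nbhs_nbhs (conj oO Ou).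
exists r => // v vu; apply: rO; rewrite -ball_normE /=.
by rewrite distrC.
Qed.

Lemma near_ballP (P : set plane) u :
  (\forall v \near u, P v) <-> exists2 r : R, 0 < r & forall v, `|v - u| < r -> P v.
Proof.
split=> [/nbhs_ballP[r r0 rO]|[r r0 rO]].
  by exists r => // v vu; apply: rO; rewrite -ball_normE /= distrC.
apply/nbhs_ballP; exists r => // v; rewrite -ball_normE /= distrC.
exact: rO.
Qed.

Lemma open_near O u : open O -> O u -> \forall v \near u, O v.
Proof. by move=> oO Ou; apply: open_nbhs_nbhs. Qed.

Definition linform (p q : R) : plane -> R := fun h => h 0 0 * p + h 1 0 * q.

Lemma linform_linear p q : linear (linform p q).
Proof. by move=> k x y; rewrite /linform !mxE /GRing.scale /=; ring. Qed.

HB.instance Definition _ p q :=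
  GRing.isLinear.Build R plane R _ (linform p q) (linform_linear p q).

Lemma linform_continuous p q : continuous (linform p q).
Proof.
have c i : continuous (fun h : plane => h i 0) by exact: coord_continuous.
move=> x; exact: (cvgD (cvgM (c 0 x) (cvg_cst p)) (cvgM (c 1 x) (cvg_cst q))).
Qed.

(** Uniqueness of the differential identifies it with the given linear form; the hypothesis has the
    shape in which estimates come out of the mean value theorem. *)
Lemma diff_build f u p q :
  (forall eps, 0 < eps -> \forall h \near (0 : plane),
     `|f (h + u) - f u - linform p q h| <= eps * `|h|) ->
  differentiable f u /\ 'd f u = linform p q :> (plane -> R).
Proof.
move=> H.
have E : f \o shift u = cst (f u) + linform p q +o_ (0 : plane) id.
  apply/eqaddoP => eps eps0; have := H _ eps0.
  by apply: filterS => h /=; rewrite /GRing.add /GRing.opp /= /cst opprD addrA.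
have D := diff_unique (@linform_continuous p q) E.
split => //; apply/diff_locallyP; rewrite D; split => //.
exact: linform_continuous.
Qed.

Lemma pder_diff a f u : differentiable f u -> pder a f u = 'd f u (e a).
Proof. by move=> df; rewrite /pder deriveE. Qed.

Lemma diffE_pder f u v : differentiable f u ->
  'd f u v = linform (pder 0 f u) (pder 1 f u) v.
Proof.
by move=> df; rewrite !pder_diff // /linform [in LHS](plane_decomp v) linearD !linearZ.
Qed.

Lemma diff_boundP f u : differentiable f u -> forall eps, 0 < eps ->
  \forall h \near (0 : plane),
    `|f (h + u) - f u - linform (pder 0 f u) (pder 1 f u) h| <= eps * `|h|.
Proof.
move=> df eps eps0; have /diff_locallyP[_ /eqaddoP/(_ _ eps0)] := df.
apply: filterS => h /=; rewrite /GRing.add /GRing.opp /= /cst opprD addrA.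
by rewrite diffE_pder.
Qed.

(** Turns a directional derivative into a derivative in one real variable, to which the mean value
    theorem and the fundamental theorem of calculus apply. *)
Lemma is_derive_slice f u v (t : R) : derivable f (u + t *: v) v ->
  is_derive t 1 (fun s : R => f (u + s *: v)) ('D_v f (u + t *: v)).
Proof.
have E : (fun h : R => h^-1 *: (((fun s : R => f (u + s *: v)) \o shift t) (h *: (1 : R)) -
      f (u + t *: v))) =
   (fun h : R => h^-1 *: ((f \o shift (u + t *: v)) (h *: v) - f (u + t *: v))).
  apply/funext => h /=; congr (_ *: (f _ - _)).
  by rewrite [h *: 1]mulr1 scalerDl addrCA addrA.
by move=> dv; apply: DeriveDef; rewrite /derivable /derive E.
Qed.

(** Derivability on the symmetric segment [|s| <= |t|] covers both signs of [t] at once. *)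
Lemma MVT_slice f u v (t : R) :
  (forall s : R, `|s| <= `|t| -> derivable f (u + s *: v) v) ->
  exists2 s : R, `|s| <= `|t| & f (u + t *: v) - f u = t * 'D_v f (u + s *: v).
Proof.
move=> H; pose g s := f (u + s *: v); pose dg s := 'D_v f (u + s *: v).
have Hg (s : R) : `|s| <= `|t| -> is_derive s 1 g (dg s) by move=> /H; exact: is_derive_slice.
have cg (s : R) : `|s| <= `|t| -> {for s, continuous g}.
  by move=> /Hg [/derivable1_diffP dg_ _]; exact: differentiable_continuous.
have g0 : g 0 = f u by rewrite /g scale0r addr0.
have [t0|t0] := leP 0 t.
  have in1 (s : R) : s \in `[0, t] -> `|s| <= `|t|.
    by rewrite in_itv /= => /andP[s0 st]; rewrite !ger0_norm.
  have [||s sI E] := @MVT_segment _ g dg 0 t t0.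
  - by move=> x; rewrite in_itv /= => /andP[x0 xt]; apply/Hg/in1; rewrite in_itv /= !ltW.
  - apply: continuous_in_subspaceT => x xI; apply: cg; apply: in1.
    by rewrite inE in xI.
  by exists s; [exact: in1|rewrite -/(g t) -g0 E subr0 mulrC].
have in1 (s : R) : s \in `[t, 0] -> `|s| <= `|t|.
  by rewrite in_itv /= => /andP[s0 st]; rewrite !ler0_norm ?lerN2 // ltW.
have [||s sI E] := @MVT_segment _ g dg t 0 (ltW t0).
- by move=> x; rewrite in_itv /= => /andP[x0 xt]; apply/Hg/in1; rewrite in_itv /= !ltW.
- apply: continuous_in_subspaceT => x xI; apply: cg; apply: in1.
  by rewrite inE in xI.
exists s; first exact: in1.
by rewrite -/(g t) -g0 -opprB E sub0r mulrN opprK mulrC.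
Qed.

(** The increment is taken along a path parallel to the axes; the mean value theorem applies to each
    leg, and continuity of the partial derivatives at [u] bounds the error. *)
Lemma C1_differentiable f u :
  (\forall v \near u, forall a, derivable f v (e a)) ->
  (forall a, {for u, continuous (pder a f)}) -> differentiable f u.
Proof.
move=> Hd Hc; apply: (proj1 (@diff_build f u (pder 0 f u) (pder 1 f u) _)).
move=> eps eps0; have eps20 : 0 < eps / 2 by rewrite divr_gt0.
have /near_ballP[r1 r10 H1] := Hd.
have near2 a : exists2 r, 0 < r & forall v, `|v - u| < r ->
    `|pder a f v - pder a f u| <= eps / 2.
  have /cvgrPdist_le /(_ _ eps20) := Hc a.
  move=> /near_ballP[r r0 Hr]; exists r => // v /Hr.
  by rewrite distrC.
have [r2 r20 H2] := near2 0; have [r3 r30 H3] := near2 1.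
apply/near_ballP; exists (Num.min r1 (Num.min r2 r3)).
  by rewrite !lt_min r10 r20.
move=> h; rewrite subr0 !lt_min => /and3P[hr1 hr2 hr3].
have small (s t : R) : `|s| <= `|h 0 0| -> `|t| <= `|h 1 0| ->
    `|(u + s *: e 0 + t *: e 1) - u| <= `|h|.
  move=> hs ht; apply/norm_planeP => //; rewrite !mxE /= !(mulr1, mulr0, addr0, add0r).
  rewrite (addrC (u 0 0)) (addrC (u 1 0)) !addrK; split.
    exact: le_trans hs (norm_coord _ _).
  exact: le_trans ht (norm_coord _ _).
have [|s hs Es] := @MVT_slice f u (e 0) (h 0 0).
  move=> s hs; apply: (H1 _ _ 0); apply: le_lt_trans hr1.
  by have := small s 0 hs; rewrite scale0r addr0 normr0 => ->.
have [|t ht Et] := @MVT_slice f (u + h 0 0 *: e 0) (e 1) (h 1 0).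
  by move=> t ht; apply: (H1 _ _ 1); apply: le_lt_trans hr1; apply: small.
have -> : h + u = u + h 0 0 *: e 0 + h 1 0 *: e 1.
  by rewrite addrC [in LHS](plane_decomp h) addrA.
have -> : f (u + h 0 0 *: e 0 + h 1 0 *: e 1) - f u - linform (pder 0 f u) (pder 1 f u) h
  = h 0 0 * (pder 0 f (u + s *: e 0) - pder 0 f u) +
    h 1 0 * (pder 1 f (u + h 0 0 *: e 0 + t *: e 1) - pder 1 f u).
  move/(canRL (subrK _)): Es => Es; move/(canRL (subrK _)): Et => Et.
  by rewrite Et Es /pder /linform; ring.
apply: le_trans (ler_normD _ _) _; rewrite !normrM (splitr eps) mulrDl.
have hsmall : `|u + s *: e 0 - u| <= `|h|.
  by have := small s 0 hs; rewrite scale0r addr0 normr0 => ->.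
apply: lerD; rewrite [leRHS]mulrC; apply: ler_pM => //.
- exact: norm_coord.
- by apply: H2; apply: le_lt_trans hr2.
- exact: norm_coord.
- by apply: H3; apply: le_lt_trans hr3; apply: small.
Qed.

End PlaneBasics.

(** * Smooth functions and their closure properties *)

Section SmoothCalculus.
Variable R : realType.
Local Notation plane := 'cV[R]_2.
Implicit Types (u v h : plane) (f g : plane -> R) (a b : 'I_2) (O : set plane)
  (t : plane -> plane).

Local Notation e a := (delta_mx a 0 : plane).

Lemma near_pder a f g u : (\forall v \near u, f v = g v) -> pder a f u = pder a g u.
Proof. by move=> fg; rewrite /pder; apply: near_eq_derive. Qed.

Lemma pder_ext_on O a f g : open O -> {in O, f =1 g} -> {in O, pder a f =1 pder a g}.
Proof.
move=> oO fg u; rewrite inE => Ou; apply: near_pder.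
by apply: filterS (open_near oO Ou) => v Ov; apply: fg; rewrite inE.
Qed.

Lemma pders_rcons s a f : pders (rcons s a) f = pders s (pder a f).
Proof. by rewrite /pders foldr_rcons. Qed.

Lemma differentiable_ext_on O f g u : open O -> {in O, f =1 g} -> O u ->
  differentiable f u -> differentiable g u.
Proof.
move=> oO fg Ou df.
have nfg : \forall v \near u, f v = g v.
  by apply: filterS (open_near oO Ou) => v Ov; apply: fg; rewrite inE.
apply: (proj1 (@diff_build _ g u (pder 0 f u) (pder 1 f u) _)) => eps eps0.
have nfg' : \forall h \near (0 : plane), f (h + u) = g (h + u).
  have /near_ballP[r r0 rP] := nfg.
  by apply/near_ballP; exists r => // h hr; apply: rP; rewrite addrK -[h]subr0.
have := diff_boundP df eps0; apply: filterS2 nfg' => h ->.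
by rewrite (fg u) ?inE.
Qed.

Lemma smooth_pder O f a : smooth_on O f -> smooth_on O (pder a f).
Proof.
by move=> sf s u Ou; rewrite -pders_rcons; apply: sf.
Qed.

Lemma smooth_diff O f u : open O -> smooth_on O f -> O u -> differentiable f u.
Proof.
move=> oO sf Ou; apply: C1_differentiable.
  by apply: filterS (open_near oO Ou) => v Ov a; exact: (proj2 (sf [::] v Ov) a).
by move=> a; exact: (proj1 (sf [:: a] u Ou)).
Qed.

Lemma smooth_sub O O' f : O `<=` O' -> smooth_on O' f -> smooth_on O f.
Proof. by move=> OO' sf s u /OO'; apply: sf. Qed.

(** A coinduction principle: iterated derivatives never leave a class that is stable under one
    partial derivative, up to equality on [O]. It replaces explicit formulas for higher derivatives
    of products, quotients and composites. *)
Lemma smooth_on_coind O (P : (plane -> R) -> Prop) : open O ->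
  (forall f, P f -> forall u, O u -> differentiable f u) ->
  (forall f a, P f -> exists2 g, P g & {in O, g =1 pder a f}) ->
  forall f, P f -> smooth_on O f.
Proof.
move=> oO Pd Pp.
have H s : forall f, P f -> exists2 g, P g & {in O, g =1 pders s f}.
  elim: s => [|a s IH] f Pf; first by exists f.
  have [g Pg Eg] := IH f Pf; have [k Pk Ek] := Pp g a Pg; exists k => // u uO.
  by rewrite Ek //= (pder_ext_on a oO Eg).
move=> f Pf s u Ou; have [g Pg Eg] := H s f Pf.
have dg : differentiable (pders s f) u by apply: (differentiable_ext_on oO Eg Ou); apply: Pd.
by split=> [|a]; [exact: differentiable_continuous | exact: diff_derivable].
Qed.

Lemma pder_cst a (c : R) : pder a (fun=> c) = fun=> 0.
Proof. by apply/funext => u; rewrite /pder; apply: derive_cst. Qed.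

Lemma pder_coord a b u : pder a (fun v => v b 0) u = (a == b)%:R.
Proof.
have d : derivable (fun v : plane => v) u (e a) by exact: derivable_id.
by have := derive_mx d; rewrite derive_id => /matrixP/(_ b 0); rewrite !mxE eqxx andbT eq_sym.
Qed.

Lemma pderD a f g u : differentiable f u -> differentiable g u ->
  pder a (fun v => f v + g v) u = pder a f u + pder a g u.
Proof.
by move=> df dg; apply: (@deriveD _ _ _ f g); apply: diff_derivable.
Qed.

Lemma pderN a f u : differentiable f u -> pder a (fun v => - f v) u = - pder a f u.
Proof. by move=> df; apply: (@deriveN _ _ _ f); apply: diff_derivable. Qed.

Lemma pderM a f g u : differentiable f u -> differentiable g u ->
  pder a (fun v => f v * g v) u = pder a f u * g u + f u * pder a g u.
Proof.
move=> df dg; rewrite /pder (@deriveM _ _ f g); try exact: diff_derivable.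
by rewrite /GRing.scale /=; ring.
Qed.

Lemma pderV a f u : differentiable f u -> f u != 0 ->
  pder a (fun v => (f v)^-1) u = - (pder a f u * (f u)^-1 * (f u)^-1).
Proof.
move=> df fu; rewrite /pder (@deriveV _ _ f) //; last exact: diff_derivable.
by rewrite /GRing.scale /= expr2 invfM mulNr; congr (- _); ring.
Qed.

Lemma differentiable_planeP t u :
  (forall b, differentiable (fun v => t v b 0) u) -> differentiable t u.
Proof.
move=> dt; have -> : t = (fun v => t v 0 0 *: e 0) + (fun v => t v 1 0 *: e 1).
  by apply/funext => v; rewrite [LHS]plane_decomp.
by apply: differentiableD; apply: differentiableZl.
Qed.

Lemma differentiable_comp_plane f t u : differentiable f (t u) ->
  (forall b, differentiable (fun v => t v b 0) u) -> differentiable (f \o t) u.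
Proof.
by move=> df dt; apply: differentiable_comp => //; apply: differentiable_planeP.
Qed.

Lemma pder_comp a f t u : differentiable f (t u) ->
  (forall b, differentiable (fun v => t v b 0) u) ->
  pder a (f \o t) u = pder 0 f (t u) * pder a (fun v => t v 0 0) u +
                      pder 1 f (t u) * pder a (fun v => t v 1 0) u.
Proof.
move=> df dt; have dt' := differentiable_planeP dt.
rewrite pder_diff; last exact: differentiable_comp_plane.
rewrite diff_comp //= diffE_pder // /linform -deriveE //.
have H b : ('D_(e a) t u) b 0 = pder a (fun v => t v b 0) u.
  by rewrite derive_mx ?mxE //; apply: diff_derivable.
by rewrite !H; congr (_ + _); rewrite mulrC.
Qed.

Lemma differentiable_sqrt f u : differentiable f u -> 0 < f u ->
  differentiable (fun v => Num.sqrt (f v)) u.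
Proof.
move=> df f0; apply: (@differentiable_comp _ _ _ _ f Num.sqrt) => //.
by apply/derivable1_diffP; have [] := is_derive1_sqrt f0.
Qed.

Lemma pder_sqrt a f u : differentiable f u -> 0 < f u ->
  pder a (fun v => Num.sqrt (f v)) u = pder a f u * (2^-1 * (Num.sqrt (f u))^-1).
Proof.
move=> df f0; have ds := is_derive1_sqrt f0.
have dd : differentiable Num.sqrt (f u) by apply/derivable1_diffP; have [] := ds.
rewrite pder_diff; last exact: differentiable_sqrt.
have := @diff_comp _ _ _ _ f Num.sqrt u df dd.
rewrite /comp => -> /=; rewrite diff1E // -pder_diff // /GRing.scale /=; congr (_ * _).
by rewrite derive1E; have [_ ->] := ds; rewrite invfM.
Qed.

(** The derivative of a quotient or of a composite involves sums and products again, so the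
    operations are closed up together: the class of all such expressions is stable under partial
    derivatives, as [smooth_on_coind] asks. *)
Inductive smooth_expr O : (plane -> R) -> Prop :=
| SEbase f : smooth_on O f -> smooth_expr O f
| SEext f g : smooth_expr O f -> {in O, f =1 g} -> smooth_expr O g
| SEcst c : smooth_expr O (fun=> c)
| SEadd f g : smooth_expr O f -> smooth_expr O g -> smooth_expr O (fun v => f v + g v)
| SEmul f g : smooth_expr O f -> smooth_expr O g -> smooth_expr O (fun v => f v * g v)
| SEinv f : smooth_expr O f -> (forall u, O u -> f u != 0) -> smooth_expr O (fun v => (f v)^-1)
| SEsqrt f : smooth_expr O f -> (forall u, O u -> 0 < f u) ->
    smooth_expr O (fun v => Num.sqrt (f v))
| SEcomp O' f t : open O' -> smooth_on O' f -> (forall u, O u -> O' (t u)) ->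
    (forall b, smooth_on O (fun v => t v b 0)) -> smooth_expr O (f \o t).

Lemma smooth_expr_diff O f u : open O -> smooth_expr O f -> O u -> differentiable f u.
Proof.
move=> oO se Ou; elim: se => {f}.
- by move=> f sf; apply: smooth_diff Ou.
- by move=> f g _ df fg; apply: (differentiable_ext_on oO fg).
- by move=> c; apply: differentiable_cst.
- by move=> f g _ df _ dg; apply: (@differentiableD _ _ _ f g).
- by move=> f g _ df _ dg; apply: (@differentiableM _ _ f g).
- by move=> f _ df f0; apply: (@differentiableV _ _ f) => //; apply: f0.
- by move=> f _ df f0; apply: differentiable_sqrt => //; apply: f0.
- move=> O' f t oO' sf OO' st; apply: differentiable_comp_plane.
    by apply: smooth_diff sf _ => //; apply: OO'.
  by move=> b; apply: smooth_diff (st b) _.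
Qed.

Lemma smooth_expr_pder O f a : open O -> smooth_expr O f ->
  exists2 g, smooth_expr O g & {in O, g =1 pder a f}.
Proof.
move=> oO; elim=> {f}.
- by move=> f sf; exists (pder a f) => //; apply/SEbase/smooth_pder.
- move=> f g sf [k sk Ek] fg; exists k => // u uO.
  by rewrite Ek // (pder_ext_on a oO fg).
- by move=> c; exists (fun=> 0); [exact: SEcst | rewrite pder_cst].
- move=> f g sf [f' sf' Ef] sg [g' sg' Eg]; exists (fun v => f' v + g' v).
    exact: SEadd.
  move=> u uO; have Ou := set_mem uO.
  by rewrite pderD ?Ef ?Eg //; apply: smooth_expr_diff Ou.
- move=> f g sf [f' sf' Ef] sg [g' sg' Eg]; exists (fun v => f' v * g v + f v * g' v).
    by apply: SEadd; apply: SEmul.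
  move=> u uO; have Ou := set_mem uO.
  by rewrite pderM ?Ef ?Eg //; apply: smooth_expr_diff Ou.
- move=> f sf [f' sf' Ef] f0; exists (fun v => -1 * (f' v * (f v)^-1 * (f v)^-1)).
    apply: SEmul; first exact: SEcst.
    by do 2?[apply: SEmul] => //; apply: SEinv.
  move=> u uO; have Ou := set_mem uO.
  by rewrite pderV ?Ef ?mulN1r //; [apply: smooth_expr_diff Ou | exact: f0].
- move=> f sf [f' sf' Ef] f0; exists (fun v => f' v * (2^-1 * (Num.sqrt (f v))^-1)).
    apply: SEmul => //; apply: SEmul; first exact: SEcst.
    apply: SEinv; first exact: SEsqrt.
    by move=> u Ou; rewrite sqrtr_eq0 -ltNge f0.
  move=> u uO; have Ou := set_mem uO.
  by rewrite pder_sqrt ?Ef //; [apply: smooth_expr_diff Ou | exact: f0].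
- move=> O' f t oO' sf OO' st.
  exists (fun v => (pder 0 f \o t) v * pder a (fun v => t v 0 0) v +
                   (pder 1 f \o t) v * pder a (fun v => t v 1 0) v).
    have H b : smooth_expr O (pder b f \o t).
      exact: (SEcomp oO' (smooth_pder b sf) OO' st).
    have K b : smooth_expr O (pder a (fun v => t v b 0)).
      exact: (SEbase (smooth_pder a (st b))).
    exact: (SEadd (SEmul (H 0) (K 0)) (SEmul (H 1) (K 1))).
  move=> u uO; have Ou := set_mem uO; rewrite pder_comp //.
    by apply: smooth_diff sf _ => //; apply: OO'.
  by move=> b; apply: smooth_diff (st b) _.
Qed.

Lemma smooth_exprP O f : open O -> smooth_expr O f -> smooth_on O f.
Proof.
move=> oO; apply: (smooth_on_coind oO (P := smooth_expr O)).
  by move=> g sg u; apply: smooth_expr_diff.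
by move=> g a; apply: smooth_expr_pder.
Qed.

Section Closure.
Variables (O : set plane) (oO : open O).

Lemma smooth_ext f g : {in O, f =1 g} -> smooth_on O f -> smooth_on O g.
Proof. by move=> fg sf; apply: smooth_exprP oO _; apply: SEext fg; apply: SEbase. Qed.

Lemma smooth_cst c : smooth_on O (fun=> c).
Proof. by apply: smooth_exprP oO _; apply: SEcst. Qed.

Lemma smoothD f g : smooth_on O f -> smooth_on O g -> smooth_on O (fun v => f v + g v).
Proof. by move=> sf sg; apply: smooth_exprP oO _; apply: SEadd; apply: SEbase. Qed.

Lemma smoothM f g : smooth_on O f -> smooth_on O g -> smooth_on O (fun v => f v * g v).
Proof. by move=> sf sg; apply: smooth_exprP oO _; apply: SEmul; apply: SEbase. Qed.

Lemma smoothN f : smooth_on O f -> smooth_on O (fun v => - f v).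
Proof.
move=> sf; apply: (@smooth_ext (fun v => -1 * f v)) => [u _|]; first by rewrite mulN1r.
exact: (smoothM (smooth_cst _) sf).
Qed.

Lemma smoothB f g : smooth_on O f -> smooth_on O g -> smooth_on O (fun v => f v - g v).
Proof. by move=> sf sg; exact: (smoothD sf (smoothN sg)). Qed.

Lemma smoothV f : (forall u, O u -> f u != 0) -> smooth_on O f ->
  smooth_on O (fun v => (f v)^-1).
Proof. by move=> f0 sf; apply: smooth_exprP oO _; apply: SEinv => //; apply: SEbase. Qed.

Lemma smooth_sqrt f : (forall u, O u -> 0 < f u) -> smooth_on O f ->
  smooth_on O (fun v => Num.sqrt (f v)).
Proof. by move=> f0 sf; apply: smooth_exprP oO _; apply: SEsqrt => //; apply: SEbase. Qed.

Lemma smooth_comp O' f t : open O' -> smooth_on O' f -> (forall u, O u -> O' (t u)) ->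
  (forall b, smooth_on O (fun v => t v b 0)) -> smooth_on O (f \o t).
Proof. by move=> oO' sf OO' st; apply: smooth_exprP oO _; apply: (@SEcomp _ O'). Qed.

Lemma smooth_coord b : smooth_on O (fun v => v b 0).
Proof.
pose P f := f = (fun v : plane => v b 0) \/ exists c, f = fun=> c.
apply: (smooth_on_coind oO (P := P)); last by left.
- by move=> f [->|[c ->]] // u _; apply: differentiable_coord.
- move=> f a [->|[c ->]].
    by exists (fun=> (a == b)%:R) => [|u _]; [right; eexists | rewrite pder_coord].
  by exists (fun=> 0) => [|u _]; [right; eexists | rewrite pder_cst].
Qed.

Lemma smooth_sum n (F : 'I_n -> plane -> R) : (forall i, smooth_on O (F i)) ->
  smooth_on O (fun v => \sum_(i < n) F i v).
Proof.
elim: n F => [|n IH] F sF.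
  by apply: (@smooth_ext (fun=> 0)) (smooth_cst _) => u _; rewrite big_ord0.
apply: (@smooth_ext (fun v => (\sum_(i < n) F (widen_ord (leqnSn n) i) v) + F ord_max v)).
  by move=> u _; rewrite big_ord_recr.
by apply: smoothD => //; apply: IH => i; apply: sF.
Qed.

End Closure.

End SmoothCalculus.

(** * Primitives on a square *)

Section RayIntegrals.
Variable R : realType.
Local Notation plane := 'cV[R]_2.
Implicit Types (u v h : plane) (f g : plane -> R) (b : 'I_2) (O : set plane).
Local Notation e a := (delta_mx a 0 : plane).
Local Notation mu := (@lebesgue_measure R).

(** The norm of ['cV[R]_2] is the maximum norm, so its balls are squares. *)
Definition csquare (a : plane) (r : R) : set plane := [set v | `|v - a| <= r].
Definition osquare (a : plane) (r : R) : set plane := [set v | `|v - a| < r].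

Lemma osquare_open a r : open (osquare a r).
Proof.
rewrite openE => v /= va; apply/near_ballP; exists (r - `|v - a|); first by rewrite subr_gt0.
move=> w wv; rewrite /osquare /= (_ : w - a = (w - v) + (v - a)); last by rewrite addrA subrK.
by apply: le_lt_trans (ler_normD _ _) _; rewrite -ltrBrDr.
Qed.

Lemma csquare_compact a r : compact (csquare a r).
Proof.
have [r0|r0] := ltP r 0.
  rewrite (_ : csquare a r = set0); first exact: compact0.
  by apply/seteqP; split => // v /= va; have := le_lt_trans va r0; rewrite ltNge normr_ge0.
have -> : csquare a r = (fun p : R * R => p.1 *: e 0 + p.2 *: e 1) @`
    (`[a 0 0 - r, a 0 0 + r]%classic `*` `[a 1 0 - r, a 1 0 + r]%classic).
  apply/seteqP; split.
    move=> v /= /(norm_planeP _ r0); rewrite !mxE !ler_distl => -[v0 v1].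
    exists (v 0 0, v 1 0); last by rewrite -plane_decomp.
    by split; rewrite /= in_itv.
  move=> _ [[s t] [/= + + <-]]; rewrite !in_itv /= => hs ht.
  by apply/(norm_planeP _ r0); rewrite !mxE /= !(mulr1, mulr0, addr0, add0r) !ler_distl.
apply: continuous_compact.
  apply: continuous_subspaceT => p.
  by apply: cvgD; apply: cvgZr_tmp; [exact: cvg_fst | exact: cvg_snd].
by apply: compact_setX; exact: segment_compact.
Qed.

Lemma csquare_max f a r : 0 <= r -> (forall v, csquare a r v -> {for v, continuous f}) ->
  exists2 c, csquare a r c & forall v, csquare a r v -> f v <= f c.
Proof.
move=> r0 cf; have [|||c cin Hc] := @compact_EVT_max _ R f (csquare a r).
- by exists a; rewrite /csquare /= subrr normr0.
- exact: csquare_compact.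
- by apply: continuous_in_subspaceT => v /set_mem; apply: cf.
by exists c => [|v vin]; [exact: set_mem | apply: Hc; rewrite inE].
Qed.

Lemma csquare_bound f a r : (forall v, csquare a r v -> {for v, continuous f}) ->
  exists2 M, 0 <= M & forall v, csquare a r v -> `|f v| <= M.
Proof.
move=> cf; have [r0|r0] := ltP r 0.
  by exists 0 => // v va; have := le_lt_trans va r0; rewrite ltNge normr_ge0.
have [v /cf cv|c _ Hc] := @csquare_max (fun v => `|f v|) a r r0.
  exact: (cvg_norm cv).
by exists `|f c|.
Qed.

Lemma continuous_planeP f u : {for u, continuous f} <->
  forall eps, 0 < eps -> exists2 d : R, 0 < d & forall v, `|v - u| < d -> `|f v - f u| <= eps.
Proof.
split=> [cf eps eps0|H].
  have /cvgrPdist_le /(_ _ eps0) /near_ballP[d d0 Hd] := cf.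
  by exists d => // v /Hd; rewrite distrC.
have H' : forall eps, 0 < eps -> \forall v \near u, `|f u - f v| <= eps.
  move=> eps eps0; have [d d0 Hd] := H eps eps0; apply/near_ballP; exists d => // v /Hd.
  by rewrite distrC.
by have /cvgrPdist_le := H'.
Qed.

Section Ray.
Variables (a : plane) (r : R).
Local Notation B := (osquare a r).

Definition ray u (t : R) : plane := a + t *: (u - a).

Lemma ray_norm u t : t \in `[0, 1] -> `|ray u t - a| <= `|u - a|.
Proof.
rewrite in_itv /= => /andP[t0 t1].
by rewrite /ray addrC addrA addNr add0r normrZ ger0_norm // ler_piMl.
Qed.

Lemma ray_in u t : B u -> t \in `[0, 1] -> B (ray u t).
Proof. by move=> Bu tI; apply: le_lt_trans (ray_norm u tI) Bu. Qed.

Lemma ray0 u : ray u 0 = a. Proof. by rewrite /ray scale0r addr0. Qed.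

Lemma ray1 u : ray u 1 = u. Proof. by rewrite /ray scale1r addrC subrK. Qed.

(** The weight [t ^+ j] makes the family stable under differentiation: by the chain rule a
    derivative in [u] brings out one more factor [t]. *)
Definition ray_int (j : nat) g u : R :=
  (\int[mu]_(t in `[0%R, 1%R]) (t ^+ j * g (ray u t)))%R.

Lemma ray_integrand_continuous j g u : smooth_on B g -> B u ->
  {within `[0, 1], continuous (fun t : R => t ^+ j * g (ray u t))}.
Proof.
move=> sg Bu; apply: continuous_in_subspaceT => t /set_mem /= tI.
have cg : {for ray u t, continuous g}.
  apply: differentiable_continuous; apply: smooth_diff sg _; first exact: osquare_open.
  exact: ray_in.
have cr : {for t, continuous (ray u)}.
  apply: cvgD; first exact: cvg_cst.
  by apply: cvgZr_tmp; exact: cvg_id.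
have ct : {for t, continuous (fun t : R => t ^+ j)} by apply: exprn_continuous.
exact: (cvgM ct (continuous_comp cr cg)).
Qed.

Lemma ray_integrable j g u : smooth_on B g -> B u ->
  mu.-integrable `[0, 1] (EFin \o (fun t : R => t ^+ j * g (ray u t))).
Proof.
move=> sg Bu; apply: continuous_compact_integrable; first exact: segment_compact.
exact: ray_integrand_continuous.
Qed.

Lemma cst_integrable01 (c : R) : mu.-integrable `[0, 1] (EFin \o (fun=> c : R)).
Proof.
apply: continuous_compact_integrable; first exact: segment_compact.
by apply: continuous_subspaceT => x; exact: cvg_cst.
Qed.

Lemma Rint_cst01 (c : R) : (\int[mu]_(t in `[0%R, 1%R]) c)%R = c.
Proof.
rewrite Rintegral_cst //= lebesgue_measure_itv /= lte_fin ltr01 -EFinB subr0 /=.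
by rewrite mulr1.
Qed.

Lemma ray_int_bound j g u M : smooth_on B g -> B u ->
  (forall t : R, t \in `[0, 1] -> `|g (ray u t)| <= M) -> `|ray_int j g u| <= M.
Proof.
move=> sg Bu HM; rewrite /ray_int.
apply: le_trans (le_normr_Rintegral _ (ray_integrable j sg Bu)) _ => //.
rewrite -[leRHS]Rint_cst01; apply: le_Rintegral => //.
- have H := ray_integrable j sg Bu.
  by have := integrable_norm H.
- exact: cst_integrable01.
move=> t tI; rewrite normrM; apply: le_trans (HM t tI).
have /andP[t0 t1] : 0 <= t <= 1 by [].
by rewrite ler_piMl // normrX ger0_norm // exprn_ile1.
Qed.

Lemma is_derive_ray_int j g u b : smooth_on B g -> B u ->
  is_derive u (e b) (ray_int j g) (ray_int j.+1 (pder b g) u).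
Proof.
move=> sg Bu.
(* Half the distance to the boundary of the square. For [|s| < d] the rays stay in the closed square
   of radius [r'], where [pder b g] is bounded, and this bound dominates the integrand. *)
pose d := (r - `|u - a|) / 2; have d0 : 0 < d by rewrite divr_gt0 // subr_gt0.
pose r' := `|u - a| + d.
have rr : r' < r by have Bu' : `|u - a| < r := Bu; rewrite /r' /d; lra.
have Bs (s : R) : `]-d, d[%classic s -> `|u + s *: e b - a| <= r'.
  rewrite /= in_itv /= => /andP[sd1 sd2]; rewrite addrAC.
  apply: le_trans (ler_normD _ _) _; rewrite lerD2l normrZ norm_e mulr1.
  by apply: ltW; rewrite ltr_norml sd1.
have Bs' (s : R) : `]-d, d[%classic s -> B (u + s *: e b).
  by move=> /Bs h; apply: le_lt_trans h rr.
pose F (s t : R) := t ^+ j * g (ray (u + s *: e b) t).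
have dF (s t : R) : `]-d, d[%classic s -> `[0, 1]%classic t ->
    is_derive s 1 (F ^~ t) (t ^+ j.+1 * pder b g (ray (u + s *: e b) t)).
  move=> sI tI.
  have E (x : R) : ray (u + x *: e b) t = ray u t + x *: (t *: e b).
    rewrite /ray; have -> : u + x *: e b - a = (u - a) + x *: e b by rewrite addrAC.
    by rewrite scalerDr addrA !scalerA (mulrC t).
  have dg : differentiable g (ray u t + s *: (t *: e b)).
    rewrite -E; apply: smooth_diff sg _; first exact: osquare_open.
    by apply: ray_in => //; exact: Bs'.
  have D := @is_derive_slice _ g (ray u t) (t *: e b) s (diff_derivable dg).
  have -> : F ^~ t = (t ^+ j) *: (fun x => g (ray u t + x *: (t *: e b))).
    by apply/funext => x; rewrite /F E.
  apply: is_derive_eq; rewrite E pder_diff // deriveE // linearZ /= exprS.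
  by rewrite /GRing.scale /=; ring.
have [M M0 HM] : exists2 M, 0 <= M & forall v, csquare a r' v -> `|pder b g v| <= M.
  apply: csquare_bound => v va; apply: differentiable_continuous.
  apply: smooth_diff (smooth_pder b sg) _; first exact: osquare_open.
  exact: le_lt_trans va rr.
have I0 : `]-d, d[%classic (0 : R) by rewrite /= in_itv /= oppr_lt0 d0.
have intF x : `]-d, d[%classic x -> mu.-integrable `[0, 1] (EFin \o F x).
  by move=> /Bs' Bx; exact: ray_integrable.
have derF x y : `]-d, d[%classic x -> `[0, 1]%classic y -> derivable (F ^~ y) x 1.
  by move=> xI yI; have [] := dF x y xI yI.
have E1 x y : `]-d, d[%classic x -> `[0, 1]%classic y ->
    partial1of2 F x y = y ^+ j.+1 * pder b g (ray (u + x *: e b) y).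
  by move=> xI yI; rewrite partial1of2E; have [_ ->] := dF x y xI yI.
have G_ub x y : `]-d, d[%classic x -> `[0, 1]%classic y -> `|partial1of2 F x y| <= (fun=> M) y.
  move=> xI yI; rewrite E1 // normrM.
  have /andP[y0 y1] : 0 <= y <= 1 by [].
  apply: (@le_trans _ _ `|pder b g (ray (u + x *: e b) y)|).
    by rewrite ler_piMl // normrX ger0_norm // exprn_ile1.
  by apply: HM; apply: le_trans (ray_norm _ yI) (Bs _ xI).
have mI : measurable (`[0, 1]%classic : set R) by [].
have D1 := @derivable_under_integral R _ _ mu F _ mI 0 (-d) d I0 intF derF _
  (fun=> M0) (cst_integrable01 M) G_ub.
have D2 := @differentiation_under_integral R _ _ mu F _ mI 0 (-d) d I0 intF derF _
  (fun=> M0) (cst_integrable01 M) G_ub.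
have H : is_derive (0 : R) 1 (fun s : R => ray_int j g (u + s *: e b)) (ray_int j.+1 (pder b g) u).
  apply: DeriveDef; first exact: D1.
  rewrite -derive1E; apply: etrans D2 _; apply: eq_Rintegral => t /set_mem tI.
  by rewrite E1 // scale0r addr0.
have HE : (fun s : R => ray_int j g (u + s *: e b)) = (fun s : R => ray_int j g (s *: e b + u)).
  by apply/funext => s; rewrite addrC.
rewrite HE in H; case: H => H1 H2; apply: DeriveDef.
  by apply/derivable1P.
have E2 : (fun h : R => h^-1 *: (((fun s : R => ray_int j g (s *: e b + u)) \o shift 0)
      (h *: (1 : R)) - ray_int j g (0 *: e b + u))) =
   (fun h : R => h^-1 *: ((ray_int j g \o shift u) (h *: e b) - ray_int j g u)).
  apply/funext => h; rewrite /= addr0 scale0r add0r.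
  by have -> : h *: (1 : R) = h by exact: mulr1.
by rewrite -H2 /derive E2.
Qed.

Lemma ray_int_derivable j g u b : smooth_on B g -> B u -> derivable (ray_int j g) u (e b).
Proof. by move=> sg Bu; have [] := is_derive_ray_int j b sg Bu. Qed.

Lemma pder_ray_int j g u b : smooth_on B g -> B u ->
  pder b (ray_int j g) u = ray_int j.+1 (pder b g) u.
Proof. by move=> sg Bu; have [_] := is_derive_ray_int j b sg Bu. Qed.

(** The partial derivatives are bounded on a slightly smaller closed square, so the mean value
    theorem along the axes makes the integral Lipschitz near [u]. *)
Lemma ray_int_continuous j g u : smooth_on B g -> B u -> {for u, continuous (ray_int j g)}.
Proof.
move=> sg Bu.
pose d := (r - `|u - a|) / 2; have d0 : 0 < d by rewrite divr_gt0 // subr_gt0.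
pose r' := `|u - a| + d.
have rr : r' < r by have Bu' : `|u - a| < r := Bu; rewrite /r' /d; lra.
have bd b : exists2 M, 0 <= M & forall v, `|v - a| <= r' -> `|pder b (ray_int j g) v| <= M.
  have [M M0 HM] : exists2 M, 0 <= M & forall v, csquare a r' v -> `|pder b g v| <= M.
    apply: csquare_bound => v va; apply: differentiable_continuous.
    apply: smooth_diff (smooth_pder b sg) _; first exact: osquare_open.
    exact: le_lt_trans va rr.
  exists M => // v va; have Bv : B v by apply: le_lt_trans va rr.
  rewrite (pder_ray_int _ _ sg Bv); apply: (ray_int_bound _ (smooth_pder b sg) Bv).
  by move=> t tI; apply: HM; apply: le_trans (ray_norm _ tI) va.
have [M0 M00 H0] := bd 0; have [M1 M10 H1] := bd 1.
apply/continuous_planeP => eps eps0.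
(* The increment is at most [|h|] times [M0 + M1]; the added 1 keeps the denominator positive. *)
exists (Num.min d (eps / (M0 + M1 + 1))).
  by rewrite lt_min d0 divr_gt0 // ltr_wpDl // addr_ge0.
move=> v; rewrite lt_min => /andP[vd ve].
pose h := v - u.
have small (s t : R) : `|s| <= `|h 0 0| -> `|t| <= `|h 1 0| ->
    `|(u + s *: e 0 + t *: e 1) - a| <= r'.
  move=> hs ht; have -> : u + s *: e 0 + t *: e 1 - a = (u - a) + (s *: e 0 + t *: e 1).
    by rewrite -!addrA; congr (_ + _); rewrite addrA addrC.
  apply: le_trans (ler_normD _ _) _; rewrite lerD2l; apply: le_trans (ltW vd).
  apply/norm_planeP => //; rewrite !mxE /= !(mulr1, mulr0, addr0, add0r); split.
    exact: le_trans hs (norm_coord _ _).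
  exact: le_trans ht (norm_coord _ _).
have small0 (s : R) : `|s| <= `|h 0 0| -> `|(u + s *: e 0) - a| <= r'.
  by move=> hs; have := small s 0 hs; rewrite scale0r addr0 normr0 => ->.
have [s hs|s hs Es] := @MVT_slice _ (ray_int j g) u (e 0) (h 0 0).
  by apply: ray_int_derivable => //; apply: le_lt_trans (small0 s hs) rr.
have [t ht|t ht Et] := @MVT_slice _ (ray_int j g) (u + h 0 0 *: e 0) (e 1) (h 1 0).
  by apply: ray_int_derivable => //; apply: le_lt_trans (small _ t _ ht) rr.
have vE : v = u + h 0 0 *: e 0 + h 1 0 *: e 1.
  by rewrite -addrA -plane_decomp /h addrC subrK.
rewrite vE.
have -> : ray_int j g (u + h 0 0 *: e 0 + h 1 0 *: e 1) - ray_int j g u =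
   h 1 0 * pder 1 (ray_int j g) (u + h 0 0 *: e 0 + t *: e 1)
   + h 0 0 * pder 0 (ray_int j g) (u + s *: e 0).
  by rewrite /pder -Es -Et addrA subrK.
apply: (@le_trans _ _ (`|h| * (M0 + M1 + 1))).
  have b1 := H1 _ (small _ _ (lexx _) ht); have b0 := H0 _ (small0 _ hs).
  move: b1 b0; move: (pder 1 _ _) (pder 0 _ _) => p1 p0 b1 b0.
  apply: le_trans (ler_normD _ _) _; rewrite !normrM.
  apply: le_trans (lerD (ler_pM (normr_ge0 _) (normr_ge0 _) (norm_coord h 1) b1)
    (ler_pM (normr_ge0 _) (normr_ge0 _) (norm_coord h 0) b0)) _.
  by rewrite -mulrDr ler_wpM2l // (addrC M1) lerDl.
rewrite -ler_pdivlMr; first exact: ltW.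
by rewrite ltr_wpDl // addr_ge0.
Qed.

(** Every iterated derivative of a ray integral is again a ray integral, with a higher weight and a
    derivative of [g] as integrand. *)
Lemma ray_int_smooth j g : smooth_on B g -> smooth_on B (ray_int j g).
Proof.
move=> sg.
have H s : exists k g', smooth_on B g' /\ {in B, ray_int k g' =1 pders s (ray_int j g)}.
  elim: s => [|b s [k [g' [sg' E]]]]; first by exists j, g.
  exists k.+1, (pder b g'); split; first exact: smooth_pder.
  move=> u uB; have Bu := set_mem uB.
  by rewrite -pder_ray_int // (pder_ext_on b (@osquare_open a r) E).
move=> s u Bu; have [k [g' [sg' E]]] := H s.
have nE : \forall v \near u, ray_int k g' v = pders s (ray_int j g) v.
  by apply: filterS (open_near (@osquare_open a r) Bu) => v Bv; apply: E; rewrite inE.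
split.
  have /continuous_planeP C := @ray_int_continuous k g' u sg' Bu.
  have /near_ballP[r1 r10 H1] := nE.
  apply/continuous_planeP => eps eps0; have [d d0 Hd] := C eps eps0.
  exists (Num.min d r1) => [|v]; first by rewrite lt_min d0.
  by rewrite lt_min => /andP[vd v1]; rewrite -H1 // -E ?inE //; exact: Hd.
by move=> b; apply: near_eq_derivable nE _; exact: ray_int_derivable.
Qed.

(* The fundamental theorem of calculus applied to t * g (ray u t). *)
Lemma ray_int_FTC g u : smooth_on B g -> B u ->
  ray_int 0 g u + (u 0 0 - a 0 0) * ray_int 1 (pder 0 g) u
    + (u 1 0 - a 1 0) * ray_int 1 (pder 1 g) u = g u.
Proof.
move=> sg Bu.
have dr (t : R) : t \in `[0, 1] -> differentiable g (ray u t).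
  move=> tI; apply: smooth_diff sg _; first exact: osquare_open.
  exact: ray_in.
pose f (t : R) := t ^+ 0 * g (ray u t) + (u 0 0 - a 0 0) * (t ^+ 1 * pder 0 g (ray u t))
   + (u 1 0 - a 1 0) * (t ^+ 1 * pder 1 g (ray u t)).
pose F (t : R) := t * g (ray u t).
have dF (t : R) : t \in `[0, 1] -> is_derive t 1 F (f t).
  move=> tI; have D := @is_derive_slice _ g a (u - a) t (diff_derivable (dr t tI)).
  have D0 : is_derive t 1 (fun t : R => t) (1 : R) by exact: is_derive_id.
  have := is_deriveM D0 D; rewrite -/(ray u t).
  move=> H; apply: is_derive_eq (H) _.
  rewrite deriveE; last exact: dr.
  by rewrite diffE_pder ?/linform /f /GRing.scale /= ?mxE; [ring | exact: dr].
have c0 := @ray_integrand_continuous 0 g u sg Bu.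
have c1 b := @ray_integrand_continuous 1 (pder b g) u (smooth_pder b sg) Bu.
have i0 := @ray_integrable 0 g u sg Bu.
have i1 b := @ray_integrable 1 (pder b g) u (smooth_pder b sg) Bu.
have cf : {within `[0, 1], continuous f}.
  move=> t; apply: cvgD; first apply: cvgD; first exact: c0.
    by apply: cvgM; [exact: cvg_cst | exact: c1].
  by apply: cvgM; [exact: cvg_cst | exact: c1].
have cF (t : R) : t \in `[0, 1] -> {for t, continuous F}.
  by move=> /dF [/derivable1_diffP d _]; exact: differentiable_continuous.
have E : (\int[mu]_(t in `[0%R, 1%R]) (f t)%:E = (F 1)%:E - (F 0)%:E)%E.
  apply: continuous_FTC2 => //.
    split.
    - by move=> t tI; have [] := dF t (subset_itv_oo_cc tI).
    - by apply: cvg_at_right_filter; apply: cF; rewrite in_itv /= lexx ler01.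
    - by apply: cvg_at_left_filter; apply: cF; rewrite in_itv /= lexx ler01.
  by move=> t tI; rewrite derive1E; have [_ ->] := dF t (subset_itv_oo_cc tI).
have : (\int[mu]_(t in `[0%R, 1%R]) f t)%R = g u.
  by rewrite /Rintegral E /F /= ray1 mul1r mul0r subr0.
rewrite /f RintegralD //; last first.
- by apply: (integrableZl _ (u 1 0 - a 1 0) (i1 1)).
- apply: (@integrableD _ _ _ mu `[0, 1] _ _ _ i0 (integrableZl _ (u 0 0 - a 0 0) (i1 0))) => //.
rewrite RintegralD //; last exact: (integrableZl _ (u 0 0 - a 0 0) (i1 0)).
by rewrite (RintegralZl _ _ (i1 0)) // (RintegralZl _ _ (i1 1)).
Qed.

(** The derivative of [g] along the segment from [a] to [u] is integrated. The factors in front of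
    the integrals vanish at [a], which later allows division by [z - z_a]. *)
Lemma Hadamard g u : smooth_on B g -> B u ->
  g u - g a = (u 0 0 - a 0 0) * ray_int 0 (pder 0 g) u
    + (u 1 0 - a 1 0) * ray_int 0 (pder 1 g) u.
Proof.
move=> sg Bu.
have dr (t : R) : t \in `[0, 1] -> differentiable g (ray u t).
  move=> tI; apply: smooth_diff sg _; first exact: osquare_open.
  exact: ray_in.
pose f (t : R) := (u 0 0 - a 0 0) * (t ^+ 0 * pder 0 g (ray u t))
   + (u 1 0 - a 1 0) * (t ^+ 0 * pder 1 g (ray u t)).
pose F (t : R) := g (ray u t).
have dF (t : R) : t \in `[0, 1] -> is_derive t 1 F (f t).
  move=> tI; have D := @is_derive_slice _ g a (u - a) t (diff_derivable (dr t tI)).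
  apply: is_derive_eq (D) _; rewrite -/(ray u t) deriveE; last exact: dr.
  by rewrite diffE_pder ?/linform /f ?mxE; [ring | exact: dr].
have c1 b := @ray_integrand_continuous 0 (pder b g) u (smooth_pder b sg) Bu.
have i1 b := @ray_integrable 0 (pder b g) u (smooth_pder b sg) Bu.
have cf : {within `[0, 1], continuous f}.
  by move=> t; apply: cvgD; apply: cvgM; [exact: cvg_cst|exact: c1|exact: cvg_cst|exact: c1].
have cF (t : R) : t \in `[0, 1] -> {for t, continuous F}.
  by move=> /dF [/derivable1_diffP d _]; exact: differentiable_continuous.
have E : (\int[mu]_(t in `[0%R, 1%R]) (f t)%:E = (F 1)%:E - (F 0)%:E)%E.
  apply: continuous_FTC2 => //.
    split.
    - by move=> t tI; have [] := dF t (subset_itv_oo_cc tI).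
    - by apply: cvg_at_right_filter; apply: cF; rewrite in_itv /= lexx ler01.
    - by apply: cvg_at_left_filter; apply: cF; rewrite in_itv /= lexx ler01.
  by move=> t tI; rewrite derive1E; have [_ ->] := dF t (subset_itv_oo_cc tI).
have : (\int[mu]_(t in `[0%R, 1%R]) f t)%R = g u - g a.
  by rewrite /Rintegral E /F /= ray1 ray0.
move=> <-; rewrite /f RintegralD //; last 2 first.
- exact: (integrableZl _ (u 0 0 - a 0 0) (i1 0)).
- exact: (integrableZl _ (u 1 0 - a 1 0) (i1 1)).
by rewrite (RintegralZl _ _ (i1 0)) // (RintegralZl _ _ (i1 1)).
Qed.

Opaque ray_int.

(* Integration of P dx + Q dy along rays from a. *)
Definition primitive (P Q : plane -> R) u : R :=
  (u 0 0 - a 0 0) * ray_int 0 P u + (u 1 0 - a 1 0) * ray_int 0 Q u.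

(** The Poincaré lemma: closedness exchanges [pder 0 Q] for [pder 1 P] under the integral, and the
    derivative of the primitive becomes the left-hand side of [ray_int_FTC]. *)
Lemma primitiveP P Q : smooth_on B P -> smooth_on B Q ->
  {in B, pder 1 P =1 pder 0 Q} ->
  [/\ smooth_on B (primitive P Q), {in B, pder 0 (primitive P Q) =1 P}
    & {in B, pder 1 (primitive P Q) =1 Q}].
Proof.
move=> sP sQ E.
have oB := @osquare_open a r.
have sc b : smooth_on B (fun u => u b 0 - a b 0).
  exact: (smoothB oB (smooth_coord oB b) (smooth_cst oB _)).
have sI f : smooth_on B f -> smooth_on B (ray_int 0 f) by apply: ray_int_smooth.
have s0 : smooth_on B (fun u => (u 0 0 - a 0 0) * ray_int 0 P u) by exact: (smoothM oB (sc 0) (sI _ sP)).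
have s1 : smooth_on B (fun u => (u 1 0 - a 1 0) * ray_int 0 Q u) by exact: (smoothM oB (sc 1) (sI _ sQ)).
have E1 u : B u -> ray_int 1 (pder 1 P) u = ray_int 1 (pder 0 Q) u.
  move=> Bu; apply: eq_Rintegral => t /set_mem tI; congr (_ * _); apply: E.
  by rewrite inE; apply: ray_in.
have pc b c u : pder b (fun v : plane => v c 0 - a c 0) u = (b == c)%:R.
  rewrite pderD ?pder_coord ?pder_cst ?addr0 //; exact: differentiable_coord.
have pI b c f u : smooth_on B f -> B u ->
    pder b (fun v => (v c 0 - a c 0) * ray_int 0 f v) u =
    (b == c)%:R * ray_int 0 f u + (u c 0 - a c 0) * ray_int 1 (pder b f) u.
  move=> sf Bu; rewrite (@pderM _ b (fun v => v c 0 - a c 0) (ray_int 0 f)).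
  - by rewrite pc pder_ray_int.
  - exact: smooth_diff (sc c) Bu.
  - exact: smooth_diff (sI _ sf) Bu.
have pP b u : B u -> pder b (primitive P Q) u =
    (b == 0)%:R * ray_int 0 P u + (u 0 0 - a 0 0) * ray_int 1 (pder b P) u
    + ((b == 1)%:R * ray_int 0 Q u + (u 1 0 - a 1 0) * ray_int 1 (pder b Q) u).
  move=> Bu; rewrite -!pI //.
  exact: (pderD b (smooth_diff oB s0 Bu) (smooth_diff oB s1 Bu)).
split; first exact: (smoothD oB s0 s1).
- move=> u uB; have Bu := set_mem uB.
  by rewrite pP //= mul1r mul0r add0r -E1 // -[RHS](ray_int_FTC sP).
- move=> u uB; have Bu := set_mem uB.
  by rewrite pP //= mul1r mul0r add0r E1 // -[RHS](ray_int_FTC sQ) // addrCA addrA.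
Qed.

End Ray.

End RayIntegrals.

(** * Wirtinger calculus and holomorphic functions *)

(* Conversion would otherwise compare derivatives by unfolding limits. *)
Opaque smooth_on.

(* Replaces derivatives by variables: comparing them up to conversion is what makes [ring] and
   [field] slow. *)
Ltac gen_der := repeat match goal with
  | |- context [pderC ?a ?f ?u] => let x := fresh "x" in set x := pderC a f u; move: x => x
  | |- context [pder ?a ?f ?u] => let x := fresh "x" in set x := pder a f u; move: x => x
  end.

Section ComplexCalculus.
Variable R : realType.
Local Notation plane := 'cV[R]_2.
Local Notation C := R[i].
Local Notation Re := (@complex.Re R).
Local Notation Im := (@complex.Im R).
Implicit Types (u v h : plane) (f g : plane -> C) (a b : 'I_2) (O : set plane)
  (t : plane -> plane).
Local Notation e a := (delta_mx a 0 : plane).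
Local Notation i := (0 +i* 1 : C)%C.

Lemma complex_eqP (x y : C) : Re x = Re y -> Im x = Im y -> x = y.
Proof. by case: x y => [? ?] [? ?] /= -> ->. Qed.

Lemma cReD (x y : C) : Re (x + y) = Re x + Re y. Proof. by case: x y => [? ?] []. Qed.
Lemma cImD (x y : C) : Im (x + y) = Im x + Im y. Proof. by case: x y => [? ?] []. Qed.
Lemma cReN (x : C) : Re (- x) = - Re x. Proof. by case: x. Qed.
Lemma cImN (x : C) : Im (- x) = - Im x. Proof. by case: x. Qed.
Lemma cReM (x y : C) : Re (x * y) = Re x * Re y - Im x * Im y.
Proof. by case: x y => [? ?] []. Qed.
Lemma cImM (x y : C) : Im (x * y) = Re x * Im y + Im x * Re y.
Proof. by case: x y => [? ?] []. Qed.
Lemma cReV (x : C) : Re x^-1 = Re x * (Re x ^+ 2 + Im x ^+ 2)^-1. Proof. by case: x. Qed.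
Lemma cImV (x : C) : Im x^-1 = - Im x * (Re x ^+ 2 + Im x ^+ 2)^-1.
Proof. by case: x => a b; rewrite mulNr. Qed.
Definition cReImE := (cReD, cImD, cReN, cImN, cReM, cImM).

Lemma i2 : i * i = -1.
Proof. by apply: complex_eqP; rewrite !cReImE /=; ring. Qed.

Lemma sqr_norm_neq0 (x : C) : x != 0 -> Re x ^+ 2 + Im x ^+ 2 != 0.
Proof.
case: x => a b; rewrite eq_complex /= => H; rewrite paddr_eq0 ?sqr_ge0 //.
by rewrite !sqrf_eq0.
Qed.

Definition smoothC O f := smooth_on O (fun v => Re (f v)) /\ smooth_on O (fun v => Im (f v)).
Definition diffC f u :=
  differentiable (fun v => Re (f v)) u /\ differentiable (fun v => Im (f v)) u.

Lemma smoothC_diff O f u : open O -> smoothC O f -> O u -> diffC f u.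
Proof. by move=> oO [s1 s2] Ou; split; [apply: smooth_diff s1 Ou | apply: smooth_diff s2 Ou]. Qed.

Lemma continuous_near_neq0 (p : plane -> R) u : {for u, continuous p} -> p u != 0 ->
  \forall v \near u, p v != 0.
Proof.
move=> /continuous_planeP c pu; have e0 : 0 < `|p u| / 2 by rewrite divr_gt0 // normr_gt0.
have [d d0 Hd] := c _ e0; apply/near_ballP; exists d => // v /Hd H.
apply/eqP => pv; move: H; rewrite pv sub0r normrN; move: e0; lra.
Qed.

Lemma diffC_near_neq0 f u : diffC f u -> f u != 0 -> \forall v \near u, f v != 0.
Proof.
move=> [/differentiable_continuous d1 /differentiable_continuous d2].
rewrite eq_complex /= negb_and => /orP[H|H].
  have /near_ballP[r r0 Hr] := continuous_near_neq0 d1 H.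
  by apply/near_ballP; exists r => // v /Hr; rewrite eq_complex negb_and => ->.
have /near_ballP[r r0 Hr] := continuous_near_neq0 d2 H.
by apply/near_ballP; exists r => // v /Hr; rewrite eq_complex negb_and => ->; rewrite orbT.
Qed.

Lemma pderC_split a f u : pderC a f u =
  (pder a (fun v => Re (f v)) u +i* pder a (fun v => Im (f v)) u)%C.
Proof. by []. Qed.

Lemma near_pderC a f g u : (\forall v \near u, f v = g v) -> pderC a f u = pderC a g u.
Proof.
by move=> fg; rewrite /pderC; congr (_ +i* _)%C; apply: near_pder; apply: filterS fg => v ->.
Qed.

Lemma pderC_ext_on O a f g : open O -> {in O, f =1 g} -> {in O, pderC a f =1 pderC a g}.
Proof.
move=> oO fg u; rewrite inE => Ou; apply: near_pderC.
by apply: filterS (open_near oO Ou) => v Ov; apply: fg; rewrite inE.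
Qed.

Lemma diffC_ext_on O f g u : open O -> {in O, f =1 g} -> O u -> diffC f u -> diffC g u.
Proof.
by move=> oO fg Ou [d1 d2]; split; [apply: (differentiable_ext_on oO) d1 => // |
  apply: (differentiable_ext_on oO) d2 => //] => v /fg ->.
Qed.

Lemma diffC_cst c u : diffC (fun=> c) u.
Proof. by split; apply: differentiable_cst. Qed.

Lemma diffCD f g u : diffC f u -> diffC g u -> diffC (fun v => f v + g v) u.
Proof.
move=> [f1 f2] [g1 g2]; split.
  rewrite (_ : (fun _ => _) = (fun v => Re (f v)) + (fun v => Re (g v))); last first.
    by apply/funext => v; rewrite cReD.
  exact: differentiableD.
rewrite (_ : (fun _ => _) = (fun v => Im (f v)) + (fun v => Im (g v))); last first.
  by apply/funext => v; rewrite cImD.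
exact: differentiableD.
Qed.

Lemma pderCD a f g u : diffC f u -> diffC g u ->
  pderC a (fun v => f v + g v) u = pderC a f u + pderC a g u.
Proof.
move=> [f1 f2] [g1 g2]; apply: complex_eqP; rewrite cReImE /= -pderD //.
  by congr (pder a _ u); apply/funext => v; rewrite cReD.
by congr (pder a _ u); apply/funext => v; rewrite cImD.
Qed.

Lemma diffCM f g u : diffC f u -> diffC g u -> diffC (fun v => f v * g v) u.
Proof.
move=> [f1 f2] [g1 g2]; split.
  rewrite (_ : (fun _ => _) = (fun v => Re (f v)) * (fun v => Re (g v)) -
     (fun v => Im (f v)) * (fun v => Im (g v))); last by apply/funext => v; rewrite cReM.
  by apply: differentiableB; apply: differentiableM.
rewrite (_ : (fun _ => _) = (fun v => Re (f v)) * (fun v => Im (g v)) +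
     (fun v => Im (f v)) * (fun v => Re (g v))); last by apply/funext => v; rewrite cImM.
by apply: differentiableD; apply: differentiableM.
Qed.

Lemma differentiableMf (p q : plane -> R) u : differentiable p u -> differentiable q u ->
  differentiable (fun v => p v * q v) u.
Proof. by move=> dp dq; apply: (@differentiableM _ _ p q). Qed.

Lemma pderCM a f g u : diffC f u -> diffC g u ->
  pderC a (fun v => f v * g v) u = pderC a f u * g u + f u * pderC a g u.
Proof.
move=> [f1 f2] [g1 g2]; apply: complex_eqP; rewrite !cReImE /=.
  have -> : (fun v => Re (f v * g v)) = (fun v => Re (f v) * Re (g v) + - (Im (f v) * Im (g v))).
    by apply/funext => v; rewrite cReM.
  rewrite pderD ?pderN ?pderM //; try exact: differentiableMf; first by ring.
  by apply: (@differentiableN _ _ _ (fun v => Im (f v) * Im (g v))); exact: differentiableMf.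
have -> : (fun v => Im (f v * g v)) = (fun v => Re (f v) * Im (g v) + Im (f v) * Re (g v)).
  by apply/funext => v; rewrite cImM.
by rewrite pderD ?pderM //; try exact: differentiableMf; ring.
Qed.

Lemma diffCN f u : diffC f u -> diffC (fun v => - f v) u.
Proof.
move=> df; rewrite (_ : (fun _ => _) = (fun v => (-1) * f v)).
  by apply: diffCM => //; exact: diffC_cst.
by apply/funext => v; rewrite mulN1r.
Qed.

Lemma pderC_cst a (c : C) u : pderC a (fun=> c) u = 0.
Proof. by apply: complex_eqP; rewrite /= pder_cst. Qed.

Lemma pderCN a f u : diffC f u -> pderC a (fun v => - f v) u = - pderC a f u.
Proof.
move=> df; rewrite (_ : (fun _ => _) = (fun v => (-1) * f v)).
  by rewrite pderCM ?pderC_cst ?mul0r ?add0r ?mulN1r //; exact: diffC_cst.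
by apply/funext => v; rewrite mulN1r.
Qed.

Lemma diffCV f u : diffC f u -> f u != 0 -> diffC (fun v => (f v)^-1) u.
Proof.
move=> [f1 f2] f0.
have dq : differentiable (fun v => (Re (f v) ^+ 2 + Im (f v) ^+ 2)^-1) u.
  apply: (@differentiableV _ _ (fun v => Re (f v) ^+ 2 + Im (f v) ^+ 2)).
    apply: (@differentiableD _ _ _ (fun v => Re (f v) ^+ 2) (fun v => Im (f v) ^+ 2));
    exact: differentiableMf.
  exact: sqr_norm_neq0.
split.
  rewrite (_ : (fun _ => _) = (fun v => Re (f v) * (Re (f v) ^+ 2 + Im (f v) ^+ 2)^-1)).
    exact: differentiableMf.
  by apply/funext => v; rewrite cReV.
rewrite (_ : (fun _ => _) = (fun v => - Im (f v) * (Re (f v) ^+ 2 + Im (f v) ^+ 2)^-1)).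
  apply: differentiableMf => //.
  exact: (@differentiableN _ _ _ (fun v => Im (f v))).
by apply/funext => v; rewrite cImV.
Qed.

Opaque pder.

(** Obtained by differentiating [f * f^-1 = 1], which holds on a neighbourhood of [u]. *)
Lemma pderCV a f u : diffC f u -> f u != 0 ->
  pderC a (fun v => (f v)^-1) u = - pderC a f u / f u ^+ 2.
Proof.
move=> df f0; have dV := diffCV df f0.
have : pderC a (fun v => f v * (f v)^-1) u = 0.
  rewrite -[RHS](pderC_cst a 1 u); apply: near_pderC.
  by apply: filterS (diffC_near_neq0 df f0) => v v0; rewrite divff.
rewrite pderCM // => /(canRL (addKr _)); rewrite addr0 => H.
by rewrite -[LHS](mulKf f0) H; field.
Qed.

Definition real_fun (p : plane -> R) : plane -> C := fun v => ((p v)%:C)%C.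

Lemma diffC_real (p : plane -> R) u : differentiable p u -> diffC (real_fun p) u.
Proof. by move=> dp; split => //; exact: differentiable_cst. Qed.

Lemma pderC_real a (p : plane -> R) u : pderC a (real_fun p) u = ((pder a p u)%:C)%C.
Proof. by apply: complex_eqP; rewrite //= pder_cst. Qed.

Lemma diffC_conj f u : diffC f u -> diffC (fun v => (f v)^*%C) u.
Proof.
move=> [f1 f2]; split.
  by rewrite (_ : (fun _ => _) = (fun v => Re (f v))) //; apply/funext => v; case: (f v).
rewrite (_ : (fun _ => _) = (fun v => - Im (f v))).
  exact: (@differentiableN _ _ _ (fun v => Im (f v))).
by apply/funext => v; case: (f v).
Qed.

Lemma pderC_conj a f u : diffC f u -> pderC a (fun v => (f v)^*%C) u = (pderC a f u)^*%C.
Proof.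
move=> [f1 f2]; apply: complex_eqP => /=.
  by congr pder; apply/funext => v; case: (f v).
by rewrite -pderN //; congr pder; apply/funext => v; case: (f v).
Qed.

Lemma pderC_comp a f t u : diffC f (t u) ->
  (forall b, differentiable (fun v => t v b 0) u) ->
  pderC a (f \o t) u = pderC 0 f (t u) * ((pder a (fun v => t v 0 0) u)%:C)%C +
                       pderC 1 f (t u) * ((pder a (fun v => t v 1 0) u)%:C)%C.
Proof.
move=> [f1 f2] dt; apply: complex_eqP; rewrite !cReImE /=.
  by rewrite (@pder_comp _ a (fun v => Re (f v)) t u) //; gen_der; ring.
by rewrite (@pder_comp _ a (fun v => Im (f v)) t u) //; gen_der; ring.
Qed.

Lemma diffC_comp f t u : diffC f (t u) ->
  (forall b, differentiable (fun v => t v b 0) u) -> diffC (f \o t) u.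
Proof.
move=> [f1 f2] dt; split.
  exact: (@differentiable_comp_plane _ (fun v => Re (f v))).
exact: (@differentiable_comp_plane _ (fun v => Im (f v))).
Qed.

Opaque pderC diffC.

(** The conjugate Wirtinger derivative; its vanishing is the system of Cauchy-Riemann equations. *)
Definition del_zb f : plane -> C := fun u => (pderC 0 f u + i * pderC 1 f u) / 2.

Lemma del_zE f u : del_z f u = (pderC 0 f u - i * pderC 1 f u) / 2.
Proof.
rewrite /del_z !big_ord_recl big_ord0 addr0 /zeta /=.
have -> : lift ord0 ord0 = 1 :> 'I_2 by apply/val_inj.
have -> : (0 +i* (-1) : C)%C = - i by apply: complex_eqP; rewrite /= ?oppr0.
by move: (pderC _ _ _) (pderC _ _ _) => x y; field.
Qed.

Lemma pderC0E f u : pderC 0 f u = del_z f u + del_zb f u.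
Proof. by rewrite del_zE /del_zb; gen_der; field. Qed.

Lemma i_neq0 : i != 0 :> C.
Proof. by rewrite eq_complex /= oner_eq0 andbF. Qed.

Lemma pderC1E f u : pderC 1 f u = i * (del_z f u - del_zb f u).
Proof.
rewrite del_zE /del_zb.
move: (pderC 0 f u) (pderC 1 f u) => x y.
have -> : i * ((x - i * y) / 2 - (x + i * y) / 2) = - (i * i) * y by field.
by rewrite i2 opprK mul1r.
Qed.

Lemma del_z_ext_on O f g : open O -> {in O, f =1 g} -> {in O, del_z f =1 del_z g}.
Proof. by move=> oO fg u uO; rewrite !del_zE !(pderC_ext_on _ oO fg). Qed.
Lemma del_zb_ext_on O f g : open O -> {in O, f =1 g} -> {in O, del_zb f =1 del_zb g}.
Proof. by move=> oO fg u uO; rewrite /del_zb !(pderC_ext_on _ oO fg). Qed.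
Lemma del_z_cst c u : del_z (fun=> c) u = 0.
Proof. by rewrite del_zE !pderC_cst; gen_der; ring. Qed.
Lemma del_zb_cst c u : del_zb (fun=> c) u = 0.
Proof. by rewrite /del_zb !pderC_cst; gen_der; ring. Qed.
Lemma del_zD f g u : diffC f u -> diffC g u ->
  del_z (fun v => f v + g v) u = del_z f u + del_z g u.
Proof. by move=> df dg; rewrite !del_zE !pderCD //; gen_der; field. Qed.
Lemma del_zbD f g u : diffC f u -> diffC g u ->
  del_zb (fun v => f v + g v) u = del_zb f u + del_zb g u.
Proof. by move=> df dg; rewrite /del_zb !pderCD //; gen_der; field. Qed.
Lemma del_zN f u : diffC f u -> del_z (fun v => - f v) u = - del_z f u.
Proof. by move=> df; rewrite !del_zE !pderCN //; gen_der; field. Qed.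
Lemma del_zbN f u : diffC f u -> del_zb (fun v => - f v) u = - del_zb f u.
Proof. by move=> df; rewrite /del_zb !pderCN //; gen_der; field. Qed.
Lemma del_zM f g u : diffC f u -> diffC g u ->
  del_z (fun v => f v * g v) u = del_z f u * g u + f u * del_z g u.
Proof. by move=> df dg; rewrite !del_zE !pderCM //; gen_der; field. Qed.
Lemma del_zbM f g u : diffC f u -> diffC g u ->
  del_zb (fun v => f v * g v) u = del_zb f u * g u + f u * del_zb g u.
Proof. by move=> df dg; rewrite /del_zb !pderCM //; gen_der; field. Qed.
Lemma del_zV f u : diffC f u -> f u != 0 ->
  del_z (fun v => (f v)^-1) u = - del_z f u / f u ^+ 2.
Proof. by move=> df f0; rewrite !del_zE !pderCV //; gen_der; field. Qed.
Lemma del_zbV f u : diffC f u -> f u != 0 ->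
  del_zb (fun v => (f v)^-1) u = - del_zb f u / f u ^+ 2.
Proof. by move=> df f0; rewrite /del_zb !pderCV //; gen_der; field. Qed.

Lemma conj_i : (i : C)^*%C = - i.
Proof. by apply: complex_eqP; rewrite /= ?oppr0. Qed.
Lemma conj2 : (2 : C)^*%C = 2.
Proof. exact: conjc_nat. Qed.

Lemma conjD (x y : C) : (x + y)^*%C = x^*%C + y^*%C. Proof. exact: rmorphD. Qed.
Lemma conjM (x y : C) : (x * y)^*%C = x^*%C * y^*%C. Proof. exact: rmorphM. Qed.
Lemma conjN (x : C) : (- x)^*%C = - x^*%C. Proof. exact: rmorphN. Qed.
Lemma conj_iM (y : C) : (i * y)^*%C = - (i * y^*%C).
Proof. by rewrite conjM conj_i mulNr. Qed.
Definition conjE := (conjD, conjM, conjN, conjc_inv, conj_i, conj2).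

Lemma del_z_conj f u : diffC f u -> del_z (fun v => (f v)^*%C) u = (del_zb f u)^*%C.
Proof.
move=> df; rewrite del_zE /del_zb !pderC_conj //.
by move: (pderC 0 f u) (pderC 1 f u) => x y; rewrite conjM conjD conj_iM conjc_inv conj2.
Qed.
Lemma del_zb_conj f u : diffC f u -> del_zb (fun v => (f v)^*%C) u = (del_z f u)^*%C.
Proof.
move=> df; rewrite del_zE /del_zb !pderC_conj //.
by move: (pderC 0 f u) (pderC 1 f u) => x y; rewrite conjM conjD conjN conj_iM opprK conjc_inv conj2.
Qed.

Transparent pderC diffC.

Section Smooth.
Variables (O : set plane) (oO : open O).

Lemma smoothC_ext f g : {in O, f =1 g} -> smoothC O f -> smoothC O g.
Proof. by move=> fg [s1 s2]; split; [apply: smooth_ext s1 | apply: smooth_ext s2] => // u /fg ->. Qed.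

Lemma smoothC_cst c : smoothC O (fun=> c).
Proof. by split; apply: smooth_cst. Qed.

Lemma smoothCD f g : smoothC O f -> smoothC O g -> smoothC O (fun v => f v + g v).
Proof.
move=> [f1 f2] [g1 g2]; split.
  by apply: (smooth_ext oO _ (smoothD oO f1 g1)) => u _; rewrite cReD.
by apply: (smooth_ext oO _ (smoothD oO f2 g2)) => u _; rewrite cImD.
Qed.

Lemma smoothCM f g : smoothC O f -> smoothC O g -> smoothC O (fun v => f v * g v).
Proof.
move=> [f1 f2] [g1 g2]; split.
  apply: (smooth_ext oO _ (smoothB oO (smoothM oO f1 g1) (smoothM oO f2 g2))) => u _.
  by rewrite cReM.
apply: (smooth_ext oO _ (smoothD oO (smoothM oO f1 g2) (smoothM oO f2 g1))) => u _.
by rewrite cImM.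
Qed.

Lemma smoothCN f : smoothC O f -> smoothC O (fun v => - f v).
Proof.
move=> sf; apply: (smoothC_ext _ (smoothCM (smoothC_cst (-1)) sf)) => u _.
by rewrite mulN1r.
Qed.

Lemma smoothCB f g : smoothC O f -> smoothC O g -> smoothC O (fun v => f v - g v).
Proof. by move=> sf sg; exact: (smoothCD sf (smoothCN sg)). Qed.

Lemma smoothCV f : (forall u, O u -> f u != 0) -> smoothC O f ->
  smoothC O (fun v => (f v)^-1).
Proof.
move=> f0 [f1 f2].
have sq := smoothV oO (fun u Ou => sqr_norm_neq0 (f0 u Ou))
  (smoothD oO (smoothM oO f1 f1) (smoothM oO f2 f2)).
split.
  by apply: (smooth_ext oO _ (smoothM oO f1 sq)) => u _; rewrite cReV.
by apply: (smooth_ext oO _ (smoothM oO (smoothN oO f2) sq)) => u _; rewrite cImV.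
Qed.

Lemma smoothC_real (p : plane -> R) : smooth_on O p -> smoothC O (real_fun p).
Proof. by move=> sp; split; [exact: sp | exact: smooth_cst]. Qed.

Lemma smoothC_pder a f : smoothC O f -> smoothC O (pderC a f).
Proof. by move=> [f1 f2]; split; apply: smooth_pder. Qed.

Lemma smoothC_del_z f : smoothC O f -> smoothC O (del_z f).
Proof.
move=> sf; apply: (smoothC_ext _ (smoothCM (smoothCB (smoothC_pder 0 sf)
  (smoothCM (smoothC_cst i) (smoothC_pder 1 sf))) (smoothC_cst 2^-1))) => u _.
by rewrite del_zE.
Qed.

Lemma smoothC_del_zb f : smoothC O f -> smoothC O (del_zb f).
Proof.
move=> sf; exact: (smoothCM (smoothCD (smoothC_pder 0 sf)
  (smoothCM (smoothC_cst i) (smoothC_pder 1 sf))) (smoothC_cst 2^-1)).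
Qed.

Lemma smoothC_comp O' f t : open O' -> smoothC O' f -> (forall u, O u -> O' (t u)) ->
  (forall b, smooth_on O (fun v => t v b 0)) -> smoothC O (f \o t).
Proof.
move=> oO' [f1 f2] OO' st; split.
  exact: (smooth_comp oO oO' f1 OO' st).
exact: (smooth_comp oO oO' f2 OO' st).
Qed.

Lemma smoothC_to_C : smoothC O (@to_C R).
Proof. by split; apply: smooth_coord. Qed.

End Smooth.

Transparent pder.

(* Mean value theorem for the second difference of p, applied first in the direction e a. *)
Lemma MVT_second O (p : plane -> R) u a b (r h : R) : smooth_on O p ->
  (forall v, `|v - u| < r -> O v) -> 2 * `|h| < r -> open O ->
  exists2 w, `|w - u| <= 2 * `|h| &
  p (u + h *: e a + h *: e b) - p (u + h *: e a) - (p (u + h *: e b) - p u)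
    = h * (h * pder b (pder a p) w).
Proof.
move=> sp Hr hr oO.
have small (s t : R) : `|s| <= `|h| -> `|t| <= `|h| ->
    `|(u + s *: e a + t *: e b) - u| <= 2 * `|h|.
  move=> hs ht; have -> : u + s *: e a + t *: e b - u = s *: e a + t *: e b.
    by rewrite addrAC (addrAC u) subrr add0r.
  apply: le_trans (ler_normD _ _) _; rewrite !normrZ !norm_e !mulr1 mulr_natl mulr2n.
  exact: lerD.
have dp (s t : R) : `|s| <= `|h| -> `|t| <= `|h| -> differentiable p (u + s *: e a + t *: e b).
  by move=> hs ht; apply: smooth_diff sp _ => //; apply/Hr/(le_lt_trans _ hr)/small.
have dp' (s t : R) : `|s| <= `|h| -> `|t| <= `|h| ->
    differentiable (pder a p) (u + s *: e a + t *: e b).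
  move=> hs ht; apply: smooth_diff (smooth_pder a sp) _ => //.
  by apply/Hr/(le_lt_trans _ hr)/small.
have shiftD (w x v : plane) (q : plane -> R) :
    derivable q (x + w) v -> derivable (fun y => q (y + w)) x v /\
    'D_v (fun y => q (y + w)) x = 'D_v q (x + w).
  have E : (fun k : R => k^-1 *: (((fun y => q (y + w)) \o shift x) (k *: v) - q (x + w))) =
    (fun k : R => k^-1 *: ((q \o shift (x + w)) (k *: v) - q (x + w))).
    by apply/funext => k /=; rewrite addrA.
  by rewrite /derivable /derive E.
pose F v := p (v + h *: e b) - p v.
have h0 : `|0 : R| <= `|h| by rewrite normr0.
have dF (s : R) : `|s| <= `|h| -> derivable F (u + s *: e a) (e a) /\
    pder a F (u + s *: e a) = pder a p (u + s *: e a + h *: e b) - pder a p (u + s *: e a).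
  move=> hs; have d1 := diff_derivable (v := e a) (dp s h hs (lexx _)).
  have := dp s 0 hs h0; rewrite scale0r addr0 => /(diff_derivable (v := e a)) d2.
  have [d3 E3] := shiftD _ _ _ _ d1; split; first exact: (derivableB d3 d2).
  by rewrite /pder -E3; exact: (deriveB d3 d2).
have [s /dF[]//|s hs Es] := @MVT_slice _ F u (e a) h.
have [t ht|t ht Et] := @MVT_slice _ (pder a p) (u + s *: e a) (e b) h.
  by apply: diff_derivable; exact: dp'.
exists (u + s *: e a + t *: e b); first exact: small.
rewrite -/(F (u + h *: e a)) -[p (u + h *: e b) - p u]/(F u) Es -/(pder a F _).
by rewrite (dF s hs).2 Et.
Qed.

Opaque pder.

(** Schwarz's theorem: the second difference over a small square is symmetric in its two directions,
    so the two mixed derivatives take a common value at two points near [u]; continuity brings this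
    to [u]. *)
Lemma pder_comm_real O (p : plane -> R) u : open O -> smooth_on O p -> O u ->
  pder 0 (pder 1 p) u = pder 1 (pder 0 p) u.
Proof.
move=> oO sp Ou; have [r r0 Hr] := open_ballP oO Ou.
have cont a b : {for u, continuous (pder a (pder b p))}.
  exact: (differentiable_continuous (smooth_diff oO (smooth_pder a (smooth_pder b sp)) Ou)).
apply/eqP; rewrite -subr_eq0 -normr_le0; apply/ler_addgt0Pr => eps eps0; rewrite add0r.
have e20 : 0 < eps / 2 by rewrite divr_gt0.
have [d1 d10 H1] := (continuous_planeP _ _).1 (cont 0 1) _ e20.
have [d2 d20 H2] := (continuous_planeP _ _).1 (cont 1 0) _ e20.
pose h := Num.min r (Num.min d1 d2) / 3.
have m0 : 0 < Num.min r (Num.min d1 d2) by rewrite !lt_min r0 d10.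
have h0 : 0 < h by rewrite divr_gt0.
have hm : 2 * `|h| < Num.min r (Num.min d1 d2) by rewrite gtr0_norm // /h; lra.
have /and3P[hr h1 h2] : [&& 2 * `|h| < r, 2 * `|h| < d1 & 2 * `|h| < d2] by rewrite -!lt_min.
have [w hw Ew] := @MVT_second O p u 0 1 r h sp Hr hr oO.
have [w' hw' Ew'] := @MVT_second O p u 1 0 r h sp Hr hr oO.
have E : pder 1 (pder 0 p) w = pder 0 (pder 1 p) w'.
  have hn : h != 0 by rewrite gt_eqF.
  apply: (mulfI hn); apply: (mulfI hn).
  apply: etrans (esym Ew) _; apply: etrans _ Ew'; rewrite (addrAC u (h *: e 1)).
  by move: (p _) (p _) (p _) (p _) => x1 x2 x3 x4; ring.
have B1 := H1 w' (le_lt_trans hw' h1); have B2 := H2 w (le_lt_trans hw h2).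
rewrite E in B2.
move: B1 B2; move: (pder 0 (pder 1 p) w') (pder 0 (pder 1 p) u) (pder 1 (pder 0 p) u).
move=> x y z B1 B2; rewrite (_ : y - z = (x - z) - (x - y)); last by ring.
by apply: le_trans (ler_normB _ _) _; rewrite (splitr eps) lerD.
Qed.

Lemma pder_comm O a b (p : plane -> R) u : open O -> smooth_on O p -> O u ->
  pder a (pder b p) u = pder b (pder a p) u.
Proof.
move=> oO sp Ou; have H := pder_comm_real oO sp Ou.
by elim/ord2P: a; elim/ord2P: b; [reflexivity | exact: H | exact: esym | reflexivity].
Qed.

Lemma pderC_comm O a b f u : open O -> smoothC O f -> O u ->
  pderC a (pderC b f) u = pderC b (pderC a f) u.
Proof.
by move=> oO [f1 f2] Ou; apply: complex_eqP; apply: (pder_comm _ _ oO _ Ou).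
Qed.

Lemma del_zb_comm O f u : open O -> smoothC O f -> O u ->
  del_zb (del_z f) u = del_z (del_zb f) u.
Proof.
move=> oO sf Ou.
have dp a := smoothC_diff oO (smoothC_pder a sf) Ou.
have P (c : C) a : pderC a (fun v => (pderC 0 f v + c * pderC 1 f v) * 2^-1) u =
    (pderC a (pderC 0 f) u + c * pderC a (pderC 1 f) u) * 2^-1.
  have d1 := diffCM (diffC_cst c u) (dp 1); have d2 := diffCD (dp 0) d1.
  rewrite (pderCM a d2 (diffC_cst 2^-1 u)) (pderCD a (dp 0) d1).
  by rewrite (pderCM a (diffC_cst c u) (dp 1)) !pderC_cst mulr0 addr0 mul0r add0r.
have -> : del_z f = fun v => (pderC 0 f v + (- i) * pderC 1 f v) * 2^-1.
  by apply/funext => v; rewrite del_zE mulNr.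
rewrite del_zE {1}/del_zb !P (pderC_comm 1 0 oO sf Ou).
by move: (pderC _ _ _) (pderC _ _ _) (pderC _ _ _) => x y z; field.
Qed.

End ComplexCalculus.

Opaque smooth_on pder pderC.

(** * Holomorphic functions: division, the maximum principle, orders of zeros *)

Section Holomorphic.
Variable R : realType.
Local Notation plane := 'cV[R]_2.
Local Notation C := R[i].
Local Notation Re := (@complex.Re R).
Local Notation Im := (@complex.Im R).
Implicit Types (u v h a : plane) (f g k : plane -> C) (O : set plane).
Local Notation e a := (delta_mx a 0 : plane).
Local Notation i := (0 +i* 1 : C)%C.

(** With smoothness built in, stability under [del_z] is just the commutation of [del_z] and
    [del_zb]. The link with complex differentiability is made in [hol_holomorphic] and
    [holomorphic_smooth]. *)
Definition hol O f := smoothC O f /\ forall u, O u -> del_zb f u = 0.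

Lemma smoothC_sub O O' f : O `<=` O' -> smoothC O' f -> smoothC O f.
Proof. by move=> OO' [s1 s2]; split; apply: smooth_sub OO' _. Qed.

Lemma hol_sub O O' f : O `<=` O' -> hol O' f -> hol O f.
Proof. by move=> OO' [sf H]; split; [exact: smoothC_sub OO' sf | move=> u /OO'/H]. Qed.

Lemma hol_pder0 O f u : hol O f -> O u -> pderC 0 f u = del_z f u.
Proof. by move=> [_ H] Ou; rewrite pderC0E H // addr0. Qed.

Lemma hol_pder1 O f u : hol O f -> O u -> pderC 1 f u = i * del_z f u.
Proof. by move=> [_ H] Ou; rewrite pderC1E H // subr0. Qed.

Section HolOpen.
Variables (O : set plane) (oO : open O).

Lemma hol_diff f u : hol O f -> O u -> diffC f u.
Proof. by move=> [sf _] Ou; exact: smoothC_diff sf Ou. Qed.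

Lemma hol_ext f g : {in O, f =1 g} -> hol O f -> hol O g.
Proof.
move=> fg [sf H]; split; first exact: (smoothC_ext oO fg).
by move=> u Ou; rewrite -(del_zb_ext_on oO fg) ?inE // H.
Qed.

Lemma hol_cst c : hol O (fun=> c).
Proof. by split; [exact: smoothC_cst | move=> u _; rewrite del_zb_cst]. Qed.

Lemma holD f g : hol O f -> hol O g -> hol O (fun v => f v + g v).
Proof.
move=> hf hg; split; first exact: (smoothCD oO hf.1 hg.1).
by move=> u Ou; rewrite (del_zbD (hol_diff hf Ou) (hol_diff hg Ou)) hf.2 // hg.2 // addr0.
Qed.

Lemma holM f g : hol O f -> hol O g -> hol O (fun v => f v * g v).
Proof.
move=> hf hg; split; first exact: (smoothCM oO hf.1 hg.1).
move=> u Ou; rewrite (del_zbM (hol_diff hf Ou) (hol_diff hg Ou)) hf.2 // hg.2 //.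
by rewrite mul0r mulr0 addr0.
Qed.

Lemma holN f : hol O f -> hol O (fun v => - f v).
Proof.
move=> hf; split; first exact: (smoothCN oO hf.1).
by move=> u Ou; rewrite (del_zbN (hol_diff hf Ou)) hf.2 // oppr0.
Qed.

Lemma holB f g : hol O f -> hol O g -> hol O (fun v => f v - g v).
Proof. by move=> hf hg; exact: (holD hf (holN hg)). Qed.

Lemma holV f : (forall u, O u -> f u != 0) -> hol O f -> hol O (fun v => (f v)^-1).
Proof.
move=> f0 hf; split; first exact: (smoothCV oO f0 hf.1).
by move=> u Ou; rewrite (del_zbV (hol_diff hf Ou) (f0 u Ou)) hf.2 // oppr0 mul0r.
Qed.

Lemma holX f n : hol O f -> hol O (fun v => f v ^+ n).
Proof.
move=> hf; elim: n => [|n IH]; first exact: hol_cst.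
by apply: (hol_ext _ (holM hf IH)) => u _; rewrite exprS.
Qed.

Lemma hol_del_z f : hol O f -> hol O (del_z f).
Proof.
move=> hf; split; first exact: (smoothC_del_z oO hf.1).
move=> u Ou; rewrite (del_zb_comm oO hf.1 Ou).
rewrite -[RHS](del_z_cst 0 u); apply: (del_z_ext_on oO); last by rewrite inE.
by move=> v vO; exact: (hf.2 v (set_mem vO)).
Qed.

Lemma pderC_to_C b u : pderC b (@to_C R) u = if b == 0 then 1 else i.
Proof. by rewrite pderC_split; apply: complex_eqP; elim/ord2P: b; rewrite /= pder_coord. Qed.

Lemma del_z_to_C u : del_z (@to_C R) u = 1.
Proof.
rewrite del_zE !pderC_to_C /= i2 opprK.
by have -> : (1 + 1 : C) = 2 by []; rewrite divff // pnatr_eq0.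
Qed.

Lemma hol_to_C : hol O (@to_C R).
Proof.
split; first exact: smoothC_to_C.
by move=> u _; rewrite /del_zb !pderC_to_C /= i2 subrr mul0r.
Qed.

Lemma hol_shift a : hol O (fun v => to_C v - to_C a).
Proof. by apply: holB; [exact: hol_to_C | exact: hol_cst]. Qed.

Lemma del_z_shift a u : del_z (fun v => to_C v - to_C a) u = 1.
Proof.
rewrite (@del_zD _ (@to_C R) (fun=> - to_C a)); last exact: diffC_cst.
  by rewrite del_z_to_C del_z_cst addr0.
by split; apply: differentiable_coord.
Qed.

End HolOpen.

Definition normsq (z : C) : R := Re z ^+ 2 + Im z ^+ 2.

Lemma normsqM x y : normsq (x * y) = normsq x * normsq y.
Proof. by rewrite /normsq !cReImE; ring. Qed.

Lemma normsqX x n : normsq (x ^+ n) = normsq x ^+ n.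
Proof.
elim: n => [|n IH]; first by rewrite /normsq /= expr0n expr1n addr0.
by rewrite !exprS normsqM IH.
Qed.

Lemma normsq_ge0 x : 0 <= normsq x.
Proof. by rewrite addr_ge0 ?sqr_ge0. Qed.

Lemma normsq_eq0 x : (normsq x == 0) = (x == 0).
Proof.
rewrite /normsq paddr_eq0 ?sqr_ge0 // !sqrf_eq0.
by case: x => p q; rewrite eq_complex.
Qed.

Section Division.
Variables (a : plane) (r : R) (f : plane -> C).
Hypothesis hf : hol (osquare a r) f.
Local Notation B := (osquare a r).

Lemma ray_int_eqN j (p q : plane -> R) u : smooth_on B q -> B u ->
  {in B, forall v, p v = - q v} -> ray_int a j p u = - ray_int a j q u.
Proof.
move=> sq Bu E; rewrite -[RHS]mulN1r.
Transparent ray_int.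
rewrite /ray_int -RintegralZl //; last exact: (ray_integrable j sq Bu).
Opaque ray_int.
apply: eq_Rintegral => t /set_mem tI; rewrite E ?inE; last exact: ray_in.
by rewrite mulN1r mulrN.
Qed.

Lemma ray_int_eq j (p q : plane -> R) u : B u ->
  {in B, forall v, p v = q v} -> ray_int a j p u = ray_int a j q u.
Proof.
move=> Bu E.
Transparent ray_int.
apply: eq_Rintegral => t /set_mem tI; rewrite E ?inE //; exact: ray_in.
Opaque ray_int.
Qed.

(** The integral of [f'] along the ray from [a] to [u], that is, the difference quotient
    [(f u - f a) / (z - z_a)] when [u != a]; in this form it is visibly smooth across [a]. *)
Definition hol_quot : plane -> C := fun u =>
  (ray_int a 0 (pder 0 (fun v => Re (f v))) u +i* ray_int a 0 (pder 0 (fun v => Im (f v))) u)%C.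

Lemma CR_re u : B u -> pder 1 (fun v => Re (f v)) u = - pder 0 (fun v => Im (f v)) u.
Proof.
move=> Bu; have H := hol_pder1 hf Bu; rewrite -(hol_pder0 hf Bu) in H.
by have := congr1 Re H; rewrite !pderC_split cReM /= mul0r mul1r sub0r.
Qed.

Lemma CR_im u : B u -> pder 1 (fun v => Im (f v)) u = pder 0 (fun v => Re (f v)) u.
Proof.
move=> Bu; have H := hol_pder1 hf Bu; rewrite -(hol_pder0 hf Bu) in H.
by have := congr1 Im H; rewrite !pderC_split cImM /= mul0r mul1r add0r.
Qed.

Lemma hol_quotP : f a = 0 ->
  hol B hol_quot /\ forall u, B u -> f u = (to_C u - to_C a) * hol_quot u.
Proof.
move=> fa; have oB := @osquare_open R a r; have [[s1 s2] _] := hf.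
have s01 := smooth_pder 0 s1; have s02 := smooth_pder 0 s2.
split.
  split; first by split; apply: ray_int_smooth.
  (* The Cauchy-Riemann equations of [f] hold under the integral sign, after the order of the
     derivatives has been exchanged. *)
  move=> u Bu; suff E : pderC 1 hol_quot u = i * pderC 0 hol_quot u.
    by rewrite /del_zb E mulrA i2 mulN1r subrr mul0r.
  have P b : pderC b hol_quot u =
      (ray_int a 1 (pder b (pder 0 (fun v => Re (f v)))) u +i*
       ray_int a 1 (pder b (pder 0 (fun v => Im (f v)))) u)%C.
    by rewrite pderC_split; congr (_ +i* _)%C;
      [exact: (pder_ray_int 0 b s01 Bu) | exact: (pder_ray_int 0 b s02 Bu)].
  rewrite !P; apply: complex_eqP; rewrite ?cReM ?cImM /= !mul0r !mul1r ?sub0r ?add0r.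
    apply: (ray_int_eqN _ (smooth_pder 0 s02) Bu) => v vB.
    have Bv := set_mem vB; rewrite (pder_comm 1 0 oB s1 Bv) -pderN; last exact: smooth_diff s02 Bv.
    by apply: (pder_ext_on 0 oB) => // w wB; apply: CR_re; exact: set_mem.
  apply: (ray_int_eq _ Bu) => v vB.
  have Bv := set_mem vB; rewrite (pder_comm 1 0 oB s2 Bv).
  by apply: (pder_ext_on 0 oB) => // w wB; apply: CR_im; exact: set_mem.
move=> u Bu; have H1 := Hadamard s1 Bu; have H2 := Hadamard s2 Bu.
move: H1 H2; rewrite fa /= !subr0.
rewrite (@ray_int_eqN 0 (pder 1 (fun v => Re (f v))) (pder 0 (fun v => Im (f v))) u s02 Bu);
  last by move=> v vB; apply: CR_re; exact: set_mem.
rewrite (@ray_int_eq 0 (pder 1 (fun v => Im (f v))) (pder 0 (fun v => Re (f v))) u Bu);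
  last by move=> v vB; apply: CR_im; exact: set_mem.
rewrite /hol_quot; move: (ray_int _ _ _ _) (ray_int _ _ _ _) => p q E1 E2.
by apply: complex_eqP; rewrite !cReImE /= ?E1 ?E2; ring.
Qed.

End Division.

(** A second difference centred at a maximum is not positive, whereas a positive second derivative,
    staying positive near [u], would make it positive. *)
Lemma pder2_max O (p : plane -> R) u b (d : R) : open O -> smooth_on O p -> O u -> 0 < d ->
  (forall v, `|v - u| < d -> p v <= p u) -> pder b (pder b p) u <= 0.
Proof.
move=> oO sp Ou d0 Hm; rewrite leNgt; apply/negP => pos.
have [r r0 Hr] := open_ballP oO Ou.
have c : {for u, continuous (pder b (pder b p))}.
  exact: (differentiable_continuous (smooth_diff oO (smooth_pder b (smooth_pder b sp)) Ou)).
have e0 : 0 < pder b (pder b p) u / 2 by rewrite divr_gt0.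
have [d1 d10 H1] := (continuous_planeP _ _).1 c _ e0.
(* [MVT_second] is applied on the ball of radius [4 * s] about a point at distance [s] from [u];
   hence the factor 5. *)
have [s [s0 mr md md1]] : exists s : R, [/\ 0 < s, 5 * s <= r, 5 * s <= d & 5 * s <= d1].
  pose m := Num.min r (Num.min d d1).
  have m0 : 0 < m by rewrite /m !lt_min r0 d0 d10.
  have /and3P[mr md md1] : [&& m <= r, m <= d & m <= d1] by rewrite -!le_min lexx.
  exists (m / 5); rewrite divr_gt0 //; have -> : 5 * (m / 5) = m by rewrite mulrC divfK // pnatr_eq0.
  by split.
(* The base point is shifted so that the second difference has [u] as its middle point. *)
pose u0 := u - s *: e b.
have nu0 : `|u0 - u| <= s by rewrite /u0 addrAC subrr sub0r normrN normrZ norm_e mulr1 gtr0_norm.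
have Hr' v : `|v - u0| < 4 * s -> O v.
  move=> vu; apply: Hr; rewrite -(subrK u0 v) -addrA; apply: le_lt_trans (ler_normD _ _) _.
  by apply: lt_le_trans (ltr_leD vu nu0) _; move: s0 mr; clear; lra.
have hs : 2 * `|s| < 4 * s by rewrite gtr0_norm //; move: s0; clear; lra.
have [w hw Ew] := @MVT_second _ O p u0 b b (4 * s) s sp Hr' hs oO.
have Eu : u0 + s *: e b = u by rewrite /u0 subrK.
rewrite !Eu in Ew.
have wu : `|w - u| < d1.
  rewrite -(subrK u0 w) -addrA; apply: le_lt_trans (ler_normD _ _) _.
  apply: le_lt_trans (lerD hw nu0) _; rewrite gtr0_norm //.
  by move: md1 s0; clear; lra.
have P1 : p (u + s *: e b) <= p u.
  apply: Hm; rewrite addrAC subrr add0r normrZ norm_e mulr1 gtr0_norm //.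
  by move: md s0; clear; lra.
have P2 : p u0 <= p u by apply: Hm; move: md s0 nu0; clear; lra.
have := H1 w wu; move: pos P1 P2 Ew.
move: (p (u + _)) (p u) (p u0) (pder b (pder b p) w) (pder b (pder b p) u).
move=> x y z q q0 pos P1 P2 Ew; rewrite ler_distl => /andP[Hq _].
have : 0 < s * (s * q) by rewrite !mulr_gt0 //; move: pos Hq; clear; lra.
by rewrite -Ew; move: P1 P2; clear; lra.
Qed.

Lemma pder2_sqr O (q : plane -> R) b u : open O -> smooth_on O q -> O u ->
  pder b (pder b (fun v => q v * q v)) u =
    2 * (pder b q u * pder b q u) + 2 * q u * pder b (pder b q) u.
Proof.
move=> oO sq Ou.
have E : {in O, pder b (fun v => q v * q v) =1 (fun v => pder b q v * q v + q v * pder b q v)}.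
  by move=> v vO; apply: pderM; apply: (smooth_diff oO sq); exact: set_mem.
have dq := smooth_diff oO sq Ou; have dq' := smooth_diff oO (smooth_pder b sq) Ou.
rewrite (pder_ext_on b oO E) ?inE // pderD; last 2 first.
- exact: differentiableMf.
- exact: differentiableMf.
by rewrite !pderM //; gen_der; ring.
Qed.

Lemma pder2D O (q1 q2 : plane -> R) b u : open O -> smooth_on O q1 -> smooth_on O q2 -> O u ->
  pder b (pder b (fun v => q1 v + q2 v)) u = pder b (pder b q1) u + pder b (pder b q2) u.
Proof.
move=> oO s1 s2 Ou.
have E : {in O, pder b (fun v => q1 v + q2 v) =1 (fun v => pder b q1 v + pder b q2 v)}.
  move=> w /set_mem Ow; exact: (pderD b (smooth_diff oO s1 Ow) (smooth_diff oO s2 Ow)).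
rewrite (pder_ext_on b oO E) ?inE //.
exact: (pderD b (smooth_diff oO (smooth_pder b s1) Ou) (smooth_diff oO (smooth_pder b s2) Ou)).
Qed.

Lemma pder2Z O (c : R) (q : plane -> R) b u : open O -> smooth_on O q -> O u ->
  pder b (pder b (fun v => c * q v)) u = c * pder b (pder b q) u.
Proof.
move=> oO sq Ou.
have P q' w : smooth_on O q' -> O w -> pder b (fun v => c * q' v) w = c * pder b q' w.
  move=> sq' Ow; have dc : differentiable (fun=> c : R) w by exact: differentiable_cst.
  by rewrite (pderM b dc (smooth_diff oO sq' Ow)) pder_cst mul0r add0r.
have E : {in O, pder b (fun v => c * q v) =1 (fun v => c * pder b q v)}.
  by move=> w /set_mem Ow; exact: P.
rewrite (pder_ext_on b oO E) ?inE //; exact: (P _ _ (smooth_pder b sq) Ou).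
Qed.

(** Adding a small multiple of [|v - a|^2] to [|k|^2] makes the Laplacian strictly positive, so the
    maximum over the closed square lies on its boundary; the multiple is then absorbed in [eps]. *)
Lemma maximum_principle O (k : plane -> C) a (r M : R) : open O -> hol O k -> 0 < r ->
  csquare a r `<=` O -> (forall v, `|v - a| = r -> normsq (k v) <= M) ->
  forall v, csquare a r v -> normsq (k v) <= M.
Proof.
move=> oO hk r0 sub HM v va; have [[s1 s2] _] := hk.
apply/ler_addgt0Pr => eps eps0.
(* On the square of radius [r] the Euclidean [rho] is at most [2 * r ^+ 2], so the perturbation is
   at most [eps]. *)
pose dl := eps / (2 * r ^+ 2); have dl0 : 0 < dl by rewrite divr_gt0 // mulr_gt0 // exprn_gt0.
have sc b : smooth_on O (fun v => v b 0 - a b 0).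
  exact: (smoothB oO (smooth_coord oO b) (smooth_cst oO _)).
have pc b c u : pder b (fun v : plane => v c 0 - a c 0) u = (b == c)%:R.
  by rewrite pderD ?pder_coord ?pder_cst ?addr0 //; exact: differentiable_coord.
pose rho v := (v 0 0 - a 0 0) * (v 0 0 - a 0 0) + (v 1 0 - a 1 0) * (v 1 0 - a 1 0).
pose p v := Re (k v) * Re (k v) + Im (k v) * Im (k v) + dl * rho v.
have sq1 := smoothM oO s1 s1; have sq2 := smoothM oO s2 s2.
have srho := smoothD oO (smoothM oO (sc 0) (sc 0)) (smoothM oO (sc 1) (sc 1)).
have sdr := smoothM oO (smooth_cst oO dl) srho.
have sp : smooth_on O p by exact: (smoothD oO (smoothD oO sq1 sq2) sdr).
(* Real and imaginary parts are harmonic, so only the squares of their gradients and the constant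
   [4 * dl] remain in the Laplacian of [p]. *)
have Lp u : O u -> 0 < pder 0 (pder 0 p) u + pder 1 (pder 1 p) u.
  move=> Ou.
  have pD b q1 q2 := @pder2D O q1 q2 b u oO; have pZ b q := @pder2Z O dl q b u oO.
  have pc0 (b c : 'I_2) : pder b (pder b (fun v : plane => v c 0 - a c 0)) u = 0.
    have -> : pder b (fun v : plane => v c 0 - a c 0) = fun=> (b == c)%:R.
      by apply/funext => w; rewrite pc.
    by rewrite pder_cst.
  have Prho b : pder b (pder b rho) u = 2.
    rewrite (pD b _ _ (smoothM oO (sc 0) (sc 0)) (smoothM oO (sc 1) (sc 1)) Ou).
    rewrite (pder2_sqr b oO (sc 0) Ou) (pder2_sqr b oO (sc 1) Ou) !pc0 !pc.
    by elim/ord2P: b => /=; ring.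
  have P b : pder b (pder b p) u =
    2 * (pder b (fun v => Re (k v)) u) ^+ 2 + 2 * Re (k u) * pder b (pder b (fun v => Re (k v))) u
    + (2 * (pder b (fun v => Im (k v)) u) ^+ 2 + 2 * Im (k u) * pder b (pder b (fun v => Im (k v))) u)
    + dl * 2.
    rewrite (pD b _ _ (smoothD oO sq1 sq2) sdr Ou) (pD b _ _ sq1 sq2 Ou) (pZ b _ srho Ou).
    by rewrite Prho (pder2_sqr b oO s1 Ou) (pder2_sqr b oO s2 Ou) !expr2.
  have CRre w : w \in O -> pder 1 (fun v => Re (k v)) w = - pder 0 (fun v => Im (k v)) w.
    move=> /set_mem Ow; have H := hol_pder1 hk Ow; rewrite -(hol_pder0 hk Ow) in H.
    by have := congr1 Re H; rewrite !pderC_split cReM /= mul0r mul1r sub0r.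
  have CRim w : w \in O -> pder 1 (fun v => Im (k v)) w = pder 0 (fun v => Re (k v)) w.
    move=> /set_mem Ow; have H := hol_pder1 hk Ow; rewrite -(hol_pder0 hk Ow) in H.
    by have := congr1 Im H; rewrite !pderC_split cImM /= mul0r mul1r add0r.
  have uO : u \in O by rewrite inE.
  have d02 := smooth_diff oO (smooth_pder 0 s2) Ou.
  have L1 : pder 1 (pder 1 (fun v => Re (k v))) u = - pder 0 (pder 0 (fun v => Re (k v))) u.
    exact: (etrans (pder_ext_on 1 oO CRre uO) (etrans (pderN 1 d02)
      (congr1 -%R (etrans (pder_comm 1 0 oO s2 Ou) (pder_ext_on 0 oO CRim uO))))).
  have L2 : pder 1 (pder 1 (fun v => Im (k v))) u = - pder 0 (pder 0 (fun v => Im (k v))) u.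
    exact: (etrans (pder_ext_on 1 oO CRim uO) (etrans (pder_comm 1 0 oO s1 Ou)
      (etrans (pder_ext_on 0 oO CRre uO) (pderN 0 d02)))).
  rewrite !P L1 L2.
  have := sqr_ge0 (pder 0 (fun v => Re (k v)) u); have := sqr_ge0 (pder 1 (fun v => Re (k v)) u).
  have := sqr_ge0 (pder 0 (fun v => Im (k v)) u); have := sqr_ge0 (pder 1 (fun v => Im (k v)) u).
  by gen_der; move: (Re (k u)) (Im (k u)) (dl) dl0; clear; move=> *; lra.
have cp v' : csquare a r v' -> {for v', continuous p}.
  by move=> /sub Ov; exact: (differentiable_continuous (smooth_diff oO sp Ov)).
have [c cin Hc] := csquare_max (ltW r0) cp.
have cb : `|c - a| = r.
  apply/eqP; rewrite eq_le cin leNgt /=; apply/negP => ca.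
  have d0 : 0 < r - `|c - a| by rewrite subr_gt0.
  have mx w : `|w - c| < r - `|c - a| -> p w <= p c.
    move=> wc; apply: Hc; rewrite /csquare /= -(subrK c w) -addrA.
    by apply: le_trans (ler_normD _ _) _; rewrite -lerBrDr ltW.
  have := Lp c (sub _ cin).
  by rewrite ltNge -[leRHS]addr0 lerD // (pder2_max _ oO sp (sub _ cin) d0).
have rho_ge0 w : 0 <= rho w by rewrite addr_ge0 // -expr2 sqr_ge0.
have rho_c : rho c <= 2 * r ^+ 2.
  have q b : (c b 0 - a b 0) * (c b 0 - a b 0) <= r ^+ 2.
    have := norm_coord (c - a) b; rewrite cb !mxE -expr2 => h.
    by rewrite -real_normK ?num_real // lerXn2r // nnegrE // ltW.
  by apply: le_trans (lerD (q 0) (q 1)) _; rewrite mulr_natl mulr2n.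
apply: (@le_trans _ _ (p v)); first by rewrite /p /normsq !expr2 lerDl mulr_ge0 // ltW.
apply: le_trans (Hc v va) _; rewrite /p -!expr2; apply: lerD; first exact: HM.
apply: le_trans (ler_wpM2l (ltW dl0) rho_c) _.
by rewrite /dl divfK // mulf_neq0 ?pnatr_eq0 // expf_neq0 // gt_eqF.
Qed.

(* If f vanished at a to infinite order, the maximum principle applied to f / (z - a)^n
   would force f to vanish nearby. *)
Lemma hol_zero_order a (r : R) f : 0 < r -> hol (osquare a r) f ->
  (forall v, `|v - a| < r / 4 -> f v = 0) \/
  exists n k, [/\ hol (osquare a r) k, k a != 0
    & forall u, osquare a r u -> f u = (to_C u - to_C a) ^+ n * k u].
Proof.
move=> r0 hf; have oB := @osquare_open R a r.
pose Q n := exists2 k, hol (osquare a r) k &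
  forall u, osquare a r u -> f u = (to_C u - to_C a) ^+ n * k u.
have aB : osquare a r a by rewrite /osquare /= subrr normr0.
have [HQ|HQ] := pselect (forall n, Q n); last first.
  (* If every quotient vanished at [a], division by [z - z_a] could be repeated indefinitely. *)
  right; apply: contrapT => N; apply: HQ; elim=> [|n [k hk Ek]].
    by exists f => // u _; rewrite mul1r.
  have [ka|ka] := eqVneq (k a) 0; last by case: N; exists n, k.
  have [hq Eq] := hol_quotP hk ka; exists (hol_quot a k) => // u Bu.
  by rewrite Ek // Eq // exprSr mulrA.
left=> v va.
have hsub : csquare a (r / 2) `<=` osquare a r.
  by move=> w wa; apply: le_lt_trans wa _; move: r0; clear; lra.
have r20 : 0 < r / 2 by rewrite divr_gt0.
have [M M0 HM] : exists2 M, 0 <= M & forall v, csquare a (r / 2) v -> `|normsq (f v)| <= M.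
  apply: csquare_bound => w /hsub Bw; apply: differentiable_continuous.
  apply: (smooth_diff oB _ Bw); have [[s1 s2] _] := hf.
  apply: (smooth_ext oB _ (smoothD oB (smoothM oB s1 s1) (smoothM oB s2 s2))) => x _.
  by rewrite /normsq !expr2.
(* On the boundary of the square of radius [r / 2] the squared modulus of [z - z_a] is at least
   [(r / 2) ^+ 2], while [|v - a| < r / 4] in the maximum norm bounds it at [v] by half of that:
   each factor [z - z_a] gains [1 / 2]. *)
have key n : normsq (f v) <= M * 2^-1 ^+ n.
  have [k hk Ek] := HQ n.
  have rn : 0 < ((r / 2) ^+ 2) ^+ n by rewrite !exprn_gt0.
  have bd : forall w, `|w - a| = r / 2 -> normsq (k w) <= M / ((r / 2) ^+ 2) ^+ n.
    move=> w wa; have wB : csquare a (r / 2) w by rewrite /csquare /= wa.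
    rewrite ler_pdivlMr //; apply: le_trans (HM w wB); rewrite ger0_norm ?normsq_ge0 //.
    rewrite (Ek w (hsub _ wB)) normsqM normsqX mulrC ler_wpM2r ?normsq_ge0 //.
    apply: lerXn2r; rewrite ?nnegrE ?sqr_ge0 ?normsq_ge0 //.
    have : r / 2 <= `|w 0 0 - a 0 0| \/ r / 2 <= `|w 1 0 - a 1 0|.
      have := lexx (r / 2); rewrite -[X in _ <= X]wa => H.
      have [h0|h0] := leP (r / 2) `|w 0 0 - a 0 0|; [by left | right].
      rewrite leNgt; apply/negP => h1.
      have : `|w - a| < r / 2 by apply/(norm_plane_ltP _ r20); rewrite !mxE.
      by rewrite wa ltxx.
    rewrite /normsq /=; case=> h.
      by rewrite ler_wpDr ?sqr_ge0 // -[leRHS]real_normK ?num_real // lerXn2r // ?nnegrE // ltW.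
    by rewrite ler_wpDl ?sqr_ge0 // -[leRHS]real_normK ?num_real // lerXn2r // ?nnegrE // ltW.
  have v2 : csquare a (r / 2) v by rewrite /csquare /=; move: va r0; clear; lra.
  have kv := maximum_principle oB hk r20 hsub bd v2.
  rewrite (Ek v (hsub _ v2)) normsqM normsqX.
  have zv : normsq (to_C v - to_C a) <= (r / 2) ^+ 2 * 2^-1.
    have c0 := norm_coord (v - a) 0; have c1 := norm_coord (v - a) 1.
    have q b : (v b 0 - a b 0) ^+ 2 <= (r / 4) ^+ 2.
      have h := norm_coord (v - a) b; rewrite !mxE in h.
      rewrite -[leLHS]real_normK ?num_real // lerXn2r // ?nnegrE //; first by rewrite divr_ge0 // ltW.
      exact: le_trans h (ltW va).
    by apply: le_trans (lerD (q 0) (q 1)) _; rewrite le_eqVlt; apply/orP; left; apply/eqP; field.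
  apply: (@le_trans _ _ (((r / 2) ^+ 2 * 2^-1) ^+ n * (M / ((r / 2) ^+ 2) ^+ n))).
    apply: ler_pM; rewrite ?exprn_ge0 ?normsq_ge0 //.
    by apply: lerXn2r; rewrite ?nnegrE ?normsq_ge0 // mulr_ge0 ?sqr_ge0.
  rewrite exprMn; move: rn; move: (((r / 2) ^+ 2) ^+ n) (2^-1 ^+ n) => q h q0.
  have qn : q != 0 by rewrite gt_eqF.
  by have -> : q * h * (M / q) = M * h by field.
apply/eqP; rewrite -normsq_eq0 eq_le normsq_ge0 andbT leNgt; apply/negP => pos.
have [n Hn] : exists n : nat, M / normsq (f v) < n%:R.
  by exists (Num.bound (M / normsq (f v))); apply: archi_boundP; rewrite divr_ge0 // ltW.
have := key n; rewrite exprVn ler_pdivlMr ?exprn_gt0 // leNgt => /negP; apply.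
rewrite mulrC -ltr_pdivrMr //; apply: lt_le_trans Hn _.
by rewrite -natrX ler_nat ltnW // ltn_expl.
Qed.

End Holomorphic.

Opaque smooth_on pder pderC.

(** * Complex differentiability and the Cauchy-Riemann equations *)

Section ComplexDerivative.
Variable R : realType.
Local Notation plane := 'cV[R]_2.
Local Notation C := R[i].
Local Notation Re := (@complex.Re R).
Local Notation Im := (@complex.Im R).
Implicit Types (u v h a : plane) (f g k : plane -> C) (O : set plane).
Local Notation e a := (delta_mx a 0 : plane).
Local Notation i := (0 +i* 1 : C)%C.

Lemma of_CK (w : C) : to_C (of_C w) = w.
Proof. by case: w => x y; rewrite /to_C /of_C !mxE. Qed.

Lemma to_CK u : of_C (to_C u) = u.
Proof. by apply: plane_eqP; rewrite !mxE. Qed.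

Lemma of_CD (x y : C) : of_C (x + y) = of_C x + of_C y.
Proof. by apply: plane_eqP; rewrite !mxE /= ?cReD ?cImD. Qed.

(** The norm of [C] takes its values in [C]; [Nm] is the same modulus as an element of [R], where
    the estimates take place. *)
Definition Nm (z : C) : R := Num.sqrt (normsq z).

Lemma normC_Nm (z : C) : `|z| = ((Nm z)%:C)%C.
Proof. exact: normc_def. Qed.

Lemma Re_le_Nm z : `|Re z| <= Nm z.
Proof. by rewrite -sqrtr_sqr ler_wsqrtr // lerDl sqr_ge0. Qed.

Lemma Im_le_Nm z : `|Im z| <= Nm z.
Proof. by rewrite -sqrtr_sqr ler_wsqrtr // lerDr sqr_ge0. Qed.

Lemma Nm_le z : Nm z <= `|Re z| + `|Im z|.
Proof.
rewrite -[leRHS]ger0_norm ?addr_ge0 // -sqrtr_sqr ler_wsqrtr // /normsq.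
by rewrite sqrrD !real_normK ?num_real // addrAC lerDl mulrn_wge0 // mulr_ge0.
Qed.

Lemma Nm_ge0 z : 0 <= Nm z. Proof. exact: sqrtr_ge0. Qed.

Lemma NmM x y : Nm (x * y) = Nm x * Nm y.
Proof. by rewrite /Nm normsqM sqrtrM // normsq_ge0. Qed.

Lemma Nm_eq0 z : (Nm z == 0) = (z == 0).
Proof. by rewrite sqrtr_eq0 -normsq_eq0 eq_le normsq_ge0 andbT. Qed.

Lemma NmV x : Nm x^-1 = (Nm x)^-1.
Proof.
have [->|x0] := eqVneq x 0.
  have N0 : Nm 0 = 0 by apply/eqP; rewrite Nm_eq0.
  have -> : (0 : C)^-1 = 0 by exact: invr0.
  by rewrite N0 invr0.
have n0 : Nm x != 0 by rewrite Nm_eq0.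
apply: (mulfI n0); rewrite -NmM !divff //.
by rewrite /Nm /normsq /= expr0n expr1n addr0 sqrtr1.
Qed.

Lemma norm_of_C z : `|of_C z| <= Nm z.
Proof.
by apply/norm_planeP; [exact: Nm_ge0 | rewrite !mxE /=; split; [exact: Re_le_Nm | exact: Im_le_Nm]].
Qed.

(** A positive element of [C] has imaginary part 0, so complex radii of balls are real ones. *)
Lemma near_CP (P : C -> Prop) (w : C) :
  (\forall z \near (w : C^o), P z) <-> exists2 d : R, 0 < d & forall z, Nm (z - w) < d -> P z.
Proof.
split.
  move=> /nbhs_ballP[/= [d d'] d0 HP].
  have d00 : 0 < d by move: d0; rewrite ltcE /= => /andP[].
  have dd : d' = 0 by move: d0; rewrite ltcE /= => /andP[/eqP].
  exists d => // z zw; apply: HP; rewrite -ball_normE /= distrC normC_Nm.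
  by rewrite ltcE /= dd eqxx.
move=> [d d0 HP]; apply/nbhs_ballP; exists (d%:C)%C => /=; first by rewrite ltcE /= eqxx.
move=> z; rewrite -ball_normE /= distrC normC_Nm ltcE /= eqxx => zw; exact: HP.
Qed.

Lemma near_planeC (P : plane -> Prop) u : (\forall v \near u, P v) ->
  \forall w \near (to_C u : C^o), P (of_C w).
Proof.
move=> /near_ballP[r r0 H]; apply/near_CP; exists r => // z zu; apply: H.
apply: le_lt_trans zu; rewrite -[X in `|_ - X| <= _]to_CK.
have -> : of_C z - of_C (to_C u) = of_C (z - to_C u).
  by apply: plane_eqP; rewrite !mxE /= ?cReD ?cImD ?cReN ?cImN.
exact: norm_of_C.
Qed.

Lemma CR_holomorphic f u : diffC f u -> del_zb f u = 0 -> holomorphic_at f u.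
Proof.
move=> [d1 d2] H; rewrite /holomorphic_at.
set p0 := pderC 0 f u.
have E1 : pderC 1 f u = i * p0 by rewrite pderC1E H /p0 pderC0E H addr0 subr0.
apply/cvg_ex; exists p0; apply/cvgrPdist_le => -[eps eps'] eps0.
have epos : 0 < eps by move: eps0; rewrite ltcE /= => /andP[].
have eim : eps' = 0 by move: eps0; rewrite ltcE /= => /andP[/eqP].
have e20 : 0 < eps / 2 by rewrite divr_gt0.
have /near_ballP[r1 r10 H1] := diff_boundP d1 e20.
have /near_ballP[r2 r20 H2] := diff_boundP d2 e20.
(* The punctured neighbourhood filter unfolds to a full neighbourhood with the side condition
   [h != 0]. *)
suff : \forall h \near (0 : C^o), h != 0 ->
  `|p0 - h^-1 *: (((f \o @of_C R) \o shift (to_C u)) (h *: (1 : C^o)) - (f \o @of_C R) (to_C u))|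
   <= (eps +i* eps')%C by [].
apply/near_CP; exists (Num.min r1 r2); first by rewrite lt_min r10.
move=> h; rewrite subr0 lt_min => /andP[h1 h2] h0.
have -> : h *: (1 : C^o) = h by exact: mulr1.
rewrite /= of_CD to_CK.
set D := f (of_C h + u) - f u.
have -> : p0 - h^-1 *: D = - (h^-1 * (D - h * p0)).
  by rewrite /GRing.scale /=; move: D => D; field.
rewrite normrN normC_Nm NmM NmV lecE /= eim eqxx /= mulrC ler_pdivrMr; last first.
  by rewrite lt_def Nm_eq0 h0 Nm_ge0.
have k1 := H1 (of_C h); have k2 := H2 (of_C h); rewrite !subr0 in k1 k2.
have {}k1 := k1 (le_lt_trans (norm_of_C h) h1); have {}k2 := k2 (le_lt_trans (norm_of_C h) h2).
have re1 : pder 1 (fun v => Re (f v)) u = - Im p0.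
  by have := congr1 Re E1; rewrite pderC_split cReM /= mul0r mul1r sub0r.
have im1 : pder 1 (fun v => Im (f v)) u = Re p0.
  by have := congr1 Im E1; rewrite pderC_split cImM /= mul0r mul1r add0r.
have re0 : pder 0 (fun v => Re (f v)) u = Re p0 by rewrite /p0 pderC_split.
have im0 : pder 0 (fun v => Im (f v)) u = Im p0 by rewrite /p0 pderC_split.
apply: le_trans (Nm_le _) _; rewrite (splitr eps) mulrDl; apply: lerD.
  apply: le_trans (ler_wpM2l (ltW e20) (norm_of_C h)); apply: le_trans k1.
  by rewrite /D /linform re0 re1 !cReImE !mxE /= le_eqVlt; apply/orP; left; apply/eqP;
    congr (`| _ |); move: (Re _) (Re _) (Re _) (Im _) => x1 x2 x3 x4; ring.
apply: le_trans (ler_wpM2l (ltW e20) (norm_of_C h)); apply: le_trans k2.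
by rewrite /D /linform im0 im1 !cReImE !mxE /= le_eqVlt; apply/orP; left; apply/eqP;
    congr (`| _ |); move: (Im _) (Im _) (Re _) (Im _) => x1 x2 x3 x4; ring.
Qed.

Lemma hol_holomorphic O f u : open O -> hol O f -> O u -> holomorphic_at f u.
Proof. by move=> oO hf Ou; apply: CR_holomorphic; [exact: hol_diff hf Ou | exact: hf.2]. Qed.

Lemma is_derive_bound (p : plane -> R) u v (L : R) :
  (forall eps, 0 < eps -> exists2 d : R, 0 < d &
     forall s : R, s != 0 -> `|s| < d -> `|L - s^-1 * (p (s *: v + u) - p u)| <= eps) ->
  is_derive u v p L.
Proof.
move=> H; have cv : (fun h : R => h^-1 *: ((p \o shift u) (h *: v) - p u)) @ 0^' --> L.
  apply/cvgrPdist_le => eps eps0; have [d d0 Hd] := H eps eps0.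
  suff : \forall s \near (0 : R), s != 0 -> `|L - s^-1 * (p (s *: v + u) - p u)| <= eps by [].
  apply/nbhs_ballP; exists d => // s; rewrite -ball_normE /= sub0r normrN => sd s0.
  exact: Hd.
apply: DeriveDef; first by apply/cvg_ex; exists L.
exact: cvg_lim.
Qed.

Transparent pder.
(** The complex difference quotient is restricted to real and to purely imaginary increments; the
    real and imaginary parts of each limit are the four partial derivatives. *)
Lemma holomorphic_CR f u : holomorphic_at f u ->
  exists D : C, [/\ is_derive u (e 0) (fun v => Re (f v)) (Re D),
    is_derive u (e 0) (fun v => Im (f v)) (Im D),
    is_derive u (e 1) (fun v => Re (f v)) (- Im D)
    & is_derive u (e 1) (fun v => Im (f v)) (Re D)].
Proof.
move=> /cvg_ex[/= D /cvgrPdist_le HD]; exists D.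
have H eps : 0 < eps -> exists2 d : R, 0 < d & forall h : C, h != 0 -> Nm h < d ->
    Nm (D - h^-1 * (f (of_C h + u) - f u)) <= eps.
  move=> eps0; have e0 : (0 : C) < ((eps%:C)%C : C) by rewrite ltcE /= eqxx.
  have : \forall h \near (0 : C^o), h != 0 ->
    `|D - h^-1 *: (((f \o @of_C R) \o shift (to_C u)) (h *: (1 : C^o)) - (f \o @of_C R) (to_C u))|
    <= (eps%:C)%C by exact: HD.
  move=> /near_CP[d d0 Hd]; exists d => // h h0 hd; have := Hd h; rewrite subr0 => /(_ hd h0).
  have -> : h *: (1 : C^o) = h by exact: mulr1.
  by rewrite /= of_CD to_CK normC_Nm lecE /= eqxx.
have Hre (s : R) : of_C ((s%:C)%C : C) = s *: e 0.
  by apply: plane_eqP; rewrite !mxE /= ?mulr1 ?mulr0.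
have Him (s : R) : of_C ((0 +i* s)%C : C) = s *: e 1.
  by apply: plane_eqP; rewrite !mxE /= ?mulr1 ?mulr0.
have Nre (s : R) : Nm ((s%:C)%C : C) = `|s|.
  by rewrite /Nm /normsq /= expr0n addr0 sqrtr_sqr.
have Nim (s : R) : Nm ((0 +i* s)%C : C) = `|s|.
  by rewrite /Nm /normsq /= expr0n add0r sqrtr_sqr.
have Vre (s : R) (z : C) : s != 0 -> ((s%:C)%C : C)^-1 * z = ((s^-1 * Re z) +i* (s^-1 * Im z))%C.
  by move=> s0; case: z => x y; apply: complex_eqP; rewrite cReImE /= expr0n /=; field.
have Vim (s : R) (z : C) : s != 0 -> ((0 +i* s)%C : C)^-1 * z = ((s^-1 * Im z) +i* (- (s^-1 * Re z)))%C.
  by move=> s0; case: z => x y; apply: complex_eqP; rewrite cReImE /= expr0n /=; field.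
have s0C (s : R) : s != 0 -> ((s%:C)%C : C) != 0 by rewrite eq_complex /= eqxx andbT.
have s1C (s : R) : s != 0 -> ((0 +i* s)%C : C) != 0 by rewrite eq_complex /= eqxx.
split; apply: is_derive_bound => eps eps0; have [d d0 Hd] := H eps eps0; exists d => // s s0 sd.
- have := Hd _ (s0C s s0); rewrite Nre Hre Vre // => /(_ sd); apply: le_trans.
  by apply: le_trans (Re_le_Nm _); rewrite !cReImE.
- have := Hd _ (s0C s s0); rewrite Nre Hre Vre // => /(_ sd); apply: le_trans.
  by apply: le_trans (Im_le_Nm _); rewrite !cReImE.
- have := Hd _ (s1C s s0); rewrite Nim Him Vim // => /(_ sd); apply: le_trans.
  apply: le_trans (Im_le_Nm _); rewrite -normrN !cReImE /=.
  by rewrite opprB addrC opprK opprK.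
- have := Hd _ (s1C s s0); rewrite Nim Him Vim // => /(_ sd); apply: le_trans.
  by apply: le_trans (Re_le_Nm _); rewrite !cReImE.
Qed.

(* No integral formula is needed here: the Cauchy-Riemann equations express the derivatives of
   the imaginary part by those of the real part, which is smooth by hypothesis. *)
Lemma holomorphic_smooth O f : open O -> (forall u, O u -> holomorphic_at f u) ->
  smooth_on O (fun v => Re (f v)) -> hol O f.
Proof.
move=> oO hf s1.
have CR u : O u -> [/\ derivable (fun v => Im (f v)) u (e 0), derivable (fun v => Im (f v)) u (e 1),
    pder 0 (fun v => Im (f v)) u = - pder 1 (fun v => Re (f v)) u
    & pder 1 (fun v => Im (f v)) u = pder 0 (fun v => Re (f v)) u].
  move=> /hf/holomorphic_CR[D [[_ a1] [b1 b2] [_ c2] [d1' d2']]].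
  by split => //; rewrite /pder ?b2 ?c2 ?opprK ?d2' ?a1.
have p0 : {in O, (fun v => - pder 1 (fun v => Re (f v)) v) =1 pder 0 (fun v => Im (f v))}.
  by move=> u /set_mem Ou; have [_ _ ->] := CR u Ou.
have p1 : {in O, pder 0 (fun v => Re (f v)) =1 pder 1 (fun v => Im (f v))}.
  by move=> u /set_mem Ou; have [_ _ _ ->] := CR u Ou.
have sp0 : smooth_on O (pder 0 (fun v => Im (f v))).
  exact: (smooth_ext oO p0 (smoothN oO (smooth_pder 1 s1))).
have sp1 : smooth_on O (pder 1 (fun v => Im (f v))).
  exact: (smooth_ext oO p1 (smooth_pder 0 s1)).
have s2 : smooth_on O (fun v => Im (f v)).
  (* The imaginary part itself is added to the class of smooth functions; its first derivatives
     already belong to that class by the Cauchy-Riemann equations. *)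
  pose P (p : plane -> R) := p = (fun v => Im (f v)) \/ smooth_on O p.
  apply: (smooth_on_coind oO (P := P)); last by left.
    move=> p [->|sp] u Ou; last exact: smooth_diff sp Ou.
    apply: C1_differentiable.
      apply: filterS (open_near oO Ou) => v /CR[? ? _ _] b.
      by elim/ord2P: b.
    move=> b; apply: differentiable_continuous.
    by elim/ord2P: b; [exact: smooth_diff sp0 Ou | exact: smooth_diff sp1 Ou].
  move=> p b [->|sp]; last by exists (pder b p) => //; right; exact: smooth_pder.
  by exists (pder b (fun v => Im (f v))); [right; elim/ord2P: b; [exact: sp0 | exact: sp1] | move=> u].
split; first by split.
move=> u Ou; have [_ _ q0 q1] := CR u Ou.
rewrite /del_zb !pderC_split q0 q1.
by move: (pder 0 _ u) (pder 1 _ u) => x y; apply: complex_eqP; rewrite !(cReImE, cReV, cImV) /=; ring.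
Qed.
Opaque pder.

End ComplexDerivative.

(** * Minimal surfaces in isothermal parameters *)

Section SpaceAlgebra.
Variable R : realType.
Local Notation C := R[i].
Local Notation Re := (@complex.Re R).
Local Notation Im := (@complex.Im R).
Local Notation E3 := 'cV[R]_3.
Local Notation i := (0 +i* 1 : C)%C.
Implicit Types (p q X Y N : E3).

Lemma ord3P (P : 'I_3 -> Prop) : P 0 -> P 1 -> P 2%:R -> forall k, P k.
Proof.
move=> P0 P1 P2 [[|[|[|k]]] hk] //.
- by move: P0; congr P; apply/val_inj.
- by move: P1; congr P; apply/val_inj.
- by move: P2; congr P; apply/val_inj.
Qed.

Lemma sum3 (V : nmodType) (F : 'I_3 -> V) : \sum_(k < 3) F k = F 0 + F 1 + F 2%:R.
Proof.
rewrite !big_ord_recl big_ord0 addr0 addrA; congr (F _ + F _ + F _); exact/val_inj.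
Qed.

Lemma sum2 (V : nmodType) (F : 'I_2 -> V) : \sum_(k < 2) F k = F 0 + F 1.
Proof. by rewrite !big_ord_recl big_ord0 addr0; congr (F _ + F _); exact/val_inj. Qed.

Lemma dotE p q : dot p q = p 0 0 * q 0 0 + p 1 0 * q 1 0 + p 2%:R 0 * q 2%:R 0.
Proof. by rewrite /dot sum3. Qed.

Lemma crossE p q :
  [/\ cross p q 0 0 = p 1 0 * q 2%:R 0 - p 2%:R 0 * q 1 0,
      cross p q 1 0 = p 2%:R 0 * q 0 0 - p 0 0 * q 2%:R 0
    & cross p q 2%:R 0 = p 0 0 * q 1 0 - p 1 0 * q 0 0].
Proof.
have e1 : (0 + 1 : 'I_3) = 1 by apply/val_inj.
have e2 : (0 + 2%:R : 'I_3) = 2%:R by apply/val_inj.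
have e3 : (1 + 1 : 'I_3) = 2%:R by apply/val_inj.
have e4 : (1 + 2%:R : 'I_3) = 0 by apply/val_inj.
have e5 : (2%:R + 1 : 'I_3) = 0 by apply/val_inj.
have e6 : (2%:R + 2%:R : 'I_3) = 1 by apply/val_inj.
by split; rewrite !mxE ?e1 ?e2 ?e3 ?e4 ?e5 ?e6.
Qed.

Lemma Lagrange p q : dot (cross p q) (cross p q) = dot p p * dot q q - dot p q ^+ 2.
Proof. by rewrite !dotE; have [-> -> ->] := crossE p q; ring. Qed.

Lemma det2 (A : 'M[R]_2) : \det A = A 0 0 * A 1 1 - A 0 1 * A 1 0.
Proof.
rewrite (expand_det_row _ 0) sum2 /cofactor !det_mx11 !mxE /= /bump /=.
have -> : lift 0 0 = 1 :> 'I_2 by exact/val_inj.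
have -> : lift 1 0 = 0 :> 'I_2 by exact/val_inj.
by rewrite expr0 expr1 mul1r mulN1r mulrN.
Qed.

Lemma cross_cross (p q r : E3) k : cross (cross p q) r k 0 = dot p r * q k 0 - dot q r * p k 0.
Proof.
have [a0 a1 a2] := crossE p q; have [b0 b1 b2] := crossE (cross p q) r.
by elim/ord3P: k; rewrite ?b0 ?b1 ?b2 ?a0 ?a1 ?a2 !dotE; ring.
Qed.

Lemma crossZl c (p q : E3) k : cross (c *: p) q k 0 = c * cross p q k 0.
Proof.
have [a0 a1 a2] := crossE p q; have [b0 b1 b2] := crossE (c *: p) q.
have sc j : (c *: p) j 0 = c * p j 0 by rewrite mxE.
by elim/ord3P: k; rewrite ?b0 ?b1 ?b2 ?a0 ?a1 ?a2 !sc; ring.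
Qed.

(** Bilinear and not Hermitian, so isotropic vectors exist. Vectors are functions of the index, so
    that [phi ^~ u] is one. *)
Definition cdot (p q : 'I_3 -> C) : C := p 0 * q 0 + p 1 * q 1 + p 2%:R * q 2%:R.

Definition cvec p : 'I_3 -> C := fun k => ((p k 0)%:C)%C.

Lemma cdotC (p q : 'I_3 -> C) : cdot p q = cdot q p.
Proof. by rewrite /cdot; ring. Qed.

Lemma cdot_cvec p q : cdot (cvec p) (cvec q) = ((dot p q)%:C)%C.
Proof. by rewrite dotE /cdot /cvec !(rmorphD, rmorphM). Qed.

(* X and Y are the partial derivatives of a conformal immersion, N its unit normal. *)
Section Frame.
Variables (X Y N : E3) (E : R).
Hypotheses (E0 : 0 < E) (XX : dot X X = E) (YY : dot Y Y = E) (XY : dot X Y = 0)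
  (NN : dot N N = 1) (NX : dot N X = 0) (NY : dot N Y = 0).

(** Orthonormality says that [B] is a right inverse of the square matrix [Q]; it is then a left
    inverse too, and this is completeness of the frame. *)
Lemma frame_delta j k :
  (X j 0 * X k 0 + Y j 0 * Y k 0) / E + N j 0 * N k 0 = (j == k)%:R.
Proof.
pose Q : 'M[R]_3 := \matrix_(i0, j0) (if i0 == 0 then X j0 0 else if i0 == 1 then Y j0 0 else N j0 0).
pose c (i0 : 'I_3) : R := if i0 == 0 then E^-1 else if i0 == 1 then E^-1 else 1.
pose B : 'M[R]_3 := \matrix_(j0, i0) (Q i0 j0 * c i0).
have En : E != 0 by rewrite gt_eqF.
have XN : dot X N = 0 by rewrite -NX !dotE; ring.
have YN : dot Y N = 0 by rewrite -NY !dotE; ring.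
have YX : dot Y X = 0 by rewrite -XY !dotE; ring.
have QB : Q *m B = 1%:M.
  apply/matrixP => a b; rewrite !mxE sum3 !mxE.
  have D (u v : E3) (r : R) : u 0 0 * (v 0 0 * r) + u 1 0 * (v 1 0 * r) + u 2%:R 0 * (v 2%:R 0 * r) =
    dot u v * r by rewrite dotE; ring.
  by elim/ord3P: a; elim/ord3P: b; rewrite /c /= D ?XX ?YY ?NN ?XY ?YX ?NX ?XN ?NY ?YN
    ?divff ?mul0r ?mulr1.
have := mulmx1C QB; move/matrixP/(_ j k); rewrite !mxE sum3 !mxE /c /= => <-.
by field.
Qed.

Definition cphi : 'I_3 -> C := fun k => (((X k 0)%:C)%C - i * ((Y k 0)%:C)%C) / 2.
Definition cphib : 'I_3 -> C := fun k => (((X k 0)%:C)%C + i * ((Y k 0)%:C)%C) / 2.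

(** Completeness of the frame, written with isotropic vectors: [cphi] and [cphib] are orthogonal to
    themselves and pair with each other to [E / 2], whence the factor [2 / E]. *)
Lemma frame_complete (p q : 'I_3 -> C) :
  cdot p q = 2 / (E%:C)%C * (cdot p cphib * cdot q cphi + cdot p cphi * cdot q cphib)
    + cdot p (cvec N) * cdot q (cvec N).
Proof.
have En : ((E%:C)%C : C) != 0 by rewrite eq_complex /= eqxx andbT gt_eqF.
have D j k : (((X j 0)%:C)%C * ((X k 0)%:C)%C + ((Y j 0)%:C)%C * ((Y k 0)%:C)%C) / (E%:C)%C
    + ((N j 0)%:C)%C * ((N k 0)%:C)%C = (j == k)%:R :> C.
  by rewrite -!(rmorphM, rmorphD, fmorphV) /= frame_delta; case: (j == k).
have D00 := D 0 0; have D11 := D 1 1; have D22 := D 2%:R 2%:R.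
have D01 := D 0 1; have D02 := D 0 2%:R; have D12 := D 1 2%:R.
move: D00 D11 D22 D01 D02 D12; clear D; rewrite /= => D00 D11 D22 D01 D02 D12.
have P (r : 'I_3 -> C) : cdot r cphi = (cdot r (cvec X) - i * cdot r (cvec Y)) / 2.
  by rewrite /cdot /cphi /cvec; field.
have Pb (r : 'I_3 -> C) : cdot r cphib = (cdot r (cvec X) + i * cdot r (cvec Y)) / 2.
  by rewrite /cdot /cphib /cvec; field.
have S : cdot p q = (cdot p (cvec X) * cdot q (cvec X) + cdot p (cvec Y) * cdot q (cvec Y)) / (E%:C)%C
    + cdot p (cvec N) * cdot q (cvec N).
  rewrite /cvec /cdot; move: D00 D11 D22 D01 D02 D12 En; clear.
  move: ((E%:C)%C : C) ((X 0 0)%:C)%C ((X 1 0)%:C)%C ((X 2%:R 0)%:C)%C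
    ((Y 0 0)%:C)%C ((Y 1 0)%:C)%C ((Y 2%:R 0)%:C)%C ((N 0 0)%:C)%C ((N 1 0)%:C)%C ((N 2%:R 0)%:C)%C
    (p 0) (p 1) (p 2%:R) (q 0) (q 1) (q 2%:R) => e x0 x1 x2 y0 y1 y2 n0 n1 n2 p0 p1 p2 q0 q1 q2.
  move=> D00 D11 D22 D01 D02 D12 En; apply/esym.
  transitivity (p0 * q0 * ((x0 * x0 + y0 * y0) / e + n0 * n0) +
    p1 * q1 * ((x1 * x1 + y1 * y1) / e + n1 * n1) +
    p2 * q2 * ((x2 * x2 + y2 * y2) / e + n2 * n2) +
    (p0 * q1 + p1 * q0) * ((x0 * x1 + y0 * y1) / e + n0 * n1) +
    (p0 * q2 + p2 * q0) * ((x0 * x2 + y0 * y2) / e + n0 * n2) +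
    (p1 * q2 + p2 * q1) * ((x1 * x2 + y1 * y2) / e + n1 * n2)); first by field.
  by rewrite D00 D11 D22 D01 D02 D12 /=; ring.
rewrite S !P !Pb; move: En; move: (cdot p (cvec X)) (cdot p (cvec Y)) (cdot q (cvec X))
  (cdot q (cvec Y)) (cdot p (cvec N) * cdot q (cvec N)) ((E%:C)%C : C) => pX pY qX qY n e e0.
congr (_ + _); have I2 := @i2 R; move: I2; move: (i) => I I2.
transitivity ((pX * qX - (I * I) * (pY * qY)) / e); first by rewrite I2 mulN1r opprK.
by field.
Qed.

End Frame.
End SpaceAlgebra.

Opaque smooth_on pder pderC del_z del_zb.

(** * The complex derivative of a minimal immersion and its moving frame *)

Section IsothermalMinimal.
Variable R : realType.
Local Notation plane := 'cV[R]_2.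
Local Notation C := R[i].
Local Notation Re := (@complex.Re R).
Local Notation Im := (@complex.Im R).
Local Notation E3 := 'cV[R]_3.
Local Notation i := (0 +i* 1 : C)%C.
Implicit Types (u v : plane) (O : set plane) (p q : 'I_3 -> plane -> C).

Lemma del_z_cdot p q u : (forall k, diffC (p k) u) -> (forall k, diffC (q k) u) ->
  del_z (fun v => cdot (p ^~ v) (q ^~ v)) u =
  cdot (fun k => del_z (p k) u) (q ^~ u) + cdot (p ^~ u) (fun k => del_z (q k) u).
Proof.
move=> dp dq; rewrite /cdot.
have d k := diffCM (dp k) (dq k).
rewrite (del_zD (diffCD (d 0) (d 1)) (d 2%:R)) (del_zD (d 0) (d 1)).
rewrite !(del_zM (dp _) (dq _)).
by move: (del_z _ _) (del_z _ _) (del_z _ _) (del_z _ _) (del_z _ _) (del_z _ _) => *; ring.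
Qed.

Lemma del_zb_cdot p q u : (forall k, diffC (p k) u) -> (forall k, diffC (q k) u) ->
  del_zb (fun v => cdot (p ^~ v) (q ^~ v)) u =
  cdot (fun k => del_zb (p k) u) (q ^~ u) + cdot (p ^~ u) (fun k => del_zb (q k) u).
Proof.
move=> dp dq; rewrite /cdot.
have d k := diffCM (dp k) (dq k).
rewrite (del_zbD (diffCD (d 0) (d 1)) (d 2%:R)) (del_zbD (d 0) (d 1)).
rewrite !(del_zbM (dp _) (dq _)).
by move: (del_zb _ _) (del_zb _ _) (del_zb _ _) (del_zb _ _) (del_zb _ _) (del_zb _ _) => *; ring.
Qed.

Lemma smoothC_cdot O p q : open O -> (forall k, smoothC O (p k)) -> (forall k, smoothC O (q k)) ->
  smoothC O (fun v => cdot (p ^~ v) (q ^~ v)).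
Proof.
move=> oO sp sq; have d k := smoothCM oO (sp k) (sq k).
exact: (smoothCD oO (smoothCD oO (d 0) (d 1)) (d 2%:R)).
Qed.

Lemma hol_cdot O p q : open O -> (forall k, hol O (p k)) -> (forall k, hol O (q k)) ->
  hol O (fun v => cdot (p ^~ v) (q ^~ v)).
Proof.
move=> oO sp sq; have d k := holM oO (sp k) (sq k).
exact: (holD oO (holD oO (d 0) (d 1)) (d 2%:R)).
Qed.

Lemma cdot0r (p : 'I_3 -> C) : cdot p (fun=> 0) = 0.
Proof. by rewrite /cdot !mulr0 !addr0. Qed.

Lemma cdotZr c (p q : 'I_3 -> C) : cdot p (fun k => c * q k) = c * cdot p q.
Proof.
by rewrite /cdot; move: (p 0) (p 1) (p 2%:R) (q 0) (q 1) (q 2%:R) => *; ring.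
Qed.

Lemma dotZl c (p q : E3) : dot (c *: p) q = c * dot p q.
Proof.
rewrite !dotE !mxE.
by move: (p 0 0) (p 1 0) (p 2%:R 0) (q 0 0) (q 1 0) (q 2%:R 0) => *; ring.
Qed.

Lemma dotC (p q : E3) : dot p q = dot q p.
Proof. by rewrite !dotE; ring. Qed.

Definition dX (x : plane -> E3) a u : E3 := col a (jac x u).

Lemma dXE x a u k : dX x a u k 0 = pder a (fun v => x v k 0) u.
Proof. by rewrite !mxE. Qed.

(* Harmonicity is the form taken by minimality in isothermal parameters. *)
Record iso_min (x : plane -> E3) O : Prop := IsoMin {
  iso_smooth : forall k, smooth_on O (fun v => x v k 0);
  iso_conf : forall u, O u -> dot (dX x 1 u) (dX x 1 u) = dot (dX x 0 u) (dX x 0 u);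
  iso_orth : forall u, O u -> dot (dX x 0 u) (dX x 1 u) = 0;
  iso_pos : forall u, O u -> 0 < dot (dX x 0 u) (dX x 0 u);
  iso_harm : forall u k, O u -> pder 0 (pder 0 (fun v => x v k 0)) u +
                                pder 1 (pder 1 (fun v => x v k 0)) u = 0 }.

Section Local.
Variables (x : plane -> E3) (O : set plane).
Hypotheses (oO : open O) (mx : iso_min x O).

Local Notation xk k := (fun v => x v k 0).
Local Notation N := (unit_normal x).

Definition cfac u : R := dot (dX x 0 u) (dX x 0 u).
Local Notation E := cfac.

Lemma cross_sq u : O u -> dot (cross (dX x 0 u) (dX x 1 u)) (cross (dX x 0 u) (dX x 1 u)) = E u ^+ 2.
Proof. by move=> Ou; rewrite Lagrange (iso_conf mx Ou) (iso_orth mx Ou) expr0n subr0 expr2. Qed.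

Lemma unit_normalE u : O u -> N u = (E u)^-1 *: cross (dX x 0 u) (dX x 1 u).
Proof.
move=> Ou; rewrite /unit_normal -/(dX x 0 u) -/(dX x 1 u) (cross_sq Ou) sqrtr_sqr gtr0_norm //.
exact: (iso_pos mx Ou).
Qed.

Lemma normal_unit u : O u -> dot (N u) (N u) = 1.
Proof.
move=> Ou; have E0 := iso_pos mx Ou; have En : E u != 0 by rewrite gt_eqF.
by rewrite unit_normalE // dotZl dotC dotZl cross_sq //; move: (E u) En => r r0; field.
Qed.

Lemma normal_dX u a : O u -> dot (N u) (dX x a u) = 0.
Proof.
move=> Ou; rewrite unit_normalE // dotZl.
apply/eqP; rewrite mulf_eq0; apply/orP; right; apply/eqP.
rewrite dotE; have [-> -> ->] := crossE (dX x 0 u) (dX x 1 u).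
by elim/ord2P: a; ring.
Qed.

Lemma frame u : O u -> forall p q : 'I_3 -> C,
  cdot p q = 2 / ((E u)%:C)%C * (cdot p (cphib (dX x 0 u) (dX x 1 u)) * cdot q (cphi (dX x 0 u) (dX x 1 u))
     + cdot p (cphi (dX x 0 u) (dX x 1 u)) * cdot q (cphib (dX x 0 u) (dX x 1 u)))
   + cdot p (cvec (N u)) * cdot q (cvec (N u)).
Proof.
move=> Ou; apply: frame_complete.
- exact: (iso_pos mx Ou).
- by [].
- exact: (iso_conf mx Ou).
- exact: (iso_orth mx Ou).
- exact: normal_unit.
- exact: normal_dX.
- exact: normal_dX.
Qed.

Definition phi k : plane -> C := del_z (real_fun (xk k)).
Definition phib k : plane -> C := fun u => (phi k u)^*%C.
Definition nu k : plane -> C := real_fun (fun v => N v k 0).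

Lemma phiE u : phi ^~ u = cphi (dX x 0 u) (dX x 1 u).
Proof. by apply/funext => k; rewrite /phi del_zE !pderC_real /cphi !dXE. Qed.

Lemma phibE u : phib ^~ u = cphib (dX x 0 u) (dX x 1 u).
Proof.
apply/funext => k; apply: etrans (congr1 (fun f : 'I_3 -> C => (f k)^*%C) (phiE u)) _.
rewrite /cphi /cphib conjM conjD conjN conj_iM opprK conjc_inv conj2.
by rewrite !conjc_real.
Qed.

Lemma smooth_xk k : smoothC O (real_fun (xk k)).
Proof. by apply: smoothC_real => //; exact: (iso_smooth mx k). Qed.

Transparent del_zb.
(** [del_zb] after [del_z] is a quarter of the Laplacian, and the coordinates of the immersion are
    harmonic. *)
Lemma hol_phi k : hol O (phi k).
Proof.
split; first exact: (smoothC_del_z oO (smooth_xk k)).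
move=> u Ou; rewrite /phi.
have dp a := smoothC_diff oO (smoothC_pder a (smooth_xk k)) Ou.
have P a : pderC a (fun v => (pderC 0 (real_fun (xk k)) v + (- i) * pderC 1 (real_fun (xk k)) v) * 2^-1) u =
    (pderC a (pderC 0 (real_fun (xk k))) u + (- i) * pderC a (pderC 1 (real_fun (xk k))) u) * 2^-1.
  have d1 := diffCM (diffC_cst (- i) u) (dp 1); have d2 := diffCD (dp 0) d1.
  rewrite (pderCM a d2 (diffC_cst 2^-1 u)) (pderCD a (dp 0) d1).
  by rewrite (pderCM a (diffC_cst (- i) u) (dp 1)) !pderC_cst mulr0 addr0 mul0r add0r.
have -> : del_z (real_fun (xk k)) = fun v =>
    (pderC 0 (real_fun (xk k)) v + (- i) * pderC 1 (real_fun (xk k)) v) * 2^-1.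
  by apply/funext => v; rewrite del_zE mulNr.
rewrite /del_zb !P (pderC_comm 1 0 oO (smooth_xk k) Ou).
have Q a b : pderC a (pderC b (real_fun (xk k))) u = ((pder a (pder b (xk k)) u)%:C)%C.
  rewrite -pderC_real; congr pderC; apply/funext => v; exact: pderC_real.
have H := iso_harm mx k Ou.
have {}H : pderC 0 (pderC 0 (real_fun (xk k))) u + pderC 1 (pderC 1 (real_fun (xk k))) u = 0.
  by rewrite !Q -rmorphD /= H.
move: H; move: (pderC _ _ _) (pderC _ _ _) (pderC _ _ _) => y z t H.
transitivity ((t - i * i * z) / 4); last by rewrite i2 mulN1r opprK H mul0r.
by field.
Qed.

Opaque del_zb.

Lemma smooth_cfac : smooth_on O E.
Proof.
have s k := smooth_pder 0 (iso_smooth mx k).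
apply: (smooth_ext oO _ (smoothD oO (smoothD oO (smoothM oO (s 0) (s 0)) (smoothM oO (s 1) (s 1)))
  (smoothM oO (s 2%:R) (s 2%:R)))) => u _.
by rewrite /E dotE !dXE.
Qed.

Lemma smooth_normal k : smooth_on O (fun v => N v k 0).
Proof.
have s a k' := smooth_pder a (iso_smooth mx k').
have sE := smoothV oO (fun u Ou => lt0r_neq0 (iso_pos mx Ou)) smooth_cfac.
have sc a b : smooth_on O (fun v => pder 0 (xk a) v * pder 1 (xk b) v - pder 0 (xk b) v * pder 1 (xk a) v).
  exact: (smoothB oO (smoothM oO (s 0 a) (s 1 b)) (smoothM oO (s 0 b) (s 1 a))).
have Nk u a b : O u -> cross (dX x 0 u) (dX x 1 u) k 0 =
    pder 0 (xk a) u * pder 1 (xk b) u - pder 0 (xk b) u * pder 1 (xk a) u ->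
    (E u)^-1 * (pder 0 (xk a) u * pder 1 (xk b) u - pder 0 (xk b) u * pder 1 (xk a) u) = N u k 0.
  by move=> Ou H; rewrite unit_normalE // [RHS]mxE H.
move: Nk; elim/ord3P: k => Nk.
- apply: (smooth_ext oO _ (smoothM oO sE (sc 1 2%:R))) => u /set_mem Ou.
  by apply: Nk => //; have [-> _ _] := crossE (dX x 0 u) (dX x 1 u); rewrite !dXE.
- apply: (smooth_ext oO _ (smoothM oO sE (sc 2%:R 0))) => u /set_mem Ou.
  by apply: Nk => //; have [_ -> _] := crossE (dX x 0 u) (dX x 1 u); rewrite !dXE.
- apply: (smooth_ext oO _ (smoothM oO sE (sc 0 1))) => u /set_mem Ou.
  by apply: Nk => //; have [_ _ ->] := crossE (dX x 0 u) (dX x 1 u); rewrite !dXE.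
Qed.

Lemma smooth_nu k : smoothC O (nu k).
Proof. by apply: smoothC_real => //; exact: smooth_normal. Qed.

Lemma nuE u : nu ^~ u = cvec (N u). Proof. by []. Qed.

Lemma conj_nu k u : (nu k u)^*%C = nu k u. Proof. exact: conjc_real. Qed.

Definition Ec u : C := ((E u)%:C)%C.

Lemma Ec_neq0 u : O u -> Ec u != 0.
Proof. by move=> Ou; rewrite eq_complex /= eqxx andbT gt_eqF // (iso_pos mx Ou). Qed.

Lemma frameC u : O u -> forall p q : 'I_3 -> C,
  cdot p q = 2 / Ec u * (cdot p (phib ^~ u) * cdot q (phi ^~ u)
     + cdot p (phi ^~ u) * cdot q (phib ^~ u)) + cdot p (nu ^~ u) * cdot q (nu ^~ u).
Proof. by move=> Ou p q; rewrite phiE phibE nuE; exact: frame. Qed.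

Lemma cdot_cphi (p : 'I_3 -> C) (X Y : E3) :
  cdot p (cphi X Y) = (cdot p (cvec X) - i * cdot p (cvec Y)) / 2.
Proof. by rewrite /cdot /cphi /cvec; field. Qed.

Lemma cdot_cphib (p : 'I_3 -> C) (X Y : E3) :
  cdot p (cphib X Y) = (cdot p (cvec X) + i * cdot p (cvec Y)) / 2.
Proof. by rewrite /cdot /cphib /cvec; field. Qed.

Lemma phi_null u : O u -> cdot (phi ^~ u) (phi ^~ u) = 0.
Proof.
move=> Ou; rewrite phiE cdot_cphi !(cdotC (cphi _ _)) !cdot_cphi !cdot_cvec.
rewrite (iso_conf mx Ou) (iso_orth mx Ou).
have -> : dot (dX x 1 u) (dX x 0 u) = 0 by rewrite -(iso_orth mx Ou) !dotE; ring.
move: ((dot (dX x 0 u) (dX x 0 u))%:C)%C => e; rewrite rmorph0.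
transitivity ((1 + i * i) * e / 4); last by rewrite i2 subrr !mul0r.
by field.
Qed.

Lemma phi_phib u : O u -> cdot (phi ^~ u) (phib ^~ u) = Ec u / 2.
Proof.
move=> Ou; rewrite phiE phibE cdot_cphib !(cdotC (cphi _ _)) !cdot_cphi !cdot_cvec.
rewrite (iso_conf mx Ou) (iso_orth mx Ou).
have -> : dot (dX x 1 u) (dX x 0 u) = 0 by rewrite -(iso_orth mx Ou) !dotE; ring.
rewrite -/(E u) -/(Ec u); move: (Ec u) => e; rewrite rmorph0.
transitivity ((1 - i * i) * e / 4); last by rewrite i2 opprK; field.
by field.
Qed.

Lemma phi_nu u : O u -> cdot (phi ^~ u) (nu ^~ u) = 0.
Proof.
move=> Ou; rewrite phiE nuE cdotC cdot_cphi !cdot_cvec !normal_dX // rmorph0.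
by rewrite mulr0 subr0 mul0r.
Qed.

Lemma nu_nu u : O u -> cdot (nu ^~ u) (nu ^~ u) = 1.
Proof. by move=> Ou; rewrite nuE cdot_cvec normal_unit. Qed.

Definition dphi k := del_z (phi k).
Definition ddphi k := del_z (dphi k).

Lemma hol_dphi k : hol O (dphi k). Proof. exact: (hol_del_z oO (hol_phi k)). Qed.
Lemma hol_ddphi k : hol O (ddphi k). Proof. exact: (hol_del_z oO (hol_dphi k)). Qed.

(* The coefficient of the Hopf differential, up to a constant. *)
Definition beta u : C := cdot (dphi ^~ u) (nu ^~ u).
Definition wdot u : C := cdot (dphi ^~ u) (dphi ^~ u).
Definition sdot u : C := cdot (ddphi ^~ u) (ddphi ^~ u).

Lemma hol_wdot : hol O wdot. Proof. by apply: hol_cdot => // k; exact: hol_dphi. Qed.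
Lemma hol_sdot : hol O sdot. Proof. by apply: hol_cdot => // k; exact: hol_ddphi. Qed.

Section AtPoint.
Variables (u : plane) (Ou : O u).

Let dphi_ k : diffC (phi k) u. Proof. exact: (hol_diff oO (hol_phi k) Ou). Qed.
Let ddphi_ k : diffC (dphi k) u. Proof. exact: (hol_diff oO (hol_dphi k) Ou). Qed.
Let dphib_ k : diffC (phib k) u. Proof. exact: (diffC_conj (dphi_ k)). Qed.
Let dnu_ k : diffC (nu k) u. Proof. exact: (smoothC_diff oO (smooth_nu k) Ou). Qed.

Lemma zb_phi k : del_zb (phi k) u = 0. Proof. exact: (hol_phi k).2. Qed.
Lemma z_phib k : del_z (phib k) u = 0.
Proof. by rewrite /phib del_z_conj // zb_phi conjc0. Qed.

Lemma zero_on (f : plane -> C) : (forall v, O v -> f v = 0) -> del_z f u = 0.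
Proof.
move=> H; rewrite -[RHS](del_z_cst 0 u); apply: (del_z_ext_on oO); last by rewrite inE.
by move=> v /set_mem; exact: H.
Qed.

Lemma dphi_phi : cdot (dphi ^~ u) (phi ^~ u) = 0.
Proof.
have := zero_on phi_null; rewrite (del_z_cdot dphi_ dphi_) (cdotC (phi ^~ u)) => /eqP.
by rewrite -mulr2n mulrn_eq0 /= => /eqP.
Qed.

Lemma dphi_phib : cdot (dphi ^~ u) (phib ^~ u) = del_z Ec u / 2.
Proof.
have E1 : {in O, (fun v => cdot (phi ^~ v) (phib ^~ v)) =1 (fun v => Ec v * 2^-1)}.
  by move=> v /set_mem; exact: phi_phib.
have := del_z_ext_on oO E1 (mem_set Ou); rewrite (del_z_cdot dphi_ dphib_).
have -> : (fun k => del_z (phib k) u) = fun=> 0 by apply/funext => k; exact: z_phib.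
rewrite cdot0r addr0 => ->.
have dE : diffC Ec u := smoothC_diff oO (smoothC_real oO smooth_cfac) Ou.
by rewrite (del_zM dE (diffC_cst 2^-1 u)) del_z_cst mulr0 addr0.
Qed.

Lemma znu_nu : cdot (fun k => del_z (nu k) u) (nu ^~ u) = 0.
Proof.
have : del_z (fun v => cdot (nu ^~ v) (nu ^~ v)) u = 0.
  rewrite -[RHS](del_z_cst 1 u); apply: (del_z_ext_on oO); last by rewrite inE.
  by move=> v /set_mem; exact: nu_nu.
rewrite (del_z_cdot dnu_ dnu_) (cdotC (nu ^~ u)) => /eqP.
by rewrite -mulr2n mulrn_eq0 /= => /eqP.
Qed.

Lemma znu_phi : cdot (fun k => del_z (nu k) u) (phi ^~ u) = - beta u.
Proof.
have := zero_on phi_nu; rewrite (del_z_cdot dphi_ dnu_) (cdotC (phi ^~ u)) => /eqP.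
by rewrite addr_eq0 => /eqP H; rewrite /beta /dphi H opprK.
Qed.

Lemma phib_nu v : O v -> cdot (phib ^~ v) (nu ^~ v) = 0.
Proof.
move=> Ov; have := congr1 conjc (phi_nu Ov); rewrite /cdot !conjD !conjM !conj_nu conjc0.
by [].
Qed.

Lemma znu_phib : cdot (fun k => del_z (nu k) u) (phib ^~ u) = 0.
Proof.
have := zero_on phib_nu; rewrite (del_z_cdot dphib_ dnu_) (cdotC (phib ^~ u)).
have -> : (fun k => del_z (phib k) u) = fun=> 0 by apply/funext => k; exact: z_phib.
by rewrite cdotC cdot0r add0r.
Qed.

(** Weingarten's equation in complex form: of the pairings of the derivative of [nu] with the frame
    only that with [phi] is nonzero, and it picks out the component along [phib]. *)
Lemma znuE k : del_z (nu k) u = - (2 * beta u / Ec u) * phib k u.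
Proof.
pose dl (k k' : 'I_3) : C := (k' == k)%:R.
have D k1 (p : 'I_3 -> C) : cdot (dl k1) p = p k1.
  by rewrite /cdot /dl; elim/ord3P: k1 => /=; rewrite ?mul1r ?mul0r ?addr0 ?add0r.
have := frameC Ou (dl k) (fun k => del_z (nu k) u).
rewrite D (D _ (phib ^~ u)) (D _ (phi ^~ u)) (D _ (nu ^~ u)) znu_phi znu_phib znu_nu => ->.
by rewrite !mulr0 !addr0; field; exact: Ec_neq0.
Qed.

Lemma zbnuE k : del_zb (nu k) u = - (2 * (beta u)^*%C / Ec u) * phi k u.
Proof.
have H : del_zb (nu k) u = (del_z (nu k) u)^*%C.
  have EQ : (fun v => (nu k v)^*%C) = nu k by apply/funext => v; exact: conj_nu.
  by rewrite -{1}EQ del_zb_conj.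
rewrite H znuE /phib conjM conjN !conjM conjc_inv conjcK conj2.
by rewrite /Ec conjc_real.
Qed.

(** [dphi] is orthogonal to the isotropic vector [phi], so the product of its two tangential
    components vanishes and only the normal one contributes. *)
Lemma wdotE : wdot u = beta u ^+ 2.
Proof. by rewrite /wdot (frameC Ou) dphi_phi mulr0 mul0r addr0 mulr0 add0r. Qed.

(** Codazzi's equation: [dphi] is holomorphic, and by Weingarten's equation [del_zb] sends [nu] to a
    multiple of [phi], which is orthogonal to [dphi]. *)
Lemma zb_beta : del_zb beta u = 0.
Proof.
rewrite /beta (del_zb_cdot ddphi_ dnu_).
have -> : (fun k => del_zb (dphi k) u) = fun=> 0 by apply/funext => k; exact: (hol_dphi k).2.
rewrite cdotC cdot0r add0r.
have -> : (fun k => del_zb (nu k) u) = fun k => - (2 * (beta u)^*%C / Ec u) * phi k u.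
  by apply/funext => k; exact: zbnuE.
by rewrite cdotZr dphi_phi mulr0.
Qed.

End AtPoint.

Lemma hol_beta : hol O beta.
Proof.
split; last by move=> u Ou; exact: zb_beta.
by apply: smoothC_cdot => // k; [exact: (hol_dphi k).1 | exact: smooth_nu].
Qed.

Lemma smooth_Ec : smoothC O Ec. Proof. exact: (smoothC_real oO smooth_cfac). Qed.

(** Differentiating the components of [dphi] gives those of [ddphi] in the frame. The resulting
    expression in [beta] and the conformal factor serves twice: for the order of the pole and for
    the dependence on the metric. *)
Lemma sdotE u : O u -> sdot u =
  (del_z beta u + beta u * (del_z Ec u / Ec u)) ^+ 2 - 2 * beta u ^+ 2 * (del_z (del_z Ec) u / Ec u).
Proof.
move=> Ou; have dp k := hol_diff oO (hol_dphi k) Ou.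
have dph k := hol_diff oO (hol_phi k) Ou.
have dn k := smoothC_diff oO (smooth_nu k) Ou.
have dpb k : diffC (phib k) u := diffC_conj (dph k).
have E1 : cdot (ddphi ^~ u) (phi ^~ u) = - wdot u.
  have := zero_on Ou dphi_phi; rewrite (del_z_cdot dp dph) => /eqP.
  by rewrite addr_eq0 => /eqP.
have E2 : cdot (ddphi ^~ u) (phib ^~ u) = del_z (del_z Ec) u / 2.
  have EQ : {in O, (fun v => cdot (dphi ^~ v) (phib ^~ v)) =1 (fun v => del_z Ec v * 2^-1)}.
    by move=> v /set_mem; exact: dphi_phib.
  have A : cdot (ddphi ^~ u) (phib ^~ u) = del_z (fun v => del_z Ec v * 2^-1) u.
    apply: etrans _ (del_z_ext_on oO EQ (mem_set Ou)); rewrite (del_z_cdot dp dpb).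
    have -> : (fun k => del_z (phib k) u) = fun=> 0 by apply/funext => k; exact: z_phib.
    exact: (esym (etrans (congr1 (GRing.add _) (cdot0r _)) (addr0 _))).
  have dE : diffC (del_z Ec) u := smoothC_diff oO (smoothC_del_z oO smooth_Ec) Ou.
  by rewrite A (del_zM dE (diffC_cst 2^-1 u)) del_z_cst mulr0 addr0.
have E3' : cdot (ddphi ^~ u) (nu ^~ u) = del_z beta u + beta u * (del_z Ec u / Ec u).
  have A : del_z beta u = cdot (ddphi ^~ u) (nu ^~ u) + cdot (dphi ^~ u) (fun k => del_z (nu k) u).
    exact: (del_z_cdot dp dn).
  have B : cdot (dphi ^~ u) (fun k => del_z (nu k) u) = - (beta u * (del_z Ec u / Ec u)).
    have B1 : (fun k => del_z (nu k) u) = (fun k => - (2 * beta u / Ec u) * phib k u).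
      by apply/funext => k; exact: znuE.
    apply: etrans (congr1 (cdot _) B1) _; apply: etrans (cdotZr _ _ _) _.
    apply: etrans (congr1 (GRing.mul _) (dphi_phib Ou)) _.
    by have := Ec_neq0 Ou; move: (Ec u) (beta u) (del_z Ec u) => r b c r0; field.
  exact: (esym (etrans (congr1 (GRing.add^~ _) (etrans A (congr1 (GRing.add _) B))) (subrK _ _))).
rewrite /sdot (frameC Ou) E1 E2 E3' (wdotE Ou).
move: (del_z beta u + _) => z.
have := Ec_neq0 Ou; move: (Ec u) (beta u) (del_z (del_z Ec) u) => e b d e0.
by field.
Qed.

End Local.
End IsothermalMinimal.

(** * The Schwarzian derivative of the Gauss map *)

Opaque smooth_on pder pderC del_z del_zb.

Section Wirtinger.
Variable R : realType.
Local Notation plane := 'cV[R]_2.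
Local Notation C := R[i].
Local Notation Re := (@complex.Re R).
Local Notation Im := (@complex.Im R).
Local Notation i := (0 +i* 1 : C)%C.
Implicit Types (u v : plane) (O : set plane) (f g : plane -> C).

(* Bundling differentiability with the value of the derivative lets the derivative of an
   explicit expression be synthesized by unification. *)
Definition has_dz f u (d : C) := diffC f u /\ del_z f u = d.

Lemma has_dz_self f u : diffC f u -> has_dz f u (del_z f u). Proof. by []. Qed.
Lemma has_dz_cst c u : has_dz (fun=> c) u 0.
Proof. by split; [exact: diffC_cst | exact: del_z_cst]. Qed.
Lemma has_dzD f g u a b : has_dz f u a -> has_dz g u b -> has_dz (fun v => f v + g v) u (a + b).
Proof. by move=> [df <-] [dg <-]; split; [exact: diffCD | exact: del_zD]. Qed.
Lemma has_dzN f u a : has_dz f u a -> has_dz (fun v => - f v) u (- a).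
Proof. by move=> [df <-]; split; [exact: diffCN | exact: del_zN]. Qed.
Lemma has_dzM f g u a b : has_dz f u a -> has_dz g u b ->
  has_dz (fun v => f v * g v) u (a * g u + f u * b).
Proof. by move=> [df <-] [dg <-]; split; [exact: diffCM | exact: del_zM]. Qed.
Lemma has_dzV f u a : has_dz f u a -> f u != 0 -> has_dz (fun v => (f v)^-1) u (- a / f u ^+ 2).
Proof. by move=> [df <-] f0; split; [exact: diffCV | exact: del_zV]. Qed.
Lemma has_dzX f u a n : has_dz f u a -> has_dz (fun v => f v ^+ n) u (n%:R * f u ^+ n.-1 * a).
Proof.
move=> H; elim: n => [|n [dn En]].
  by rewrite !mul0r; exact: has_dz_cst.
have [d2 E2] := has_dzM H (conj dn En).
have FE : (fun v => f v ^+ n.+1) = (fun v => f v * f v ^+ n) by apply/funext => v; rewrite exprS.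
rewrite FE; split; rewrite // E2; case: n {dn En d2 E2 FE} => [|n] /=; first by rewrite !mul0r mulr0 expr0; ring.
by rewrite exprS -[n.+2%:R]natr1; move: (f u) (f u ^+ n) => p q; ring.
Qed.
Lemma has_dz_ext O f g u a : open O -> O u -> {in O, f =1 g} -> has_dz f u a -> has_dz g u a.
Proof.
move=> oO Ou fg [df <-]; split; first exact: (diffC_ext_on oO fg Ou df).
by symmetry; apply: (del_z_ext_on oO fg); rewrite inE.
Qed.
Lemma has_dz_eq f u a b : has_dz f u a -> a = b -> has_dz f u b.
Proof. by move=> H <-. Qed.
Lemma has_dz_val f u a : has_dz f u a -> del_z f u = a. Proof. by case. Qed.
Lemma has_dz_hol O f u : open O -> hol O f -> O u -> has_dz f u (del_z f u).
Proof. by move=> oO hf Ou; split; first exact: hol_diff hf Ou. Qed.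

Lemma schwarzian_ext O f g u : open O -> {in O, f =1 g} -> O u -> schwarzian f u = schwarzian g u.
Proof.
move=> oO fg Ou; have uO : u \in O by rewrite inE.
have e1 := del_z_ext_on oO fg; have e2 := del_z_ext_on oO e1; have e3 := del_z_ext_on oO e2.
exact: (f_equal3 (fun a b c : C => c / a - 3%:R / 2%:R * (b / a) ^+ 2) (e1 u uO) (e2 u uO) (e3 u uO)).
Qed.

(** The quadratic form [p q + c^2] evaluated on derivatives; for [p], [q], [c] equal to
    [phi_0 - i phi_1], [phi_0 + i phi_1], [phi_2] it is [phi'.phi']. *)
Definition sw (p q c : plane -> C) u := del_z p u * del_z q u + del_z c u ^+ 2.

(* A null curve is parametrized by p and G as p (1 - G^2) / 2, i p (1 + G^2) / 2, p G. *)
Lemma schwarzian_null O (p q c G : plane -> C) (eps : C) u : open O -> O u -> eps * eps = 1 ->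
  hol O p -> hol O G -> (forall v, O v -> q v = - (p v * (G v * G v))) ->
  (forall v, O v -> c v = eps * (p v * G v)) ->
  sw p q c u != 0 ->
  schwarzian G u = sw (del_z p) (del_z q) (del_z c) u / (2 * sw p q c u)
    + del_z (del_z (sw p q c)) u / (2 * sw p q c u)
    - 3%:R / 4%:R * (del_z (sw p q c) u / sw p q c u) ^+ 2.
Proof.
(* The sign [eps] is 1 for the Gauss map and -1 for its reciprocal, and it enters only through its
   square. *)
move=> oO Ou ee hp hG Eq Ec w0.
pose p1 := del_z p; pose p2 := del_z p1; pose G1 := del_z G; pose G2 := del_z G1.
have hp1 : hol O p1 := hol_del_z oO hp; have hp2 : hol O p2 := hol_del_z oO hp1.
have hG1 : hol O G1 := hol_del_z oO hG; have hG2 : hol O G2 := hol_del_z oO hG1.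
have D f v : hol O f -> O v -> has_dz f v (del_z f v) by move=> hf; exact: has_dz_hol.
have q1 v : O v -> has_dz q v (- (p1 v * (G v * G v) + p v * (2 * (G v * G1 v)))).
  move=> Ov; apply: (has_dz_ext oO Ov (f := fun v => - (p v * (G v * G v)))).
    by move=> t /set_mem Ot; rewrite Eq.
  apply: has_dz_eq (has_dzN (has_dzM (D _ _ hp Ov) (has_dzM (D _ _ hG Ov) (D _ _ hG Ov)))) _.
  by rewrite -/p1 -/G1; move: (p v) (p1 v) (G v) (G1 v) => *; ring.
have c1 v : O v -> has_dz c v (eps * (p1 v * G v + p v * G1 v)).
  move=> Ov; apply: (has_dz_ext oO Ov (f := fun v => eps * (p v * G v))).
    by move=> t /set_mem Ot; rewrite Ec.
  apply: has_dz_eq (has_dzM (has_dz_cst eps v) (has_dzM (D _ _ hp Ov) (D _ _ hG Ov))) _.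
  by rewrite mul0r add0r.
(* All terms containing [G] itself cancel, here and in [S] below; [p] and derivatives of [p] and [G]
   are left. *)
have W v : O v -> sw p q c v = p v * p v * (G1 v * G1 v).
  move=> Ov; rewrite /sw (has_dz_val (q1 v Ov)) (has_dz_val (c1 v Ov)) -/p1.
  rewrite exprMn expr2 ee mul1r.
  by move: (p v) (p1 v) (G v) (G1 v) => *; ring.
have W1 v : O v -> has_dz (sw p q c) v
    (2 * (p v * (p1 v * (G1 v * G1 v))) + 2 * (p v * (p v * (G1 v * G2 v)))).
  move=> Ov; apply: (has_dz_ext oO Ov (f := fun v => p v * p v * (G1 v * G1 v))).
    by move=> t /set_mem Ot; rewrite W.
  apply: has_dz_eq (has_dzM (has_dzM (D _ _ hp Ov) (D _ _ hp Ov))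
    (has_dzM (D _ _ hG1 Ov) (D _ _ hG1 Ov))) _.
  by rewrite -/p1 -/G2; move: (p v) (p1 v) (G1 v) (G2 v) => *; ring.
have W2 : has_dz (del_z (sw p q c)) u (2 * (p1 u * (p1 u * (G1 u * G1 u))) +
    2 * (p u * (p2 u * (G1 u * G1 u))) + 8%:R * (p u * (p1 u * (G1 u * G2 u)))
    + 2 * (p u * (p u * (G2 u * G2 u))) + 2 * (p u * (p u * (G1 u * del_z G2 u)))).
  apply: (has_dz_ext oO Ou (f := fun v =>
    2 * (p v * (p1 v * (G1 v * G1 v))) + 2 * (p v * (p v * (G1 v * G2 v))))).
    by move=> t /set_mem Ot; rewrite (has_dz_val (W1 t Ot)).
  apply: has_dz_eq (has_dzD
    (has_dzM (has_dz_cst 2 u) (has_dzM (D _ _ hp Ou) (has_dzM (D _ _ hp1 Ou) (has_dzM (D _ _ hG1 Ou) (D _ _ hG1 Ou)))))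
    (has_dzM (has_dz_cst 2 u) (has_dzM (D _ _ hp Ou) (has_dzM (D _ _ hp Ou) (has_dzM (D _ _ hG1 Ou) (D _ _ hG2 Ou)))))) _.
  rewrite -/p1 -/p2 -/G2.
  by move: (p u) (p1 u) (p2 u) (G1 u) (G2 u) (del_z G2 u) => *; ring.
have q2 : has_dz (del_z q) u (- (p2 u * (G u * G u) + 4%:R * (p1 u * (G u * G1 u))
     + 2 * (p u * (G1 u * G1 u)) + 2 * (p u * (G u * G2 u)))).
  apply: (has_dz_ext oO Ou (f := fun v => - (p1 v * (G v * G v) + p v * (2 * (G v * G1 v))))).
    by move=> t /set_mem Ot; rewrite (has_dz_val (q1 t Ot)).
  apply: has_dz_eq (has_dzN (has_dzD (has_dzM (D _ _ hp1 Ou) (has_dzM (D _ _ hG Ou) (D _ _ hG Ou)))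
    (has_dzM (D _ _ hp Ou) (has_dzM (has_dz_cst 2 u) (has_dzM (D _ _ hG Ou) (D _ _ hG1 Ou)))))) _.
  rewrite -/p2 -/p1 -/G1 -/G2.
  by move: (p u) (p1 u) (p2 u) (G u) (G1 u) (G2 u) => *; ring.
have c2 : has_dz (del_z c) u (eps * (p2 u * G u + 2 * (p1 u * G1 u) + p u * G2 u)).
  apply: (has_dz_ext oO Ou (f := fun v => eps * (p1 v * G v + p v * G1 v))).
    by move=> t /set_mem Ot; rewrite (has_dz_val (c1 t Ot)).
  apply: has_dz_eq (has_dzM (has_dz_cst eps u) (has_dzD (has_dzM (D _ _ hp1 Ou) (D _ _ hG Ou))
    (has_dzM (D _ _ hp Ou) (D _ _ hG1 Ou)))) _.
  rewrite -/p2 -/p1 -/G1 -/G2.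
  by move: (p u) (p1 u) (p2 u) (G u) (G1 u) (G2 u) => *; ring.
have S : sw (del_z p) (del_z q) (del_z c) u =
   - (2 * (p u * (p2 u * (G1 u * G1 u)))) + (2 * (p1 u * G1 u) + p u * G2 u) ^+ 2.
  rewrite /sw (has_dz_val q2) (has_dz_val c2) -/p1 -/p2 exprMn expr2 ee mul1r.
  by move: (p u) (p1 u) (p2 u) (G u) (G1 u) (G2 u) => *; ring.
move: w0; rewrite S (has_dz_val W2) (has_dz_val (W1 u Ou)) (W u Ou) /schwarzian.
rewrite -[del_z (del_z (del_z G)) u]/(del_z G2 u) -[del_z (del_z G) u]/(G2 u) -[del_z G u]/(G1 u).
move: (p u) (p1 u) (p2 u) (G1 u) (G2 u) (del_z G2 u) => y y1 y2 g1 g2 g3.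
rewrite !mulf_eq0 !negb_or => /andP[/andP[y0 _] /andP[g0 _]].
by field; rewrite y0 g0.
Qed.

Lemma conn_coef_conformal O (g : plane -> 'M[R]_2) (lam : plane -> R) u : open O -> O u ->
  (forall v, O v -> g v = lam v *: 1%:M) -> differentiable lam u -> lam u != 0 ->
  conn_coef g u = del_z (real_fun lam) u / ((lam u)%:C)%C.
Proof.
move=> oO Ou Eg dl l0.
have P a b c : pder a (fun v => g v b c) u = pder a lam u * (b == c)%:R.
  have E : {in O, (fun v => g v b c) =1 (fun v => lam v * (b == c)%:R)}.
    by move=> v /set_mem Ov; rewrite Eg // !mxE.
  apply: etrans (pder_ext_on a oO E (mem_set Ou)) _.
  have dc : differentiable (fun=> (b == c)%:R : R) u by exact: differentiable_cst.
  by rewrite (pderM a dl dc) pder_cst mulr0 addr0.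
have I : invmx (g u) = (lam u)^-1 *: 1%:M.
  by rewrite Eg // !scalemx1 invmx_scalar.
have Gm k a b : christoffel g k a b u = 2%:R^-1 * ((lam u)^-1 *
    (pder a lam u * (b == k)%:R + pder b lam u * (a == k)%:R - pder k lam u * (a == b)%:R)).
  rewrite /christoffel sum2 I !mxE !P; congr (_ * _).
  by elim/ord2P: k => /=; rewrite ?mulr1 ?mulr0 ?mul0r ?addr0 ?add0r.
pose A a := ((pder a lam u)%:C)%C : C; pose l := ((lam u)%:C)%C : C.
have GmC k a b : ((christoffel g k a b u)%:C)%C = 2%:R^-1 * (l^-1 *
    (A a * (b == k)%:R + A b * (a == k)%:R - A k * (a == b)%:R)) :> C.
  rewrite Gm rmorphM rmorphM rmorphB rmorphD !rmorphM !fmorphV !rmorph_nat; reflexivity.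
rewrite /conn_coef /nabla_del_del !sum2 !GmC /= del_zE !pderC_real /zeta /= -!/(A _) -/l.
have -> : (0 +i* (-1) : C)%C = - i by apply: complex_eqP; rewrite /= ?oppr0.
have lc : l != 0 by rewrite eq_complex /= eqxx andbT.
move: lc; move: (A 0) (A 1) (l) => a b c c0.
have I2 := @i2 R; move: I2; move: (i) => J J2.
(* The Christoffel symbols add up to the asserted value plus a multiple of [i^2 + 1]. *)
transitivity ((a - J * b) / 2 / c + (J * J + 1) * ((J * b - 3%:R * a) / 8%:R / c)); first by field.
by rewrite J2 addNr mul0r addr0.
Qed.

End Wirtinger.

Opaque smooth_on pder pderC del_z del_zb.

(** * Curvature, flat metric and Gauss map in an isothermal parameter *)

Section EntropyFormula.
Variable R : realType.
Local Notation plane := 'cV[R]_2.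
Local Notation C := R[i].
Local Notation Re := (@complex.Re R).
Local Notation Im := (@complex.Im R).
Local Notation E3 := 'cV[R]_3.
Local Notation i := (0 +i* 1 : C)%C.
Implicit Types (u v : plane) (O : set plane) (s w : plane -> C).

(** The Schwarzian is [s / (2 w) + w'' / (2 w) - 3/4 (w' / w)^2], and the connection adds
    [gamma^2 / 2 - gamma'] with [gamma = w' / (4 w)]. The coefficients are therefore
    [1/4 = 1/2 - 1/4] and [15/32 = 3/4 - 1/4 - 1/32]. *)
Definition ent0 s w : plane -> C := fun u =>
  s u / (2 * w u) + del_z (del_z w) u / (4%:R * w u) - 15%:R / 32%:R * (del_z w u / w u) ^+ 2.

Definition ent_conn w : plane -> C := fun u => del_z w u / (4%:R * w u).

(* The entropy differentials in terms of s = phi''.phi'' and w = phi'.phi', phi = del_z x. *)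
Fixpoint ent s w (n : nat) : plane -> C :=
  if n is m.+1 then cov_del (ent_conn w) m.+2 (ent s w m) else ent0 s w.

Lemma cov_del_ext O (g h f k : plane -> C) l : open O -> {in O, g =1 h} -> {in O, f =1 k} ->
  {in O, cov_del g l f =1 cov_del h l k}.
Proof.
move=> oO gh fk u uO; rewrite /cov_del (gh u uO) (fk u uO).
by rewrite (del_z_ext_on oO fk uO).
Qed.

Lemma hol_ent O s w n : open O -> hol O s -> hol O w -> (forall u, O u -> w u != 0) ->
  hol O (ent s w n).
Proof.
move=> oO hs hw w0; have hw1 := hol_del_z oO hw; have hw2 := hol_del_z oO hw1.
have n0 m : (m.+1)%:R != 0 :> C by rewrite pnatr_eq0.
have hc c := hol_cst oO (c : C).
have hV m : hol O (fun v => ((m.+1)%:R * w v)^-1).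
  by apply: (holV oO _ (holM oO (hc _) hw)) => u Ou; rewrite mulf_neq0 ?w0.
have hg : hol O (ent_conn w) by exact: (holM oO hw1 (hV 3)).
elim: n => [|n IH] /=.
  have hq := holM oO hw1 (holV oO w0 hw).
  exact: (holB oO (holD oO (holM oO hs (hV 1)) (holM oO hw2 (hV 3)))
    (holM oO (hc _) (holX oO 2 hq))).
exact: (holB oO (hol_del_z oO IH) (holM oO (holM oO (hc _) hg) IH)).
Qed.

Lemma ent_ext O s w s' w' n : open O -> {in O, s =1 s'} -> {in O, w =1 w'} ->
  {in O, ent s w n =1 ent s' w' n}.
Proof.
move=> oO Es Ew; have E1 := del_z_ext_on oO Ew; have E2 := del_z_ext_on oO E1.
elim: n => [|n IH] /=.
  by move=> u uO; rewrite /ent0 (Es u uO) (Ew u uO) (E1 u uO) (E2 u uO).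
apply: cov_del_ext => // u uO.
by rewrite /ent_conn (Ew u uO) (E1 u uO).
Qed.

Lemma ent_scale O s w (c : C) n : open O -> hol O w -> c != 0 -> (forall u, O u -> w u != 0) ->
  {in O, ent (fun v => c * s v) (fun v => c * w v) n =1 ent s w n}.
Proof.
move=> oO hw c0 w0; have hw1 := hol_del_z oO hw.
have D f u : hol O f -> O u -> del_z (fun v => c * f v) u = c * del_z f u.
  move=> hf Ou; rewrite (has_dz_val (has_dzM (has_dz_cst c u) (has_dz_hol oO hf Ou))).
  by rewrite mul0r add0r.
have E1 : {in O, del_z (fun v => c * w v) =1 (fun v => c * del_z w v)}.
  by move=> u /set_mem Ou; exact: D.
have E2 : {in O, del_z (del_z (fun v => c * w v)) =1 (fun v => c * del_z (del_z w) v)}.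
  move=> u uO; rewrite (del_z_ext_on oO E1 uO); exact: (D _ _ hw1 (set_mem uO)).
elim: n => [|n IH] /=.
  move=> u uO; rewrite /ent0 (E1 u uO) (E2 u uO); have := w0 u (set_mem uO).
  move: (w u) (s u) (del_z w u) (del_z (del_z w) u) => w_ s_ w1 w2 n0.
  by field; rewrite n0 c0.
apply: cov_del_ext => // u uO.
rewrite /ent_conn (E1 u uO); have := w0 u (set_mem uO).
move: (w u) (del_z w u) => w_ w1 n0; by field; rewrite n0 c0.
Qed.

Section Local.
Variables (x : plane -> E3) (O : set plane).
Hypotheses (oO : open O) (mx : iso_min x O).

Local Notation xk k := (fun v => x v k 0).
Local Notation N := (unit_normal x).
Local Notation E := (cfac x).
Local Notation Ec := (Ec x).
Local Notation beta := (beta x).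
Local Notation phi := (phi x).
Local Notation nu := (nu x).

Lemma metric_iso u : O u -> metric x u = E u *: 1%:M.
Proof.
move=> Ou; apply/matrixP => a b; rewrite !mxE -/(dX x a u) -/(dX x b u).
elim/ord2P: a; elim/ord2P: b; rewrite /= ?mulr1 ?mulr0.
- by [].
- exact: (iso_orth mx Ou).
- by rewrite dotC (iso_orth mx Ou).
- by rewrite (iso_conf mx Ou).
Qed.

Definition sff a b u : R := second_form x u a b.

Lemma sffE a b u : sff a b u = pder a (pder b (xk 0)) u * N u 0 0
  + pder a (pder b (xk 1)) u * N u 1 0 + pder a (pder b (xk 2%:R)) u * N u 2%:R 0.
Proof.
have -> : sff a b u = dot (\col_k pder a (pder b (xk k)) u) (N u) by rewrite /sff mxE.
by rewrite dotE; congr (_ * _ + _ * _ + _ * _); rewrite mxE.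
Qed.

Lemma sff11 u : O u -> sff 1 1 u = - sff 0 0 u.
Proof.
move=> Ou; rewrite !sffE.
have H k : pder 1 (pder 1 (xk k)) u = - pder 0 (pder 0 (xk k)) u.
  by apply/eqP; rewrite -addr_eq0 addrC (iso_harm mx k Ou).
rewrite !H; move: (N u 0 0) (N u 1 0) (N u 2%:R 0) => n0 n1 n2.
by gen_der; ring.
Qed.

Lemma sff10 u : O u -> sff 1 0 u = sff 0 1 u.
Proof.
move=> Ou; rewrite !sffE.
have H k := pder_comm 1 0 oO (iso_smooth mx k) Ou.
exact: (f_equal3 (fun a b c => a * N u 0 0 + b * N u 1 0 + c * N u 2%:R 0) (H 0) (H 1) (H 2%:R)).
Qed.

Lemma dphiE k u : O u -> dphi x k u =
  (((pder 0 (pder 0 (xk k)) u)%:C)%C - i * ((pder 0 (pder 1 (xk k)) u)%:C)%C) / 2.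
Proof.
move=> Ou; have H := hol_pder0 (hol_phi oO mx k) Ou; rewrite /dphi -H.
have sx := iso_smooth mx k.
rewrite /phi.
have -> : del_z (real_fun (xk k)) = fun v =>
    (real_fun (pder 0 (xk k)) v + (- i) * real_fun (pder 1 (xk k)) v) * 2^-1.
  by apply/funext => v; rewrite del_zE !pderC_real mulNr.
have d a := diffC_real (smooth_diff oO (smooth_pder a sx) Ou).
have d1 := diffCM (diffC_cst (- i) u) (d 1); have d2 := diffCD (d 0) d1.
rewrite (pderCM 0 d2 (diffC_cst 2^-1 u)) (pderCD 0 (d 0) d1).
rewrite (pderCM 0 (diffC_cst (- i) u) (d 1)) !pderC_cst !pderC_real mulr0 addr0 mul0r add0r.
by rewrite mulNr.
Qed.

Lemma betaE u : O u -> beta u = (((sff 0 0 u)%:C)%C - i * ((sff 0 1 u)%:C)%C) / 2.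
Proof.
move=> Ou; pose p k := ((pder 0 (pder 0 (xk k)) u)%:C)%C : C.
pose q k := ((pder 0 (pder 1 (xk k)) u)%:C)%C : C.
have B : beta u = cdot (fun k => (p k - i * q k) / 2) (nu ^~ u).
  have F : (dphi x ^~ u) = (fun k => (p k - i * q k) / 2) by apply/funext => k; exact: dphiE.
  exact: (congr1 (fun f => cdot f (nu ^~ u)) F).
have RC (a b c d e f : R) : ((a * b + c * d + e * f)%:C)%C = (a%:C)%C * (b%:C)%C + (c%:C)%C * (d%:C)%C + (e%:C)%C * (f%:C)%C.
  by rewrite !rmorphD !rmorphM.
have S0 : ((sff 0 0 u)%:C)%C = p 0 * nu 0 u + p 1 * nu 1 u + p 2%:R * nu 2%:R u.
  exact: (etrans (congr1 (real_complex R) (sffE 0 0 u)) (RC _ _ _ _ _ _)).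
have S1 : ((sff 0 1 u)%:C)%C = q 0 * nu 0 u + q 1 * nu 1 u + q 2%:R * nu 2%:R u.
  exact: (etrans (congr1 (real_complex R) (sffE 0 1 u)) (RC _ _ _ _ _ _)).
rewrite B S0 S1 /cdot; move: (p 0) (p 1) (p 2%:R) (q 0) (q 1) (q 2%:R) (nu 0 u) (nu 1 u) (nu 2%:R u).
by move=> p0 p1 p2 q0 q1 q2 n0 n1 n2; field.
Qed.

Lemma normsq_betaE u : O u -> 4%:R * normsq (beta u) = sff 0 0 u ^+ 2 + sff 0 1 u ^+ 2.
Proof.
move=> Ou; rewrite betaE // /normsq !(cReImE, cReV, cImV) /=.
move: (sff 0 0 u) (sff 0 1 u) => a b.
by field.
Qed.

Lemma gauss_curvatureE u : O u -> gauss_curvature x u = - (4%:R * normsq (beta u) / E u ^+ 2).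
Proof.
move=> Ou; rewrite normsq_betaE // /gauss_curvature metric_iso // scalemx1 det_scalar.
rewrite det2 -/(sff 0 0 u) -/(sff 1 1 u) -/(sff 0 1 u) -/(sff 1 0 u) sff11 // sff10 //.
by rewrite mulrN -opprD -!expr2 mulNr.
Qed.


Lemma E_gt0 u : O u -> 0 < E u. Proof. exact: (iso_pos mx). Qed.

Lemma gauss_curvature_eq0 u : O u -> (gauss_curvature x u == 0) = (beta u == 0).
Proof.
move=> Ou; rewrite gauss_curvatureE // oppr_eq0 mulf_eq0 mulf_eq0 pnatr_eq0 /= normsq_eq0.
by rewrite invr_eq0 sqrf_eq0 (gt_eqF (E_gt0 Ou)) orbF.
Qed.

Lemma flat_metricE u : O u -> flat_metric x u = (2 * Nm (beta u)) *: 1%:M.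
Proof.
move=> Ou; rewrite /flat_metric gauss_curvatureE // opprK metric_iso // scalerA.
congr (_ *: _); have E0 := E_gt0 Ou.
have -> : 4%:R * normsq (beta u) / E u ^+ 2 = (2 * Nm (beta u) / E u) ^+ 2.
  rewrite exprMn exprVn; congr (_ / _).
  by rewrite exprMn /Nm sqr_sqrtr ?normsq_ge0 // -natrX.
rewrite sqrtr_sqr ger0_norm; last by rewrite divr_ge0 ?mulr_ge0 ?Nm_ge0 // ltW.
by rewrite divfK // gt_eqF.
Qed.

Local Notation w := (wdot x).
Local Notation s := (sdot x).

Lemma wdot_neq0 u : O u -> (w u != 0) = (beta u != 0).
Proof. by move=> Ou; rewrite (wdotE oO mx Ou) sqrf_eq0. Qed.

Definition Oreg : set plane := [set u | O u /\ beta u != 0].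

Lemma Oreg_open : open Oreg.
Proof.
rewrite openE => u [Ou b0].
have /near_ballP[r r0 Hr] := open_near oO Ou.
have /near_ballP[r' r0' Hr'] := diffC_near_neq0 (hol_diff oO (hol_beta oO mx) Ou) b0.
apply/near_ballP; exists (Num.min r r'); first by rewrite lt_min r0.
by move=> v; rewrite lt_min => /andP[h1 h2]; split; [exact: Hr | exact: Hr'].
Qed.

Lemma Oreg_sub : Oreg `<=` O. Proof. by move=> u []. Qed.

Lemma del_z_wdot u : O u -> del_z w u = 2 * (beta u * del_z beta u).
Proof.
move=> Ou; have hb := has_dz_hol oO (hol_beta oO mx) Ou.
apply: has_dz_val; apply: (has_dz_ext oO Ou (f := fun v => beta v * beta v)).
  by move=> v /set_mem Ov; rewrite (wdotE oO mx Ov) expr2.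
by apply: has_dz_eq (has_dzM hb hb) _; move: (beta u) (del_z beta u) => *; ring.
Qed.

Lemma conn_coef_flat u : Oreg u -> conn_coef (flat_metric x) u = ent_conn w u.
Proof.
move=> [Ou b0].
have [[s1 s2] _] := hol_beta oO mx; have bpos : 0 < normsq (beta u).
  by rewrite lt_def normsq_eq0 b0 normsq_ge0.
have dn : differentiable (fun v => normsq (beta v)) u.
  exact: (smooth_diff oO (smoothD oO (smoothM oO s1 s1) (smoothM oO s2 s2)) Ou).
have dl : differentiable (fun v => 2 * Nm (beta v)) u.
  apply: differentiableMf; first exact: differentiable_cst.
  exact: differentiable_sqrt.
have Npos : 0 < Nm (beta u) by rewrite sqrtr_gt0.
have l0 : 2 * Nm (beta u) != 0 by rewrite mulf_neq0 ?pnatr_eq0 // gt_eqF.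
rewrite (conn_coef_conformal oO Ou flat_metricE dl l0).
pose L := real_fun (fun v => 2 * Nm (beta v)).
have dL : diffC L u := diffC_real dl.
have hb := hol_diff oO (hol_beta oO mx) Ou.
(* The logarithmic derivative of the conformal factor is found from its square, in which the
   conjugate of [beta] behaves as a constant under [del_z]. *)
have LL v : L v * L v = 4%:R * (beta v * (beta v)^*%C).
  rewrite /L /real_fun -rmorphM; apply: complex_eqP.
    rewrite /= mulrACA -expr2 -expr2 /Nm sqr_sqrtr ?normsq_ge0 // -natrX.
    case: (beta v) => a b; rewrite /normsq !cReImE /=; ring.
  by case: (beta v) => a b; rewrite /normsq !cReImE /=; ring.
have H : 2 * (L u * del_z L u) = 4%:R * (del_z beta u * (beta u)^*%C).
  have D1 := has_dz_val (has_dzM (has_dz_self dL) (has_dz_self dL)).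
  have D2 := has_dz_val (has_dzM (has_dz_cst 4%:R u) (has_dzM (has_dz_self hb) (has_dz_self (diffC_conj hb)))).
  have E1 : (fun v => L v * L v) = (fun v => 4%:R * (beta v * (beta v)^*%C)) by apply/funext.
  rewrite -E1 D1 (del_z_conj hb) ((hol_beta oO mx).2 u Ou) conjc0 mulr0 addr0 mul0r add0r in D2.
  by rewrite -D2; move: (L u) (del_z L u) => *; ring.
rewrite /ent_conn del_z_wdot // (wdotE oO mx Ou) -[((_)%:C)%C]/(L u).
have Ln0 : L u != 0 by rewrite eq_complex /= eqxx andbT.
apply: (mulfI Ln0); apply: (mulfI Ln0).
transitivity (L u * del_z L u); first by move: (L u) (del_z L u) Ln0 => l l1 l0'; field.
rewrite mulrA LL; apply: (@mulfI _ 2); first by rewrite pnatr_eq0.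
rewrite H; move: b0; move: (beta u) (del_z beta u) ((beta u)^*%C) => b b1 bb b0.
by field.
Qed.

(** Isotropic coordinates: the null condition factors as [phi_minus phi_plus = - phi_2^2], and the
    Gauss map is [phi_2 / phi_minus], or [- phi_minus^-1] times its conjugate analogue near the
    other pole. *)
Definition phi_minus : plane -> C := fun v => phi 0 v - i * phi 1 v.
Definition phi_plus : plane -> C := fun v => phi 0 v + i * phi 1 v.

Lemma eta_etab u : O u -> phi_minus u * phi_plus u = - phi 2%:R u ^+ 2.
Proof.
move=> Ou; have H := phi_null mx Ou; rewrite /cdot in H.
have -> : phi_minus u * phi_plus u = (phi 0 u * phi 0 u - (i * i) * (phi 1 u * phi 1 u)).
  by rewrite /phi_minus /phi_plus; move: (phi 0 u) (phi 1 u) => a b; ring.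
rewrite i2 mulN1r opprK; apply/eqP; rewrite -addr_eq0 expr2.
by rewrite H.
Qed.

(** The cross product with the unit normal is the quarter turn of the tangent plane, which acts on
    [phi] as multiplication by [i]. *)
Lemma normal_cross u : O u ->
  [/\ nu 1 u * phi 2%:R u - nu 2%:R u * phi 1 u = i * phi 0 u,
      nu 2%:R u * phi 0 u - nu 0 u * phi 2%:R u = i * phi 1 u
    & nu 0 u * phi 1 u - nu 1 u * phi 0 u = i * phi 2%:R u].
Proof.
move=> Ou; have Enz : E u != 0 by rewrite gt_eqF // E_gt0.
have NX k : cross (N u) (dX x 0 u) k 0 = dX x 1 u k 0.
  rewrite (unit_normalE mx Ou) crossZl cross_cross (dotC (dX x 1 u)) (iso_orth mx Ou) mul0r subr0.
  by rewrite -/(E u) mulKf.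
have NY k : cross (N u) (dX x 1 u) k 0 = - dX x 0 u k 0.
  rewrite (unit_normalE mx Ou) crossZl cross_cross (iso_orth mx Ou) mul0r sub0r (iso_conf mx Ou).
  by rewrite -/(E u) mulrN mulKf.
have F k : phi k u = (((dX x 0 u k 0)%:C)%C - i * ((dX x 1 u k 0)%:C)%C) / 2.
  exact: (congr1 (fun f : 'I_3 -> C => f k) (phiE x u)).
have [X0 X1 X2] := crossE (N u) (dX x 0 u); have [Y0 Y1 Y2] := crossE (N u) (dX x 1 u).
have nuk k : nu k u = ((N u k 0)%:C)%C by [].
have K (a b c d e f : R) : (a%:C)%C * (((b%:C)%C - i * (c%:C)%C) / 2) -
    (d%:C)%C * (((e%:C)%C - i * (f%:C)%C) / 2) = (((a * b - d * e)%:C)%C - i * ((a * c - d * f)%:C)%C) / 2.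
  by rewrite !(rmorphB, rmorphM) /=; field.
have K2 (a b : R) : (((b%:C)%C - i * ((- a)%:C)%C) / 2 = i * (((a%:C)%C - i * (b%:C)%C) / 2)).
  have I2 := @i2 R; rewrite rmorphN /=; move: I2; move: (i) => J J2.
  transitivity ((- (J * J) * (b%:C)%C + J * (a%:C)%C) / 2); first by rewrite J2; field.
  by field.
by split; rewrite !F !nuk K -?X0 -?X1 -?X2 -?Y0 -?Y1 -?Y2 NX NY K2.
Qed.

Lemma phi_eq0 u : O u -> ~ (phi 0 u = 0 /\ phi 1 u = 0 /\ phi 2%:R u = 0).
Proof.
move=> Ou [p0 [p1 p2]]; have := phi_phib mx Ou; rewrite /cdot p0 p1 p2 !mul0r !addr0 => /esym/eqP.
by rewrite mulf_eq0 (negbTE (Ec_neq0 mx Ou)) invr_eq0 pnatr_eq0.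
Qed.

(** From [phi.nu = 0] and the last component of the relation in [normal_cross], the product of
    [nu_0 + i nu_1] with [phi_minus] is [(1 - nu_2) phi_2]. A zero of [phi_minus] would force all
    components of [phi] to vanish. *)
Lemma stereo_eta u : O u -> nu 2%:R u != 1 ->
  phi_minus u != 0 /\ (nu 0 u + i * nu 1 u) / (1 - nu 2%:R u) = phi 2%:R u / phi_minus u.
Proof.
move=> Ou n1; have [C0 C1 C2] := normal_cross Ou; have Nphi := phi_nu mx Ou.
have n1' : 1 - nu 2%:R u != 0 by rewrite subr_eq0 eq_sym.
have H : (nu 0 u + i * nu 1 u) * phi_minus u = (1 - nu 2%:R u) * phi 2%:R u.
  transitivity (cdot (phi ^~ u) (nu ^~ u) - nu 2%:R u * phi 2%:R u
      - i * (nu 0 u * phi 1 u - nu 1 u * phi 0 u) - (i * i + 1) * (nu 1 u * phi 1 u)).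
    by rewrite /phi_minus /cdot; move: (phi 0 u) (phi 1 u) (phi 2%:R u) (nu 0 u) (nu 1 u) (nu 2%:R u) => *; ring.
  by rewrite Nphi C2 mulrA i2 addNr mul0r; move: (nu 2%:R u) (phi 2%:R u) => *; ring.
have e0 : phi_minus u != 0.
  apply/eqP => e0; rewrite e0 mulr0 in H; move/esym/eqP: H; rewrite mulf_eq0 (negbTE n1') /= => /eqP p2.
  have p0 : phi 0 u = i * phi 1 u by apply/eqP; rewrite -subr_eq0; apply/eqP.
  have p1 : phi 1 u = 0.
    have := C0; rewrite p2 mulr0 sub0r p0 mulrA i2 mulN1r => /eqP; rewrite -subr_eq0 opprK.
    have -> : - (nu 2%:R u * phi 1 u) + phi 1 u = (1 - nu 2%:R u) * phi 1 u.
      by move: (nu 2%:R u) (phi 1 u) => *; ring.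
    by rewrite mulf_eq0 (negbTE n1') /= => /eqP.
  by apply: (phi_eq0 Ou); rewrite p0 p1 mulr0.
split=> //; move: H e0 n1'; move: (nu 0 u + _) (phi_minus u) (1 - _) (phi 2%:R u) => a e n p H e0 n0.
by apply/eqP; rewrite eqr_div // H mulrC.
Qed.

(** The conjugate of the projection from the opposite pole. On the unit sphere it is the reciprocal
    of the Gauss map, finite where the latter has its poles. *)
Lemma stereo_etab u : O u -> nu 2%:R u != -1 ->
  phi_plus u != 0 /\ (nu 0 u - i * nu 1 u) / (1 + nu 2%:R u) = - phi 2%:R u / phi_plus u.
Proof.
move=> Ou n1; have [C0 C1 C2] := normal_cross Ou; have Nphi := phi_nu mx Ou.
have n1' : 1 + nu 2%:R u != 0 by rewrite addrC addr_eq0.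
have H : (nu 0 u - i * nu 1 u) * phi_plus u = (1 + nu 2%:R u) * (- phi 2%:R u).
  transitivity (cdot (phi ^~ u) (nu ^~ u) - nu 2%:R u * phi 2%:R u
      + i * (nu 0 u * phi 1 u - nu 1 u * phi 0 u) - (i * i + 1) * (nu 1 u * phi 1 u)).
    by rewrite /phi_plus /cdot; move: (phi 0 u) (phi 1 u) (phi 2%:R u) (nu 0 u) (nu 1 u) (nu 2%:R u) => *; ring.
  by rewrite Nphi C2 mulrA i2 addNr mul0r; move: (nu 2%:R u) (phi 2%:R u) => *; ring.
have e0 : phi_plus u != 0.
  apply/eqP => e0; rewrite e0 mulr0 in H; move/esym/eqP: H; rewrite mulf_eq0 (negbTE n1') /= oppr_eq0 => /eqP p2.
  have p0 : phi 0 u = - (i * phi 1 u) by apply/eqP; rewrite -addr_eq0; apply/eqP.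
  have p1 : phi 1 u = 0.
    have := C0; rewrite p2 mulr0 sub0r p0 mulrN mulrA i2 mulN1r opprK => /eqP; rewrite eq_sym -subr_eq0 opprK.
    have -> : phi 1 u + nu 2%:R u * phi 1 u = (1 + nu 2%:R u) * phi 1 u.
      by move: (nu 2%:R u) (phi 1 u) => *; ring.
    by rewrite mulf_eq0 (negbTE n1') /= => /eqP.
  by apply: (phi_eq0 Ou); rewrite p0 p1 mulr0 oppr0.
split=> //; move: H e0 n1'; move: (nu 0 u - _) (phi_plus u) (1 + _) (phi 2%:R u) => a e n p H e0 n0.
by apply/eqP; rewrite eqr_div // H mulrC.
Qed.

End Local.
End EntropyFormula.

Opaque smooth_on pder pderC del_z del_zb.

(** * The entropy differentials as rational expressions in [s] and [w] *)

Section Stereographic.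
Variable R : realType.
Local Notation plane := 'cV[R]_2.
Local Notation C := R[i].
Local Notation E3 := 'cV[R]_3.
Local Notation i := (0 +i* 1 : C)%C.
Variables (x : plane -> E3) (O : set plane).
Hypotheses (oO : open O) (mx : iso_min x O).
Local Notation phi := (phi x).
Local Notation nu := (nu x).
Local Notation phi_minus := (phi_minus x).
Local Notation phi_plus := (phi_plus x).
Local Notation w := (wdot x).
Local Notation s := (sdot x).

Let hphi k := hol_phi oO mx k.

Lemma hol_eta : hol O phi_minus.
Proof. exact: (holB oO (hphi 0) (holM oO (hol_cst oO i) (hphi 1))). Qed.

Lemma hol_etab : hol O phi_plus.
Proof. exact: (holD oO (hphi 0) (holM oO (hol_cst oO i) (hphi 1))). Qed.

Lemma del_z_lin (c : C) f g u : hol O f -> hol O g -> O u ->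
  del_z (fun v => f v + c * g v) u = del_z f u + c * del_z g u.
Proof.
move=> hf hg Ou; apply: has_dz_val.
apply: has_dz_eq (has_dzD (has_dz_hol oO hf Ou) (has_dzM (has_dz_cst c u) (has_dz_hol oO hg Ou))) _.
by rewrite mul0r add0r.
Qed.

Let etaD : phi_minus = (fun v => phi 0 v + (- i) * phi 1 v).
Proof. by apply/funext => v; rewrite mulNr. Qed.

Let detaE u : O u -> del_z phi_minus u = dphi x 0 u + (- i) * dphi x 1 u.
Proof. by move=> Ou; rewrite etaD; exact: (del_z_lin _ (hphi 0) (hphi 1) Ou). Qed.

Let detabE u : O u -> del_z phi_plus u = dphi x 0 u + i * dphi x 1 u.
Proof. by move=> Ou; exact: (del_z_lin _ (hphi 0) (hphi 1) Ou). Qed.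

Let ddE c f u : {in O, f =1 (fun v => dphi x 0 v + c * dphi x 1 v)} -> O u ->
  del_z f u = ddphi x 0 u + c * ddphi x 1 u.
Proof.
move=> H Ou; rewrite (del_z_ext_on oO H (mem_set Ou)).
exact: (del_z_lin _ (hol_dphi oO mx 0) (hol_dphi oO mx 1) Ou).
Qed.

Let sq (a b c : C) : (a + (- i) * b) * (a + i * b) + c ^+ 2 = a * a + b * b + c * c.
Proof.
have I2 := @i2 R; move: I2; move: (i) => J J2.
by transitivity (a * a - (J * J) * (b * b) + c * c); [ring | rewrite J2; ring].
Qed.

Lemma sw_eta u : O u -> sw phi_minus phi_plus (phi 2%:R) u = w u.
Proof. by move=> Ou; rewrite /sw detaE // detabE // sq. Qed.

Lemma sw_deta u : O u -> sw (del_z phi_minus) (del_z phi_plus) (del_z (phi 2%:R)) u = s u.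
Proof.
move=> Ou; rewrite /sw.
have -> : del_z (del_z phi_minus) u = ddphi x 0 u + (- i) * ddphi x 1 u.
  by apply: ddE Ou => v /set_mem; exact: detaE.
have -> : del_z (del_z phi_plus) u = ddphi x 0 u + i * ddphi x 1 u.
  by apply: ddE Ou => v /set_mem; exact: detabE.
exact: sq.
Qed.

Lemma sw_sym (p q c : plane -> C) u : sw p q c u = sw q p c u.
Proof. by rewrite /sw mulrC. Qed.

Let schw (B : set plane) (p q c : plane -> C) u : open B -> B `<=` O -> B u ->
  {in B, sw p q c =1 w} -> sw (del_z p) (del_z q) (del_z c) u = s u ->
  sw (del_z p) (del_z q) (del_z c) u / (2 * sw p q c u)
    + del_z (del_z (sw p q c)) u / (2 * sw p q c u)
    - 3%:R / 4%:R * (del_z (sw p q c) u / sw p q c u) ^+ 2 =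
  s u / (2 * w u) + del_z (del_z w) u / (2 * w u) - 3%:R / 4%:R * (del_z w u / w u) ^+ 2.
Proof.
move=> oB BO Bu E1 ->; have uB := mem_set Bu.
have E2 := del_z_ext_on oB E1.
exact: (f_equal3 (fun a b c : C => s u / (2 * a) + b / (2 * a) - 3%:R / 4%:R * (c / a) ^+ 2)
  (E1 u uB) (del_z_ext_on oB E2 uB) (E2 u uB)).
Qed.

Lemma open_neq0 (f : plane -> C) : smoothC O f -> open [set v | O v /\ f v != 0].
Proof.
move=> sf; rewrite openE => v [Ov f0]; have /near_ballP[r r0 Hr] := open_near oO Ov.
have /near_ballP[r' r0' Hr'] := diffC_near_neq0 (smoothC_diff oO sf Ov) f0.
apply/near_ballP; exists (Num.min r r'); first by rewrite lt_min r0.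
by move=> y; rewrite lt_min => /andP[h1 h2]; split; [exact: Hr | exact: Hr'].
Qed.

Lemma schwarzianS_gauss u : O u -> w u != 0 -> schwarzianS (stereo_gauss x) u =
  s u / (2 * w u) + del_z (del_z w) u / (2 * w u) - 3%:R / 4%:R * (del_z w u / w u) ^+ 2.
Proof.
move=> Ou w0; have one (v : plane) : (unit_normal x v 2%:R 0 == 1) = (nu 2%:R v == 1).
  by rewrite /nu /real_fun eq_complex /= eqxx andbT.
have SS v : stereo_gauss x v = if nu 2%:R v == 1 then None
    else Some ((nu 0 v + i * nu 1 v) / (1 - nu 2%:R v)).
  rewrite /stereo_gauss one; case: ifP => // _; congr Some.
  by congr (_ / _); [apply: complex_eqP; rewrite /nu /real_fun /=; ring | rewrite rmorphB].
(* At a pole the reciprocal of the Gauss map is differentiated; near [u] it agrees with the quotient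
   of [stereo_etab]. *)
rewrite /schwarzianS SS; case: ifPn => [/eqP n1|n1].
  pose B := [set v | O v /\ 1 + nu 2%:R v != 0].
  have oB : open B by exact: (open_neq0 (smoothCD oO (smoothC_cst oO 1) (smooth_nu oO mx 2%:R))).
  have Bu : B u by split=> //; rewrite n1 -(natrD _ 1 1) pnatr_eq0.
  have BO : B `<=` O by move=> v [].
  have bm v : B v -> nu 2%:R v != -1 by case=> _; rewrite -addr_eq0 addrC.
  pose G v : C := - phi 2%:R v / phi_plus v.
  have e0 v : B v -> phi_plus v != 0.
    by move=> Bv; have [] := stereo_etab mx Bv.1 (bm v Bv).
  have hG : hol B G.
    exact: (holM oB (holN oB (hol_sub BO (hphi 2%:R))) (holV oB e0 (hol_sub BO hol_etab))).
  have EG : {in B, ((odflt 0 \o @sphere_inv R) \o stereo_gauss x) =1 G}.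
    move=> v /set_mem Bv; have [Ov b0] := Bv; rewrite /comp SS.
    have [_ HE] := stereo_etab mx Ov (bm v Bv).
    have nn : (nu 0 v + i * nu 1 v) * (nu 0 v - i * nu 1 v) = (1 - nu 2%:R v) * (1 + nu 2%:R v).
      have := nu_nu mx Ov; rewrite /cdot; have I2 := @i2 R; move: I2; move: (i) => J J2 N1.
      transitivity (nu 0 v * nu 0 v - (J * J) * (nu 1 v * nu 1 v)); first by ring.
      rewrite J2; transitivity (nu 0 v * nu 0 v + nu 1 v * nu 1 v + nu 2%:R v * nu 2%:R v - nu 2%:R v * nu 2%:R v); first by ring.
      by rewrite N1; ring.
    (* At a pole [sphere_inv] takes the value 0, and so does the quotient because [nu_0 = nu_1 = 0]
       there; elsewhere [nn] identifies the two fractions. *)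
    case: ifPn => [/eqP m1|m1] /=.
      rewrite /G -HE.
      have : cdot (nu ^~ v) (nu ^~ v) = 1 := nu_nu mx Ov.
      have re k : nu k v = ((unit_normal x v k 0)%:C)%C by [].
      have r1 : unit_normal x v 2%:R 0 = 1 by move/eqP: (m1); rewrite -one => /eqP.
      rewrite /cdot !re r1 -!rmorphM -!rmorphD /= => /complexI H1.
      suff [-> ->] : unit_normal x v 0 0 = 0 /\ unit_normal x v 1 0 = 0.
        by rewrite rmorph0 mulr0 subr0 mul0r.
      move/eqP: H1; rewrite mulr1 -subr_eq0 addrK -!expr2 paddr_eq0 ?sqr_ge0 // !sqrf_eq0.
      by move=> /andP[/eqP-> /eqP->].
    have m1' : 1 - nu 2%:R v != 0 by rewrite subr_eq0 eq_sym.
    have a0 : nu 0 v + i * nu 1 v != 0.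
      by apply/eqP => a0; move/esym/eqP: nn; rewrite a0 mul0r mulf_eq0 (negbTE m1') (negbTE b0).
    rewrite mulf_eq0 invr_eq0 (negbTE a0) (negbTE m1') /= /G -HE.
    by apply/eqP; rewrite invf_div eqr_div // -nn mulrC.
  rewrite (schwarzian_ext oB EG Bu).
  have SB : {in B, sw phi_plus phi_minus (phi 2%:R) =1 w}.
    by move=> v /set_mem[Ov _]; rewrite sw_sym sw_eta.
  (* The two isotropic coordinates exchange their roles, and [phi_2 = - phi_plus G] accounts for the
     sign. *)
  rewrite (schwarzian_null (eps := -1) oB Bu _ (hol_sub BO hol_etab) hG (q := phi_minus) (c := phi 2%:R)).
  - by apply: (schw oB BO Bu SB); rewrite sw_sym sw_deta.
  - by rewrite mulrNN mulr1.
  - move=> v Bv; have [Ov _] := Bv; have ee := eta_etab mx Ov; have n0 := e0 v Bv.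
    rewrite /G; move: ee n0; move: (phi_minus v) (phi_plus v) (phi 2%:R v) => a b c ee n0.
    by apply: (mulIf n0); rewrite ee; field.
  - move=> v Bv; have n0 := e0 v Bv; rewrite /G; move: n0; move: (phi_plus v) (phi 2%:R v) => b c n0.
    by field.
  - by rewrite SB // inE.
pose B := [set v | O v /\ 1 - nu 2%:R v != 0].
have oB : open B by exact: (open_neq0 (smoothCB oO (smoothC_cst oO 1) (smooth_nu oO mx 2%:R))).
have Bu : B u by split=> //; rewrite subr_eq0 eq_sym.
have BO : B `<=` O by move=> v [].
have b1 v : B v -> nu 2%:R v != 1 by case=> _; rewrite subr_eq0 eq_sym.
pose G v : C := phi 2%:R v / phi_minus v.
have e0 v : B v -> phi_minus v != 0 by move=> Bv; have [] := stereo_eta mx Bv.1 (b1 v Bv).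
have hG : hol B G.
  exact: (holM oB (hol_sub BO (hphi 2%:R)) (holV oB e0 (hol_sub BO hol_eta))).
have EG : {in B, (odflt 0 \o stereo_gauss x) =1 G}.
  move=> v /set_mem Bv; rewrite /comp SS (negbTE (b1 v Bv)) /=.
  by have [_ ->] := stereo_eta mx Bv.1 (b1 v Bv).
rewrite (schwarzian_ext oB EG Bu).
have SB : {in B, sw phi_minus phi_plus (phi 2%:R) =1 w}.
  by move=> v /set_mem[Ov _]; rewrite sw_eta.
rewrite (schwarzian_null (eps := 1) oB Bu _ (hol_sub BO hol_eta) hG (q := phi_plus) (c := phi 2%:R)).
- by apply: (schw oB BO Bu SB); rewrite sw_deta.
- by rewrite mulr1.
- move=> v Bv; have [Ov _] := Bv; have ee := eta_etab mx Ov; have n0 := e0 v Bv.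
  rewrite /G; move: ee n0; move: (phi_minus v) (phi_plus v) (phi 2%:R v) => a b c ee n0.
  by apply: (mulfI n0); rewrite ee; field.
- move=> v Bv; have n0 := e0 v Bv; rewrite /G; move: n0; move: (phi_minus v) (phi 2%:R v) => b c n0.
  by field.
- by rewrite SB // inE.
Qed.

Local Notation Oreg := (Oreg x O).

Let oOreg : open Oreg := Oreg_open oO mx.
Let sub := @Oreg_sub R x O.

Lemma del_z_ent_conn u : hol O w -> O u -> w u != 0 ->
  del_z (ent_conn w) u = del_z (del_z w) u / (4%:R * w u) - (del_z w u) ^+ 2 / (4%:R * w u ^+ 2).
Proof.
move=> hw Ou w0; have h0 := has_dz_hol oO hw Ou.
have h1 := has_dz_hol oO (hol_del_z oO hw) Ou.
have c4 : 4%:R * w u != 0 by rewrite mulf_neq0 ?pnatr_eq0.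
have H := has_dzM h1 (has_dzV (has_dzM (has_dz_cst 4%:R u) h0) c4).
rewrite (has_dz_val H); move: w0; move: (w u) (del_z w u) (del_z (del_z w) u) => a b c a0.
by field.
Qed.

Lemma entropyE l u : Oreg u -> entropy x l u = ent s w (l - 2) u.
Proof.
move=> Hu; rewrite /entropy; elim: (l - 2)%N u Hu => [|n IH] u Hu /=.
  have [Ou b0] := Hu; have w0 : w u != 0 by rewrite (wdot_neq0 oO mx).
  have Eg : {in Oreg, conn_coef (flat_metric x) =1 ent_conn w}.
    by move=> v /set_mem; exact: conn_coef_flat.
  rewrite schwarzianS_gauss // (Eg u (mem_set Hu)) (del_z_ext_on oOreg Eg (mem_set Hu)).
  rewrite (del_z_ent_conn (hol_wdot oO mx) Ou w0) /ent_conn /ent0.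
  by move: w0; move: (w u) (del_z w u) (del_z (del_z w) u) (s u) => a b c d a0; field.
apply: (cov_del_ext _ oOreg _ _ (mem_set Hu)).
  by move=> v /set_mem; exact: conn_coef_flat.
by move=> v /set_mem; exact: IH.
Qed.

Lemma entropy_hol l : hol Oreg (entropy x l).
Proof.
apply: (hol_ext oOreg (f := ent s w (l - 2))).
  by move=> v /set_mem Hv; rewrite entropyE.
apply: (hol_ent _ oOreg (hol_sub sub (hol_sdot oO mx)) (hol_sub sub (hol_wdot oO mx))).
by move=> v [Ov b0]; rewrite (wdot_neq0 oO mx).
Qed.

End Stereographic.

(** * The pole at an umbilic point *)

Opaque smooth_on pder pderC del_z del_zb.

Section Pole.
Variable R : realType.
Local Notation plane := 'cV[R]_2.
Local Notation C := R[i].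
Local Notation E3 := 'cV[R]_3.

Lemma open_off (O : set plane) (a : plane) : open O -> open [set v | O v /\ v != a].
Proof.
move=> oO; rewrite openE => v [Ov va]; have /near_ballP[r r0 Hr] := open_near oO Ov.
apply/near_ballP; exists (Num.min r `|a - v|).
  by rewrite lt_min r0 normr_gt0 subr_eq0 eq_sym.
move=> y; rewrite lt_min => /andP[h1 h2]; split; first exact: Hr.
by apply/eqP => ya; rewrite ya ltxx in h2.
Qed.

Lemma near_off (P : plane -> Prop) a : (\forall v \near a, P v) -> exists2 v, v != a & P v.
Proof.
move=> /near_ballP[r r0 H].
have N : `|(r / 2) *: (delta_mx 0 0 : plane)| = r / 2.
  by rewrite normrZ norm_e mulr1 ger0_norm // divr_ge0 // ltW.
exists (a + (r / 2) *: delta_mx 0 0); last first.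
  by apply: H; rewrite addrAC subrr add0r N ltr_pdivrMr // mulr_natr mulr2n ltrDl.
rewrite -subr_eq0 addrAC subrr add0r -normr_eq0 N mulf_eq0 (gt_eqF r0) /=.
by rewrite invr_eq0 pnatr_eq0.
Qed.

(** [del_zb f] is continuous: were it nonzero at [a], it would be nonzero at nearby points other
    than [a]. *)
Lemma hol_extend (O : set plane) a f : open O -> smoothC O f -> hol [set v | O v /\ v != a] f -> hol O f.
Proof.
move=> oO sf hf; split=> // u Ou; apply/eqP; apply: contraT => n0.
have /near_ballP[r r0 Hr] := diffC_near_neq0 (smoothC_diff oO (smoothC_del_zb oO sf) Ou) n0.
have /near_ballP[r' r0' Hr'] := open_near oO Ou.
have nb : \forall v \near u, del_zb f v != 0 /\ O v.
  apply/near_ballP; exists (Num.min r r'); first by rewrite lt_min r0.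
  by move=> y; rewrite lt_min => /andP[h1 h2]; split; [exact: Hr | exact: Hr'].
have [ua|ua] := eqVneq u a; last by rewrite hf.2 ?eqxx in n0.
have [v vu [dv Ov]] := near_off nb; rewrite ua in vu.
by rewrite hf.2 ?eqxx in dv.
Qed.

Lemma osquare_center a (r : R) : 0 < r -> osquare a r a.
Proof. by move=> r0; rewrite /osquare /= subrr normr0. Qed.

Lemma sub_osquare (O : set plane) a : open O -> O a -> exists2 r : R, 0 < r & osquare a r `<=` O.
Proof. by move=> oO Oa; have [r r0 H] := open_ballP oO Oa; exists r => // v; exact: H. Qed.

Section Local.
Variables (x : plane -> E3) (O : set plane) (a : plane).
Hypotheses (oO : open O) (mx : iso_min x O) (Oa : O a).
Local Notation beta := (beta x).
Local Notation w := (wdot x).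
Local Notation s := (sdot x).
Local Notation Ec := (Ec x).
Local Notation "'ζ'" := (fun v : plane => to_C v - to_C a).

Hypotheses (b0 : beta a = 0) (nb : ~ \forall v \near a, beta v = 0).

(** The order supplied by [hol_zero_order] is a successor because [beta a = 0]; [B] is shrunk to
    where the cofactor [k] has no zero. *)
Lemma beta_factor : exists n k B, [/\ open B, B a, B `<=` O & hol B k] /\
  (forall u, B u -> k u != 0 /\ beta u = (to_C u - to_C a) ^+ n.+1 * k u).
Proof.
have [r r0 rO] := sub_osquare oO Oa.
have hb := hol_sub rO (hol_beta oO mx).
have [H|[n [k [hk k0 H]]]] := hol_zero_order r0 hb.
  by case: nb; apply/near_ballP; exists (r / 4); rewrite ?divr_gt0.
have oB := @osquare_open R a r; have Ba := @osquare_center a r r0.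
case: n H => [|n] H.
  by move: (H a Ba); rewrite b0 mul1r => /esym/eqP; rewrite (negbTE k0).
exists n, k, [set u | osquare a r u /\ k u != 0]; split; first split.
- exact: (open_neq0 oB hk.1).
- by [].
- by move=> u [/rO].
- by apply: hol_sub hk => u [].
- by move=> u [Bu ku]; split=> //; exact: H.
Qed.

Section Factor.
Variables (n : nat) (k : plane -> C) (B : set plane).
Hypotheses (oB : open B) (Ba : B a) (BO : B `<=` O) (hk : hol B k).
Hypothesis kB : forall u, B u -> k u != 0 /\ beta u = (to_C u - to_C a) ^+ n.+1 * k u.

Let B' := [set v | B v /\ v != a].
Let oB' : open B' := open_off oB.
Let B'B : B' `<=` B. Proof. by move=> u []. Qed.
Let hz : hol B ζ := hol_shift oB a.
Let hc (c : C) : hol B (fun=> c) := hol_cst oB c.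
Let kap u := del_z k u / k u.
Let k0 u : B u -> k u != 0. Proof. by move=> /kB[]. Qed.
Let hkap : hol B kap := holM oB (hol_del_z oB hk) (holV oB k0 hk).
(* [mu / ζ] is the logarithmic derivative of [beta]. *)
Let mu u := n.+1%:R + (to_C u - to_C a) * kap u.
Let hmu : hol B mu := holD oB (hc _) (holM oB hz hkap).

Let z0 u : u != a -> to_C u - to_C a != 0.
Proof. by rewrite subr_eq0 => ua; apply: contraNneq ua => H; rewrite -(to_CK u) H to_CK. Qed.

Lemma factor_neq0 u : B' u -> beta u != 0.
Proof.
by move=> [Bu ua]; have [ku ->] := kB Bu; rewrite mulf_neq0 // expf_neq0 // z0.
Qed.

Let dbeta u : B u -> del_z beta u = (to_C u - to_C a) ^+ n * (mu u * k u).
Proof.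
move=> Bu; have E : {in B, beta =1 (fun v => (to_C v - to_C a) ^+ n.+1 * k v)}.
  by move=> v /set_mem /kB[].
rewrite (del_z_ext_on oB E (mem_set Bu)).
have H1 := has_dz_hol oB hz Bu; rewrite del_z_shift in H1.
have dX m := has_dzX m H1.
rewrite (has_dz_val (has_dzM (dX n.+1) (has_dz_hol oB hk Bu))) /= /mu /kap (exprS _ n).
by have := k0 Bu; move: (k u) (del_z k u) (to_C u - to_C a) => c c1 t c0; field.
Qed.

Let logw u : B' u -> del_z w u / w u = 2 * mu u / (to_C u - to_C a).
Proof.
move=> [Bu ua]; rewrite (del_z_wdot oO mx (BO Bu)) (wdotE oO mx (BO Bu)) dbeta // (kB Bu).2 (exprS _ n).
have t0 := z0 ua; have := k0 Bu; have : (to_C u - to_C a) ^+ n != 0 by rewrite expf_neq0.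
move: (k u) (mu u) ((to_C u - to_C a) ^+ n) t0; move: (to_C u - to_C a) => t c m p t0 p0 c0.
by field; rewrite t0 p0 c0.
Qed.

Let sig u : C := (mu u * k u + (to_C u - to_C a) * k u * (del_z Ec u / Ec u)) ^+ 2
  - 2 * ((to_C u - to_C a) * k u) ^+ 2 * (del_z (del_z Ec) u / Ec u).

Let sigE u : B u -> s u = ((to_C u - to_C a) ^+ n) ^+ 2 * sig u.
Proof.
move=> Bu; rewrite (sdotE oO mx (BO Bu)) dbeta // (kB Bu).2 (exprS _ n) /sig.
move: (mu u) (k u) ((to_C u - to_C a) ^+ n) (del_z Ec u / Ec u) (del_z (del_z Ec) u / Ec u).
by move: (to_C u - to_C a) => t m c p e1 e2; ring.
Qed.

(** The formula for [sig] contains the conformal factor, which is not holomorphic. Away from [a],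
    however, [sig] is the holomorphic quotient of [s] by a power of [ζ], and it is smooth at [a]. *)
Let hsig : hol B sig.
Proof.
have sE : smoothC B Ec by apply: smoothC_sub BO _; exact: smooth_Ec oO mx.
have sE1 := smoothC_del_z oB sE; have sE2 := smoothC_del_z oB sE1.
have E0 u : B u -> Ec u != 0 by move=> /BO; exact: Ec_neq0.
have sV := smoothCV oB E0 sE.
have sz := hz.1; have sk := hk.1; have sm := hmu.1.
have sX f : smoothC B f -> smoothC B (fun u => f u ^+ 2) by move=> sf; exact: (smoothCM oB sf sf).
apply: (hol_extend (a := a) oB).
  apply: (smoothCB oB); first apply: sX.
    exact: (smoothCD oB (smoothCM oB sm sk) (smoothCM oB (smoothCM oB sz sk) (smoothCM oB sE1 sV))).
  exact: (smoothCM oB (smoothCM oB (smoothC_cst oB 2) (sX _ (smoothCM oB sz sk))) (smoothCM oB sE2 sV)).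
have zn0 u : B' u -> ((to_C u - to_C a) ^+ n) ^+ 2 != 0.
  by move=> [_ ua]; rewrite !expf_neq0 // z0.
have hs : hol B' s by apply: hol_sub (hol_sdot oO mx) => u /B'B/BO.
have hzn := holX oB' 2 (holX oB' n (hol_sub B'B hz)).
apply: (hol_ext oB' _ (holM oB' hs (holV oB' zn0 hzn))) => u /set_mem Hu.
by rewrite sigE; [rewrite mulrAC divff ?mul1r // zn0 | exact: B'B].
Qed.

(** The covariant derivative of [H / ζ^m] multiplied by [ζ^(m+1)], with [gamma = mu / (2 ζ)]. *)
Let step (m : nat) (H : plane -> C) u : C :=
  (to_C u - to_C a) * del_z H u - m%:R * H u - m%:R / 2 * (mu u * H u).

(** [ent0] multiplied by [ζ^2], with [w' / w = 2 mu / ζ]; the coefficient [7/8] is [15/8 - 1]. *)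
Let P2 u : C := sig u / (2 * k u ^+ 2) + del_z mu u * (to_C u - to_C a) / 2 - mu u / 2
  - 7%:R / 8%:R * mu u ^+ 2.

Fixpoint polar j : plane -> C := if j is m.+1 then step m.+2 (polar m) else P2.

Lemma hol_polar j : hol B (polar j).
Proof.
elim: j => [|j IH] /=.
  have k2 u : B u -> 2 * k u ^+ 2 != 0.
    by move=> Bu; rewrite mulf_neq0 ?pnatr_eq0 // expf_neq0 // k0.
  have h1 := holM oB hsig (holV oB k2 (holM oB (hc 2) (holX oB 2 hk))).
  have h2 := holM oB (holM oB (hol_del_z oB hmu) hz) (hc 2^-1).
  exact: (holB oB (holB oB (holD oB h1 h2) (holM oB hmu (hc 2^-1))) (holM oB (hc _) (holX oB 2 hmu))).
exact: (holB oB (holB oB (holM oB hz (hol_del_z oB IH)) (holM oB (hc _) IH))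
  (holM oB (hc _) (holM oB hmu IH))).
Qed.

Lemma polar_neq0 j : polar j a != 0.
Proof.
have za : to_C a - to_C a = 0 by rewrite subrr.
have mua : mu a = n.+1%:R by rewrite /mu za mul0r addr0.
elim: j => [|j IH] /=.
  have ka := k0 Ba.
  (* At [a] the terms of [sig] with the conformal factor vanish, and [sig] reduces to the square of
     [mu k]. *)
  have -> : P2 a = - ((4%:R * n.+1%:R + 3%:R * n.+1%:R ^+ 2) / 8%:R) :> C.
    rewrite /P2 /sig za mua; move: ka.
    move: (k a) (n.+1%:R : C) (del_z Ec a / Ec a) (del_z (del_z Ec) a / Ec a) (del_z mu a).
    by move=> c N e1 e2 m c0; field.
  by rewrite oppr_eq0 mulf_neq0 ?invr_eq0 ?pnatr_eq0 // -natrX -!natrM -natrD pnatr_eq0.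
rewrite /step za mua mul0r sub0r.
have -> : - (j.+2%:R * polar j a) - j.+2%:R / 2 * (n.+1%:R * polar j a) =
    - (j.+2%:R * (2 + n.+1%:R) / 2) * polar j a.
  by move: (j.+2%:R : C) (n.+1%:R : C) (polar j a) => p q t; field.
by rewrite mulf_neq0 // oppr_eq0 mulf_neq0 ?invr_eq0 -?(natrD _ 2 n.+1) -?natrM ?pnatr_eq0.
Qed.

Lemma ent_polar j u : B' u -> ent s w j u = polar j u / (to_C u - to_C a) ^+ j.+2.
Proof.
have hw : hol B' w by apply: hol_sub (hol_wdot oO mx) => v /B'B/BO.
have dz v := del_z_shift a v.
elim: j u => [|j IH] u Hu; have [Bu ua] := Hu; have t0 := z0 ua.
  have w0 : w u != 0 by rewrite (wdot_neq0 oO mx (BO Bu)) factor_neq0.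
  have hw0 := has_dz_hol oB' hw Hu; have hw1 := has_dz_hol oB' (hol_del_z oB' hw) Hu.
  have W1 : {in B', (fun v => del_z w v / w v) =1 (fun v => 2 * mu v / (to_C v - to_C a))}.
    by move=> v /set_mem; exact: logw.
  have D1 := has_dz_val (has_dzM hw1 (has_dzV hw0 w0)).
  have hzu := has_dz_hol oB hz Bu; rewrite dz in hzu.
  have D2 := has_dz_val (has_dzM (has_dzM (has_dz_cst 2 u) (has_dz_hol oB hmu Bu)) (has_dzV hzu t0)).
  (* The derivative of [w' / w] is computed in two ways, which yields [w'' / w]. *)
  have D := etrans (esym D1) (etrans (del_z_ext_on oB' W1 (mem_set Hu)) D2).
  have E2 : del_z (del_z w) u / w u = 2 * del_z mu u / (to_C u - to_C a)
      - 2 * mu u / (to_C u - to_C a) ^+ 2 + (2 * mu u / (to_C u - to_C a)) ^+ 2.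
    rewrite -(logw Hu); move: D w0 t0.
    move: (del_z (del_z w) u) (del_z w u) (w u) (mu u) (del_z mu u); move: (to_C u - to_C a).
    move=> t w2 w1 w_ m m1 D w0 t0.
    transitivity ((w2 / w_ + w1 * (- w1 / w_ ^+ 2)) + (w1 / w_) ^+ 2); first by field.
    by rewrite D; congr (_ + _); field.
  have E3 : s u / w u = sig u / (k u ^+ 2 * (to_C u - to_C a) ^+ 2).
    rewrite sigE // (wdotE oO mx (BO Bu)) (kB Bu).2 (exprS _ n).
    have := k0 Bu; have : (to_C u - to_C a) ^+ n != 0 by rewrite expf_neq0.
    move: (k u) (sig u) ((to_C u - to_C a) ^+ n) t0; move: (to_C u - to_C a) => t c m p t0 p0 c0.
    by field; rewrite t0 p0 c0.
  transitivity (s u / w u / 2 + del_z (del_z w) u / w u / 4%:R - 15%:R / 32%:R * (del_z w u / w u) ^+ 2).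
    by rewrite /= /ent0; move: w0; move: (w u) (s u) (del_z w u) (del_z (del_z w) u) => *; field.
  rewrite E3 E2 (logw Hu) /= /P2; have := k0 Bu; move: t0.
  move: (k u) (sig u) (mu u) (del_z mu u) (to_C u - to_C a) => c g m m1 t t0 c0.
  by field; rewrite t0 c0.
have zj v : B' v -> (to_C v - to_C a) ^+ j.+2 != 0 by case=> _ va; rewrite expf_neq0 // z0.
have hpj := hol_sub B'B (hol_polar j).
have EI : {in B', ent s w j =1 (fun v => polar j v / (to_C v - to_C a) ^+ j.+2)}.
  by move=> v /set_mem; exact: IH.
rewrite /= /cov_del (del_z_ext_on oB' EI (mem_set Hu)) IH //.
have H1 := has_dz_hol oB hz Bu; rewrite del_z_shift in H1.
have dX m := has_dzX m H1.
rewrite (has_dz_val (has_dzM (has_dz_hol oB' hpj Hu) (has_dzV (dX j.+2) (zj u Hu)))).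
have -> : ent_conn w u = mu u / (2 * (to_C u - to_C a)).
  have -> : ent_conn w u = del_z w u / w u / 4%:R.
    rewrite /ent_conn; have w0 : w u != 0 by rewrite (wdot_neq0 oO mx (BO Bu)) factor_neq0.
    by move: w0; move: (w u) (del_z w u) => *; field.
  by rewrite (logw Hu); move: t0; move: (mu u) (to_C u - to_C a) => *; field.
rewrite /step /= !exprS; have : (to_C u - to_C a) ^+ j != 0 by rewrite expf_neq0.
move: ((to_C u - to_C a) ^+ j) t0; move: (mu u) (to_C u - to_C a) (polar j u) (del_z (polar j) u) (j.+2%:R : C).
by move=> m t p p1 J q t0 q0; field; rewrite t0 q0.
Qed.

End Factor.

Lemma entropy_pole l : (2 <= l)%N -> exists h B, [/\ open B, B a, hol B h, h a != 0
  & forall u, B u -> u != a -> Oreg x O u /\ entropy x l u = h u / (to_C u - to_C a) ^+ l].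
Proof.
move=> l2; have [n [k [B [[oB Ba BO hk] kB]]]] := beta_factor.
exists (polar n k (l - 2)), B; split=> //.
- exact: hol_polar.
- exact: (polar_neq0 Ba kB).
- move=> u Bu ua; have Hu : Oreg x O u.
    by split; [exact: BO | apply: (factor_neq0 kB); split].
  by split=> //; rewrite (entropyE oO mx l Hu) (ent_polar oB BO hk kB) // -(addn2 (l - 2)) subnK.
Qed.

End Local.

Lemma has_pole_hol (D B : set plane) (f h : plane -> C) a n : open B -> B a -> hol B h -> h a != 0 ->
  (forall u, B u -> u != a -> D u /\ f u = h u / (to_C u - to_C a) ^+ n) -> has_pole D f a n.
Proof.
move=> oB Ba hh h0 H; exists (h \o @of_C R); split.
- have := near_planeC (open_near oB Ba) => /near_CP[d d0 Hd]; apply/near_CP; exists d => // z zd.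
  by rewrite -(of_CK z); apply: (hol_holomorphic oB hh); exact: Hd.
- by rewrite /= to_CK.
- have /near_CP[d d0 Hd] := near_planeC (open_near oB Ba).
  have : \forall z \near (to_C a : C^o), z != to_C a -> D (of_C z) /\ f (of_C z) = (h \o @of_C R) z / (z - to_C a) ^+ n.
    apply/near_CP; exists d => // z zd za.
    have [] := H (of_C z) (Hd z zd) _; last by rewrite of_CK.
    by apply: contraNneq za => <-; rewrite of_CK.
  by [].
Qed.

End Pole.

(** * Change of parameters *)

Opaque smooth_on pder pderC del_z del_zb.

Section Reparametrization.
Variable R : realType.
Local Notation plane := 'cV[R]_2.
Local Notation E3 := 'cV[R]_3.

Lemma metricE (x : plane -> E3) u a b : metric x u a b = dot (dX x a u) (dX x b u).
Proof. by rewrite mxE. Qed.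

Lemma metric_gram (x : plane -> E3) u : metric x u = (jac x u)^T *m jac x u.
Proof.
apply/matrixP => a b; rewrite metricE mxE /dot; apply: eq_bigr => k _.
by rewrite [dX x a u k 0]mxE [dX x b u k 0]mxE [(jac x u)^T a k]mxE.
Qed.

Definition ddX (x : plane -> E3) a b u : E3 := \col_k pder a (pder b (fun v => x v k 0)) u.

Lemma second_formE (x : plane -> E3) u a b : second_form x u a b = dot (ddX x a b u) (unit_normal x u).
Proof. by rewrite mxE. Qed.

Lemma dotDl (p q r : E3) : dot (p + q) r = dot p r + dot q r.
Proof.
rewrite !dotE !mxE.
by move: (p 0 0) (p 1 0) (p 2%:R 0) (q 0 0) (q 1 0) (q 2%:R 0) => *; ring.
Qed.

Lemma cross_lin (p q : E3) (a b c d : R) :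
  cross (a *: p + b *: q) (c *: p + d *: q) = (a * d - b * c) *: cross p q.
Proof.
have [p0 p1 p2] := crossE p q.
have [q0 q1 q2] := crossE (a *: p + b *: q) (c *: p + d *: q).
have L s t k : (s *: p + t *: q) k 0 = s * p k 0 + t * q k 0 by rewrite !mxE.
apply/matrixP => k j; rewrite ord1 [RHS]mxE; elim/ord3P: k.
- by rewrite q0 p0 !L; ring.
- by rewrite q1 p1 !L; ring.
- by rewrite q2 p2 !L; ring.
Qed.

Lemma dot_cross (p q : E3) : dot p (cross p q) = 0 /\ dot q (cross p q) = 0.
Proof. by rewrite !dotE; have [-> -> ->] := crossE p q; split; ring. Qed.

Lemma dot_normal (x : plane -> E3) a u : dot (dX x a u) (unit_normal x u) = 0.
Proof.
rewrite dotC dotZl dotC; have [H0 H1] := dot_cross (dX x 0 u) (dX x 1 u).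
by elim/ord2P: a; rewrite ?H0 ?H1 mulr0.
Qed.

Lemma jacE n (x : plane -> 'cV[R]_n) k a u : jac x u k a = pder a (fun v => x v k 0) u.
Proof. by rewrite mxE. Qed.

Lemma ddXE (x : plane -> E3) a b k u : ddX x a b u k 0 = pder a (pder b (fun v => x v k 0)) u.
Proof. by rewrite mxE. Qed.

Lemma unit_normal_cross (x : plane -> E3) u : let n := cross (dX x 0 u) (dX x 1 u) in
  unit_normal x u = (Num.sqrt (dot n n))^-1 *: n.
Proof. by []. Qed.

Opaque jac dX ddX metric second_form unit_normal.

Lemma jac_comp n (x : plane -> 'cV[R]_n) (t : plane -> plane) u :
  (forall k, differentiable (fun v => x v k 0) (t u)) -> (forall b, differentiable (fun v => t v b 0) u) ->
  jac (x \o t) u = jac x (t u) *m jac t u.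
Proof.
move=> dx dt; apply/matrixP => k a; rewrite [RHS]mxE sum2 !jacE.
exact: (pder_comp a (dx k) dt).
Qed.

Variables (x : plane -> E3) (t : plane -> plane) (O W : set plane).
Hypotheses (oO : open O) (oW : open W).
Hypothesis sx : forall k, smooth_on O (fun v => x v k 0).
Hypothesis st : forall b, smooth_on W (fun v => t v b 0).
Hypothesis tW : forall u, W u -> O (t u).
Local Notation y := (x \o t).

Lemma smooth_reparam k : smooth_on W (fun v => y v k 0).
Proof. exact: (smooth_comp oW oO (sx k) tW st). Qed.

Let dx u k : W u -> differentiable (fun v => x v k 0) (t u).
Proof. by move=> Wu; exact: smooth_diff oO (sx k) (tW Wu). Qed.

Let dt u b : W u -> differentiable (fun v => t v b 0) u.
Proof. by move=> Wu; exact: smooth_diff oW (st b) Wu. Qed.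

Let pdery a k u : W u -> pder a (fun v => y v k 0) u =
  pder 0 (fun v => x v k 0) (t u) * pder a (fun v => t v 0 0) u +
  pder 1 (fun v => x v k 0) (t u) * pder a (fun v => t v 1 0) u.
Proof. by move=> Wu; exact: (pder_comp a (dx k Wu) (fun b => dt b Wu)). Qed.

Lemma jac_reparam u : W u -> jac y u = jac x (t u) *m jac t u.
Proof.
by move=> Wu; exact: (jac_comp (fun k => dx k Wu) (fun b => dt b Wu)).
Qed.

Lemma metric_reparam u : W u -> metric y u = (jac t u)^T *m metric x (t u) *m jac t u.
Proof. by move=> Wu; rewrite !metric_gram jac_reparam // trmx_mul !mulmxA. Qed.

Lemma dX_reparam a u : W u -> dX y a u = jac t u 0 a *: dX x 0 (t u) + jac t u 1 a *: dX x 1 (t u).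
Proof.
move=> Wu; apply/matrixP => k j; rewrite ord1 dXE pdery // [RHS]mxE.
rewrite [X in _ = X + _]mxE [X in _ = _ + X]mxE !dXE.
by rewrite !jacE mulrC; congr (_ + _); rewrite mulrC.
Qed.

Lemma normal_reparam u : W u -> 0 < \det (jac t u) -> unit_normal y u = unit_normal x (t u).
Proof.
move=> Wu J0; rewrite !unit_normal_cross !dX_reparam // cross_lin; move: J0; rewrite det2 [jac t u 0 1 * _]mulrC.
have -> (a b c : R) : a - b * c = a - c * b by rewrite mulrC.
move: (_ - _) (cross _ _) => d n d0.
rewrite dotZl dotC dotZl mulrA -expr2 sqrtrM ?sqr_ge0 // sqrtr_sqr gtr0_norm // scalerA invfM.
by rewrite mulrAC mulVf ?gt_eqF // mul1r.
Qed.

Let ddt a b c u := pder a (pder b (fun v => t v c 0)) u.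

Let pderyy a b k u : W u -> pder a (pder b (fun v => y v k 0)) u =
  (ddX x 0 0 (t u) k 0 * jac t u 0 a + ddX x 1 0 (t u) k 0 * jac t u 1 a) * jac t u 0 b +
  dX x 0 (t u) k 0 * ddt a b 0 u +
  ((ddX x 0 1 (t u) k 0 * jac t u 0 a + ddX x 1 1 (t u) k 0 * jac t u 1 a) * jac t u 1 b +
   dX x 1 (t u) k 0 * ddt a b 1 u).
Proof.
move=> Wu; have E1 : {in W, pder b (fun v => y v k 0) =1 (fun v =>
    (pder 0 (fun v => x v k 0) \o t) v * pder b (fun v => t v 0 0) v +
    (pder 1 (fun v => x v k 0) \o t) v * pder b (fun v => t v 1 0) v)}.
  by move=> v /set_mem; exact: pdery.
rewrite (pder_ext_on a oW E1 (mem_set Wu)).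
have d1 c : differentiable (pder c (fun v => x v k 0)) (t u).
  exact: smooth_diff oO (smooth_pder c (sx k)) (tW Wu).
have d2 c := differentiable_comp_plane (d1 c) (fun b => dt b Wu).
have d3 c : differentiable (pder b (fun v => t v c 0)) u.
  exact: smooth_diff oW (smooth_pder b (st c)) Wu.
rewrite (pderD a (differentiableMf (d2 0) (d3 0)) (differentiableMf (d2 1) (d3 1))).
rewrite (pderM a (d2 0) (d3 0)) (pderM a (d2 1) (d3 1)).
rewrite (pder_comp a (d1 0) (fun b => dt b Wu)) (pder_comp a (d1 1) (fun b => dt b Wu)).
by congr ((_ * _ + _ * _) * _ + _ * _ + ((_ * _ + _ * _) * _ + _ * _)); rewrite ?ddXE ?jacE ?dXE.
Qed.

(** In the chain rule the second derivatives of [t] multiply tangent vectors, which the normal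
    annihilates; the sign of the Jacobian enters through the normal. *)
Lemma second_form_reparam u : W u -> 0 < \det (jac t u) ->
  second_form y u = (jac t u)^T *m second_form x (t u) *m jac t u.
Proof.
move=> Wu J0; apply/matrixP => a b; rewrite second_formE normal_reparam //.
have -> : ddX y a b u = jac t u 0 a *: (jac t u 0 b *: ddX x 0 0 (t u)) + jac t u 1 a *: (jac t u 0 b *: ddX x 1 0 (t u))
    + ddt a b 0 u *: dX x 0 (t u) + (jac t u 0 a *: (jac t u 1 b *: ddX x 0 1 (t u)) +
     jac t u 1 a *: (jac t u 1 b *: ddX x 1 1 (t u)) + ddt a b 1 u *: dX x 1 (t u)).
  apply/matrixP => k j; rewrite ord1 ddXE pderyy //.
  have Rg (p q r s p' q' : E3) (j0 j1 k0 k1 e f : R) :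
      (p k 0 * j0 + q k 0 * j1) * k0 + p' k 0 * e + ((r k 0 * j0 + s k 0 * j1) * k1 + q' k 0 * f) =
      (j0 *: (k0 *: p) + j1 *: (k0 *: q) + e *: p' + (j0 *: (k1 *: r) + j1 *: (k1 *: s) + f *: q')) k 0.
    rewrite !mxE; move: (p k 0) (q k 0) (r k 0) (s k 0) (p' k 0) (q' k 0) => P Q P1 Q1 P2 Q2.
    by ring.
  exact: Rg.
have Dl (p q r s p' q' n : E3) (j0 j1 k0 k1 e f : R) : dot p' n = 0 -> dot q' n = 0 ->
    dot (j0 *: (k0 *: p) + j1 *: (k0 *: q) + e *: p' + (j0 *: (k1 *: r) + j1 *: (k1 *: s) + f *: q')) n =
    (j0 * dot p n + j1 * dot q n) * k0 + (j0 * dot r n + j1 * dot s n) * k1.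
  by move=> p0 q0; rewrite !dotDl !dotZl p0 q0; ring.
have QF (h J : 'M[R]_2) : (J^T *m h *m J) a b =
    (J 0 a * h 0 0 + J 1 a * h 1 0) * J 0 b + (J 0 a * h 0 1 + J 1 a * h 1 1) * J 1 b.
  have Tr c d : J^T c d = J d c by rewrite mxE.
  by rewrite mxE sum2 [(J^T *m h) a 0]mxE [(J^T *m h) a 1]mxE !sum2 !Tr.
rewrite QF (Dl _ _ _ _ _ _ _ _ _ _ _ _ _ (dot_normal x 0 (t u)) (dot_normal x 1 (t u))).
by congr ((_ * _ + _ * _) * _ + (_ * _ + _ * _) * _); rewrite second_formE.
Qed.

Lemma gauss_curvature_reparam u : W u -> 0 < \det (jac t u) ->
  gauss_curvature y u = gauss_curvature x (t u).
Proof.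
move=> Wu J0; rewrite /gauss_curvature (second_form_reparam Wu J0) (metric_reparam Wu).
move: (second_form x (t u)) (metric x (t u)) (jac t u) J0 => h g J J0.
rewrite !det_mulmx det_tr; move: (\det J) (\det h) (\det g) J0 => d a b d0.
have H c : d * c * d = d * d * c by ring.
by rewrite !H -mulf_div divff ?mul1r // mulf_neq0 // gt_eqF.
Qed.

Lemma mean_curvature_reparam u : W u -> 0 < \det (jac t u) -> \det (metric x (t u)) != 0 ->
  mean_curvature y u = mean_curvature x (t u).
Proof.
move=> Wu J0 g0; rewrite /mean_curvature (second_form_reparam Wu J0) (metric_reparam Wu).
have uJ : jac t u \in unitmx by rewrite unitmxE unitfE gt_eqF.
have uJT : (jac t u)^T \in unitmx by rewrite unitmx_tr.
have ug : metric x (t u) \in unitmx by rewrite unitmxE unitfE.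
move: (jac t u) (metric x (t u)) (second_form x (t u)) uJ uJT ug => J g h uJ uJT ug.
have -> : invmx (J^T *m g *m J) = invmx J *m invmx g *m invmx J^T.
  have uP : J^T *m g *m J \in unitmx by rewrite !unitmx_mul uJ uJT ug.
  rewrite -[RHS]mulmx1 -(mulmxV uP) -!mulmxA (mulKmx uJT) (mulKmx ug) (mulKmx uJ).
  by [].
rewrite -!mulmxA (mulKmx uJT) mxtrace_mulC -!mulmxA mulmxV // mulmx1.
by [].
Qed.

End Reparametrization.

Opaque smooth_on pder pderC del_z del_zb.
Opaque jac dX ddX metric second_form unit_normal.

(** * The Gauss equation and Brioschi's formula *)

Section MetricDerivatives.
Variable R : realType.
Local Notation plane := 'cV[R]_2.
Local Notation E3 := 'cV[R]_3.

Definition dvec (P : plane -> E3) c u : E3 := \col_k pder c (fun v => P v k 0) u.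

Lemma dvecE P c u k : dvec P c u k 0 = pder c (fun v => P v k 0) u.
Proof. by rewrite mxE. Qed.

Lemma col_eqP n (p q : 'cV[R]_n) : (forall k, p k 0 = q k 0) -> p = q.
Proof. by move=> H; apply/matrixP => k j; rewrite ord1. Qed.

Opaque dvec.

Lemma pder_dot (P Q : plane -> E3) c u :
  (forall k, differentiable (fun v => P v k 0) u) -> (forall k, differentiable (fun v => Q v k 0) u) ->
  pder c (fun v => dot (P v) (Q v)) u = dot (dvec P c u) (Q u) + dot (P u) (dvec Q c u).
Proof.
move=> dP dQ; have -> : (fun v => dot (P v) (Q v)) =
    (fun v => P v 0 0 * Q v 0 0 + P v 1 0 * Q v 1 0 + P v 2%:R 0 * Q v 2%:R 0).
  by apply/funext => v; rewrite dotE.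
have d k := differentiableMf (dP k) (dQ k).
rewrite (pderD c (differentiableD (d 0) (d 1)) (d 2%:R)) (pderD c (d 0) (d 1)).
rewrite (pderM c (dP 0) (dQ 0)) (pderM c (dP 1) (dQ 1)) (pderM c (dP 2%:R) (dQ 2%:R)).
rewrite !dotE !dvecE.
move: (pder c _ u) (pder c _ u) (pder c _ u) (pder c _ u) (pder c _ u) (pder c _ u) => *.
by ring.
Qed.

Opaque dot cross.

Section Immersion.
Variables (x : plane -> E3) (O : set plane).
Hypotheses (oO : open O) (sx : forall k, smooth_on O (fun v => x v k 0)).

Lemma smooth_dX a k : smooth_on O (fun v => dX x a v k 0).
Proof.
have -> : (fun v => dX x a v k 0) = pder a (fun v => x v k 0) by apply/funext => v; rewrite dXE.
exact: smooth_pder.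
Qed.

Lemma smooth_ddX a b k : smooth_on O (fun v => ddX x a b v k 0).
Proof.
have -> : (fun v => ddX x a b v k 0) = pder a (pder b (fun v => x v k 0)).
  by apply/funext => v; rewrite ddXE.
exact/smooth_pder/smooth_pder.
Qed.

Lemma dvec_dX a b u : dvec (dX x b) a u = ddX x a b u.
Proof.
apply: col_eqP => k; rewrite dvecE ddXE.
by congr (pder a _ u); apply/funext => v; rewrite dXE.
Qed.

Lemma ddXC a b u : O u -> ddX x a b u = ddX x b a u.
Proof.
move=> Ou; apply: col_eqP => k.
exact: (etrans (ddXE _ _ _ _ _) (etrans (pder_comm a b oO (sx k) Ou) (esym (ddXE _ _ _ _ _)))).
Qed.

Lemma dvec_ddX a b u : O u -> dvec (ddX x b b) a u = dvec (ddX x b a) b u.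
Proof.
move=> Ou; apply: col_eqP => k.
apply: (etrans (dvecE _ _ _ _)); apply: (etrans _ (esym (dvecE _ _ _ _))).
have F c d : (fun v => ddX x c d v k 0) = pder c (pder d (fun v => x v k 0)).
  by apply/funext => v; rewrite ddXE.
have E : {in O, pder a (pder b (fun v => x v k 0)) =1 pder b (pder a (fun v => x v k 0))}.
  by move=> v /set_mem Ov; exact: (pder_comm a b oO (sx k) Ov).
have H1 := pder_comm a b oO (smooth_pder b (sx k)) Ou.
have H2 := pder_ext_on b oO E (mem_set Ou).
exact: (etrans (congr1 (fun f => pder a f u) (F b b))
  (etrans H1 (etrans H2 (esym (congr1 (fun f => pder b f u) (F b a)))))).
Qed.

Local Notation g a b := (fun v => dot (dX x a v) (dX x b v)).

Let dd a u : O u -> forall k, differentiable (fun v => dX x a v k 0) u.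
Proof. by move=> Ou k; exact: smooth_diff oO (smooth_dX a k) Ou. Qed.

Lemma pder_metric c a b u : O u ->
  pder c (g a b) u = dot (ddX x c a u) (dX x b u) + dot (dX x a u) (ddX x c b u).
Proof. by move=> Ou; rewrite (pder_dot c (dd a Ou) (dd b Ou)) !dvec_dX. Qed.

Lemma smooth_dot (P Q : plane -> E3) : (forall k, smooth_on O (fun v => P v k 0)) ->
  (forall k, smooth_on O (fun v => Q v k 0)) -> smooth_on O (fun v => dot (P v) (Q v)).
Proof. by move=> sP sQ; apply: (smooth_sum oO) => k; exact: (smoothM oO (sP k) (sQ k)). Qed.

Lemma smooth_metric a b : smooth_on O (g a b).
Proof. exact: smooth_dot (smooth_dX a) (smooth_dX b). Qed.

(** This and the next lemma give the Christoffel symbols of the first kind: the tangential parts of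
    the second derivatives are determined by the metric. *)
Lemma ddX_dX_self c a u : O u -> dot (ddX x c a u) (dX x a u) = pder c (g a a) u / 2.
Proof.
move=> Ou; rewrite (pder_metric _ _ _ Ou) [X in _ + X]dotC.
by move: (dot _ _) => r; field.
Qed.

Lemma ddX_dX_other a b u : O u -> dot (ddX x a a u) (dX x b u) = pder a (g a b) u - pder b (g a a) u / 2.
Proof.
move=> Ou; rewrite (pder_metric _ _ _ Ou) -(ddX_dX_self _ _ Ou) (ddXC b a Ou) [dot (dX x a u) _]dotC.
by rewrite addrK.
Qed.

(** The core of the Theorema Egregium. The pairing of [x_aa] with [x_b] is differentiated along [b],
    that of [x_ab] with [x_b] along [a]; the third derivatives coincide and cancel in the
    difference. *)
Lemma ddX_dot a b u : O u -> dot (ddX x a a u) (ddX x b b u) - dot (ddX x a b u) (ddX x a b u) =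
  pder b (pder a (g a b)) u - pder b (pder b (g a a)) u / 2 - pder a (pder a (g b b)) u / 2.
Proof.
move=> Ou; have s1 := smooth_metric a b; have s2 := smooth_metric a a; have s3 := smooth_metric b b.
have E1 : {in O, (fun v => dot (ddX x a a v) (dX x b v)) =1 (fun v => pder a (g a b) v + pder b (g a a) v * (- 2^-1))}.
  by move=> v /set_mem Ov; rewrite (ddX_dX_other _ _ Ov) mulrN.
have E2 : {in O, (fun v => dot (ddX x a b v) (dX x b v)) =1 (fun v => pder a (g b b) v * 2^-1)}.
  by move=> v /set_mem Ov; rewrite (ddX_dX_self _ _ Ov).
have sd c d e : differentiable (pder c (g d e)) u.
  exact: smooth_diff oO (smooth_pder c (smooth_metric d e)) Ou.
have H1 := pder_ext_on b oO E1 (mem_set Ou).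
have H2 := pder_ext_on a oO E2 (mem_set Ou).
have dc (r : R) : differentiable (fun=> r : R) u by exact: differentiable_cst.
have d1 := differentiableMf (sd b a a) (dc (- 2^-1)).
rewrite (pderD b (sd a a b) d1) (pderM b (sd b a a) (dc _)) pder_cst mulr0 addr0 in H1.
rewrite (pderM a (sd a b b) (dc _)) pder_cst mulr0 addr0 in H2.
have sdd c d : forall k, differentiable (fun v => ddX x c d v k 0) u.
  by move=> k; exact: smooth_diff oO (smooth_ddX c d k) Ou.
rewrite (pder_dot b (sdd a a) (dd b Ou)) dvec_dX in H1.
rewrite (pder_dot a (sdd a b) (dd b Ou)) dvec_dX -(dvec_ddX b a Ou) in H2.
have Rg (t r s p1 p2 p3 : R) : t + r = p1 + p2 * - 2^-1 -> t + s = p3 / 2 -> r - s = p1 - p2 / 2 - p3 / 2.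
  move=> h1 h2; have -> : r - s = (t + r) - (t + s) by ring.
  by rewrite h1 h2 mulrN.
exact: (Rg _ _ _ _ _ _ H1 H2).
Qed.

(** The Gram determinant of [p, q, r] against [p, q, s], expanded so as to isolate [dot r s]. *)
Lemma triple_mul (p q r s : E3) : dot r (cross p q) * dot s (cross p q) =
  (dot p p * dot q q - dot p q * dot p q) * dot r s
  - (dot q q * (dot r p * dot s p) - dot p q * (dot r p * dot s q + dot r q * dot s p)
     + dot p p * (dot r q * dot s q)).
Proof.
rewrite !dotE; have [-> -> ->] := crossE p q.
move: (p 0 0) (p 1 0) (p 2%:R 0) (q 0 0) (q 1 0) (q 2%:R 0) => p0 p1 p2 q0 q1 q2.
move: (r 0 0) (r 1 0) (r 2%:R 0) (s 0 0) (s 1 0) (s 2%:R 0) => r0 r1 r2 s0 s1 s2.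
by ring.
Qed.

(* The numerator of Brioschi's formula for the Gauss curvature of [f di^2 + 2 g di dj + h dj^2]. *)
Definition brioschi_num i j (f g h : plane -> R) u : R :=
  (f u * h u - g u * g u) * (pder j (pder i g) u - pder j (pder j f) u / 2 - pder i (pder i h) u / 2)
   - (h u * (pder i f u / 2 * (pder j g u - pder i h u / 2))
      - g u * (pder i f u / 2 * (pder j h u / 2)
               + (pder i g u - pder j f u / 2) * (pder j g u - pder i h u / 2))
      + f u * ((pder i g u - pder j f u / 2) * (pder j h u / 2)))
   + (h u * (pder j f u / 2 * (pder j f u / 2)) - g u * (pder j f u / 2 * (pder i h u / 2) + pder i h u / 2 * (pder j f u / 2))
      + f u * (pder i h u / 2 * (pder i h u / 2))).

(** Each product of triple products is expanded by [triple_mul]. The tangential pairings are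
    Christoffel symbols, and the pairings of second derivatives occur only in the difference given
    by [ddX_dot]. *)
Lemma gauss_num i j u (n := cross (dX x i u) (dX x j u)) : O u ->
  dot (ddX x i i u) n * dot (ddX x j j u) n - dot (ddX x i j u) n * dot (ddX x i j u) n =
  brioschi_num i j (g i i) (g i j) (g j j) u.
Proof.
move=> Ou; have e10 := ddX_dX_other j i Ou.
have gC : (fun v => dot (dX x j v) (dX x i v)) = g i j by apply/funext => v; rewrite dotC.
rewrite gC in e10.
have f0 := ddX_dX_self j i Ou; rewrite (ddXC j i Ou) in f0.
have Rg (F G H rs ss a1 a2 b1 b2 c1 c2 X2 X3 X4 fi fj gi gj hi hj T1 T2 : R) :
    T1 = (F * H - G * G) * rs - (H * (a1 * b1) - G * (a1 * b2 + a2 * b1) + F * (a2 * b2)) ->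
    T2 = (F * H - G * G) * ss - (H * (c1 * c1) - G * (c1 * c2 + c2 * c1) + F * (c2 * c2)) ->
    rs - ss = X2 - X3 / 2 - X4 / 2 ->
    a1 = fi / 2 -> a2 = gi - fj / 2 -> b1 = gj - hi / 2 -> b2 = hj / 2 -> c1 = fj / 2 -> c2 = hi / 2 ->
    T1 - T2 = (F * H - G * G) * (X2 - X3 / 2 - X4 / 2)
     - (H * (fi / 2 * (gj - hi / 2)) - G * (fi / 2 * (hj / 2) + (gi - fj / 2) * (gj - hi / 2))
        + F * ((gi - fj / 2) * (hj / 2)))
     + (H * (fj / 2 * (fj / 2)) - G * (fj / 2 * (hi / 2) + hi / 2 * (fj / 2)) + F * (hi / 2 * (hi / 2))).
  by move=> -> -> <- <- <- <- <- <- <-; ring.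
exact: (Rg _ _ _ _ _ _ _ _ _ _ _ _ _ _ _ _ _ _ _ _ _ _
  (triple_mul (dX x i u) (dX x j u) (ddX x i i u) (ddX x j j u))
  (triple_mul (dX x i u) (dX x j u) (ddX x i j u) (ddX x i j u))
  (ddX_dot i j Ou) (ddX_dX_self i i Ou) (ddX_dX_other i j Ou) e10
  (ddX_dX_self j j Ou) f0 (ddX_dX_self i j Ou)).
Qed.

End Immersion.

Definition brioschi (f g h : plane -> R) u : R :=
  brioschi_num 0 1 f g h u / ((f u * h u - g u * g u) * (f u * h u - g u * g u)).

Lemma det_metric (x : plane -> E3) u : \det (metric x u) =
  dot (dX x 0 u) (dX x 0 u) * dot (dX x 1 u) (dX x 1 u) - dot (dX x 0 u) (dX x 1 u) * dot (dX x 0 u) (dX x 1 u).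
Proof.
have H := f_equal4 (fun p q r s : R => p * q - r * s) (metricE x u 0 0) (metricE x u 1 1)
  (metricE x u 0 1) (metricE x u 1 0).
by rewrite det2; apply: (etrans H); rewrite (dotC (dX x 1 u) (dX x 0 u)).
Qed.

Lemma gauss_brioschi (x : plane -> E3) (O : set plane) u : open O ->
  (forall k, smooth_on O (fun v => x v k 0)) -> O u -> 0 < \det (metric x u) ->
  gauss_curvature x u = brioschi (fun v => metric x v 0 0) (fun v => metric x v 0 1) (fun v => metric x v 1 1) u.
Proof.
move=> oO sx Ou D0.
have M a b : (fun v => metric x v a b) = (fun v => dot (dX x a v) (dX x b v)).
  by apply/funext => v; rewrite metricE.
have H := gauss_num oO sx 0 1 Ou.
have DD := det_metric x u.
have nn := Lagrange (dX x 0 u) (dX x 1 u); rewrite expr2 -DD in nn.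
have NN := unit_normal_cross x u; rewrite /= nn in NN.
have B : brioschi (fun v => metric x v 0 0) (fun v => metric x v 0 1) (fun v => metric x v 1 1) u =
    brioschi_num 0 1 (fun v => dot (dX x 0 v) (dX x 0 v)) (fun v => dot (dX x 0 v) (dX x 1 v))
      (fun v => dot (dX x 1 v) (dX x 1 v)) u / (\det (metric x u) * \det (metric x u)).
  rewrite (M 0 0) (M 0 1) (M 1 1) /brioschi; congr (_ / _).
  by rewrite DD.
rewrite B -H /gauss_curvature.
have sE a b : second_form x u a b = (Num.sqrt (\det (metric x u)))^-1 * dot (ddX x a b u) (cross (dX x 0 u) (dX x 1 u)).
  by rewrite second_formE NN dotC dotZl dotC.
have dE : \det (second_form x u) = ((Num.sqrt (\det (metric x u)))^-1) ^+ 2 *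
  (dot (ddX x 0 0 u) (cross (dX x 0 u) (dX x 1 u)) * dot (ddX x 1 1 u) (cross (dX x 0 u) (dX x 1 u))
  - dot (ddX x 0 1 u) (cross (dX x 0 u) (dX x 1 u)) * dot (ddX x 0 1 u) (cross (dX x 0 u) (dX x 1 u))).
  have Rg (k a b c d : R) : (k * a) * (k * b) - (k * c) * (k * d) = k ^+ 2 * (a * b - c * d) by ring.
  rewrite det2; apply: (etrans (f_equal4 (fun p q r s : R => p * q - r * s) (sE 0 0) (sE 1 1) (sE 0 1) (sE 1 0))).
  by rewrite (ddXC oO sx 1 0 Ou); exact: Rg.
rewrite dE exprVn sqr_sqrtr; last exact: ltW.
by rewrite invfM mulrAC mulrC mulrA.
Qed.

(* The mean curvature is half the trace of the second form, and the derivatives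
   of the conformality relations make the Laplacian of [x] normal. *)
Lemma iso_min_of_conformal (x : plane -> E3) (O : set plane) : open O ->
  (forall k, smooth_on O (fun v => x v k 0)) ->
  (forall u, O u -> metric x u 0 0 = metric x u 1 1 /\ metric x u 0 1 = 0) ->
  (forall u, O u -> \det (metric x u) != 0) ->
  (forall u, O u -> mean_curvature x u = 0) -> iso_min x O.
Proof.
move=> oO sx conf det0 H0.
have c1 u : O u -> dot (dX x 1 u) (dX x 1 u) = dot (dX x 0 u) (dX x 0 u).
  move=> Ou; have [h _] := conf u Ou.
  exact: (etrans (esym (metricE x u 1 1)) (etrans (esym h) (metricE x u 0 0))).
have c2 u : O u -> dot (dX x 0 u) (dX x 1 u) = 0.
  move=> Ou; have [_ h] := conf u Ou; exact: (etrans (esym (metricE x u 0 1)) h).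
have pos u : O u -> 0 < dot (dX x 0 u) (dX x 0 u).
  move=> Ou; have := det0 u Ou; rewrite det_metric c1 // c2 // mul0r subr0.
  rewrite mulf_eq0 orbb lt_def => ->; rewrite dotE -!expr2.
  by rewrite !addr_ge0 ?sqr_ge0.
split=> // u k Ou.
have dm u' : O u' -> metric x u' = dot (dX x 0 u') (dX x 0 u') *: 1%:M.
  move=> Ou'; apply/matrixP => a b; rewrite metricE [RHS]mxE [1%:M a b]mxE.
  elim/ord2P: a; elim/ord2P: b; rewrite /= ?mulr1 ?mulr0.
  - by [].
  - exact: c2.
  - by rewrite dotC c2.
  - exact: c1.
pose L := ddX x 0 0 u + ddX x 1 1 u.
have En : dot (dX x 0 u) (dX x 0 u) != 0 by rewrite gt_eqF ?pos.
have LN : dot L (unit_normal x u) = 0.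
  have := H0 u Ou; rewrite /mean_curvature dm // scalemx1 invmx_scalar mul_scalar_mx mxtraceZ.
  move/eqP; rewrite mulf_eq0 invr_eq0 pnatr_eq0 orbF mulf_eq0 invr_eq0 (negbTE En) /=.
  rewrite /mxtrace sum2 => /eqP T.
  exact: (etrans (dotDl _ _ _) (etrans (esym (f_equal2 +%R (second_formE x u 0 0) (second_formE x u 1 1))) T)).
have z1 c : pder c (fun v => dot (dX x 0 v) (dX x 1 v)) u = 0.
  have E : {in O, (fun v => dot (dX x 0 v) (dX x 1 v)) =1 (fun=> 0)} by move=> v /set_mem; exact: c2.
  by rewrite (pder_ext_on c oO E (mem_set Ou)) pder_cst.
have z2 c : pder c (fun v => dot (dX x 1 v) (dX x 1 v)) u = pder c (fun v => dot (dX x 0 v) (dX x 0 v)) u.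
  have E : {in O, (fun v => dot (dX x 1 v) (dX x 1 v)) =1 (fun v => dot (dX x 0 v) (dX x 0 v))}.
    by move=> v /set_mem; exact: c1.
  exact: (pder_ext_on c oO E (mem_set Ou)).
have g10 : (fun v => dot (dX x 1 v) (dX x 0 v)) = (fun v => dot (dX x 0 v) (dX x 1 v)).
  by apply/funext => v; rewrite dotC.
have e10 := ddX_dX_other oO sx 1 0 Ou; rewrite g10 z1 z2 sub0r in e10.
have e01 := ddX_dX_other oO sx 0 1 Ou; rewrite z1 sub0r in e01.
have e00 := ddX_dX_self oO sx 0 0 Ou; have e11 := ddX_dX_self oO sx 1 1 Ou; rewrite z2 in e11.
have L0 : dot L (dX x 0 u) = 0 by exact: (etrans (dotDl _ _ _) (etrans (f_equal2 +%R e00 e10) (subrr _))).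
have L1 : dot L (dX x 1 u) = 0 by exact: (etrans (dotDl _ _ _) (etrans (f_equal2 +%R e01 e11) (addNr _))).
have NN : dot (unit_normal x u) (unit_normal x u) = 1.
  rewrite unit_normal_cross /= dotZl dotC dotZl Lagrange c1 // c2 // expr0n subr0.
  rewrite -expr2 sqrtr_sqr gtr0_norm ?pos //.
  by move: En; move: (dot _ _) => r r0; field.
have D j := frame_delta (pos u Ou) (erefl _) (c1 u Ou) (c2 u Ou) NN
  (etrans (dotC _ _) (dot_normal x 0 u)) (etrans (dotC _ _) (dot_normal x 1 u)) k j.
have LE : L k 0 = (dX x 0 u k 0 * dot L (dX x 0 u) + dX x 1 u k 0 * dot L (dX x 1 u)) / dot (dX x 0 u) (dX x 0 u)
   + unit_normal x u k 0 * dot L (unit_normal x u).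
  transitivity (\sum_(j < 3) L j 0 * (k == j)%:R).
    rewrite (bigD1 k) //= eqxx mulr1 big1 ?addr0 // => j jk.
    by rewrite eq_sym (negbTE jk) mulr0.
  rewrite sum3 -!D [dot L _]dotE [dot L (dX x 1 u)]dotE [dot L (unit_normal x u)]dotE.
  move: En; move: (dot _ _) => e e0.
  move: (L 0 0) (L 1 0) (L 2%:R 0) (dX x 0 u) (dX x 1 u) (unit_normal x u) => l0 l1 l2 X Y N.
  by field.
rewrite L0 L1 LN !mulr0 !addr0 mul0r in LE.
have AE : L k 0 = ddX x 0 0 u k 0 + ddX x 1 1 u k 0 by rewrite mxE.
exact: (etrans (esym (f_equal2 +%R (ddXE x 0 0 k u) (ddXE x 1 1 k u))) (etrans (esym AE) LE)).
Qed.

End MetricDerivatives.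

(** * The entropy differentials in arbitrary parameters *)

Opaque smooth_on pder pderC del_z del_zb.
Opaque jac dX ddX metric second_form unit_normal dot cross dvec.

Section GeneralParameters.
Variable R : realType.
Local Notation plane := 'cV[R]_2.
Local Notation C := R[i].
Local Notation E3 := 'cV[R]_3.
Local Notation i := (0 +i* 1 : C)%C.

(* [dz = z_x (dx + tau dy)] for an isothermal coordinate [z] of [f dx^2 + 2 g dx dy + h dy^2]. *)
Definition beltrami (f g h : plane -> R) u : C :=
  (((g u)%:C)%C + i * ((Num.sqrt (f u * h u - g u * g u))%:C)%C) / ((f u)%:C)%C.

(* [z_x del_z] in the parameters [x, y]. *)
Definition dtau (tau F : plane -> C) u : C :=
  (pderC 1 F u - (tau u)^*%C * pderC 0 F u) / (tau u - (tau u)^*%C).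

(** [z_x] times [K_z / (2 K)]. *)
Definition curv_coef (tau : plane -> C) (K : plane -> R) u : C :=
  dtau tau (real_fun K) u / (2 * real_fun K u).

(** [z_x gamma] plus the logarithmic [dtau]-derivative of [z_x]. The logarithmic derivative of
    [f = E z_x conj(z_x)] also contains that of [conj(z_x)], which the last term removes. *)
Definition conn_gen (tau : plane -> C) (f K : plane -> R) u : C :=
  curv_coef tau K u + dtau tau (real_fun f) u / real_fun f u
  - pderC 0 (fun v => (tau v)^*%C) u / (tau u - (tau u)^*%C).

(** [z_x^l P_l] with [l = n + 2]: the derivatives of the powers of [z_x] are absorbed by the second
    summand of [conn_gen], so the recursion has the same form as in an isothermal parameter. *)
Fixpoint ent_gen (tau : plane -> C) (f K : plane -> R) (n : nat) : plane -> C := fun u =>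
  if n is m.+1 then dtau tau (ent_gen tau f K m) u - m.+2%:R * conn_gen tau f K u * ent_gen tau f K m u
  else dtau tau (curv_coef tau K) u - conn_gen tau f K u * curv_coef tau K u - curv_coef tau K u ^+ 2 / 2.

Definition has_dtau tau F u (d : C) := diffC F u /\ dtau tau F u = d.

Lemma has_dtau_cst tau c u : has_dtau tau (fun=> c) u 0.
Proof. by split; [exact: diffC_cst | rewrite /dtau !pderC_cst mulr0 subr0 mul0r]. Qed.

Lemma has_dtauM tau F G u a b : has_dtau tau F u a -> has_dtau tau G u b ->
  has_dtau tau (fun v => F v * G v) u (a * G u + F u * b).
Proof.
move=> [dF <-] [dG <-]; split; first exact: diffCM.
rewrite /dtau (pderCM 0 dF dG) (pderCM 1 dF dG).
move: (pderC 0 F u) (pderC 1 F u) (pderC 0 G u) (pderC 1 G u) ((tau u - _)^-1) => *.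
by ring.
Qed.

Lemma has_dtauX tau F u a n : has_dtau tau F u a ->
  has_dtau tau (fun v => F v ^+ n) u (n%:R * F u ^+ n.-1 * a).
Proof.
move=> H; elim: n => [|n [dn En]].
  by rewrite !mul0r; exact: has_dtau_cst.
have [d2 E2] := has_dtauM H (conj dn En).
have FE : (fun v => F v ^+ n.+1) = (fun v => F v * F v ^+ n) by apply/funext => v; rewrite exprS.
rewrite FE; split; rewrite // E2; case: n {dn En d2 E2 FE} => [|n] /=; first by rewrite !mul0r mulr0 expr0; ring.
by rewrite exprS -[n.+2%:R]natr1; move: (F u) (F u ^+ n) => p q; ring.
Qed.

Lemma dtau_ext O tau F G u : open O -> {in O, F =1 G} -> O u -> dtau tau F u = dtau tau G u.
Proof.
move=> oO FG Ou; have uO := mem_set Ou.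
exact: (f_equal2 (fun p q : C => (p - (tau u)^*%C * q) / (tau u - (tau u)^*%C))
  (pderC_ext_on 1 oO FG uO) (pderC_ext_on 0 oO FG uO)).
Qed.

Variables (x : plane -> E3) (t : plane -> plane) (O W : set plane).
Hypotheses (oO : open O) (oW : open W) (mx : iso_min x O).
Hypothesis st : forall b, smooth_on W (fun v => t v b 0).
Hypothesis tW : forall u, W u -> O (t u).
Hypothesis Jpos : forall u, W u -> 0 < \det (jac t u).
Local Notation y := (x \o t).
Local Notation f := (fun v => metric y v 0 0).
Local Notation g := (fun v => metric y v 0 1).
Local Notation h := (fun v => metric y v 1 1).
Local Notation tau := (beltrami f g h).
Local Notation K := (gauss_curvature y).
Local Notation E := (cfac x).
Local Notation Ec := (Ec x).
Local Notation beta := (beta x).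

Let T : plane -> C := fun v => to_C (t v).
Let Tx := pderC 0 T.
Let Ty := pderC 1 T.

Let sT : smoothC W T. Proof. by split; exact: st. Qed.
Let sTx : smoothC W Tx. Proof. exact: (smoothC_pder 0 sT). Qed.
Let sTy : smoothC W Ty. Proof. exact: (smoothC_pder 1 sT). Qed.

Let pT a u : pderC a T u = ((pder a (fun v => t v 0 0) u)%:C)%C + i * ((pder a (fun v => t v 1 0) u)%:C)%C.
Proof.
have Rg (p q : R) : (p +i* q)%C = (p%:C)%C + i * (q%:C)%C.
  by apply: complex_eqP; rewrite !cReImE /=; ring.
exact: Rg.
Qed.

Let metE a b u : W u -> metric y u a b = E (t u) * (jac t u 0 a * jac t u 0 b + jac t u 1 a * jac t u 1 b).
Proof.
move=> Wu; rewrite (metric_reparam oO oW (iso_smooth mx) st tW Wu) (metric_iso mx (tW Wu)).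
rewrite -scalemxAr mulmx1 -scalemxAl [LHS]mxE [X in _ * X = _]mxE sum2.
have Tr c d : (jac t u)^T c d = jac t u d c by rewrite mxE.
by rewrite !Tr.
Qed.

Let detJ u : \det (jac t u) = pder 0 (fun v => t v 0 0) u * pder 1 (fun v => t v 1 0) u
  - pder 1 (fun v => t v 0 0) u * pder 0 (fun v => t v 1 0) u.
Proof. by rewrite det2 !jacE. Qed.

Lemma det_metric_reparam u : W u -> metric y u 0 0 * metric y u 1 1 - metric y u 0 1 * metric y u 0 1 =
  (E (t u) * \det (jac t u)) ^+ 2.
Proof.
move=> Wu; apply: (etrans (f_equal3 (fun p q r : R => p * q - r * r) (metE 0 0 Wu) (metE 1 1 Wu) (metE 0 1 Wu))).
rewrite det2; move: (jac t u) (E (t u)) => J e.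
by move: (J 0 0) (J 0 1) (J 1 0) (J 1 1) => *; ring.
Qed.

Let Epos u : W u -> 0 < E (t u). Proof. by move=> Wu; exact: (iso_pos mx (tW Wu)). Qed.

Let sqrtE u : W u -> Num.sqrt (metric y u 0 0 * metric y u 1 1 - metric y u 0 1 * metric y u 0 1) =
  E (t u) * \det (jac t u).
Proof.
by move=> Wu; rewrite det_metric_reparam // sqrtr_sqr gtr0_norm // mulr_gt0 ?Epos ?Jpos.
Qed.

Let fE u : W u -> real_fun f u = Ec (t u) * (Tx u * (Tx u)^*%C).
Proof.
move=> Wu; rewrite /real_fun (metE 0 0 Wu) /Tx pT !jacE /Ec.
move: (pder 0 _ u) (pder 0 _ u) (E (t u)) => p q e.
by apply: complex_eqP; rewrite !cReImE /= ; ring.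
Qed.

Let Tx0 u : W u -> Tx u != 0.
Proof.
move=> Wu; apply/eqP => H; have J0 := Jpos Wu; rewrite detJ in J0; rewrite /Tx pT in H.
have Rg (p q r s : R) : 0 < p * s - r * q -> ((p%:C)%C + i * (q%:C)%C : C) <> 0.
  move=> D H0; have := congr1 (@complex.Re R) H0; have := congr1 (@complex.Im R) H0.
  rewrite !cReImE /= !mul0r !mul1r !add0r subr0 ?addr0 => q0 p0.
  by rewrite p0 q0 mul0r mulr0 subr0 ltxx in D.
exact: (Rg _ _ _ _ J0 H).
Qed.

Let conj0 (z : C) : z != 0 -> z^*%C != 0. Proof. by rewrite fmorph_eq0. Qed.

Lemma metric00_neq0 u : W u -> real_fun f u != 0.
Proof.
move=> Wu; rewrite fE // !mulf_neq0 ?conj0 ?Tx0 //.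
by rewrite /Ec eq_complex /= eqxx andbT gt_eqF // Epos.
Qed.

Let bE u : W u -> tau u * real_fun f u = ((metric y u 0 1)%:C)%C + i * ((E (t u) * \det (jac t u))%:C)%C.
Proof.
move=> Wu; have n0 := metric00_neq0 Wu; rewrite -(sqrtE Wu); exact: divfK.
Qed.

(** The metric determines the quotient [z_y / z_x]; the positive Jacobian fixes the sign of the
    square root in [beltrami]. *)
Let tauE u : W u -> tau u * Tx u = Ty u.
Proof.
move=> Wu; have B := bE Wu; have F := fE Wu.
have Rc (ta fu T1 T2 N : C) : fu != 0 -> ta * fu = N -> N * T1 = fu * T2 -> ta * T1 = T2.
  by move=> n0 <- H; apply: (mulfI n0); rewrite -H; ring.
apply: (Rc _ _ _ _ _ (metric00_neq0 Wu) B); rewrite F {B F}.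
rewrite (metE 0 1 Wu) detJ /Tx /Ty !pT !jacE /Ec.
have Rg (p q r s e : R) : (((e * (p * r + q * s))%:C)%C + i * ((e * (p * s - r * q))%:C)%C) * ((p%:C)%C + i * (q%:C)%C)
   = (e%:C)%C * (((p%:C)%C + i * (q%:C)%C) * ((p%:C)%C + i * (q%:C)%C)^*%C) * ((r%:C)%C + i * (s%:C)%C).
  by apply: complex_eqP; rewrite !cReImE /=; ring.
exact: Rg.
Qed.

Lemma beltrami_nonreal u : W u -> tau u - (tau u)^*%C != 0.
Proof.
move=> Wu; have n0 := metric00_neq0 Wu; apply/eqP => H.
have rc (r : R) : (((r%:C)%C : C)^*)%C = (r%:C)%C by exact: conjc_real.
have : (tau u - (tau u)^*%C) * real_fun f u = 2 * i * (((E (t u) * \det (jac t u))%:C)%C).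
  have bc := congr1 (fun z : C => z^*%C) (bE Wu).
  rewrite conjM conjD conj_iM !rc in bc; rewrite mulrBl bE //.
  have -> : (tau u)^*%C * real_fun f u = ((metric y u 0 1)%:C)%C - i * ((E (t u) * \det (jac t u))%:C)%C.
    by rewrite -bc.
  by move: ((metric y u 0 1)%:C)%C ((E (t u) * \det (jac t u))%:C)%C => p q; ring.
rewrite H mul0r => /esym/eqP; rewrite mulf_eq0 mulf_eq0 pnatr_eq0 (negbTE (@i_neq0 R)) /=.
by rewrite eq_complex /= eqxx andbT mulf_eq0 !gt_eqF ?Epos ?Jpos.
Qed.

(** [dtau] combines the two partial derivatives in such a way that the [del_zb] part of the chain
    rule cancels. *)
Let dtF (F : plane -> C) u : W u -> diffC F (t u) -> has_dtau tau (F \o t) u (del_z F (t u) * Tx u).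
Proof.
move=> Wu dF; have dt b : differentiable (fun v => t v b 0) u by exact: smooth_diff oW (st b) Wu.
split; first exact: diffC_comp.
have H a : pderC a (F \o t) u = del_z F (t u) * pderC a T u + del_zb F (t u) * (pderC a T u)^*%C.
  rewrite (pderC_comp a dF dt) pderC0E pderC1E pT.
  have rc (r : R) : (((r%:C)%C : C)^*)%C = (r%:C)%C by exact: conjc_real.
  by rewrite !conjE !rc; move: (del_z F (t u)) (del_zb F (t u)) => p q; ring.
rewrite /dtau !H -/(Tx u) -/(Ty u) -(tauE Wu) conjM.
have := beltrami_nonreal Wu; move: (tau u) (Tx u) (del_z F (t u)) (del_zb F (t u)) => a b p q a0.
by field.
Qed.

Let dTx u : W u -> diffC Tx u. Proof. by move=> Wu; exact: smoothC_diff oW sTx Wu. Qed.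

Let stau : smoothC W tau.
Proof.
apply: (smoothC_ext oW (f := fun v => Ty v / Tx v)).
  by move=> v /set_mem Wv; rewrite -tauE // mulfK // Tx0.
exact: (smoothCM oW sTy (smoothCV oW Tx0 sTx)).
Qed.

(** The mixed derivatives of [T] agree; inserting [Ty = tau Tx] expresses the derivative of the
    conjugate of [Tx] by that conjugate and [tau]. *)
Let dconjTx u : W u -> dtau tau (fun v => (Tx v)^*%C) u =
  pderC 0 (fun v => (tau v)^*%C) u / (tau u - (tau u)^*%C) * (Tx u)^*%C.
Proof.
move=> Wu; have dt := diffC_conj (smoothC_diff oW stau Wu).
have dx := diffC_conj (dTx Wu).
have H : pderC 1 (fun v => (Tx v)^*%C) u =
    pderC 0 (fun v => (tau v)^*%C) u * (Tx u)^*%C + (tau u)^*%C * pderC 0 (fun v => (Tx v)^*%C) u.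
  rewrite -(pderCM 0 dt dx) (pderC_conj 1 (dTx Wu)).
  have EQ : {in W, (fun v => (Ty v)^*%C) =1 (fun v => (tau v)^*%C * (Tx v)^*%C)}.
    by move=> v /set_mem Wv; rewrite -conjM tauE.
  rewrite -(pderC_ext_on 0 oW EQ (mem_set Wu)) (pderC_conj 0 (smoothC_diff oW sTy Wu)).
  by rewrite (pderC_comm 1 0 oW sT Wu).
by rewrite /dtau H addrK mulrAC.
Qed.

Let W' := [set u | W u /\ beta (t u) != 0].

Let oW' : open W'.
Proof.
have sb : smoothC W (beta \o t) by exact: (smoothC_comp oW oO (hol_beta oO mx).1 tW st).
exact: (open_neq0 oW sb).
Qed.

(** Half the logarithmic [del_z]-derivative of the curvature, which is [-4] times the squared
    modulus of [beta] divided by the squared conformal factor. *)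
Let m v : C := del_z beta v / (2 * beta v) - del_z Ec v / Ec v.

Let Ec0 v : O v -> Ec v != 0. Proof. exact: Ec_neq0. Qed.

Let KE u : W u -> K u = gauss_curvature x (t u).
Proof. by move=> Wu; exact: (gauss_curvature_reparam oO oW (iso_smooth mx) st tW Wu (Jpos Wu)). Qed.

Let mcE u : W' u -> curv_coef tau K u = m (t u) * Tx u.
Proof.
move=> [Wu b0]; have Ou := tW Wu; have hb := hol_beta oO mx.
pose Kz v : C := (- 4%:R) * ((beta v * (beta v)^*%C) * (Ec v)^-1 ^+ 2).
have K1 v : O v -> real_fun (gauss_curvature x) v = Kz v.
  move=> Ov; rewrite /real_fun (gauss_curvatureE oO mx Ov) /Kz.
  have nb : beta v * (beta v)^*%C = ((normsq (beta v))%:C)%C.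
    by case: (beta v) => p q; apply: complex_eqP; rewrite /normsq !cReImE /=; ring.
  have Rg (n e : R) : ((- (4%:R * n / e ^+ 2))%:C)%C = (- 4%:R) * ((n%:C)%C * ((e%:C)%C)^-1 ^+ 2) :> C.
    have -> : (- 4%:R : C) = ((- 4%:R)%:C)%C by rewrite rmorphN rmorph_nat.
    rewrite -(fmorphV (real_complex R)) -(rmorphXn (real_complex R)) -!(rmorphM (real_complex R)) /=.
    by congr ((_)%:C)%C; rewrite exprVn mulNr mulrA.
  by rewrite nb /Ec Rg.
have K2 : {in W, real_fun K =1 (Kz \o t)}.
  by move=> v /set_mem Wv; rewrite /real_fun KE //; exact: K1 (tW Wv).
have db := has_dz_hol oO hb Ou.
have dbc : has_dz (fun v => (beta v)^*%C) (t u) 0.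
  split; first exact: diffC_conj db.1.
  by rewrite (del_z_conj db.1) hb.2 // conjc0.
have dE := has_dz_self (smoothC_diff oO (smooth_Ec oO mx) Ou).
have dV := has_dzV dE (Ec0 Ou).
have D : has_dz Kz (t u) (2 * m (t u) * Kz (t u)).
  apply: has_dz_eq (has_dzM (has_dz_cst (- 4%:R) (t u)) (has_dzM (has_dzM db dbc) (has_dzM dV dV))) _.
  rewrite /m /Kz; move: b0 (Ec0 Ou); move: (beta (t u)) (del_z beta (t u)) ((beta (t u))^*%C) (Ec (t u)) (del_z Ec (t u)).
  by move=> b b1 bc e e1 b0 e0; field; rewrite b0 e0.
have [_ D2] := dtF Wu D.1; rewrite D.2 in D2.
rewrite /curv_coef (dtau_ext tau oW K2 Wu) D2 (K2 u (mem_set Wu)) /comp.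
have Kn : Kz (t u) != 0.
  have n4 : - 4%:R != 0 :> C by rewrite oppr_eq0 pnatr_eq0.
  exact: (mulf_neq0 n4 (mulf_neq0 (mulf_neq0 b0 (conj0 b0)) (expf_neq0 2 (invr_neq0 (Ec0 Ou))))).
by move: Kn; move: (Kz (t u)) (m (t u)) (Tx u) => k a b k0; field.
Qed.

Local Notation w := (wdot x).
Local Notation s := (sdot x).

Let gamE v : O v -> beta v != 0 -> ent_conn w v = del_z beta v / (2 * beta v).
Proof.
move=> Ov b0; rewrite /ent_conn (del_z_wdot oO mx Ov) (wdotE oO mx Ov).
by move: b0; move: (beta v) (del_z beta v) => b b1 b0; field.
Qed.

Let connE u : W' u -> conn_gen tau f K u = ent_conn w (t u) * Tx u + dtau tau Tx u / Tx u.
Proof.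
move=> Hu; have [Wu b0] := Hu; rewrite /conn_gen mcE // (gamE (tW Wu) b0).
have dE := smoothC_diff oO (smooth_Ec oO mx) (tW Wu).
have d1 := dtF Wu dE.
have d2 : has_dtau tau Tx u (dtau tau Tx u) by split=> //; exact: dTx.
have d3 : has_dtau tau (fun v => (Tx v)^*%C) u _ := conj (diffC_conj (dTx Wu)) (dconjTx Wu).
have FE : {in W, real_fun f =1 (fun v => (Ec \o t) v * (Tx v * (Tx v)^*%C))}.
  by move=> v /set_mem; exact: fE.
rewrite (dtau_ext tau oW FE Wu) (FE u (mem_set Wu)) (has_dtauM d1 (has_dtauM d2 d3)).2 /comp /m.
move: (Ec0 (tW Wu)) (Tx0 Wu) (conj0 (Tx0 Wu)) b0.
move: (Ec (t u)) (del_z Ec (t u)) (Tx u) ((Tx u)^*%C) (beta (t u)) (del_z beta (t u)) (dtau tau Tx u).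
move: (pderC 0 _ u / _) => q e e1 T1 Tc b b1 d e0 t0 c0 b0.
by field; rewrite b0 t0 c0 e0.
Qed.

(** Once [sdotE] has replaced [s], both sides are rational expressions in [beta], the conformal
    factor and their [del_z]-derivatives. *)
Let ent0E v : O v -> beta v != 0 ->
  ent0 s w v = del_z m v - ent_conn w v * m v - m v ^+ 2 / 2.
Proof.
move=> Ov b0; have e0 := Ec0 Ov; have hb := hol_beta oO mx.
have hw := hol_wdot oO mx.
have db := has_dz_hol oO hb Ov; have db1 := has_dz_hol oO (hol_del_z oO hb) Ov.
have sEc := smooth_Ec oO mx.
have dE := has_dz_self (smoothC_diff oO sEc Ov).
have dE1 := has_dz_self (smoothC_diff oO (smoothC_del_z oO sEc) Ov).
have b20 : 2 * beta v != 0 by rewrite mulf_neq0 ?pnatr_eq0.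
have Dm := has_dz_val (has_dzD (has_dzM db1 (has_dzV (has_dzM (has_dz_cst 2 v) db) b20))
  (has_dzN (has_dzM dE1 (has_dzV dE e0)))).
have w2 : del_z (del_z w) v = 2 * (del_z beta v * del_z beta v + beta v * del_z (del_z beta) v).
  have EQ : {in O, del_z w =1 (fun v => 2 * (beta v * del_z beta v))}.
    by move=> v' /set_mem; exact: del_z_wdot.
  rewrite (del_z_ext_on oO EQ (mem_set Ov)) (has_dz_val (has_dzM (has_dz_cst 2 v) (has_dzM db db1))).
  by rewrite mul0r add0r.
rewrite gamE // /ent0 w2 (del_z_wdot oO mx Ov) (wdotE oO mx Ov) (sdotE oO mx Ov).
rewrite -[del_z m v]/(del_z (fun v' => del_z beta v' / (2 * beta v') - del_z Ec v' / Ec v') v) Dm /m.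
move: b0 e0; move: (beta v) (del_z beta v) (del_z (del_z beta) v) (Ec v) (del_z Ec v) (del_z (del_z Ec) v).
by move=> b b1 b2 e e1 e2 b0 e0; field; rewrite b0 e0.
Qed.

Let sm v : O v -> beta v != 0 -> diffC m v.
Proof.
move=> Ov b0; have e0 := Ec0 Ov; have hb := hol_beta oO mx.
have sEc := smooth_Ec oO mx.
have dE := smoothC_diff oO sEc Ov.
have dE1 := smoothC_diff oO (smoothC_del_z oO sEc) Ov.
have b20 : 2 * beta v != 0 by rewrite mulf_neq0 ?pnatr_eq0.
have db := hol_diff oO hb Ov; have db1 := hol_diff oO (hol_del_z oO hb) Ov.
exact: (diffCD (diffCM db1 (diffCV (diffCM (diffC_cst 2 v) db) b20)) (diffCN (diffCM dE1 (diffCV dE e0)))).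
Qed.

Lemma ent_genE n u : W u -> beta (t u) != 0 ->
  ent s w n (t u) * pderC 0 T u ^+ n.+2 = ent_gen tau f K n u.
Proof.
move=> Wu b0; have Hu : W' u by []; rewrite -/(Tx u) {Wu b0}.
elim: n u Hu => [|n IH] u Hu; have [Wu b0] := Hu; have Ou := tW Wu.
  have d2 : has_dtau tau Tx u (dtau tau Tx u) by split=> //; exact: dTx.
  have EQ : {in W', curv_coef tau K =1 (fun v => (m \o t) v * Tx v)}.
    by move=> v /set_mem; exact: mcE.
  rewrite /= (dtau_ext tau oW' EQ Hu) (has_dtauM (dtF Wu (sm Ou b0)) d2).2 connE // mcE // ent0E // /comp.
  move: (Tx0 Wu); move: (del_z m (t u)) (m (t u)) (ent_conn w (t u)) (Tx u) (dtau tau Tx u).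
  by move=> m1 m0 ga T1 d t0; field.
have EQ : {in W', ent_gen tau f K n =1 (fun v => (ent s w n \o t) v * Tx v ^+ n.+2)}.
  by move=> v /set_mem Hv; rewrite -IH.
have d2 : has_dtau tau Tx u (dtau tau Tx u) by split=> //; exact: dTx.
have oR := Oreg_open oO mx.
have he : hol (Oreg x O) (ent s w n).
  have sub := @Oreg_sub R x O.
  apply: (hol_ent _ oR (hol_sub sub (hol_sdot oO mx)) (hol_sub sub (hol_wdot oO mx))).
  by move=> v [Ov bv]; rewrite (wdot_neq0 oO mx).
have de := dtF Wu (hol_diff oR he (conj Ou b0)).
rewrite [RHS]/= (dtau_ext tau oW' EQ Hu) (EQ u (mem_set Hu)) (has_dtauM de (has_dtauX n.+2 d2)).2 connE //.
rewrite /= /cov_del /comp !exprS.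
move: (Tx0 Wu); move: (del_z (ent s w n) (t u)) (ent s w n (t u)) (ent_conn w (t u)) (Tx u ^+ n).
move: (Tx u) (dtau tau Tx u) (n.+2%:R : C) => T1 d N e1 e ga q t0.
by field.
Qed.

Lemma dcoord_gen u (v : plane) : W u -> to_C (jac t u *m v) =
  pderC 0 T u * (((v 0 0)%:C)%C + tau u * ((v 1 0)%:C)%C).
Proof.
move=> Wu; have -> : pderC 0 T u * (((v 0 0)%:C)%C + tau u * ((v 1 0)%:C)%C) =
    Tx u * ((v 0 0)%:C)%C + (tau u * Tx u) * ((v 1 0)%:C)%C by rewrite -/(Tx u); ring.
rewrite tauE // /Tx /Ty !pT.
have J k : (jac t u *m v) k 0 = pder 0 (fun v => t v k 0) u * v 0 0 + pder 1 (fun v => t v k 0) u * v 1 0.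
  by rewrite mxE sum2 !jacE.
have Rg (p q r s a b : R) : ((p * a + r * b) +i* (q * a + s * b))%C =
  ((p%:C)%C + i * (q%:C)%C) * (a%:C)%C + ((r%:C)%C + i * (s%:C)%C) * (b%:C)%C.
  by apply: complex_eqP; rewrite !cReImE /=; ring.
by rewrite /to_C !J; exact: Rg.
Qed.

End GeneralParameters.

Opaque smooth_on pder pderC del_z del_zb.

(** * Expressions determined by finitely many derivatives at a point *)

Section Jets.
Variable R : realType.
Local Notation plane := 'cV[R]_2.
Local Notation C := R[i].
Local Notation Re := (@complex.Re R).
Local Notation Im := (@complex.Im R).
Local Notation i := (0 +i* 1 : C)%C.

Variables (O O' : set plane) (u u' : plane).
Hypotheses (oO : open O) (oO' : open O') (Ou : O u) (Ou' : O' u').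
Implicit Types (f g h : plane -> R) (F G : plane -> C).

(** Equality of the derivatives at [u] and [u'], by recursion on the order so that the rules of
    calculus carry over by induction. *)
Fixpoint jet n f f' : Prop :=
  f u = f' u' /\ if n is m.+1 then forall a, jet m (pder a f) (pder a f') else True.

Lemma jetP n f f' : (forall s : seq 'I_2, (size s <= n)%N -> pders s f u = pders s f' u') -> jet n f f'.
Proof.
elim: n f f' => [|n IH] f f' H; split; try exact: (H [::]); first by [].
by move=> a; apply: IH => s sn; rewrite -!pders_rcons; apply: H; rewrite size_rcons.
Qed.

Lemma jet_val n f f' : jet n f f' -> f u = f' u'. Proof. by case: n => [|n] []. Qed.

Lemma jet_leS n f f' : jet n.+1 f f' -> jet n f f'.
Proof.
elim: n f f' => [|n IH] f f' [H0 H1]; split=> // a.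
by apply: IH; exact: H1.
Qed.

Lemma jet_le m n f f' : (m <= n)%N -> jet n f f' -> jet m f f'.
Proof.
move=> mn; rewrite -(subnK mn); elim: (n - m)%N => [//|k IH] H.
by apply: IH; apply: jet_leS.
Qed.

Lemma jet_ext n f f' g g' : {in O, f =1 g} -> {in O', f' =1 g'} -> jet n f f' -> jet n g g'.
Proof.
elim: n f f' g g' => [|n IH] f f' g g' fg fg' [H0 H1].
  by split=> //; rewrite -fg ?inE // -fg' ?inE.
split; first by rewrite -fg ?inE // -fg' ?inE.
by move=> a; apply: IH (H1 a); [exact: pder_ext_on oO fg | exact: pder_ext_on oO' fg'].
Qed.

(** Smoothness on [O] and [O'] is carried along because the rules for higher derivatives are applied
    on neighbourhoods of the two points. *)
Definition jetR n f f' := [/\ smooth_on O f, smooth_on O' f' & jet n f f'].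

Lemma jetR_le m n f f' : (m <= n)%N -> jetR n f f' -> jetR m f f'.
Proof. by move=> mn [s s' H]; split=> //; exact: jet_le H. Qed.

Lemma jetR_ext n f f' g g' : {in O, f =1 g} -> {in O', f' =1 g'} -> jetR n f f' -> jetR n g g'.
Proof.
move=> fg fg' [s s' H]; split; [exact: (smooth_ext oO fg s) | exact: (smooth_ext oO' fg' s')|].
exact: jet_ext H.
Qed.

Lemma jetR_pder n a f f' : jetR n.+1 f f' -> jetR n (pder a f) (pder a f').
Proof. by move=> [s s' [_ H]]; split; [exact: smooth_pder|exact: smooth_pder|exact: H]. Qed.

Lemma jetR_S n f f' : smooth_on O f -> smooth_on O' f' -> f u = f' u' ->
  (forall a, exists g g', [/\ {in O, g =1 pder a f}, {in O', g' =1 pder a f'} & jetR n g g']) ->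
  jetR n.+1 f f'.
Proof.
move=> s s' E H; split=> //; split=> // a.
by have [g [g' [e e' [_ _ j]]]] := H a; exact: jet_ext e e' j.
Qed.

Lemma jetR_cst n c : jetR n (fun=> c) (fun=> c).
Proof.
elim: n => [|n IH]; first by split; [exact: smooth_cst|exact: smooth_cst|].
apply: jetR_S; [exact: smooth_cst|exact: smooth_cst|by []|] => a.
(* The derivative of the constant [c] is the constant 0, about which the induction hypothesis for
   [c] says nothing. *)
have z : jetR n (fun=> 0) (fun=> 0).
  elim: n {IH} => [|n IH]; first by split; [exact: smooth_cst|exact: smooth_cst|].
  apply: jetR_S; [exact: smooth_cst|exact: smooth_cst|by []|] => b.
  by exists (fun=> 0), (fun=> 0); split=> // v _; rewrite pder_cst.
by exists (fun=> 0), (fun=> 0); split=> // v _; rewrite pder_cst.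
Qed.

Let sd f v : smooth_on O f -> O v -> differentiable f v. Proof. exact: smooth_diff. Qed.
Let sd' f v : smooth_on O' f -> O' v -> differentiable f v. Proof. exact: smooth_diff. Qed.

Lemma jetR_D n f f' g g' : jetR n f f' -> jetR n g g' ->
  jetR n (fun v => f v + g v) (fun v => f' v + g' v).
Proof.
elim: n f f' g g' => [|n IH] f f' g g' jf jg; have [s1 s1' h1] := jf; have [s2 s2' h2] := jg.
  split; [exact: (smoothD oO s1 s2)|exact: (smoothD oO' s1' s2')|].
  by split=> //; rewrite (jet_val h1) (jet_val h2).
apply: jetR_S; [exact: (smoothD oO s1 s2)|exact: (smoothD oO' s1' s2')| |] => [|a].
  by rewrite (jet_val h1) (jet_val h2).
exists (fun v => pder a f v + pder a g v), (fun v => pder a f' v + pder a g' v); split.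
- by move=> v /set_mem Ov; rewrite (pderD a (sd s1 Ov) (sd s2 Ov)).
- by move=> v /set_mem Ov; rewrite (pderD a (sd' s1' Ov) (sd' s2' Ov)).
- by apply: IH; apply: jetR_pder.
Qed.

Lemma jetR_M n f f' g g' : jetR n f f' -> jetR n g g' ->
  jetR n (fun v => f v * g v) (fun v => f' v * g' v).
Proof.
elim: n f f' g g' => [|n IH] f f' g g' jf jg; have [s1 s1' h1] := jf; have [s2 s2' h2] := jg.
  split; [exact: (smoothM oO s1 s2)|exact: (smoothM oO' s1' s2')|].
  by split=> //; rewrite (jet_val h1) (jet_val h2).
apply: jetR_S; [exact: (smoothM oO s1 s2)|exact: (smoothM oO' s1' s2')| |] => [|a].
  by rewrite (jet_val h1) (jet_val h2).
exists (fun v => pder a f v * g v + f v * pder a g v), (fun v => pder a f' v * g' v + f' v * pder a g' v); split.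
- by move=> v /set_mem Ov; rewrite (pderM a (sd s1 Ov) (sd s2 Ov)).
- by move=> v /set_mem Ov; rewrite (pderM a (sd' s1' Ov) (sd' s2' Ov)).
- have jf1 := jetR_le (leqnSn n) jf; have jg1 := jetR_le (leqnSn n) jg.
  exact: (jetR_D (IH _ _ _ _ (jetR_pder a jf) jg1) (IH _ _ _ _ jf1 (jetR_pder a jg))).
Qed.

Lemma jetR_N n f f' : jetR n f f' -> jetR n (fun v => - f v) (fun v => - f' v).
Proof.
move=> H; apply: (jetR_ext (f := fun v => (-1) * f v) (f' := fun v => (-1) * f' v)).
- by move=> v _; rewrite mulN1r.
- by move=> v _; rewrite mulN1r.
- exact: jetR_M (jetR_cst n (-1)) H.
Qed.

Lemma jetR_B n f f' g g' : jetR n f f' -> jetR n g g' ->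
  jetR n (fun v => f v - g v) (fun v => f' v - g' v).
Proof. by move=> H1 H2; exact: jetR_D H1 (jetR_N H2). Qed.

Lemma jetR_V n f f' : (forall v, O v -> f v != 0) -> (forall v, O' v -> f' v != 0) ->
  jetR n f f' -> jetR n (fun v => (f v)^-1) (fun v => (f' v)^-1).
Proof.
move=> f0 f0'; elim: n => [|n IH] jf; have [s1 s1' h1] := jf.
  split; [exact: (smoothV oO f0 s1)|exact: (smoothV oO' f0' s1')|].
  by split=> //; rewrite (jet_val h1).
apply: jetR_S; [exact: (smoothV oO f0 s1)|exact: (smoothV oO' f0' s1')| |] => [|a].
  by rewrite (jet_val h1).
have jV := IH (jetR_le (leqnSn n) jf).
exists (fun v => - (pder a f v * (f v)^-1 * (f v)^-1)), (fun v => - (pder a f' v * (f' v)^-1 * (f' v)^-1)); split.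
- by move=> v /set_mem Ov; rewrite (pderV a (sd s1 Ov) (f0 v Ov)).
- by move=> v /set_mem Ov; rewrite (pderV a (sd' s1' Ov) (f0' v Ov)).
- exact: (jetR_N (jetR_M (jetR_M (jetR_pder a jf) jV) jV)).
Qed.

Lemma jetR_sqrt n f f' : (forall v, O v -> 0 < f v) -> (forall v, O' v -> 0 < f' v) ->
  jetR n f f' -> jetR n (fun v => Num.sqrt (f v)) (fun v => Num.sqrt (f' v)).
Proof.
move=> f0 f0'; have q0 v : O v -> Num.sqrt (f v) != 0 by move=> /f0 h; rewrite gt_eqF ?sqrtr_gt0.
have q0' v : O' v -> Num.sqrt (f' v) != 0 by move=> /f0' h; rewrite gt_eqF ?sqrtr_gt0.
elim: n => [|n IH] jf; have [s1 s1' h1] := jf.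
  split; [exact: (smooth_sqrt oO f0 s1)|exact: (smooth_sqrt oO' f0' s1')|].
  by split=> //; rewrite (jet_val h1).
apply: jetR_S; [exact: (smooth_sqrt oO f0 s1)|exact: (smooth_sqrt oO' f0' s1')| |] => [|a].
  by rewrite (jet_val h1).
have jV := jetR_V q0 q0' (IH (jetR_le (leqnSn n) jf)).
exists (fun v => pder a f v * (2^-1 * (Num.sqrt (f v))^-1)),
  (fun v => pder a f' v * (2^-1 * (Num.sqrt (f' v))^-1)); split.
- by move=> v /set_mem Ov; rewrite (pder_sqrt a (sd s1 Ov) (f0 v Ov)).
- by move=> v /set_mem Ov; rewrite (pder_sqrt a (sd' s1' Ov) (f0' v Ov)).
- exact: (jetR_M (jetR_pder a jf) (jetR_M (jetR_cst n 2^-1) jV)).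
Qed.

Definition jetC n F F' := jetR n (fun v => Re (F v)) (fun v => Re (F' v)) /\
  jetR n (fun v => Im (F v)) (fun v => Im (F' v)).

Lemma jetC_val n F F' : jetC n F F' -> F u = F' u'.
Proof. by move=> [[_ _ /jet_val h1] [_ _ /jet_val h2]]; exact: complex_eqP. Qed.

Lemma jetC_le m n F F' : (m <= n)%N -> jetC n F F' -> jetC m F F'.
Proof. by move=> mn [h1 h2]; split; [exact: jetR_le h1|exact: jetR_le h2]. Qed.

Lemma jetC_ext n F F' G G' : {in O, F =1 G} -> {in O', F' =1 G'} -> jetC n F F' -> jetC n G G'.
Proof.
by move=> fg fg' [h1 h2]; split; [apply: jetR_ext h1|apply: jetR_ext h2] => v Ov; rewrite (fg, fg').
Qed.

Lemma jetC_real n f f' : jetR n f f' -> jetC n (real_fun f) (real_fun f').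
Proof. by move=> h; split; [exact: h | exact: jetR_cst]. Qed.

Lemma jetC_cst n c : jetC n (fun=> c) (fun=> c).
Proof. by split; exact: jetR_cst. Qed.

Lemma jetC_pder n a F F' : jetC n.+1 F F' -> jetC n (pderC a F) (pderC a F').
Proof. by move=> [h1 h2]; split; [exact: (jetR_pder a h1) | exact: (jetR_pder a h2)]. Qed.

Lemma jetC_D n F F' G G' : jetC n F F' -> jetC n G G' ->
  jetC n (fun v => F v + G v) (fun v => F' v + G' v).
Proof.
move=> [h1 h2] [k1 k2]; split.
  by apply: jetR_ext (jetR_D h1 k1) => v _; rewrite cReD.
by apply: jetR_ext (jetR_D h2 k2) => v _; rewrite cImD.
Qed.

Lemma jetC_M n F F' G G' : jetC n F F' -> jetC n G G' ->
  jetC n (fun v => F v * G v) (fun v => F' v * G' v).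
Proof.
move=> [h1 h2] [k1 k2]; split.
  by apply: jetR_ext (jetR_B (jetR_M h1 k1) (jetR_M h2 k2)) => v _; rewrite cReM.
by apply: jetR_ext (jetR_D (jetR_M h1 k2) (jetR_M h2 k1)) => v _; rewrite cImM.
Qed.

Lemma jetC_N n F F' : jetC n F F' -> jetC n (fun v => - F v) (fun v => - F' v).
Proof.
move=> [h1 h2]; split.
  by apply: jetR_ext (jetR_N h1) => v _; rewrite cReN.
by apply: jetR_ext (jetR_N h2) => v _; rewrite cImN.
Qed.

Lemma jetC_B n F F' G G' : jetC n F F' -> jetC n G G' ->
  jetC n (fun v => F v - G v) (fun v => F' v - G' v).
Proof. by move=> H1 H2; exact: jetC_D H1 (jetC_N H2). Qed.

Lemma jetC_conj n F F' : jetC n F F' -> jetC n (fun v => (F v)^*%C) (fun v => (F' v)^*%C).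
Proof.
move=> [h1 h2]; split.
  by apply: jetR_ext h1 => v _ /=; case: (F v) (F' v) => [? ?] [? ?].
by apply: jetR_ext (jetR_N h2) => v _; case: (F v) (F' v) => [? ?] [? ?].
Qed.

(** Inversion is reduced to the real case: the inverse is the conjugate divided by the squared
    modulus. *)
Lemma jetC_V n F F' : (forall v, O v -> F v != 0) -> (forall v, O' v -> F' v != 0) ->
  jetC n F F' -> jetC n (fun v => (F v)^-1) (fun v => (F' v)^-1).
Proof.
move=> F0 F0' H; have HM := jetC_M H (jetC_conj H).
have N (z : C) : z != 0 -> complex.Re (z * z^*%C) != 0.
  case: z => a b; apply: contraNneq => /eqP; rewrite /= mulrN opprK -!expr2 paddr_eq0 ?sqr_ge0 //.
  by rewrite !sqrf_eq0 => /andP[/eqP-> /eqP->].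
have NV := jetR_V (fun v Ov => N _ (F0 v Ov)) (fun v Ov => N _ (F0' v Ov)) HM.1.
have K (z : C) : z != 0 -> z^*%C * (((complex.Re (z * z^*%C))^-1)%:C)%C = z^-1.
  move=> z0; have := N _ z0; have -> : z^-1 = z^*%C / (z * z^*%C).
    by rewrite invfM mulrC -mulrA mulVf ?mulr1 // fmorph_eq0.
  case: z {z0} => a b /= n0; congr (_ * _); rewrite fmorphV /=; congr (_^-1).
  by apply: complex_eqP => //=; ring.
apply: jetC_ext (jetC_M (jetC_conj H) (jetC_real NV)) => v /set_mem Ov.
  by rewrite /real_fun K ?F0.
by rewrite /real_fun K ?F0'.
Qed.

Lemma jetC_dtau n tau tau' F F' : (forall v, O v -> tau v - (tau v)^*%C != 0) ->
  (forall v, O' v -> tau' v - (tau' v)^*%C != 0) -> jetC n tau tau' -> jetC n.+1 F F' ->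
  jetC n (dtau tau F) (dtau tau' F').
Proof.
move=> t0 t0' ht hF; have ht' := jetC_B ht (jetC_conj ht).
exact: (jetC_M (jetC_B (jetC_pder 1 hF) (jetC_M (jetC_conj ht) (jetC_pder 0 hF))) (jetC_V t0 t0' ht')).
Qed.

Section Gen.
Variables (tau tau' : plane -> C) (f f' K K' : plane -> R).
Hypotheses (t0 : forall v, O v -> tau v - (tau v)^*%C != 0)
  (t0' : forall v, O' v -> tau' v - (tau' v)^*%C != 0)
  (f0 : forall v, O v -> f v != 0) (f0' : forall v, O' v -> f' v != 0)
  (K0 : forall v, O v -> K v != 0) (K0' : forall v, O' v -> K' v != 0).

Let rn0 (r : R) : r != 0 -> (r%:C)%C != 0 :> C. Proof. by rewrite fmorph_eq0. Qed.

Lemma jetC_curv n : jetC n tau tau' -> jetR n.+1 K K' -> jetC n (curv_coef tau K) (curv_coef tau' K').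
Proof.
move=> ht hK; have hc := jetC_real hK.
have n2 (r : R) : r != 0 -> 2 * (r%:C)%C != 0 :> C by move=> r0; rewrite mulf_neq0 ?pnatr_eq0 ?rn0.
have h2 := jetC_V (fun v Ov => n2 _ (K0 Ov)) (fun v Ov => n2 _ (K0' Ov))
  (jetC_M (jetC_cst n 2) (jetC_le (leqnSn n) hc)).
exact: (jetC_M (jetC_dtau t0 t0' ht hc) h2).
Qed.

Lemma jetC_conn n : jetC n.+1 tau tau' -> jetR n.+1 f f' -> jetR n.+1 K K' ->
  jetC n (conn_gen tau f K) (conn_gen tau' f' K').
Proof.
move=> ht hf hK; have ht1 := jetC_le (leqnSn n) ht; have hc := jetC_real hf.
have hV := jetC_V (fun v Ov => rn0 (f0 Ov)) (fun v Ov => rn0 (f0' Ov)) (jetC_le (leqnSn n) hc).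
have hT := jetC_V t0 t0' (jetC_B ht1 (jetC_conj ht1)).
exact: (jetC_B (jetC_D (jetC_curv ht1 hK) (jetC_M (jetC_dtau t0 t0' ht1 hc) hV))
  (jetC_M (jetC_pder 0 (jetC_conj ht)) hT)).
Qed.

(** The order count: two derivatives of [K] in the base case and one more for each covariant
    derivative. *)
Lemma jetC_ent_gen j n : jetC (n + j).+2 tau tau' -> jetR (n + j).+2 f f' -> jetR (n + j).+2 K K' ->
  jetC n (ent_gen tau f K j) (ent_gen tau' f' K' j).
Proof.
elim: j n => [|j IH] n.
  rewrite addn0 => ht hf hK.
  have ht0 : jetC n tau tau' by apply: jetC_le ht; rewrite ltnW.
  have ht1 : jetC n.+1 tau tau' by exact: jetC_le ht.
  have hm := jetC_curv ht1 hK; have hm0 := jetC_le (leqnSn n) hm.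
  have hG := jetC_conn ht1 (jetR_le (leqnSn _) hf) (jetR_le (leqnSn _) hK).
  have h2 := jetC_M (jetC_M hm0 hm0) (jetC_cst n 2^-1).
  apply: jetC_ext (jetC_B (jetC_B (jetC_dtau t0 t0' ht0 hm) (jetC_M hG hm0)) h2) => v _.
    by rewrite /= expr2.
  by rewrite /= expr2.
rewrite addnS => ht hf hK.
have le1 : (n.+1 <= (n + j).+3)%N by rewrite ltnS (leq_trans (leq_addr j n)) // -addn2 leq_addr.
have le0 := ltnW le1.
have hE := IH n.+1 ht hf hK.
have hG := jetC_conn (jetC_le le1 ht) (jetR_le le1 hf) (jetR_le le1 hK).
exact: (jetC_B (jetC_dtau t0 t0' (jetC_le le0 ht) hE)
  (jetC_M (jetC_M (jetC_cst n j.+2%:R) hG) (jetC_le (leqnSn n) hE))).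
Qed.

End Gen.

Lemma jetC_beltrami n f f' g g' h h' : (forall v, O v -> f v != 0) -> (forall v, O' v -> f' v != 0) ->
  (forall v, O v -> 0 < f v * h v - g v * g v) -> (forall v, O' v -> 0 < f' v * h' v - g' v * g' v) ->
  jetR n f f' -> jetR n g g' -> jetR n h h' -> jetC n (beltrami f g h) (beltrami f' g' h').
Proof.
move=> f0 f0' d0 d0' jf jg jh.
have rn0 (r : R) : r != 0 -> (r%:C)%C != 0 :> C by rewrite fmorph_eq0.
have hs := jetC_real (jetR_sqrt d0 d0' (jetR_B (jetR_M jf jh) (jetR_M jg jg))).
have hV := jetC_V (fun v Ov => rn0 _ (f0 v Ov)) (fun v Ov => rn0 _ (f0' v Ov)) (jetC_real jf).
exact: (jetC_M (jetC_D (jetC_real jg) (jetC_M (jetC_cst n i) hs)) hV).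
Qed.

(** Two orders are lost, to the second derivatives of the metric in Brioschi's formula. *)
Lemma jetR_brioschi n f f' g g' h h' :
  (forall v, O v -> 0 < f v * h v - g v * g v) -> (forall v, O' v -> 0 < f' v * h' v - g' v * g' v) ->
  jetR n.+2 f f' -> jetR n.+2 g g' -> jetR n.+2 h h' -> jetR n (brioschi f g h) (brioschi f' g' h').
Proof.
move=> d0 d0' jf jg jh.
have l1 : (n <= n.+2)%N by rewrite ltnW.
have l2 := leqnSn n.
have f_ := jetR_le l1 jf; have g_ := jetR_le l1 jg; have h_ := jetR_le l1 jh.
have fa a := jetR_le l2 (jetR_pder a jf).
have ga a := jetR_le l2 (jetR_pder a jg).
have ha a := jetR_le l2 (jetR_pder a jh).
have half k k' : jetR n k k' -> jetR n (fun v => k v / 2) (fun v => k' v / 2).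
  by move=> jk; exact: jetR_M jk (jetR_cst n 2^-1).
have hf a := half _ _ (fa a); have hh a := half _ _ (ha a).
have f11 := half _ _ (jetR_pder 1 (jetR_pder 1 jf)).
have h00 := half _ _ (jetR_pder 0 (jetR_pder 0 jh)).
have g10 := jetR_pder 1 (jetR_pder 0 jg).
have D := jetR_B (jetR_M f_ h_) (jetR_M g_ g_).
have A1 := jetR_B (ga 0) (hf 1); have A2 := jetR_B (ga 1) (hh 0).
have N := jetR_D (jetR_B (jetR_M D (jetR_B (jetR_B g10 f11) h00))
    (jetR_D (jetR_B (jetR_M h_ (jetR_M (hf 0) A2)) (jetR_M g_ (jetR_D (jetR_M (hf 0) (hh 1)) (jetR_M A1 A2))))
      (jetR_M f_ (jetR_M A1 (hh 1)))))
  (jetR_D (jetR_B (jetR_M h_ (jetR_M (hf 1) (hf 1))) (jetR_M g_ (jetR_D (jetR_M (hf 1) (hh 0)) (jetR_M (hh 0) (hf 1)))))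
     (jetR_M f_ (jetR_M (hh 0) (hh 0)))).
have DD v : O v -> (f v * h v - g v * g v) * (f v * h v - g v * g v) != 0.
  by move=> Ov; rewrite mulf_neq0 // gt_eqF ?d0.
have DD' v : O' v -> (f' v * h' v - g' v * g' v) * (f' v * h' v - g' v * g' v) != 0.
  by move=> Ov; rewrite mulf_neq0 // gt_eqF ?d0'.
exact: (jetR_M N (jetR_V DD DD' (jetR_M D D))).
Qed.

End Jets.

(** * Isothermal parameters *)

Opaque smooth_on pder pderC del_z del_zb.

(** * The inverse function theorem in the plane *)

Section InverseFunction.
Variable R : realType.
Local Notation plane := 'cV[R]_2.
Local Notation e a := (delta_mx a 0 : plane).
Implicit Types (u v : plane) (O : set plane).

Lemma csquare_slice u0 (r s t : R) a u : csquare u0 r u -> `|s| <= `|t| -> `|t| <= 2 * r ->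
  csquare u0 (3%:R * r) (u + s *: e a).
Proof.
rewrite /csquare /= => ur st tr; rewrite addrAC.
apply: le_trans (ler_normD _ _) _; rewrite normrZ norm_e mulr1.
have -> : 3%:R * r = r + 2 * r by ring.
by rewrite lerD // (le_trans st).
Qed.

(** The path from [v] to [u] is parallel to the axes. [MVT_slice] works on symmetric segments, of
    half-length at most [2 * r] here, whence the square of radius [3 * r]. *)
Lemma MVT_plane O u0 (r : R) (f : plane -> R) u v : open O -> smooth_on O f ->
  csquare u0 (3%:R * r) `<=` O -> csquare u0 r u -> csquare u0 r v ->
  exists xi xi', [/\ csquare u0 (3%:R * r) xi, csquare u0 (3%:R * r) xi' &
    f u - f v = (u 0 0 - v 0 0) * pder 0 f xi + (u 1 0 - v 1 0) * pder 1 f xi'].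
Proof.
move=> oO sf rO ru rv; have r0 : 0 <= r by exact: le_trans (normr_ge0 _) ru.
pose t0 := u 0 0 - v 0 0; pose t1 := u 1 0 - v 1 0; pose w := v + t0 *: e 0.
have w0 : w 0 0 = u 0 0 by rewrite !mxE /= mulr1 /t0 addrC subrK.
have w1 : w 1 0 = v 1 0 by rewrite !mxE /= mulr0 addr0.
have uw : u = w + t1 *: e 1.
  apply: plane_eqP; first by rewrite [RHS]mxE w0 !mxE /= mulr0 addr0.
  by rewrite [RHS]mxE w1 !mxE /= mulr1 /t1 addrC subrK.
have sub1 (p q : plane) k : (p - q) k 0 = p k 0 - q k 0 by rewrite !mxE.
have ru' := ru; have rv' := rv; rewrite /csquare /= in ru' rv'.
move/(norm_planeP _ r0): ru'; move/(norm_planeP _ r0): rv'; rewrite !sub1 => -[v0 v1] [u0_ u1_].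
have rw : csquare u0 r w by apply/(norm_planeP _ r0); rewrite !sub1 w0 w1.
have tb k : `|u k 0 - u0 k 0| <= r -> `|v k 0 - u0 k 0| <= r -> `|u k 0 - v k 0| <= 2 * r.
  move=> h1 h2; have -> : u k 0 - v k 0 = (u k 0 - u0 k 0) - (v k 0 - u0 k 0) by ring.
  by apply: le_trans (ler_normB _ _) _; rewrite mulrDl mul1r lerD.
have T0 := tb 0 u0_ v0; have T1 := tb 1 u1_ v1.
have drv a p : O p -> derivable f p (e a) by move=> Op; exact: diff_derivable (smooth_diff oO sf Op).
have [s s0 E0] := @MVT_slice _ f v (e 0) t0 (fun s st => drv 0 _ (rO _ (csquare_slice 0 rv st T0))).
have [s' s1 E1] := @MVT_slice _ f w (e 1) t1 (fun s st => drv 1 _ (rO _ (csquare_slice 1 rw st T1))).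
exists (v + s *: e 0), (w + s' *: e 1); split.
- exact: csquare_slice rv s0 T0.
- exact: csquare_slice rw s1 T1.
- rewrite -uw in E1; have -> : f u - f v = (f w - f v) + (f u - f w) by ring.
  exact: (f_equal2 +%R E0 E1).
Qed.

(* The entries of the matrix m are derivatives at four different points, as the mean value theorem
   yields them; a is the Jacobian matrix at the centre. *)
Lemma cramer_bound (a00 a01 a10 a11 m00 m01 m10 m11 h0 h1 E M eps : R) :
  let D := a00 * a11 - a01 * a10 in
  0 < eps -> eps <= 1 -> 8%:R * M * eps <= `|D| ->
  `|a00| + 1 <= M -> `|a01| + 1 <= M -> `|a10| + 1 <= M -> `|a11| + 1 <= M ->
  `|m00 - a00| <= eps -> `|m01 - a01| <= eps -> `|m10 - a10| <= eps -> `|m11 - a11| <= eps ->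
  `|h0 * m00 + h1 * m01| <= E -> `|h0 * m10 + h1 * m11| <= E ->
  `|h0| * `|D| <= 4%:R * M * E /\ `|h1| * `|D| <= 4%:R * M * E.
Proof.
move=> D e0 e1 eD A00 A01 A10 A11 d00 d01 d10 d11 E0 E1.
have bM (a m : R) : `|a| + 1 <= M -> `|m - a| <= eps -> `|m| <= M.
  move=> h1' h2; have -> : m = (m - a) + a by ring.
  by apply: le_trans (ler_normD _ _) _; move: h1' h2 e1; clear; lra.
have M00 := bM _ _ A00 d00; have M01 := bM _ _ A01 d01.
have M10 := bM _ _ A10 d10; have M11 := bM _ _ A11 d11.
have Mp : 0 <= M by apply: le_trans M00; exact: normr_ge0.
have Ep : 0 <= E by apply: le_trans E0; exact: normr_ge0.
have pb (p q x y : R) : `|p| <= x -> `|q| <= y -> `|p * q| <= x * y.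
  by move=> h1' h2; rewrite normrM ler_pM.
have aM (a : R) : `|a| + 1 <= M -> `|a| <= M by apply: le_trans; rewrite lerDl ler01.
pose D' := m00 * m11 - m01 * m10.
have dD : `|D' - D| <= 4%:R * M * eps.
  have -> : D' - D = ((m00 - a00) * m11 + a00 * (m11 - a11)) - ((m01 - a01) * m10 + a01 * (m10 - a10)).
    by rewrite /D' /D; ring.
  apply: le_trans (ler_normB _ _) _.
  have H1 := le_trans (ler_normD ((m00 - a00) * m11) (a00 * (m11 - a11))) (lerD (pb _ _ _ _ d00 M11) (pb _ _ _ _ (aM _ A00) d11)).
  have H2 := le_trans (ler_normD ((m01 - a01) * m10) (a01 * (m10 - a10))) (lerD (pb _ _ _ _ d01 M10) (pb _ _ _ _ (aM _ A01) d10)).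
  apply: le_trans (lerD H1 H2) _; rewrite le_eqVlt; apply/orP; left; apply/eqP; ring.
(* [4 M eps] is at most half of [|D|], so the perturbed determinant keeps at least half the size of
   [D]. *)
have DD : `|D| <= 2 * `|D'|.
  have -> : D = D' - (D' - D) by ring.
  apply: le_trans (ler_normB _ _) _.
  have : `|D| <= `|D'| + `|D' - D|.
    have -> : `|D| = `|D' - (D' - D)| by congr `|_|; ring.
    exact: ler_normB.
  by move: dD eD; move: `|D' - D| `|D'| `|D| (M * eps) => p q r s; rewrite -!mulrA; move: (M * eps) => t; lra.
have F (h : R) (k : R) : h * D' = k -> `|k| <= 2 * M * E -> `|h| * `|D| <= 4%:R * M * E.
  move=> hk kb; apply: le_trans (ler_wpM2l (normr_ge0 h) DD) _.
  rewrite mulrCA -normrM hk; have -> : 4%:R * M * E = 2 * (2 * M * E) by ring.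
  by rewrite ler_pM2l // ltr0n.
split; [apply: (F _ (m11 * (h0 * m00 + h1 * m01) - m01 * (h0 * m10 + h1 * m11)))
      | apply: (F _ (m00 * (h0 * m10 + h1 * m11) - m10 * (h0 * m00 + h1 * m01)))].
- by rewrite /D'; ring.
- apply: le_trans (ler_normB _ _) _.
  apply: le_trans (lerD (pb _ _ _ _ M11 E0) (pb _ _ _ _ M01 E1)) _.
  by rewrite le_eqVlt; apply/orP; left; apply/eqP; ring.
- by rewrite /D'; ring.
- apply: le_trans (ler_normB _ _) _.
  apply: le_trans (lerD (pb _ _ _ _ M00 E1) (pb _ _ _ _ M10 E0)) _.
  by rewrite le_eqVlt; apply/orP; left; apply/eqP; ring.
Qed.

Variables (F : plane -> plane) (O : set plane).
Hypotheses (oO : open O) (sF : forall b, smooth_on O (fun v => F v b 0)).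
Local Notation Fk b := (fun v => F v b 0).

(** Increments of [F] are linear in those of the argument, with coefficients close to the Jacobian
    matrix at [u0]; Cramer's rule bounds [u - v] by them. Injectivity of [F] and the Lipschitz bound
    for its inverse both come from here. *)
Lemma expanding u0 : O u0 -> \det (jac F u0) != 0 -> exists r k : R, [/\ 0 < r, 0 < k, csquare u0 r `<=` O &
  forall u v E, csquare u0 r u -> csquare u0 r v ->
    `|F u 0 0 - F v 0 0| <= E -> `|F u 1 0 - F v 1 0| <= E -> `|u - v| <= k * E].
Proof.
move=> Ou0; rewrite det2 !jacE.
pose a b c := pder c (Fk b) u0; rewrite -/(a 0 0) -/(a 0 1) -/(a 1 0) -/(a 1 1) => D0.
set D := _ - _ in D0.
pose M := 1 + `|a 0 0| + `|a 0 1| + `|a 1 0| + `|a 1 1|.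
have M0 : 0 < M by rewrite !ltr_wpDr.
have Dp : 0 < `|D| by rewrite normr_gt0.
(* The largest tolerance allowed by [cramer_bound]: at most 1, and small against [|D|]. *)
pose eps := Num.min 1 (`|D| / (8%:R * M)).
have e0 : 0 < eps by rewrite lt_min ltr01 divr_gt0 // mulr_gt0.
have e1 : eps <= 1 by rewrite ge_min lexx.
have eD : 8%:R * M * eps <= `|D|.
  have h : eps <= `|D| / (8%:R * M) by rewrite ge_min lexx orbT.
  by rewrite mulrC -ler_pdivlMr // mulr_gt0.
have Mb b c : `|a b c| + 1 <= M.
  have Rg (p q r s : R) : 0 <= p -> 0 <= q -> 0 <= r -> 0 <= s ->
      [/\ p + 1 <= 1 + p + q + r + s, q + 1 <= 1 + p + q + r + s, r + 1 <= 1 + p + q + r + s & s + 1 <= 1 + p + q + r + s].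
    by clear; move=> *; split; lra.
  have [m0 m1 m2 m3] := Rg _ _ _ _ (normr_ge0 (a 0 0)) (normr_ge0 (a 0 1)) (normr_ge0 (a 1 0)) (normr_ge0 (a 1 1)).
  by elim/ord2P: b; elim/ord2P: c; [exact: m0|exact: m1|exact: m2|exact: m3].
have cont b c : exists2 d : R, 0 < d & forall v, `|v - u0| < d -> `|pder c (Fk b) v - a b c| <= eps.
  have cp : {for u0, continuous (pder c (Fk b))}.
    exact: differentiable_continuous (smooth_diff oO (smooth_pder c (sF b)) Ou0).
  by have /continuous_planeP := cp; apply.
have [d1 d10 H1] := cont 0 0; have [d2 d20 H2] := cont 0 1.
have [d3 d30 H3] := cont 1 0; have [d4 d40 H4] := cont 1 1.
have [d5 d50 H5] := open_ballP oO Ou0.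
pose d := Num.min (Num.min (Num.min d1 d2) (Num.min d3 d4)) d5.
have d0 : 0 < d by rewrite !lt_min d10 d20 d30 d40 d50.
have r30 : 3%:R * (d / 4%:R) < d.
  by rewrite mulrA ltr_pdivrMr // mulrC ltr_pM2l // ltr_nat.
have sub v : csquare u0 (3%:R * (d / 4%:R)) v -> [/\ `|v - u0| < d1, `|v - u0| < d2, `|v - u0| < d3, `|v - u0| < d4 & `|v - u0| < d5].
  move=> h; have := le_lt_trans h r30; rewrite /d !lt_min -!andbA.
  by move=> /and5P[].
have sO : csquare u0 (3%:R * (d / 4%:R)) `<=` O by move=> v /sub[_ _ _ _ /H5].
exists (d / 4%:R), (4%:R * M / `|D|); split.
- by rewrite divr_gt0.
- by rewrite divr_gt0 // mulr_gt0.
- move=> v h; apply: sO; apply: le_trans h _; rewrite ler_peMl ?divr_ge0 ?ler1n //; exact: ltW.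
- move=> u v E hu hv E0 E1.
  have [x0 [x1 [c0 c1 Q0]]] := MVT_plane oO (sF 0) sO hu hv.
  have [y0 [y1 [c2 c3 Q1]]] := MVT_plane oO (sF 1) sO hu hv.
  rewrite Q0 in E0; rewrite Q1 in E1.
  have [B0 B1] := cramer_bound e0 e1 eD (Mb 0 0) (Mb 0 1) (Mb 1 0) (Mb 1 1)
    (H1 _ (let: And5 h _ _ _ _ := sub _ c0 in h)) (H2 _ (let: And5 _ h _ _ _ := sub _ c1 in h))
    (H3 _ (let: And5 _ _ h _ _ := sub _ c2 in h)) (H4 _ (let: And5 _ _ _ h _ := sub _ c3 in h)) E0 E1.
  have Ep : 0 <= E by apply: le_trans E0; exact: normr_ge0.
  have sub1 k : (u - v) k 0 = u k 0 - v k 0 by rewrite !mxE.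
  apply/norm_planeP; first by rewrite mulr_ge0 // divr_ge0 ?mulr_ge0 // ltW.
  rewrite !sub1; split; rewrite mulrAC ler_pdivlMr //.
Qed.

(** At an interior minimum of the squared distance from [F] to [y] the gradient vanishes. It is
    twice the transposed Jacobian matrix, which is invertible, applied to [F u - y]. *)
Lemma critical_solution u (y : plane) (r : R) : O u -> \det (jac F u) != 0 -> 0 < r ->
  (forall v, `|v - u| < r -> O v /\ (F u 0 0 - y 0 0) ^+ 2 + (F u 1 0 - y 1 0) ^+ 2 <=
     (F v 0 0 - y 0 0) ^+ 2 + (F v 1 0 - y 1 0) ^+ 2) -> F u = y.
Proof.
move=> Ou D0 r0 H.
pose p v := - ((F v 0 0 - y 0 0) * (F v 0 0 - y 0 0) + (F v 1 0 - y 1 0) * (F v 1 0 - y 1 0)).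
have sq b : smooth_on O (fun v => (F v b 0 - y b 0) * (F v b 0 - y b 0)).
  have s := smoothB oO (sF b) (smooth_cst oO (y b 0)); exact: (smoothM oO s s).
have sp : smooth_on O p by exact: (smoothN oO (smoothD oO (sq 0) (sq 1))).
have dF b : differentiable (Fk b) u := smooth_diff oO (sF b) Ou.
have z a : pder a p u = 0.
  have N (s : R) : `|(u + s *: e a) - u| = `|s| by rewrite addrAC subrr add0r normrZ norm_e mulr1.
  have dv (s : R) : s \in `]-r, r[%R -> derivable (fun s : R => p (u + s *: e a)) s 1.
    rewrite in_itv /= -ltr_norml => sr; apply: ex_derive.
    apply: is_derive_slice; apply: diff_derivable; apply: (smooth_diff oO sp).
    by have [] := H (u + s *: e a); rewrite ?N.
  have mr : - r <= r by rewrite ge0_cp // ltW.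
  have z0 : (0 : R) \in `]-r, r[%R by rewrite in_itv /= oppr_lt0 r0.
  have mx (s : R) : s \in `]-r, r[%R -> p (u + s *: e a) <= p (u + 0 *: e a).
    rewrite in_itv /= -ltr_norml => sr; rewrite scale0r addr0 /p lerN2 -!expr2.
    by have [] := H (u + s *: e a); rewrite ?N.
  have D1 := derive1_at_max mr dv z0 mx.
  have D2 : is_derive (0 : R) 1 (fun s : R => p (u + s *: e a)) ('D_(e a) p (u + 0 *: e a)).
    by apply: is_derive_slice; rewrite scale0r addr0; exact: diff_derivable (smooth_diff oO sp Ou).
  have := etrans (esym (@derive_val _ _ _ _ _ _ _ D2)) (@derive_val _ _ _ _ _ _ _ D1).
  by rewrite scale0r addr0.
pose h b := F u b 0 - y b 0.
have G a : h 0 * pder a (Fk 0) u + h 1 * pder a (Fk 1) u = 0.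
  have dh b : differentiable (fun v => F v b 0 - y b 0) u.
    exact: (smooth_diff oO (smoothB oO (sF b) (smooth_cst oO (y b 0))) Ou).
  have ph b : pder a (fun v => F v b 0 - y b 0) u = pder a (Fk b) u.
    rewrite (pderD a (dF b) (differentiable_cst _ _)) pder_cst addr0 //.
  have := z a; rewrite /p pderN; last exact: (smooth_diff oO (smoothD oO (sq 0) (sq 1)) Ou).
  rewrite (pderD a (differentiableMf (dh 0) (dh 0)) (differentiableMf (dh 1) (dh 1))).
  rewrite (pderM a (dh 0) (dh 0)) (pderM a (dh 1) (dh 1)) !ph -/(h 0) -/(h 1).
  move: (pder a _ u) (pder a _ u) (h 0) (h 1) => q0 q1 h0 h1 E0.
  by apply: (@mulfI _ 2); rewrite ?pnatr_eq0 // mulr0 -[RHS]oppr0 -E0; ring.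
have G0 := G 0; have G1 := G 1; move: D0; rewrite det2 !jacE.
have [h0 h1] : h 0 * \det (jac F u) = 0 /\ h 1 * \det (jac F u) = 0.
  have Rg (a b p0 p1 q0 q1 : R) : a * p0 + b * p1 = 0 -> a * q0 + b * q1 = 0 ->
      a * (p0 * q1 - q0 * p1) = 0 /\ b * (p0 * q1 - q0 * p1) = 0.
    move=> H0 H1; split.
      have -> : a * (p0 * q1 - q0 * p1) = (a * p0 + b * p1) * q1 - (a * q0 + b * q1) * p1 by ring.
      by rewrite H0 H1 !mul0r subrr.
    have -> : b * (p0 * q1 - q0 * p1) = (a * q0 + b * q1) * p0 - (a * p0 + b * p1) * q0 by ring.
    by rewrite H0 H1 !mul0r subrr.
  by rewrite det2 !jacE; exact: Rg.
move=> D0; rewrite det2 !jacE in h0 h1.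
have H0 b : h b * (pder 0 (Fk 0) u * pder 1 (Fk 1) u - pder 1 (Fk 0) u * pder 0 (Fk 1) u) = 0 -> F u b 0 = y b 0.
  by move/eqP; rewrite mulf_eq0 (negbTE D0) orbF subr_eq0 => /eqP.
by apply: plane_eqP; exact: H0.
Qed.

(** The default [y] is the value off the image. *)
Definition local_inv (U : set plane) (y : plane) : plane := xget y [set v | U v /\ F v = y].

Theorem inverse_function u0 : O u0 -> (forall u, O u -> \det (jac F u) != 0) -> exists U G,
  [/\ open U, U u0, U `<=` O, open (F @` U) &
     (forall u, U u -> G (F u) = u) /\ (forall b, smooth_on (F @` U) (fun v => G v b 0))].
Proof.
move=> Ou0 D0; have [r [k [r0 k0 rO ex]]] := expanding Ou0 (D0 _ Ou0).
pose U := osquare u0 r; have oU : open U by exact: osquare_open.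
have UO : U `<=` O by move=> v h; apply: rO; exact: ltW.
have inj u v : U u -> U v -> F u = F v -> u = v.
  move=> hu hv E; apply/eqP; rewrite -subr_eq0 -normr_le0.
  have z b : `|F u b 0 - F v b 0| <= 0 by rewrite E subrr normr0.
  by have := ex u v 0 (ltW hu) (ltW hv) (z 0) (z 1); rewrite mulr0.
have sub1 (p q : plane) c : (p - q) c 0 = p c 0 - q c 0 by rewrite !mxE.
(* For [y] near [F u1] the squared distance from [F] to [y] attains its minimum on a closed square
   about [u1]; by [expanding] the minimizer is interior, so it solves [F c = y]. *)
have oV : open (F @` U).
  rewrite openE => _ [u1 Uu1 <-]; apply/near_ballP.
  have [rho rho0 Hrho] := open_ballP oU Uu1.
  have q0 : 0 < rho / 2 by rewrite divr_gt0.
  have subU v : csquare u1 (rho / 2) v -> U v.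
    by move=> h; apply: Hrho; apply: le_lt_trans h _; rewrite ltr_pdivrMr // mulr_natr mulr2n ltrDl.
  (* The image of the minimizer is within [3 * et] of [F u1], so the minimizer is within
     [3 * k * et = 3 * rho / 8 < rho / 2] of [u1]. *)
  pose et := rho / (8%:R * k).
  have et0 : 0 < et by rewrite divr_gt0 // mulr_gt0.
  exists et => // y /(norm_plane_ltP _ et0); rewrite !sub1 => -[y0 y1].
  pose p v := - ((F v 0 0 - y 0 0) ^+ 2 + (F v 1 0 - y 1 0) ^+ 2).
  have cp v : csquare u1 (rho / 2) v -> {for v, continuous p}.
    move=> /subU/UO Ov; apply: differentiable_continuous; apply: (smooth_diff oO _ Ov).
    have sq b : smooth_on O (fun v => (F v b 0 - y b 0) ^+ 2).
      have s := smoothB oO (sF b) (smooth_cst oO (y b 0)).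
      by apply: (smooth_ext oO _ (smoothM oO s s)) => w _; rewrite expr2.
    exact: (smoothN oO (smoothD oO (sq 0) (sq 1))).
  have [c cin Hc] := csquare_max (ltW q0) cp.
  have cc : csquare u1 (rho / 2) u1 by rewrite /csquare /= subrr normr0 ltW.
  have Q : (F c 0 0 - y 0 0) ^+ 2 + (F c 1 0 - y 1 0) ^+ 2 <= 2 * et ^+ 2.
    have := Hc u1 cc; rewrite /p lerN2 => h; apply: le_trans h _.
    have sq b : `|y b 0 - F u1 b 0| < et -> (F u1 b 0 - y b 0) ^+ 2 <= et ^+ 2.
      by move=> h; rewrite -(real_normK (num_real _)) distrC ler_sqr ?nnegrE ?normr_ge0 //; exact: ltW.
    by rewrite mulrDl mul1r lerD // sq.
  have bnd b : (F c b 0 - y b 0) ^+ 2 <= 2 * et ^+ 2 -> `|y b 0 - F u1 b 0| < et -> `|F c b 0 - F u1 b 0| <= 3%:R * et.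
    move=> h1 h2; have h3 : `|F c b 0 - y b 0| <= 2 * et.
      rewrite -ler_sqr ?nnegrE ?normr_ge0 //; last by rewrite mulr_ge0 // ltW.
      rewrite (real_normK (num_real _)) exprMn; apply: le_trans h1 _.
      by rewrite ler_wpM2r ?sqr_ge0 // -natrX ler_nat.
    have -> : F c b 0 - F u1 b 0 = (F c b 0 - y b 0) + (y b 0 - F u1 b 0) by ring.
    apply: le_trans (ler_normD _ _) _.
    have -> : 3%:R * et = 2 * et + et by ring.
    by rewrite lerD // ltW.
  have cs : csquare u0 r c by exact/ltW/subU.
  have us : csquare u0 r u1 by exact/ltW.
  have B0 : (F c 0 0 - y 0 0) ^+ 2 <= 2 * et ^+ 2 by apply: le_trans Q; rewrite lerDl sqr_ge0.
  have B1 : (F c 1 0 - y 1 0) ^+ 2 <= 2 * et ^+ 2 by apply: le_trans Q; rewrite lerDr sqr_ge0.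
  have cu := ex c u1 _ cs us (bnd 0 B0 y0) (bnd 1 B1 y1).
  have cin' : `|c - u1| < rho / 2.
    apply: le_lt_trans cu _; rewrite /et.
    have -> : k * (3%:R * (rho / (8%:R * k))) = rho * (3%:R / 8%:R) by field; rewrite gt_eqF.
    by rewrite ltr_pM2l // ltr_pdivrMr // -(ltr_pM2l (ltr0Sn _ 1)) mulrA divff ?pnatr_eq0 // mul1r -natrM ltr_nat.
  exists c; first exact: subU.
  apply: (@critical_solution c y (rho / 2 - `|c - u1|) (UO _ (subU _ cin)) (D0 _ (UO _ (subU _ cin)))).
    by rewrite subr_gt0.
  move=> v vc; have vin : csquare u1 (rho / 2) v.
    rewrite /csquare /=; have -> : v - u1 = (v - c) + (c - u1) by rewrite addrA subrK.
    by apply: le_trans (ler_normD _ _) _; rewrite -lerBrDr ltW.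
  split; first exact/UO/subU.
  by have := Hc v vin; rewrite /p lerN2.
pose G := local_inv U.
have GP y : (F @` U) y -> U (G y) /\ F (G y) = y.
  by move=> [u Uu <-]; exact: (@xgetPex _ (F u) [set v | U v /\ F v = F u] (ex_intro _ u (conj Uu erefl))).
have GF u : U u -> G (F u) = u.
  move=> Uu; have [UG FG] := GP (F u) (ex_intro2 _ _ u Uu erefl); exact: inj FG.
exists U, G; split=> //; first exact: osquare_center.
split=> //; pose V := F @` U.
have lip y y' : V y -> V y' -> `|G y - G y'| <= k * `|y - y'|.
  move=> /GP[U1 F1] /GP[U2 F2]; have H b : `|F (G y) b 0 - F (G y') b 0| <= `|y - y'|.
    by rewrite F1 F2 -sub1 norm_coord.
  exact: (ex _ _ _ (ltW U1) (ltW U2) (H 0) (H 1)).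
pose J b c : plane -> R := pder c (fun v => F v b 0).
pose Dt v := J 0 0 v * J 1 1 v - J 0 1 v * J 1 0 v.
have DtE v : Dt v = \det (jac F v) by rewrite det2 !jacE.
have Dt0 v : U v -> Dt v != 0 by move=> /UO Ov; rewrite DtE D0.
pose I (b c : 'I_2) v : R := (if b == 0 then (if c == 0 then J 1 1 v else - J 0 1 v)
                    else (if c == 0 then - J 1 0 v else J 0 0 v)) / Dt v.
have sJ b c : smooth_on U (J b c) by exact: smooth_sub UO (smooth_pder c (sF b)).
have sDt : smooth_on U Dt by exact: (smoothB oU (smoothM oU (sJ 0 0) (sJ 1 1)) (smoothM oU (sJ 0 1) (sJ 1 0))).
have sI b c : smooth_on U (I b c).
  have sV := smoothV oU Dt0 sDt.
  rewrite /I; case: (b == 0); case: (c == 0); [exact: (smoothM oU (sJ 1 1) sV)|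
    exact: (smoothM oU (smoothN oU (sJ 0 1)) sV)|exact: (smoothM oU (smoothN oU (sJ 1 0)) sV)|exact: (smoothM oU (sJ 0 0) sV)].
have Iinv b v (q0 q1 : R) : U v ->
    I b 0 v * (q0 * J 0 0 v + q1 * J 0 1 v) + I b 1 v * (q0 * J 1 0 v + q1 * J 1 1 v) = if b == 0 then q0 else q1.
  move=> /Dt0 D1.
  have Rg (a00 a01 a10 a11 : R) : a00 * a11 - a01 * a10 != 0 ->
      a11 / (a00 * a11 - a01 * a10) * (q0 * a00 + q1 * a01) + - a01 / (a00 * a11 - a01 * a10) * (q0 * a10 + q1 * a11) = q0
      /\ - a10 / (a00 * a11 - a01 * a10) * (q0 * a00 + q1 * a01) + a00 / (a00 * a11 - a01 * a10) * (q0 * a10 + q1 * a11) = q1.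
    by move=> n0; split; field.
  have [H0 H1] := Rg _ _ _ _ D1.
  by elim/ord2P: b; [exact: H0 | exact: H1].
(* The linear approximation of [F] at [G y] is multiplied by the inverse matrix [I]; the Lipschitz
   bound on [G] turns an error small against the increment of [G] into one small against [h]. *)
have dG b y : V y -> differentiable (fun v => G v b 0) y /\ forall c, pder c (fun v => G v b 0) y = I b c (G y).
  move=> Vy; have [Uu FGy] := GP y Vy; set u := G y in Uu FGy.
  have [df dE] : differentiable (fun v => G v b 0) y /\ 'd (fun v => G v b 0) y = linform (I b 0 u) (I b 1 u) :> (plane -> R).
    apply: diff_build => eps eps0.
    pose B := `|I b 0 u| + `|I b 1 u| + 1.
    have B0 : 0 < B by rewrite ltr_wpDl ?addr_ge0.
    (* [k] is the Lipschitz constant of [G] and [B] exceeds the sum of the entries of the inverse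
       matrix in absolute value. *)
    pose ep := eps / (B * k); have ep0 : 0 < ep by rewrite divr_gt0 // mulr_gt0.
    have Ou := UO _ Uu.
    have /near_ballP[d1 d10 H1] := diff_boundP (smooth_diff oO (sF 0) Ou) ep0.
    have /near_ballP[d2 d20 H2] := diff_boundP (smooth_diff oO (sF 1) Ou) ep0.
    have [d3 d30 H3] := open_ballP oV Vy.
    apply/near_ballP; exists (Num.min d3 (Num.min (d1 / k) (d2 / k))).
      by rewrite !lt_min d30 !divr_gt0.
    move=> h; rewrite subr0 !lt_min !ltr_pdivlMr // => /and3P[h3 h1 h2].
    have Vh : V (h + y) by apply: H3; rewrite addrK.
    have [Uh Fh] := GP _ Vh; pose q := G (h + y) - u.
    have qk : `|q| <= k * `|h| by have := lip _ _ Vh Vy; rewrite addrK.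
    have qu : q + u = G (h + y) by rewrite /q subrK.
    have q1 : `|q| < d1 by apply: le_lt_trans qk _; rewrite mulrC.
    have q2 : `|q| < d2 by apply: le_lt_trans qk _; rewrite mulrC.
    have E0 := H1 q; have E1 := H2 q; rewrite subr0 in E0 E1.
    move: (E0 q1) (E1 q2); rewrite /linform qu Fh FGy {E0 E1}.
    have hy c : (h + y) c 0 - y c 0 = h c 0 by rewrite mxE addrK.
    rewrite !hy -/(J 0 0 u) -/(J 0 1 u) -/(J 1 0 u) -/(J 1 1 u).
    set r0' := h 0 0 - _; set r1' := h 1 0 - _ => R0 R1.
    have := Iinv b u (q 0 0) (q 1 0) Uu.
    have qb : G (h + y) b 0 - G y b 0 = if b == 0 then q 0 0 else q 1 0.
      by rewrite -sub1; apply: (ord2P (P := fun c => q c 0 = if c == 0 then q 0 0 else q 1 0)).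
    rewrite -qb => <-.
    have -> : q 0 0 * J 0 0 u + q 1 0 * J 0 1 u = h 0 0 - r0' by rewrite /r0'; ring.
    have -> : q 0 0 * J 1 0 u + q 1 0 * J 1 1 u = h 1 0 - r1' by rewrite /r1'; ring.
    have -> : I b 0 u * (h 0 0 - r0') + I b 1 u * (h 1 0 - r1') - (h 0 0 * I b 0 u + h 1 0 * I b 1 u) =
       - (I b 0 u * r0' + I b 1 u * r1') by ring.
    rewrite normrN; apply: le_trans (ler_normD _ _) _.
    rewrite (normrM (I b 0 u)) (normrM (I b 1 u)).
    have qe : ep * `|q| <= eps / B * `|h|.
      apply: le_trans (ler_wpM2l (ltW ep0) qk) _; rewrite le_eqVlt; apply/orP; left; apply/eqP.
      by rewrite /ep; field; rewrite !gt_eqF.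
    have L0 := ler_wpM2l (normr_ge0 (I b 0 u)) (le_trans R0 qe).
    have L1 := ler_wpM2l (normr_ge0 (I b 1 u)) (le_trans R1 qe).
    apply: le_trans (lerD L0 L1) _; rewrite -mulrDl mulrA ler_wpM2r //.
    rewrite mulrCA -[leRHS]mulr1 ler_wpM2l // ?ler_pdivrMr ?mul1r ?lerDl //; exact: ltW.
  split=> // c; rewrite pder_diff // dE /linform !mxE /=.
  by elim/ord2P: c; rewrite /= !(mul1r, mul0r, addr0, add0r).
(* The derivatives of [G] are smooth functions composed with [G], so by the chain rule the class of
   all [g \o G] is stable under derivatives. *)
have H := @smooth_on_coind R V (fun f => exists2 g, smooth_on U g & f = g \o G) oV.
move=> b; apply: H.
- move=> _ [g sg ->] y Vy; have [Uy _] := GP y Vy.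
  by apply: differentiable_comp_plane; [exact: smooth_diff oU sg Uy | move=> c; exact: (dG c y Vy).1].
- move=> _ a [g sg ->].
  exists ((fun v => pder 0 g v * I 0 a v + pder 1 g v * I 1 a v) \o G).
    eexists; last by [].
    exact: (smoothD oU (smoothM oU (smooth_pder 0 sg) (sI 0 a)) (smoothM oU (smooth_pder 1 sg) (sI 1 a))).
  move=> y /set_mem Vy; have [Uy _] := GP y Vy.
  rewrite (pder_comp a (smooth_diff oU sg Uy) (fun c => (dG c y Vy).1)).
  by rewrite (dG 0 y Vy).2 (dG 1 y Vy).2.
- by exists (fun v => v b 0); [exact: (smooth_coord oU) | ].
Qed.

End InverseFunction.

Opaque smooth_on pder pderC del_z del_zb.
Opaque jac dX ddX metric second_form unit_normal dot cross dvec.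

(** * Conjugate coordinate functions of a minimal surface *)

Section Isothermal.
Variable R : realType.
Local Notation plane := 'cV[R]_2.
Local Notation E3 := 'cV[R]_3.

Lemma dot_crossl (p q r : E3) : dot (cross p q) r = dot p (cross q r).
Proof. by rewrite !dotE; have [-> -> ->] := crossE p q; have [-> -> ->] := crossE q r; ring. Qed.

Lemma dot_cross_cross (p q r s : E3) : dot (cross p q) (cross r s) = dot p r * dot q s - dot p s * dot q r.
Proof.
rewrite !dotE; have [-> -> ->] := crossE p q; have [-> -> ->] := crossE r s.
move: (p 0 0) (p 1 0) (p 2%:R 0) (q 0 0) (q 1 0) (q 2%:R 0) => p0 p1 p2 q0 q1 q2.
move: (r 0 0) (r 1 0) (r 2%:R 0) (s 0 0) (s 1 0) (s 2%:R 0) => r0 r1 r2 s0 s1 s2.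
by ring.
Qed.

Lemma cross_anti (p q : E3) : cross p q = - cross q p.
Proof.
have [a0 a1 a2] := crossE p q; have [b0 b1 b2] := crossE q p.
apply: col_eqP => k; rewrite [RHS]mxE; elim/ord3P: k; rewrite ?a0 ?a1 ?a2 ?b0 ?b1 ?b2; ring.
Qed.

Lemma dotNr (p q : E3) : dot p (- q) = - dot p q.
Proof. by rewrite -[- q]scaleN1r dotC dotZl mulN1r dotC. Qed.

(** Cramer's rule: the squared length of [cross p q] times [w] is a combination of vectors with the
    three pairings as coefficients. *)
Lemma orthogonal_frame (p q w : E3) : dot (cross p q) (cross p q) != 0 ->
  dot w p = 0 -> dot w q = 0 -> dot w (cross p q) = 0 -> w = 0.
Proof.
move=> n0 wp wq wn; apply: col_eqP => k; rewrite [RHS]mxE; apply: (mulfI n0); rewrite mulr0.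
set n := cross p q in n0 wn *.
have [c0 c1 c2] := crossE p q; rewrite -/n in c0 c1 c2.
have I (w0 w1 w2 p0 p1 p2 q0 q1 q2 m0 m1 m2 : R) : m0 = p1 * q2 - p2 * q1 -> m1 = p2 * q0 - p0 * q2 ->
   m2 = p0 * q1 - p1 * q0 ->
   [/\ (m0 * m0 + m1 * m1 + m2 * m2) * w0 = (w0 * m0 + w1 * m1 + w2 * m2) * m0
     - (w0 * p0 + w1 * p1 + w2 * p2) * (m1 * q2 - m2 * q1) + (w0 * q0 + w1 * q1 + w2 * q2) * (m1 * p2 - m2 * p1),
     (m0 * m0 + m1 * m1 + m2 * m2) * w1 = (w0 * m0 + w1 * m1 + w2 * m2) * m1
     - (w0 * p0 + w1 * p1 + w2 * p2) * (m2 * q0 - m0 * q2) + (w0 * q0 + w1 * q1 + w2 * q2) * (m2 * p0 - m0 * p2)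
   & (m0 * m0 + m1 * m1 + m2 * m2) * w2 = (w0 * m0 + w1 * m1 + w2 * m2) * m2
     - (w0 * p0 + w1 * p1 + w2 * p2) * (m0 * q1 - m1 * q0) + (w0 * q0 + w1 * q1 + w2 * q2) * (m0 * p1 - m1 * p0)].
  by move=> -> -> ->; split; ring.
rewrite !dotE in wp wq wn *.
have [I0 I1 I2] := I (w 0 0) (w 1 0) (w 2%:R 0) _ _ _ _ _ _ _ _ _ c0 c1 c2.
rewrite wp wq wn !mul0r subrr addr0 in I0 I1 I2.
by elim/ord3P: k.
Qed.

Lemma dvec_cross (P Q : plane -> E3) c u :
  (forall k, differentiable (fun v => P v k 0) u) -> (forall k, differentiable (fun v => Q v k 0) u) ->
  dvec (fun v => cross (P v) (Q v)) c u = cross (dvec P c u) (Q u) + cross (P u) (dvec Q c u).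
Proof.
move=> dP dQ; apply: col_eqP => k; rewrite dvecE [RHS]mxE.
have H a b : pder c (fun v => P v a 0 * Q v b 0 - P v b 0 * Q v a 0) u =
   (dvec P c u a 0 * Q u b 0 - dvec P c u b 0 * Q u a 0) + (P u a 0 * dvec Q c u b 0 - P u b 0 * dvec Q c u a 0).
  have d1 := differentiableMf (dP a) (dQ b); have d2 := differentiableMf (dP b) (dQ a).
  have dN : differentiable (fun v => - (P v b 0 * Q v a 0)) u by apply: differentiableN.
  rewrite (pderD c d1 dN) (pderN c d2) (pderM c (dP a) (dQ b)) (pderM c (dP b) (dQ a)) !dvecE.
  by move: (pder c _ u) (pder c _ u) (pder c _ u) (pder c _ u) => *; ring.
have [a0 a1 a2] := crossE (dvec P c u) (Q u); have [b0 b1 b2] := crossE (P u) (dvec Q c u).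
have F a b j : (forall v, cross (P v) (Q v) j 0 = P v a 0 * Q v b 0 - P v b 0 * Q v a 0) ->
   (fun v => cross (P v) (Q v) j 0) = (fun v => P v a 0 * Q v b 0 - P v b 0 * Q v a 0).
  by move=> E; apply/funext.
elim/ord3P: k.
- rewrite a0 b0 (F 1 2%:R 0) ?H // => v; by have [] := crossE (P v) (Q v).
- rewrite a1 b1 (F 2%:R 0 1) ?H // => v; by have [] := crossE (P v) (Q v).
- rewrite a2 b2 (F 0 1 2%:R) ?H // => v; by have [] := crossE (P v) (Q v).
Qed.

Lemma smooth_cross (O : set plane) (P Q : plane -> E3) k : open O -> (forall k, smooth_on O (fun v => P v k 0)) ->
  (forall k, smooth_on O (fun v => Q v k 0)) -> smooth_on O (fun v => cross (P v) (Q v) k 0).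
Proof.
move=> oO sP sQ.
have H a b j : (forall v, cross (P v) (Q v) j 0 = P v a 0 * Q v b 0 - P v b 0 * Q v a 0) ->
   smooth_on O (fun v => cross (P v) (Q v) j 0).
  move=> E; apply: (smooth_ext oO _ (smoothB oO (smoothM oO (sP a) (sQ b)) (smoothM oO (sP b) (sQ a)))) => v _.
  by rewrite E.
by elim/ord3P: k; [apply: (H 1 2%:R)|apply: (H 2%:R 0)|apply: (H 0 1)] => v; have [] := crossE (P v) (Q v).
Qed.

Section Minimal.
Variables (x : plane -> E3) (O : set plane).
Hypotheses (oO : open O) (sx : forall k, smooth_on O (fun v => x v k 0)).
Hypothesis det0 : forall u, O u -> 0 < \det (metric x u).
Local Notation N := (unit_normal x).
Local Notation n u := (cross (dX x 0 u) (dX x 1 u)).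

Let nn u : dot (n u) (n u) = \det (metric x u).
Proof. by rewrite Lagrange det_metric expr2. Qed.

Lemma smooth_unit_normal k : smooth_on O (fun v => N v k 0).
Proof.
have sn j : smooth_on O (fun v => n v j 0) := smooth_cross j oO (smooth_dX sx 0) (smooth_dX sx 1).
have sD : smooth_on O (fun v => dot (n v) (n v)) := smooth_dot oO sn sn.
have D0 v : O v -> 0 < dot (n v) (n v) by move=> Ov; rewrite nn det0.
have sq v : O v -> Num.sqrt (dot (n v) (n v)) != 0 by move=> Ov; rewrite gt_eqF ?sqrtr_gt0 ?D0.
apply: (smooth_ext oO _ (smoothM oO (smoothV oO sq (smooth_sqrt oO D0 sD)) (sn k))) => v _.
by rewrite unit_normal_cross [RHS]mxE.
Qed.

Let dN u : O u -> forall k, differentiable (fun v => N v k 0) u.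
Proof. by move=> Ou k; exact: smooth_diff oO (smooth_unit_normal k) Ou. Qed.

Let ddx a u : O u -> forall k, differentiable (fun v => dX x a v k 0) u.
Proof. by move=> Ou k; exact: smooth_diff oO (smooth_dX sx a k) Ou. Qed.

Lemma normal_normal u : O u -> dot (N u) (N u) = 1.
Proof.
move=> Ou; rewrite unit_normal_cross /= dotZl dotC dotZl nn.
rewrite mulrA -expr2 exprVn sqr_sqrtr ?mulVf ?gt_eqF ?ltW ?det0 //.
Qed.

Lemma dnormal_normal a u : O u -> dot (dvec N a u) (N u) = 0.
Proof.
move=> Ou; have E : {in O, (fun v => dot (N v) (N v)) =1 (fun=> 1)} by move=> v /set_mem; exact: normal_normal.
have := pder_ext_on a oO E (mem_set Ou); rewrite pder_cst (pder_dot a (dN Ou) (dN Ou)) [X in _ + X]dotC.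
by move/eqP; rewrite -mulr2n mulrn_eq0 /= => /eqP.
Qed.

Lemma weingarten a b u : O u -> dot (dvec N a u) (dX x b u) = - second_form x u a b.
Proof.
move=> Ou; have E : (fun v => dot (N v) (dX x b v)) = (fun=> 0) by apply/funext => v; rewrite dotC dot_normal.
have := pder_dot a (dN Ou) (ddx b Ou); rewrite E pder_cst dvec_dX second_formE => /esym/eqP.
by rewrite addr_eq0 [dot (N u) _]dotC => /eqP.
Qed.

Lemma mean_curvature_eq0 u : O u -> mean_curvature x u = 0 ->
  metric x u 1 1 * second_form x u 0 0 - metric x u 0 1 * (second_form x u 0 1 + second_form x u 1 0)
  + metric x u 0 0 * second_form x u 1 1 = 0.
Proof.
move=> Ou; have D0 := det0 Ou; have gs : metric x u 1 0 = metric x u 0 1.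
  exact: (etrans (metricE x u 1 0) (etrans (dotC _ _) (esym (metricE x u 0 1)))).
rewrite /mean_curvature => /eqP; rewrite mulf_eq0 invr_eq0 pnatr_eq0 orbF => /eqP.
move: D0 gs; move: (metric x u) (second_form x u) => g h D0 gs.
(* The adjugate of [g]. *)
pose B : 'M[R]_2 := \matrix_(a, b) (if a == b then (if a == 0 then g 1 1 else g 0 0) else - g a b).
have [B00 B01 B10 B11] : [/\ B 0 0 = g 1 1, B 0 1 = - g 0 1, B 1 0 = - g 1 0 & B 1 1 = g 0 0].
  by split; rewrite mxE.
have Bg : B *m g = (\det g)%:M.
  rewrite det2; apply/matrixP => a b; rewrite !mxE sum2.
  by elim/ord2P: a; elim/ord2P: b; rewrite ?B00 ?B01 ?B10 ?B11 /= ?gs; ring.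
have ug : g \in unitmx by rewrite unitmxE unitfE gt_eqF.
have -> : invmx g = (\det g)^-1 *: B.
  have -> : B = B *m g *m invmx g by rewrite mulmxK.
  by rewrite Bg mul_scalar_mx scalerA mulVf ?scale1r // gt_eqF.
rewrite -scalemxAl mxtraceZ => /eqP; rewrite mulf_eq0 invr_eq0 gt_eqF //= => /eqP.
rewrite /mxtrace sum2 !mxE !sum2 B00 B01 B10 B11 gs => <-.
by ring.
Qed.

Hypothesis H0 : forall u, O u -> mean_curvature x u = 0.

(** Up to sign, the differential of the conjugate surface is the cross product of the normal with
    [dX]. In its exterior derivative the second derivatives of [x] cancel by symmetry, the rest is
    normal since the derivatives of [N] are tangential, and its normal part vanishes with the mean
    curvature. *)
Lemma conj_closed u : O u ->
  dvec (fun v => cross (N v) (dX x 0 v)) 1 u = dvec (fun v => cross (N v) (dX x 1 v)) 0 u.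
Proof.
move=> Ou; rewrite (dvec_cross 1 (dN Ou) (ddx 0 Ou)) (dvec_cross 0 (dN Ou) (ddx 1 Ou)) !dvec_dX.
rewrite (ddXC oO sx 1 0 Ou); congr (_ + _).
apply/eqP; rewrite -subr_eq0; apply/eqP.
have Dn : dot (n u) (n u) != 0 by rewrite nn gt_eqF ?det0.
have nN : exists c, n u = c *: N u.
  exists (Num.sqrt (dot (n u) (n u))); rewrite unit_normal_cross /= scalerA divff ?scale1r //.
  by rewrite gt_eqF // sqrtr_gt0 nn det0.
have z a : dot (dvec N a u) (n u) = 0.
  by have [c ->] := nN; rewrite dotC dotZl dotC dnormal_normal // mulr0.
have dotBl (p q r : E3) : dot (p - q) r = dot p r - dot q r.
  by rewrite dotDl [dot (- q) r]dotC dotNr [dot r q]dotC.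
apply: (orthogonal_frame Dn); rewrite dotBl.
- rewrite dotC (dot_cross _ _).2 dot_crossl cross_anti dotNr z opprK addr0 //.
- by rewrite dot_crossl z sub0r dotC (dot_cross _ _).2 oppr0.
- have M a b : dot (dX x a u) (dX x b u) = metric x u a b by rewrite metricE.
  have Rg (A B a b c d g00 g01 g10 g11 s00 s01 s10 s11 m00 m01 m11 : R) :
      A = a * g01 - b * g00 -> B = c * g11 - d * g10 -> a = - s10 -> b = - s11 -> c = - s00 -> d = - s01 ->
      g10 = g01 -> g00 = m00 -> g01 = m01 -> g11 = m11 ->
      m11 * s00 - m01 * (s01 + s10) + m00 * s11 = 0 -> A - B = 0.
    by move=> -> -> -> -> -> -> -> -> -> -> <-; ring.
  exact: (Rg _ _ _ _ _ _ _ _ _ _ _ _ _ _ _ _ _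
    (dot_cross_cross (dvec N 1 u) (dX x 0 u) (dX x 0 u) (dX x 1 u))
    (dot_cross_cross (dvec N 0 u) (dX x 1 u) (dX x 0 u) (dX x 1 u))
    (weingarten 1 0 Ou) (weingarten 1 1 Ou) (weingarten 0 0 Ou) (weingarten 0 1 Ou)
    (dotC _ _) (M 0 0) (M 0 1) (M 1 1) (mean_curvature_eq0 Ou (H0 Ou))).
Qed.

(** The left-hand sides form the Hodge star of the differential of [x], so a primitive is a harmonic
    conjugate of the coordinate function. *)
Lemma conj_formula k u : O u -> let s := Num.sqrt (\det (metric x u)) in
  - cross (N u) (dX x 0 u) k 0 = (metric x u 0 1 * dX x 0 u k 0 - metric x u 0 0 * dX x 1 u k 0) / s /\
  - cross (N u) (dX x 1 u) k 0 = (metric x u 1 1 * dX x 0 u k 0 - metric x u 0 1 * dX x 1 u k 0) / s.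
Proof.
move=> Ou s; rewrite unit_normal_cross /= !crossZl !cross_cross nn -/s.
rewrite [dot (dX x 1 u) (dX x 0 u)]dotC.
have M a b : dot (dX x a u) (dX x b u) = metric x u a b by rewrite metricE.
by split; rewrite ?M mulrC -mulNr opprB.
Qed.

Lemma isothermal_map u0 : O u0 -> exists (U : set plane) (F : plane -> plane),
  [/\ open U, U u0, U `<=` O, (forall b, smooth_on U (fun v => F v b 0)) &
  forall u, U u -> 0 < \det (jac F u) /\ exists2 l : R, l != 0 & (jac F u)^T *m jac F u = l *: metric x u].
Proof.
move=> Ou0.
(* Some coordinate function has a nonzero derivative in the first direction, since the metric is
   nondegenerate. *)
have [k fk] : exists k, pder 0 (fun v => x v k 0) u0 != 0.
  apply: contrapT => /forallNP H; have z : dX x 0 u0 = 0.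
    by apply: col_eqP => k; rewrite dXE [RHS]mxE; apply/eqP; apply: contrapT => /negP; exact: H.
  have := det0 Ou0; rewrite det_metric z.
  have d0 (p : E3) : dot 0 p = 0 by rewrite -(scale0r 0) dotZl mul0r.
  by rewrite !d0 !mul0r subrr ltxx.
pose O1 := [set v | O v /\ pder 0 (fun v => x v k 0) v != 0].
have oO1 : open O1.
  have s0 : smoothC O (real_fun (pder 0 (fun v => x v k 0))) := smoothC_real oO (smooth_pder 0 (sx k)).
  have -> : O1 = [set v | O v /\ real_fun (pder 0 (fun v => x v k 0)) v != 0].
    by apply/funext => v; rewrite /O1 /= /real_fun fmorph_eq0.
  exact: (open_neq0 oO s0).
have [r r0 rO] := sub_osquare oO1 (conj Ou0 fk : O1 u0).
pose U := osquare u0 r; have oU : open U by exact: osquare_open.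
have UO : U `<=` O by move=> v /rO[].
(* With this sign a coordinate function followed by its conjugate is an orientation-preserving
   map. *)
pose P v := - cross (N v) (dX x 0 v) k 0; pose Q v := - cross (N v) (dX x 1 v) k 0.
have sP : smooth_on U P.
  exact: (smoothN oU (smooth_sub UO (smooth_cross k oO smooth_unit_normal (smooth_dX sx 0)))).
have sQ : smooth_on U Q.
  exact: (smoothN oU (smooth_sub UO (smooth_cross k oO smooth_unit_normal (smooth_dX sx 1)))).
have cl : {in U, pder 1 P =1 pder 0 Q}.
  move=> v /set_mem /UO Ov; have dc a : differentiable (fun v => cross (N v) (dX x a v) k 0) v.
    exact: smooth_diff oO (smooth_cross k oO smooth_unit_normal (smooth_dX sx a)) Ov.
  rewrite (pderN 1 (dc 0)) (pderN 0 (dc 1)) -(dvecE (fun v => cross (N v) (dX x 0 v))).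
  by rewrite -(dvecE (fun v => cross (N v) (dX x 1 v))) conj_closed.
have [sp p0 p1] := primitiveP sP sQ cl.
pose F v : plane := \col_b (if b == 0 then x v k 0 else primitive u0 P Q v).
have F0 : (fun v => F v 0 0) = (fun v => x v k 0) by apply/funext => v; rewrite mxE.
have F1 : (fun v => F v 1 0) = primitive u0 P Q by apply/funext => v; rewrite mxE.
exists U, F; split; [exact: oU|exact: osquare_center|exact: UO| |].
  by apply: ord2P; [rewrite F0; exact: smooth_sub UO (sx k) | rewrite F1].
move=> u Uu; have Ou := UO u Uu.
have J00 : jac F u 0 0 = dX x 0 u k 0 by rewrite jacE F0 dXE.
have J01 : jac F u 0 1 = dX x 1 u k 0 by rewrite jacE F0 dXE.
have J10 : jac F u 1 0 = P u by rewrite jacE F1 p0 ?inE.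
have J11 : jac F u 1 1 = Q u by rewrite jacE F1 p1 ?inE.
have [PE QE] := conj_formula k Ou; rewrite -/(P u) -/(Q u) in PE QE.
have fx : dX x 0 u k 0 != 0 by rewrite dXE; have [] := rO u Uu.
have D0 := det0 Ou; have DE : \det (metric x u) = metric x u 0 0 * metric x u 1 1 - metric x u 0 1 * metric x u 0 1.
  rewrite det2; congr (_ - _ * _).
  exact: (etrans (metricE x u 1 0) (etrans (dotC _ _) (esym (metricE x u 0 1)))).
have gs : metric x u 1 0 = metric x u 0 1.
  exact: (etrans (metricE x u 1 0) (etrans (dotC _ _) (esym (metricE x u 0 1)))).
have g0 : 0 < metric x u 1 1.
  have h : 0 <= metric x u 1 1 by rewrite metricE dotE -!expr2 !addr_ge0 ?sqr_ge0.
  rewrite lt_def h andbT; apply/eqP => z; move: D0; rewrite DE z mulr0 sub0r -expr2.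
  by rewrite oppr_gt0 ltNge sqr_ge0.
set s := Num.sqrt _ in PE QE; have s0 : 0 < s by rewrite sqrtr_gt0.
have ss : s * s = metric x u 0 0 * metric x u 1 1 - metric x u 0 1 * metric x u 0 1.
  by rewrite -DE -expr2 sqr_sqrtr // ltW.
(* The determinant of the metric times the squared length of the differential of the coordinate
   function, shown positive by completing the square; it is also the Jacobian of [F] times [s]. *)
have qpos : 0 < metric x u 1 1 * dX x 0 u k 0 ^+ 2 - 2 * metric x u 0 1 * dX x 0 u k 0 * dX x 1 u k 0
    + metric x u 0 0 * dX x 1 u k 0 ^+ 2.
  rewrite -(pmulr_rgt0 _ g0).
  have -> : metric x u 1 1 * (metric x u 1 1 * dX x 0 u k 0 ^+ 2 - 2 * metric x u 0 1 * dX x 0 u k 0 * dX x 1 u k 0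
    + metric x u 0 0 * dX x 1 u k 0 ^+ 2) =
    (metric x u 1 1 * dX x 0 u k 0 - metric x u 0 1 * dX x 1 u k 0) ^+ 2 + (s * s) * dX x 1 u k 0 ^+ 2.
    rewrite ss; move: (metric x u 0 0) (metric x u 0 1) (metric x u 1 1) (dX x 0 u k 0) (dX x 1 u k 0) => *.
    by ring.
  have [y0|y0] := eqVneq (dX x 1 u k 0) 0.
    rewrite y0 mulr0 subr0 expr0n mulr0 addr0 lt_def sqr_ge0 andbT sqrf_eq0 mulf_neq0 //.
    by rewrite gt_eqF.
  rewrite ltr_wpDl ?sqr_ge0 // pmulr_rgt0; last by rewrite mulr_gt0.
  by rewrite lt_def sqrf_eq0 y0 sqr_ge0.
move: qpos PE QE ss gs J00 J01 J10 J11; clearbody s; move: s0 fx.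
move: (metric x u) (jac F u) (dX x 0 u k 0) (dX x 1 u k 0) (P u) (Q u) => g J a b p r' t0 a0.
move: s t0 => t t0 qpos PE QE ss gs J00 J01 J10 J11.
have tn : t != 0 by rewrite gt_eqF.
have dJ : \det J = (g 1 1 * a ^+ 2 - 2 * g 0 1 * a * b + g 0 0 * b ^+ 2) / t.
  by rewrite det2 J00 J01 J10 J11 PE QE; field.
split; first by rewrite dJ divr_gt0.
(* The conformal factor is the squared length of the differential of the chosen coordinate
   function. *)
exists ((g 1 1 * a ^+ 2 - 2 * g 0 1 * a * b + g 0 0 * b ^+ 2) / (t * t)).
  by rewrite mulf_neq0 ?gt_eqF // invr_gt0 mulr_gt0.
have tt : g 0 0 * g 1 1 - g 0 1 * g 0 1 != 0 by rewrite -ss mulf_neq0.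
have Tr c d : J^T c d = J d c by rewrite mxE.
apply/matrixP => c d; rewrite mxE sum2 [RHS]mxE !Tr.
have PQ : [/\ p * p = (g 0 1 * a - g 0 0 * b) ^+ 2 / (t * t), p * r' = (g 0 1 * a - g 0 0 * b) * (g 1 1 * a - g 0 1 * b) / (t * t)
   & r' * r' = (g 1 1 * a - g 0 1 * b) ^+ 2 / (t * t)] by rewrite PE QE; split; field.
have [pp pr rr] := PQ; have rp : r' * p = p * r' by ring.
elim/ord2P: c; elim/ord2P: d; rewrite ?J00 ?J01 ?J10 ?J11 ?gs ?rp ?pp ?pr ?rr ss; move: tt;
  move: (g 0 0) (g 0 1) (g 1 1) => *; by field.
Qed.

Lemma isothermal_param u0 : O u0 -> exists (U : set plane) (F G : plane -> plane),
  [/\ open U, U u0, U `<=` O, open (F @` U) &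
  [/\ forall b, smooth_on U (fun v => F v b 0), forall u, U u -> 0 < \det (jac F u),
    forall u, U u -> G (F u) = u, forall b, smooth_on (F @` U) (fun v => G v b 0) &
    forall y, (F @` U) y -> [/\ 0 < \det (jac G y), metric (x \o G) y 0 0 = metric (x \o G) y 1 1
      & metric (x \o G) y 0 1 = 0]]].
Proof.
move=> Ou0; have [U1 [F [oU1 U1u U1O sF HF]]] := isothermal_map Ou0.
have D0 u : U1 u -> \det (jac F u) != 0 by move=> /HF[h _]; rewrite gt_eqF.
have [U [G [oU Uu UU1 oV [GF sG]]]] := inverse_function oU1 sF U1u D0.
have UO : U `<=` O by move=> v /UU1/U1O.
exists U, F, G; split; [exact: oU|exact: Uu|exact: UO|exact: oV|].
split; [by move=> b; exact: smooth_sub UU1 (sF b)|by move=> u /UU1/HF[]|exact: GF|exact: sG|].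
move=> y Vy; have [u Uy yE] := Vy; have Gy : G y = u by rewrite -yE GF.
have [J0 [l l0 lE]] := HF u (UU1 u Uy).
have VO v : (F @` U) v -> O (G v) by case=> w /[swap] <- Uw; rewrite GF //; exact: UO.
have dG b : differentiable (fun v => G v b 0) y by exact: smooth_diff oV (sG b) Vy.
have JJ : jac F u *m jac G y = 1%:M.
  apply/matrixP => b a; rewrite mxE sum2 !jacE.
  have dF : differentiable (fun v => F v b 0) (G y).
    by rewrite Gy; exact: smooth_diff oU1 (sF b) (UU1 u Uy).
  have := pder_comp a dF dG; rewrite Gy => <-.
  have E : {in F @` U, ((fun v => F v b 0) \o G) =1 (fun v => v b 0)}.
    by move=> v /set_mem[w Uw <-]; rewrite /= GF.
  by rewrite (pder_ext_on a oV E (mem_set Vy)) pder_coord [RHS]mxE eq_sym.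
have gE : metric (x \o G) y = l^-1 *: 1%:M.
  rewrite (metric_reparam oO oV sx sG VO Vy) Gy.
  have -> : metric x u = l^-1 *: ((jac F u)^T *m jac F u) by rewrite lE scalerA mulVf // scale1r.
  by rewrite -scalemxAr -scalemxAl !mulmxA -trmx_mul JJ trmx1 mul1mx JJ.
split.
- have := congr1 determinant JJ; rewrite det_mulmx det1 => h.
  by rewrite -(pmulr_rgt0 _ J0) h.
- by rewrite gE !mxE.
- by rewrite gE !mxE /= mulr0.
Qed.

End Minimal.
End Isothermal.

(** * Minimal surfaces *)

Opaque smooth_on pder pderC del_z del_zb.
Opaque jac dX ddX metric second_form unit_normal dot cross dvec.

Section LocalExt.
Variable R : realType.
Local Notation plane := 'cV[R]_2.
Local Notation E3 := 'cV[R]_3.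

Variables (O : set plane) (x y : plane -> E3).
Hypotheses (oO : open O) (xy : {in O, x =1 y}).

Let xyk k : {in O, (fun v => x v k 0) =1 (fun v => y v k 0)}.
Proof. by move=> v /xy ->. Qed.

Lemma dX_ext a u : O u -> dX x a u = dX y a u.
Proof. by move=> Ou; apply: col_eqP => k; rewrite !dXE; exact: (pder_ext_on a oO (xyk k) (mem_set Ou)). Qed.

Lemma ddX_ext a b u : O u -> ddX x a b u = ddX y a b u.
Proof.
move=> Ou; apply: col_eqP => k; have H := pder_ext_on a oO (pder_ext_on b oO (xyk k)) (mem_set Ou).
exact: (etrans (ddXE x a b k u) (etrans H (esym (ddXE y a b k u)))).
Qed.

Lemma metric_ext u : O u -> metric x u = metric y u.
Proof. by move=> Ou; apply/matrixP => a b; rewrite !metricE (dX_ext a Ou) (dX_ext b Ou). Qed.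

Lemma second_form_ext u : O u -> second_form x u = second_form y u.
Proof.
move=> Ou; apply/matrixP => a b.
have N : unit_normal x u = unit_normal y u.
  apply: (etrans (unit_normal_cross x u)); apply: (etrans _ (esym (unit_normal_cross y u))).
  exact: (f_equal2 (fun p q => (Num.sqrt (dot (cross p q) (cross p q)))^-1 *: cross p q) (dX_ext 0 Ou) (dX_ext 1 Ou)).
exact: (etrans (second_formE x u a b) (etrans (f_equal2 (@dot R) (ddX_ext a b Ou) N) (esym (second_formE y u a b)))).
Qed.

Lemma gauss_curvature_ext u : O u -> gauss_curvature x u = gauss_curvature y u.
Proof. by move=> Ou; rewrite /gauss_curvature (metric_ext Ou) (second_form_ext Ou). Qed.

Lemma mean_curvature_ext u : O u -> mean_curvature x u = mean_curvature y u.
Proof. by move=> Ou; rewrite /mean_curvature (metric_ext Ou) (second_form_ext Ou). Qed.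

Lemma smooth_x_ext : (forall k, smooth_on O (fun v => x v k 0)) -> forall k, smooth_on O (fun v => y v k 0).
Proof. by move=> s k; exact: (smooth_ext oO (xyk k) (s k)). Qed.

End LocalExt.

(** * Charts, isothermal coordinates and umbilic points *)

Section Charts.
Variables (R : realType) (M : surface R).
Local Notation plane := 'cV[R]_2.
Local Notation E3 := 'cV[R]_3.
Implicit Types (c d z : chart R M) (p q : M).

Lemma chart_cod_open c : open (chart_cod c).
Proof. exact: chart_image_open. Qed.

Lemma chart_cod_map c p : chart_dom c p -> chart_cod c (chart_map c p).
Proof. by move=> cp; exists p. Qed.

Lemma chart_inv_dom c u : chart_cod c u -> chart_dom c (chart_inv c u).
Proof. by move=> [p cp <-]; rewrite chart_mapK. Qed.

Lemma chart_invK c u : chart_cod c u -> chart_map c (chart_inv c u) = u.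
Proof. by move=> [p cp <-]; rewrite chart_mapK. Qed.

Lemma continuous_preimage (T S : topologicalType) (f : T -> S) (A : set T) (B : set S) :
  open A -> open B -> (forall a, A a -> {for a, continuous f}) -> open [set a | A a /\ B (f a)].
Proof.
move=> oA oB cf; rewrite openE => a [Aa Bfa].
apply: filterI; first exact: open_nbhs_nbhs.
by apply: (cf a Aa); exact: open_nbhs_nbhs.
Qed.

Lemma chart_image_sub_open c (B : set M) : open B -> open (chart_map c @` (chart_dom c `&` B)).
Proof.
move=> oB; have -> : chart_map c @` (chart_dom c `&` B) = [set u | chart_cod c u /\ B (chart_inv c u)].
  apply/seteqP; split=> u.
    by move=> [p [cp Bp] <-]; split; [exact: chart_cod_map | rewrite chart_mapK].
  by move=> [[p cp <-] Bp]; exists p => //; split=> //; rewrite chart_mapK in Bp.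
apply: continuous_preimage => //; first exact: chart_cod_open.
by move=> u; exact: chart_inv_continuous.
Qed.

(* Oriented charts are compared with each other by way of a chart of the atlas. *)
Lemma transition c z p : oriented_chart c -> oriented_chart z -> chart_dom c p -> chart_dom z p ->
  exists W : set plane, [/\ open W, W (chart_map c p), W `<=` chart_map c @` (chart_dom c `&` chart_dom z),
   forall k, smooth_on W (fun u => (chart_map z \o chart_inv c) u k 0) &
   forall u, W u -> 0 < \det (jac (chart_map z \o chart_inv c) u)].
Proof.
move=> oc oz cp zp; have [a aA ap] := atlas_cover p.
have [[sca dca] _] := oc a aA; have [_ [saz daz]] := oz a aA.
set t1 := chart_map a \o chart_inv c in sca dca; set t2 := chart_map z \o chart_inv a in saz daz.
set Oca := _ @` _ in sca dca; set Oaz := _ @` _ in saz daz.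
have oca : open Oca by exact: chart_image_sub_open (chart_dom_open a).
have oaz : open Oaz by exact: chart_image_sub_open (chart_dom_open z).
pose W := chart_map c @` (chart_dom c `&` (chart_dom a `&` chart_dom z)).
have oW : open W by apply: chart_image_sub_open; apply: openI; exact: chart_dom_open.
have WO : W `<=` Oca by move=> u [q [cq [aq zq]] <-]; exists q.
have Wt u : W u -> Oaz (t1 u) by move=> [q [cq [aq zq]] <-]; exists q; rewrite /t1 /= ?chart_mapK.
have E : {in W, t2 \o t1 =1 chart_map z \o chart_inv c}.
  by move=> u /set_mem[q [cq [aq zq]] <-]; rewrite /t1 /t2 /= chart_mapK // chart_mapK.
have Ek k : {in W, (fun u => (t2 \o t1) u k 0) =1 (fun u => (chart_map z \o chart_inv c) u k 0)}.
  by move=> u /E ->.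
have st1 b : smooth_on W (fun v => t1 v b 0) by exact: smooth_sub WO (sca b).
exists W; split; [exact: oW|by exists p|by move=> u [q [cq [aq zq]] <-]; exists q| |].
  by move=> k; apply: (smooth_ext oW (Ek k)); exact: (smooth_comp oW oaz (saz k) Wt st1).
move=> u Wu.
have -> : jac (chart_map z \o chart_inv c) u = jac (t2 \o t1) u.
  by apply/matrixP => k b; rewrite !jacE; exact: (esym (pder_ext_on b oW (Ek k) (mem_set Wu))).
have d2 k : differentiable (fun v => t2 v k 0) (t1 u) := smooth_diff oaz (saz k) (Wt u Wu).
have d1 b : differentiable (fun v => t1 v b 0) u := smooth_diff oW (st1 b) Wu.
rewrite (jac_comp d2 d1) det_mulmx; exact: (mulr_gt0 (daz _ (Wt u Wu)) (dca u (WO u Wu))).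
Qed.

Section OneMap.
Variable X : M -> E3.

Lemma change_chart c z p (V : set plane) : oriented_chart c -> oriented_chart z -> chart_dom c p -> chart_dom z p ->
  open V -> V (chart_map z p) -> exists W : set plane, let t := chart_map z \o chart_inv c in
  [/\ open W, W (chart_map c p), W `<=` chart_cod c, forall u, W u -> V (t u) &
   [/\ forall k, smooth_on W (fun u => t u k 0), forall u, W u -> 0 < \det (jac t u),
     t (chart_map c p) = chart_map z p & {in W, in_chart X z \o t =1 in_chart X c}]].
Proof.
move=> oc oz cp zp oV Vp; have [W0 [oW0 W0p W0O st dt]] := transition oc oz cp zp.
set t := _ \o _ in st dt *.
have ct u : W0 u -> {for u, continuous t}.
  move=> Wu; apply: differentiable_continuous; apply: differentiable_planeP => b.
  exact: smooth_diff oW0 (st b) Wu.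
have tp : t (chart_map c p) = chart_map z p by rewrite /t /= chart_mapK.
exists [set u | W0 u /\ V (t u)]; split.
- exact: continuous_preimage.
- by split=> //; rewrite tp.
- by move=> u [/W0O[q [cq _] <-] _]; exists q.
- by move=> u [].
- split=> //.
  + by move=> k; apply: smooth_sub (st k) => u [].
  + by move=> u [/dt].
  + move=> u /set_mem[/W0O[q [cq zq] <-] _].
    by rewrite /in_chart /t /= (chart_mapK cq) (chart_mapK zq).
Qed.

Lemma gauss_curvature_change c z p (V : set plane) : oriented_chart c -> oriented_chart z -> chart_dom c p ->
  chart_dom z p -> open V -> V (chart_map z p) -> (forall k, smooth_on V (fun v => in_chart X z v k 0)) ->
  gauss_curvature (in_chart X c) (chart_map c p) = gauss_curvature (in_chart X z) (chart_map z p).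
Proof.
move=> oc oz cp zp oV Vp sx; have [W [oW Wp WO Wt [st dt tp E]]] := change_chart oc oz cp zp oV Vp.
rewrite -(gauss_curvature_ext oW E Wp) (gauss_curvature_reparam oV oW sx st Wt Wp (dt _ Wp)).
by rewrite tp.
Qed.

(** Smoothness is asked for in the chart [z] alone, so that the lemma also applies to a transform of
    [X], which is controlled in coordinates adapted to [X]. *)
Lemma umbilicE z p (V : set plane) : oriented_chart z -> chart_dom z p -> open V -> V (chart_map z p) ->
  (forall k, smooth_on V (fun v => in_chart X z v k 0)) ->
  umbilic X p <-> gauss_curvature (in_chart X z) (chart_map z p) = 0.
Proof.
move=> oz zp oV Vp sx; split=> [|H c oc cp]; first exact.
by rewrite (gauss_curvature_change oc oz cp zp oV Vp sx).
Qed.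

Lemma det_metric_pos (x : plane -> E3) u : \rank (jac x u) = 2%N -> 0 < \det (metric x u).
Proof.
move=> rk; rewrite lt_def; apply/andP; split; last first.
  by rewrite det_metric -expr2 -Lagrange dotE -!expr2 !addr_ge0 ?sqr_ge0.
apply/det0P => -[v v0]; rewrite metric_gram mulmxA => H.
have H2 : (v *m (jac x u)^T) *m (v *m (jac x u)^T)^T = 0 by rewrite trmx_mul trmxK mulmxA H mul0mx.
have fr : row_free (jac x u)^T by rewrite /row_free mxrank_tr rk.
have z : v *m (jac x u)^T = 0.
  move: H2; set r := v *m _ => H2; apply/matrixP => a k; rewrite ord1 [RHS]mxE.
  have : \sum_(j < 3) r 0 j ^+ 2 = 0.
    have := congr1 (fun A : 'M[R]_1 => A 0 0) H2; rewrite [LHS]mxE [RHS]mxE => HH; rewrite -[RHS]HH.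
    by apply: eq_bigr => j _; rewrite expr2 [r^T j 0]mxE.
  by move/eqP; rewrite psumr_eq0 => [/allP/(_ k (mem_index_enum _))|j _]; rewrite ?sqr_ge0 // sqrf_eq0 => /eqP.
by move/eqP: v0; apply; apply: (row_free_inj fr); rewrite /= z mul0mx.
Qed.

Hypothesis minX : minimal_immersion X.

Lemma smooth_in_chart c k : oriented_chart c -> smooth_on (chart_cod c) (fun v => in_chart X c v k 0).
Proof. by move=> oc; have [s _] := minX oc; exact: s. Qed.

Lemma metric_in_chart_pos c u : oriented_chart c -> chart_cod c u -> 0 < \det (metric (in_chart X c) u).
Proof. by move=> oc cu; have [_ [rk _]] := minX oc; exact: det_metric_pos (rk u cu). Qed.

Lemma hol_coord_iso_min z : hol_coord X z -> iso_min (in_chart X z) (chart_cod z).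
Proof.
move=> [oz conf]; have [s [_ H0]] := minX oz.
apply: (iso_min_of_conformal (@chart_cod_open z) s conf _ H0) => u zu.
by rewrite gt_eqF // metric_in_chart_pos.
Qed.

Lemma umbilic_beta z p : hol_coord X z -> chart_dom z p ->
  umbilic X p <-> beta (in_chart X z) (chart_map z p) = 0.
Proof.
move=> hz zp; have oz := hz.1; have mx := hol_coord_iso_min hz.
have cz := chart_cod_map zp.
rewrite (umbilicE oz zp (@chart_cod_open z) cz (fun k => smooth_in_chart k oz)).
have HK := gauss_curvature_eq0 (@chart_cod_open z) mx cz.
by split=> /eqP h; apply/eqP; [rewrite -HK|rewrite HK].
Qed.

(** A chart of the atlas followed by the map of [isothermal_param]. Transition maps with every chart
    of the atlas, in both directions, factor through that chart and so stay smooth with positive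
    Jacobian. *)
Lemma hol_coord_exists p : exists2 z, hol_coord X z & chart_dom z p.
Proof.
have [c cA cp] := atlas_cover p.
have oc : oriented_chart c by move=> d dA; split; exact: atlas_compatible.
have oO := @chart_cod_open c; have cu := chart_cod_map cp.
have [U [F [G [oU Up UO oV [sF dF GF sG conf]]]]] := isothermal_param oO (fun k => smooth_in_chart k oc)
  (fun u => metric_in_chart_pos oc) (fun u => (minX oc).2.2 u) cu.
pose D := [set q | chart_dom c q /\ U (chart_map c q)].
have DE : (F \o chart_map c) @` D = F @` U.
  apply/seteqP; split=> y.
    by move=> [q [cq Uq] <-]; exists (chart_map c q).
  by move=> [u Uu <-]; have [q cq qu] := UO u Uu; exists q; rewrite /= ?qu //; split; rewrite //= qu.
have oD : open D by exact: (continuous_preimage (chart_dom_open c) oU (@chart_map_continuous _ _ c)).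
have oI : open ((F \o chart_map c) @` D) by rewrite DE.
have cF q : D q -> {for q, continuous (F \o chart_map c)}.
  move=> [cq Uq]; apply: continuous_comp; first exact: chart_map_continuous.
  apply: differentiable_continuous; apply: differentiable_planeP => b.
  exact: smooth_diff oU (sF b) Uq.
have cG y : ((F \o chart_map c) @` D) y -> {for y, continuous (chart_inv c \o G)}.
  rewrite DE => Vy; apply: continuous_comp.
    apply: differentiable_continuous; apply: differentiable_planeP => b.
    exact: smooth_diff oV (sG b) Vy.
  by have [u Uu <-] := Vy; rewrite GF //; apply: chart_inv_continuous; exact: UO.
have K q : D q -> (chart_inv c \o G) ((F \o chart_map c) q) = q.
  by move=> [cq Uq]; rewrite /= GF // chart_mapK.
pose z : chart R M := Chart oD oI cF cG K.
exists z; last by split.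
split.
  move=> d dA; have [[scd dcd] [sdc ddc]] := oc d dA.
  set Ocd := _ @` _ in scd dcd; set Odc := _ @` _ in sdc ddc.
  have ocd : open Ocd by exact: chart_image_sub_open (chart_dom_open d).
  have odc : open Odc by exact: chart_image_sub_open (chart_dom_open c).
  split; split.
  - move=> k; pose W := chart_map z @` (chart_dom z `&` chart_dom d).
    have oW : open W by exact: chart_image_sub_open (chart_dom_open d).
    have WV : W `<=` F @` U by move=> y [q [Dq _] <-]; rewrite -DE; exists q.
    have WG y : W y -> Ocd (G y) by move=> [q [[cq Uq] dq] <-]; rewrite /= GF //; exists q.
    exact: (smooth_comp oW ocd (scd k) WG (fun b => smooth_sub WV (sG b))).
  - move=> y [q [[cq Uq] dq] yE].
    have Vy : (F @` U) y by rewrite -DE; exists q.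
    have Gy : G y = chart_map c q by rewrite -yE /= GF.
    have Oy : Ocd (G y) by rewrite Gy; exists q.
    have [J0 _ _] := conf y Vy.
    have d2 k : differentiable (fun v => (chart_map d \o chart_inv c) v k 0) (G y) := smooth_diff ocd (scd k) Oy.
    have d1 b : differentiable (fun v => G v b 0) y := smooth_diff oV (sG b) Vy.
    have JE : jac (chart_map d \o chart_inv z) y = jac (chart_map d \o chart_inv c) (G y) *m jac G y := jac_comp d2 d1.
    by rewrite JE det_mulmx; exact: (mulr_gt0 (dcd _ Oy) J0).
  - move=> k; pose W := chart_map d @` (chart_dom d `&` chart_dom z).
    have oW : open W by exact: chart_image_sub_open oD.
    have WV : W `<=` Odc by move=> y [q [dq [cq Uq]] <-]; exists q.
    have WU y : W y -> U ((chart_map c \o chart_inv d) y).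
      by move=> [q [dq [cq Uq]] <-]; rewrite /= chart_mapK.
    exact: (smooth_comp oW oU (sF k) WU (fun b => smooth_sub WV (sdc b))).
  - move=> y [q [dq [cq Uq]] yE].
    have Oy : Odc y by rewrite -yE; exists q.
    have Uy : U ((chart_map c \o chart_inv d) y) by rewrite -yE /= chart_mapK.
    have d2 k : differentiable (fun v => F v k 0) ((chart_map c \o chart_inv d) y) := smooth_diff oU (sF k) Uy.
    have d1 b : differentiable (fun v => (chart_map c \o chart_inv d) v b 0) y := smooth_diff odc (sdc b) Oy.
    have JE : jac (chart_map z \o chart_inv d) y = jac F ((chart_map c \o chart_inv d) y) *m jac (chart_map c \o chart_inv d) y := jac_comp d2 d1.
    by rewrite JE det_mulmx; exact: (mulr_gt0 (dF _ Uy) (ddc _ Oy)).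
move=> y zy; have Vy : (F @` U) y by rewrite -DE; exact: zy.
by have [_ h1 h2] := conf y Vy.
Qed.

Lemma umbilic_interior z0 q : hol_coord X z0 -> chart_dom z0 q ->
  (\forall v \near chart_map z0 q, beta (in_chart X z0) v = 0) -> ((umbilic X)° : set M) q.
Proof.
move=> hz zq H.
have H2 : \forall q' \near q, beta (in_chart X z0) (chart_map z0 q') = 0 := chart_map_continuous zq H.
have H3 : \forall q' \near q, chart_dom z0 q' by apply: open_nbhs_nbhs; split=> //; exact: chart_dom_open.
have H4 : \forall q' \near q, umbilic X q'.
  by apply: filterS2 H3 H2 => q' dq' bq'; apply/(umbilic_beta hz dq').
exact: H4.
Qed.

(** In an isothermal coordinate about a limit point [q], either [beta] vanishes near [q] or its
    zeros near [q] reduce to [q] at most; interior umbilics arbitrarily close to [q] exclude the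
    second case. *)
Lemma umbilic_interior_closed : closed ((umbilic X)° : set M).
Proof.
move=> q clq; have [z0 hz zq] := hol_coord_exists q.
have mx := hol_coord_iso_min hz; have oO := @chart_cod_open z0.
have [r r0 rO] := sub_osquare oO (chart_cod_map zq).
have hb := hol_sub rO (hol_beta oO mx).
have [H|[n [k [hk k0 H]]]] := hol_zero_order r0 hb.
  by apply: (umbilic_interior hz zq); apply/near_ballP; exists (r / 4); rewrite ?divr_gt0.
exfalso; pose a := chart_map z0 q.
have nk : \forall v \near a, osquare a r v /\ k v != 0.
  apply: filterI; first exact: open_near (@osquare_open R a r) (osquare_center a r0).
  exact: diffC_near_neq0 (hol_diff (@osquare_open R a r) hk (osquare_center a r0)) k0.
have H2 := chart_map_continuous zq nk.
have H3 : \forall q' \near q, chart_dom z0 q' by apply: open_nbhs_nbhs; split=> //; exact: chart_dom_open.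
have [q1 [Aq1 [dq1 [oq1 kq1]]]] : (umbilic X)° `&` [set q' | chart_dom z0 q' /\ (osquare a r (chart_map z0 q') /\ k (chart_map z0 q') != 0)] !=set0.
  by apply: clq; exact: filterI.
have um : \forall v \near chart_map z0 q1, chart_cod z0 v /\ (osquare a r v /\ k v != 0 /\ umbilic X (chart_inv z0 v)).
  have c1 := chart_cod_map dq1.
  apply: filterI; first exact: open_near oO c1.
  apply: filterI; first exact: open_near (@osquare_open R a r) oq1.
  apply: filterI; first exact: diffC_near_neq0 (hol_diff (@osquare_open R a r) hk oq1) kq1.
  have cc : chart_inv z0 @ nbhs (chart_map z0 q1) --> chart_inv z0 (chart_map z0 q1) := chart_inv_continuous c1.
  by rewrite (chart_mapK dq1) in cc; exact: (cc _ Aq1).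
(* The interior umbilic found near [q] may be [q] itself; a neighbouring umbilic is then taken
   instead. *)
have [v va [cv [ov [kv uv]]]] : exists2 v, v != a & chart_cod z0 v /\ (osquare a r v /\ k v != 0 /\ umbilic X (chart_inv z0 v)).
  have [e|ne] := eqVneq (chart_map z0 q1) a; last by exists (chart_map z0 q1) => //; exact: nbhs_singleton um.
  by have [v v1 Pv] := near_off um; exists v; rewrite // -e.
move/(umbilic_beta hz (chart_inv_dom cv)): uv; rewrite chart_invK // H // => /eqP.
rewrite mulf_eq0 (negbTE kv) orbF expf_eq0 => /andP[_]; rewrite subr_eq0 => /eqP E.
by move/eqP: va; apply; rewrite -(to_CK v) E to_CK.
Qed.

Hypothesis nonflatX : nonflat X.

(** The interior of the umbilic set is open and closed. If it contained a point, it would be the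
    whole connected surface, against non-flatness. *)
Lemma beta_not_locally0 z p : hol_coord X z -> chart_dom z p ->
  ~ \forall v \near chart_map z p, beta (in_chart X z) v = 0.
Proof.
move=> hz zp H; have Ap := umbilic_interior hz zp H.
have nA : (umbilic X)° <> setT :> set M.
  move=> AT; have [q nq] := nonflatX; apply: nq; apply: (@interior_subset _ (umbilic X)).
  by rewrite AT.
apply: nA; apply: (@surface_connected R M ((umbilic X)° : set M)); first by exists p.
- by exists (umbilic X)°; rewrite ?setTI; first exact: open_interior.
- by exists (umbilic X)°; rewrite ?setTI; first exact: umbilic_interior_closed.
Qed.

End OneMap.
End Charts.

(** * Invariance *)

Opaque smooth_on pder pderC del_z del_zb.
Opaque jac dX ddX metric second_form unit_normal dot cross dvec.

(** * Complex orthogonal maps acting on [phi] *)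

Section ComplexOrthogonal.
Variable R : realType.
Local Notation plane := 'cV[R]_2.
Local Notation C := R[i].
Local Notation E3 := 'cV[R]_3.
Local Notation i := (0 +i* 1 : C)%C.

Lemma cdot_mulmx (A : 'M[C]_3) (c : C) (p q : 'I_3 -> C) : A^T *m A = c%:M ->
  cdot (fun k => \sum_j A k j * p j) (fun k => \sum_j A k j * q j) = c * cdot p q.
Proof.
move=> AA; pose P : 'cV[C]_3 := \col_k p k; pose Q : 'cV[C]_3 := \col_k q k.
have D (r s : 'I_3 -> C) : cdot r s = ((\col_k r k)^T *m (\col_k s k) : 'M[C]_1) 0 0.
  by rewrite mxE sum3 !mxE.
have AP (r : 'I_3 -> C) : \col_k (\sum_j A k j * r j) = A *m (\col_k r k) :> 'cV[C]_3.
  by apply/matrixP => k j; rewrite !mxE; apply: eq_bigr => l _; rewrite mxE.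
rewrite !D !AP trmx_mul -mulmxA (mulmxA A^T) AA mul_scalar_mx -scalemxAr.
by rewrite [LHS]mxE.
Qed.

Lemma mulmx_orth_eq0 (A : 'M[C]_3) (c : C) (p : 'I_3 -> C) : A^T *m A = c%:M -> c != 0 ->
  (forall k, \sum_j A k j * p j = 0) -> forall k, p k = 0.
Proof.
move=> AA c0 H k; pose P : 'cV[C]_3 := \col_k p k.
have AP : A *m P = 0.
  by apply/matrixP => l j; rewrite [RHS]mxE -[RHS](H l) mxE; apply: eq_bigr => m _; rewrite mxE.
have : c%:M *m P = 0 by rewrite -AA -mulmxA AP mulmx0.
rewrite mul_scalar_mx => /matrixP/(_ k 0); rewrite !mxE => /eqP.
by rewrite mulf_eq0 (negbTE c0) => /eqP.
Qed.

Lemma hol_lin O (F : 'I_3 -> plane -> C) (a : 'I_3 -> C) : open O -> (forall j, hol O (F j)) ->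
  hol O (fun v => \sum_j a j * F j v) /\
  forall u, O u -> del_z (fun v => \sum_j a j * F j v) u = \sum_j a j * del_z (F j) u.
Proof.
move=> oO hF; have -> : (fun v => \sum_j a j * F j v) =
    (fun v => a 0 * F 0 v + a 1 * F 1 v + a 2%:R * F 2%:R v) by apply/funext => v; rewrite sum3.
have h j := holM oO (hol_cst oO (a j)) (hF j).
split; first exact: (holD oO (holD oO (h 0) (h 1)) (h 2%:R)).
move=> u Ou; have d j := has_dzM (has_dz_cst (a j) u) (has_dz_hol oO (hF j) Ou).
by rewrite (has_dz_val (has_dzD (has_dzD (d 0) (d 1)) (d 2%:R))) sum3 !mul0r !add0r.
Qed.

Lemma phi_cphi (x : plane -> E3) u k : phi x k u = ((((dX x 0 u) k 0)%:C)%C - i * (((dX x 1 u) k 0)%:C)%C) / 2.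
Proof. exact: (congr1 (fun f : 'I_3 -> C => f k) (phiE x u)). Qed.

(** The two conclusions are the real and imaginary parts of [4 phi.phi = 0]. *)
Lemma phi_null_conformal (x : plane -> E3) u : cdot (phi x ^~ u) (phi x ^~ u) = 0 ->
  dot (dX x 1 u) (dX x 1 u) = dot (dX x 0 u) (dX x 0 u) /\ dot (dX x 0 u) (dX x 1 u) = 0.
Proof.
have I2 := @i2 R; move=> H.
have E : 4%:R * cdot (phi x ^~ u) (phi x ^~ u) =
    ((dot (dX x 0 u) (dX x 0 u) - dot (dX x 1 u) (dX x 1 u)) +i* (- (2 * dot (dX x 0 u) (dX x 1 u))))%C.
  rewrite /cdot !phi_cphi !dotE.
  move: (dX x 0 u 0 0) (dX x 0 u 1 0) (dX x 0 u 2%:R 0) (dX x 1 u 0 0) (dX x 1 u 1 0) (dX x 1 u 2%:R 0).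
  move=> p0 p1 p2 q0 q1 q2.
  have S (p q : R) : 4%:R * ((((p%:C)%C - i * (q%:C)%C) / 2) * (((p%:C)%C - i * (q%:C)%C) / 2)) =
      ((p * p - q * q) +i* (- (2 * (p * q))))%C.
    transitivity ((p%:C)%C * (p%:C)%C - 2 * i * ((p%:C)%C * (q%:C)%C) + (i * i) * ((q%:C)%C * (q%:C)%C)); first by field.
    by rewrite I2; apply: complex_eqP; rewrite !cReImE /=; ring.
  rewrite !mulrDr !S; apply: complex_eqP; rewrite !cReImE /=; ring.
rewrite H mulr0 in E; case: E => e1 e2; split; first by apply/esym/eqP; rewrite -subr_eq0 -e1.
by move/esym/eqP: e2; rewrite oppr_eq0 mulf_eq0 pnatr_eq0 => /eqP.
Qed.

(** Stated under smoothness alone: for a transformed map, harmonicity is deduced from the holomorphy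
    of its [phi] by this formula. *)
Lemma Re_zb_phi (x : plane -> E3) (O : set plane) k u : open O -> (forall k, smooth_on O (fun v => x v k 0)) -> O u ->
  complex.Re (del_zb (phi x k) u) = (pder 0 (pder 0 (fun v => x v k 0)) u + pder 1 (pder 1 (fun v => x v k 0)) u) / 4%:R.
Proof.
move=> oO sx Ou; have -> : phi x k = fun v =>
    (real_fun (pder 0 (fun v => x v k 0)) v + (- i) * real_fun (pder 1 (fun v => x v k 0)) v) * 2^-1.
  by apply/funext => v; rewrite phi_cphi /real_fun !dXE mulNr.
have d a := diffC_real (smooth_diff oO (smooth_pder a (sx k)) Ou).
have d1 := diffCM (diffC_cst (- i) u) (d 1); have d2 := diffCD (d 0) d1.
have P a : pderC a (fun v => (real_fun (pder 0 (fun v => x v k 0)) v + (- i) * real_fun (pder 1 (fun v => x v k 0)) v) * 2^-1) u =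
   (((pder a (pder 0 (fun v => x v k 0)) u)%:C)%C - i * ((pder a (pder 1 (fun v => x v k 0)) u)%:C)%C) / 2.
  rewrite (pderCM a d2 (diffC_cst 2^-1 u)) (pderCD a (d 0) d1).
  rewrite (pderCM a (diffC_cst (- i) u) (d 1)) !pderC_cst !pderC_real mulr0 addr0 mul0r add0r.
  by rewrite mulNr.
have Rg (p q r s : R) : complex.Re (((((p%:C)%C - i * (q%:C)%C) / 2) + i * (((r%:C)%C - i * (s%:C)%C) / 2)) / 2) = (p + s) / 4%:R.
  have I2 := @i2 R.
  have -> : ((((p%:C)%C - i * (q%:C)%C) / 2) + i * (((r%:C)%C - i * (s%:C)%C) / 2)) / 2 =
     (((p + s) / 4%:R)%:C)%C + i * (((r - q) / 4%:R)%:C)%C.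
    transitivity (((p%:C)%C - i * (q%:C)%C + i * (r%:C)%C - (i * i) * (s%:C)%C) / 4%:R); first by field.
    by rewrite I2 !(rmorphM, rmorphD, rmorphN) /= fmorphV rmorph_nat; field.
  by rewrite !cReImE /=; ring.
have Z := etrans (congr1 (@complex.Re R) (f_equal2 (fun a b : C => (a + i * b) / 2) (P 0) (P 1))) (Rg _ _ _ _).
exact: Z.
Qed.

Section Transform.
Variables (x y : plane -> E3) (O : set plane) (A : 'M[C]_3) (c : C).
Hypotheses (oO : open O) (mx : iso_min x O) (sy : forall k, smooth_on O (fun v => y v k 0)).
Hypotheses (c0 : c != 0) (AA : A^T *m A = c%:M).
Hypothesis phiy : forall u k, O u -> phi y k u = \sum_j A k j * phi x j u.

Let hx j := hol_phi oO mx j.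

(** Conformality is [phi.phi = 0], being an immersion is then [phi != 0], and harmonicity is
    holomorphy of [phi]; each survives a complex linear map with [A^T A] a nonzero scalar. *)
Lemma transform_iso_min : iso_min y O.
Proof.
have conf u : O u -> dot (dX y 1 u) (dX y 1 u) = dot (dX y 0 u) (dX y 0 u) /\ dot (dX y 0 u) (dX y 1 u) = 0.
  move=> Ou; apply: phi_null_conformal.
  have -> : phi y ^~ u = (fun k => \sum_j A k j * phi x j u) by apply/funext => k; exact: phiy.
  by rewrite (cdot_mulmx _ _ AA) (phi_null mx Ou) mulr0.
split=> // [u /conf[]//|u /conf[]//|u Ou|u k Ou].
  have d0 (p : E3) : 0 <= dot p p by rewrite dotE -!expr2 !addr_ge0 ?sqr_ge0.
  have z (p : E3) k : dot p p = 0 -> p k 0 = 0.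
    rewrite dotE -!expr2 => /eqP; rewrite paddr_eq0 ?addr_ge0 ?sqr_ge0 // paddr_eq0 ?sqr_ge0 // !sqrf_eq0.
    by case/andP=> /andP[/eqP h0 /eqP h1] /eqP h2; elim/ord3P: k.
  rewrite lt_def d0 andbT; apply/eqP => E0; have [E1 _] := conf u Ou; rewrite E0 in E1.
  have py k : phi y k u = 0 by rewrite phi_cphi (z _ _ E0) (z _ _ E1) rmorph0 mulr0 subr0 mul0r.
  have px := mulmx_orth_eq0 AA c0 (fun k => etrans (esym (phiy k Ou)) (py k)).
  by apply: (phi_eq0 mx Ou).
have [hs _] := hol_lin (A k) oO hx.
have E : {in O, (fun v => \sum_j A k j * phi x j v) =1 phi y k} by move=> v /set_mem Ov; rewrite phiy.
have := Re_zb_phi k oO sy Ou; rewrite -(del_zb_ext_on oO E (mem_set Ou)) hs.2 //= => /esym/eqP.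
by rewrite mulf_eq0 invr_eq0 pnatr_eq0 orbF => /eqP.
Qed.

Let dphiy u k : O u -> dphi y k u = \sum_j A k j * dphi x j u.
Proof.
move=> Ou; have [_ D] := hol_lin (A k) oO hx.
have E : {in O, phi y k =1 (fun v => \sum_j A k j * phi x j v)} by move=> v /set_mem; exact: phiy.
exact: (etrans (del_z_ext_on oO E (mem_set Ou)) (D u Ou)).
Qed.

Let ddphiy u k : O u -> ddphi y k u = \sum_j A k j * ddphi x j u.
Proof.
move=> Ou; have [_ D] := hol_lin (A k) oO (hol_dphi oO mx).
have E : {in O, dphi y k =1 (fun v => \sum_j A k j * dphi x j v)} by move=> v /set_mem; exact: dphiy.
exact: (etrans (del_z_ext_on oO E (mem_set Ou)) (D u Ou)).
Qed.

Lemma transform_wdot u : O u -> wdot y u = c * wdot x u.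
Proof.
move=> Ou; rewrite /wdot -(cdot_mulmx _ _ AA).
have -> : dphi y ^~ u = (fun k => \sum_j A k j * dphi x j u) by apply/funext => k; exact: dphiy.
by [].
Qed.

Lemma transform_sdot u : O u -> sdot y u = c * sdot x u.
Proof.
move=> Ou; rewrite /sdot -(cdot_mulmx _ _ AA).
have -> : ddphi y ^~ u = (fun k => \sum_j A k j * ddphi x j u) by apply/funext => k; exact: ddphiy.
by [].
Qed.

Lemma transform_beta u : O u -> (beta y u == 0) = (beta x u == 0).
Proof.
move=> Ou; have H1 := wdot_neq0 oO mx Ou; have H2 := wdot_neq0 oO transform_iso_min Ou.
have E : (c * wdot x u != 0) = (wdot x u != 0) by rewrite mulf_eq0 negb_or c0.
exact: (negb_inj (etrans (esym H2) (etrans (congr1 (fun z => z != 0) (transform_wdot Ou)) (etrans E H1)))).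
Qed.

Lemma transform_entropy l u : O u -> beta x u != 0 -> entropy y l u = entropy x l u.
Proof.
move=> Ou b0; have oR := Oreg_open oO mx; have my := transform_iso_min.
have Ry : Oreg y O u by split; [exact: Ou | rewrite (transform_beta Ou)].
have Rx : Oreg x O u by exact: (conj Ou b0).
rewrite (entropyE oO my l Ry) (entropyE oO mx l Rx).
have sub := @Oreg_sub R x O.
have E1 : {in Oreg x O, sdot y =1 (fun v => c * sdot x v)} by move=> v /set_mem[Ov _]; exact: transform_sdot.
have E2 : {in Oreg x O, wdot y =1 (fun v => c * wdot x v)} by move=> v /set_mem[Ov _]; exact: transform_wdot.
have w0 v : Oreg x O v -> wdot x v != 0 by move=> [Ov bv]; rewrite (wdot_neq0 oO mx Ov).
exact: (etrans (ent_ext (l - 2) oR E1 E2 (mem_set Rx))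
  (ent_scale _ (l - 2) oR (hol_sub sub (hol_wdot oO mx)) c0 w0 (mem_set Rx))).
Qed.

End Transform.

Lemma iso_min_det (x : plane -> E3) (O : set plane) u : iso_min x O -> O u -> 0 < \det (metric x u).
Proof.
move=> mx Ou; rewrite det_metric (iso_conf mx Ou) (iso_orth mx Ou) mul0r subr0.
exact: (mulr_gt0 (iso_pos mx Ou) (iso_pos mx Ou)).
Qed.

Lemma iso_min_mean (x : plane -> E3) (O : set plane) u : iso_min x O -> O u -> mean_curvature x u = 0.
Proof.
move=> mx Ou; rewrite /mean_curvature (metric_iso mx Ou) scalemx1 invmx_scalar mul_scalar_mx mxtraceZ.
rewrite /mxtrace sum2; have H := sff11 mx Ou; rewrite /sff in H.
by rewrite H subrr mulr0 mul0r.
Qed.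

Lemma del_z_Re_hol (O : set plane) (G : plane -> C) u : open O -> hol O G -> O u ->
  del_z (real_fun (fun v => complex.Re (G v))) u = del_z G u / 2.
Proof.
move=> oO hG Ou; have dG := hol_diff oO hG Ou.
have -> : real_fun (fun v => complex.Re (G v)) = (fun v => (G v + (G v)^*%C) * 2^-1).
  apply/funext => v; rewrite /real_fun; case: (G v) => a b.
  have -> : (a +i* b)%C + ((a +i* b)^*)%C = (((2 * a)%:C)%C : C) by apply: complex_eqP => //=; ring.
  by rewrite rmorphM /= rmorph_nat mulrAC divff ?mul1r ?pnatr_eq0.
have dc := diffC_conj dG.
rewrite (has_dz_val (has_dzM (has_dzD (has_dz_self dG) (has_dz_self dc)) (has_dz_cst 2^-1 u))).
by rewrite (del_z_conj dG) hG.2 // conjc0 addr0 mulr0 addr0.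
Qed.

End ComplexOrthogonal.

(** * Holomorphy, poles and invariance on surfaces *)

Section Surfaces.
Variables (R : realType).
Local Notation plane := 'cV[R]_2.
Local Notation C := R[i].
Local Notation E3 := 'cV[R]_3.

Lemma entropy_holomorphic (M : surface R) (X : M -> E3) l (z : chart R M) p : minimal_immersion X ->
  hol_coord X z -> chart_dom z p -> ~ umbilic X p ->
  holomorphic_at (entropy (in_chart X z) l) (chart_map z p).
Proof.
move=> minX hz zp nu; have mx := hol_coord_iso_min minX hz; have oO := @chart_cod_open R M z.
apply: (hol_holomorphic (Oreg_open oO mx) (entropy_hol oO mx l)).
split; first exact: chart_cod_map.
by apply/eqP => b0; apply: nu; apply/(umbilic_beta minX hz zp).
Qed.

Lemma entropy_has_pole (M : surface R) (X : M -> E3) l (z : chart R M) p : minimal_immersion X -> nonflat X ->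
  (2 <= l)%N -> hol_coord X z -> chart_dom z p -> umbilic X p ->
  has_pole [set u | ~ umbilic X (chart_inv z u)] (entropy (in_chart X z) l) (chart_map z p) l.
Proof.
move=> minX nX l2 hz zp um; have mx := hol_coord_iso_min minX hz; have oO := @chart_cod_open R M z.
have b0 : beta (in_chart X z) (chart_map z p) = 0 by apply/(umbilic_beta minX hz zp).
have [h [B [oB Ba hh h0 H]]] := entropy_pole oO mx (chart_cod_map zp) b0 (beta_not_locally0 minX nX hz zp) l2.
apply: (has_pole_hol oB Ba hh h0) => u Bu ua; have [[Ou bu] ->] := H u Bu ua; split=> //=.
by move/(umbilic_beta minX hz (chart_inv_dom Ou)); rewrite chart_invK // => /eqP; rewrite (negbTE bu).
Qed.

(* The right-hand side involves only the metric in the chart c. *)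
Lemma entropy_val_gen (M : surface R) (X : M -> E3) (z c : chart R M) p (V : set plane) :
  oriented_chart z -> oriented_chart c -> chart_dom z p -> chart_dom c p -> open V -> V (chart_map z p) ->
  iso_min (in_chart X z) V -> beta (in_chart X z) (chart_map z p) != 0 ->
  exists (W : set plane) (y : plane -> E3),
    let f := fun v => metric y v 0 0 in let g := fun v => metric y v 0 1 in let h := fun v => metric y v 1 1 in
    let tau := beltrami f g h in
    [/\ open W, W (chart_map c p), {in W, y =1 in_chart X c}, forall k, smooth_on W (fun v => y v k 0) &
    (forall u, W u -> [/\ 0 < f u * h u - g u * g u, f u != 0, tau u - (tau u)^*%C != 0 & gauss_curvature y u != 0])
    /\ forall l v, (2 <= l)%N -> entropy_val X z c p l v =
      ent_gen tau f (gauss_curvature y) (l - 2) (chart_map c p) *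
      (((v 0 0)%:C)%C + tau (chart_map c p) * ((v 1 0)%:C)%C) ^+ l].
Proof.
move=> oz oc zp cp oV Vp mx b0.
have oR := Oreg_open oV mx.
have [W [oW Wp WO Wt [st dt tp E]]] := change_chart X oc oz cp zp oR (conj Vp b0).
set t := chart_map z \o chart_inv c in Wt st dt tp E.
have WV u : W u -> V (t u) by move=> /Wt[].
have Wb u : W u -> beta (in_chart X z) (t u) != 0 by move=> /Wt[].
exists W, (in_chart X z \o t); split=> //.
- exact: (smooth_reparam oV oW (iso_smooth mx) st WV).
split=> [u Wu|l v l2].
  have f0 := metric00_neq0 oV oW mx st WV dt Wu.
  split.
  - rewrite (det_metric_reparam oV oW mx st WV Wu).
    have h : 0 < cfac (in_chart X z) (t u) * \det (jac t u) by exact: mulr_gt0 (iso_pos mx (WV u Wu)) (dt u Wu).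
    by rewrite exprn_gt0.
  - by move: f0; rewrite /real_fun fmorph_eq0.
  - exact: (beltrami_nonreal oV oW mx st WV dt Wu).
  - rewrite (gauss_curvature_reparam oV oW (iso_smooth mx) st WV Wu (dt u Wu)).
    by rewrite (gauss_curvature_eq0 oV mx (WV u Wu)) Wb.
have EG := ent_genE oV oW mx st WV dt (l - 2) Wp (Wb _ Wp).
rewrite tp in EG.
have Rz : Oreg (in_chart X z) V (chart_map z p) by split.
rewrite /entropy_val /dcoord (entropyE oV mx l Rz) (dcoord_gen oV oW mx st WV dt v Wp) exprMn mulrA.
congr (_ * _); rewrite -EG; congr (_ * _ ^+ _).
by rewrite -(addn2 (l - 2)) subnK.
Qed.

(** Minimality is required only near the point in one isothermal coordinate, which is how it is
    known for transforms. With the same map and the same chart on both sides the lemma compares two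
    isothermal coordinates. *)
Lemma entropy_jets (M N : surface R) (X : M -> E3) (Y : N -> E3) (z c : chart R M) (w d : chart R N) p q l
  (V V' : set plane) : (2 <= l)%N ->
  oriented_chart z -> oriented_chart c -> chart_dom z p -> chart_dom c p -> open V -> V (chart_map z p) ->
  iso_min (in_chart X z) V -> beta (in_chart X z) (chart_map z p) != 0 ->
  oriented_chart w -> oriented_chart d -> chart_dom w q -> chart_dom d q -> open V' -> V' (chart_map w q) ->
  iso_min (in_chart Y w) V' -> beta (in_chart Y w) (chart_map w q) != 0 ->
  same_metric_jet X Y c d p q (l + 4) -> forall v, entropy_val X z c p l v = entropy_val Y w d q l v.
Proof.
move=> l2 oz oc zp cp oV Vp mx b0 ow od wq dq oV' Vq my b0' J v.
have [W [x' [oW Wp Ex sx' [Px Fx]]]] := entropy_val_gen oz oc zp cp oV Vp mx b0.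
have [W' [y' [oW' Wq Ey sy' [Py Fy]]]] := entropy_val_gen ow od wq dq oV' Vq my b0'.
rewrite (Fx l v l2) (Fy l v l2).
set a := chart_map c p in Wp Fx *; set b := chart_map d q in Wq Fy *.
have jm j k : jetR W W' a b (l + 4) (fun u => metric x' u j k) (fun u => metric y' u j k).
  have M1 (x : plane -> E3) : (fun u => metric x u j k) = (fun u => dot (dX x j u) (dX x k u)).
    by apply/funext => u; rewrite metricE.
  split; [by rewrite M1; exact: smooth_metric | by rewrite M1; exact: smooth_metric |].
  apply: (jet_ext oW oW' Wp Wq (f := fun u => metric (in_chart X c) u j k) (f' := fun u => metric (in_chart Y d) u j k)).
  - by move=> u /set_mem Wu; rewrite (metric_ext oW Ex Wu).
  - by move=> u /set_mem Wu; rewrite (metric_ext oW' Ey Wu).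
  - by apply: jetP => s sl; exact: J.
(* [K] takes two derivatives of the metric and [P_l] takes [l] further ones of [K]; [tau] and the
   coefficient [f] enter with derivatives up to order [l]. *)
have le1 : (l.+2 <= l + 4)%N by rewrite -addn2 leq_add2l.
have le0 : (l <= l + 4)%N by rewrite leq_addr.
have D u : W u -> 0 < metric x' u 0 0 * metric x' u 1 1 - metric x' u 0 1 * metric x' u 0 1 by move=> /Px[].
have D' u : W' u -> 0 < metric y' u 0 0 * metric y' u 1 1 - metric y' u 0 1 * metric y' u 0 1 by move=> /Py[].
have F0 u : W u -> metric x' u 0 0 != 0 by move=> /Px[].
have F0' u : W' u -> metric y' u 0 0 != 0 by move=> /Py[].
have jt := jetC_beltrami oW oW' Wp Wq F0 F0' D D' (jetR_le le0 (jm 0 0)) (jetR_le le0 (jm 0 1)) (jetR_le le0 (jm 1 1)).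
have jb := jetR_brioschi oW oW' Wp Wq D D' (jetR_le le1 (jm 0 0)) (jetR_le le1 (jm 0 1)) (jetR_le le1 (jm 1 1)).
have dE (x : plane -> E3) u : \det (metric x u) = metric x u 0 0 * metric x u 1 1 - metric x u 0 1 * metric x u 0 1.
  exact: (etrans (det_metric x u) (esym (f_equal3 (fun p q r : R => p * q - r * r) (metricE x u 0 0) (metricE x u 1 1) (metricE x u 0 1)))).
have jK : jetR W W' a b l (gauss_curvature x') (gauss_curvature y').
  apply: (jetR_ext oW oW' Wp Wq _ _ jb) => u /set_mem Wu.
    by rewrite (gauss_brioschi oW sx' Wu) // dE; exact: D.
  by rewrite (gauss_brioschi oW' sy' Wu) // dE; exact: D'.
have lE : (0 + (l - 2)).+2 = l by rewrite add0n -(addn2 (l - 2)) subnK.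
have je := jetC_ent_gen oW oW' Wp Wq (j := (l - 2)%N) (n := 0)
  (fun u Wu => let: And4 _ _ h _ := Px u Wu in h) (fun u Wu => let: And4 _ _ h _ := Py u Wu in h) F0 F0'
  (fun u Wu => let: And4 _ _ _ h := Px u Wu in h) (fun u Wu => let: And4 _ _ _ h := Py u Wu in h).
rewrite lE in je; have je' := je jt (jetR_le le0 (jm 0 0)) jK.
exact: (f_equal2 (fun p q : C => p * (((v 0 0)%:C)%C + q * ((v 1 0)%:C)%C) ^+ l) (jetC_val je') (jetC_val jt)).
Qed.

(** Both maps are compared in one coordinate [z] isothermal for [X], hence also for [Y].
    Independence of the coordinate then passes from [z'] to [z] for [X] and from [z] to [w'] for
    [Y]. *)
Lemma transform_same (M : surface R) (X Y : M -> E3) : minimal_immersion X ->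
  (forall z, hol_coord X z -> exists (A : 'M[C]_3) (c : C), [/\ c != 0, A^T *m A = c%:M,
     forall k, smooth_on (chart_cod z) (fun v => in_chart Y z v k 0) &
     forall u k, chart_cod z u -> phi (in_chart Y z) k u = \sum_j A k j * phi (in_chart X z) j u]) ->
  same_entropy_differentials X Y.
Proof.
move=> minX H p; have [z hz zp] := hol_coord_exists minX p.
have [A [c [c0 AA sy py]]] := H z hz; have oz := hz.1.
have mx := hol_coord_iso_min minX hz; have oO := @chart_cod_open R M z; have zc := chart_cod_map zp.
have my := transform_iso_min oO mx sy c0 AA py.
have bE := transform_beta oO mx sy c0 AA py zc.
have uX := umbilic_beta minX hz zp.
have uY : umbilic Y p <-> beta (in_chart Y z) (chart_map z p) = 0.
  rewrite (umbilicE oz zp oO zc sy); have HK := gauss_curvature_eq0 oO my zc.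
  by split=> /eqP h; apply/eqP; [rewrite -HK|rewrite HK].
split.
  by rewrite uX uY; split=> /eqP h; apply/eqP; [rewrite bE|rewrite -bE].
move=> nu l l2 c' oc' cp' z' w' hz' zp' hw' wp' v.
have b0 : beta (in_chart X z) (chart_map z p) != 0 by apply/eqP => b0; apply: nu; apply/uX.
have b0' : beta (in_chart X z') (chart_map z' p) != 0.
  by apply/eqP => b; apply: nu; apply/(umbilic_beta minX hz' zp').
have bY : beta (in_chart Y z) (chart_map z p) != 0 by rewrite bE.
have E1 : entropy_val X z' c' p l v = entropy_val X z c' p l v.
  exact: (entropy_jets l2 hz'.1 oc' zp' cp' (@chart_cod_open R M z') (chart_cod_map zp') (hol_coord_iso_min minX hz') b0'
    oz oc' zp cp' oO zc mx b0 (fun _ _ _ _ => erefl)).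
have E2 : entropy_val X z c' p l v = entropy_val Y z c' p l v.
  by rewrite /entropy_val (transform_entropy oO mx sy c0 AA py l zc b0).
have [ow' confw] := hw'.
(* In [w'] the map [Y] is only known to be conformal; its smoothness, regularity and minimality near
   the point are transported from [z]. *)
have [W [oW Wp WO Wt [st dt tp E]]] := change_chart Y ow' oz wp' zp oO zc.
set t := chart_map z \o chart_inv w' in Wt st dt tp E.
have dY u : W u -> 0 < \det (metric (in_chart Y z) (t u)).
  by move=> Wu; exact: (iso_min_det my (Wt u Wu)).
have mw : iso_min (in_chart Y w') W.
  apply: (iso_min_of_conformal oW).
  - exact: (smooth_x_ext oW E (smooth_reparam oO oW (iso_smooth my) st Wt)).
  - by move=> u /WO; exact: confw.
  - move=> u Wu; rewrite -(metric_ext oW E Wu) (metric_reparam oO oW (iso_smooth my) st Wt Wu).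
    rewrite !det_mulmx det_tr; have d1 := dt u Wu; have d2 := dY u Wu.
    by rewrite (gt_eqF (mulr_gt0 (mulr_gt0 d1 d2) d1)).
  - move=> u Wu; rewrite -(mean_curvature_ext oW E Wu).
    have d2 : \det (metric (in_chart Y z) (t u)) != 0 by rewrite (gt_eqF (dY u Wu)).
    rewrite (mean_curvature_reparam oO oW (iso_smooth my) st Wt Wu (dt u Wu) d2).
    exact: iso_min_mean my (Wt u Wu).
have bw : beta (in_chart Y w') (chart_map w' p) != 0.
  rewrite -(gauss_curvature_eq0 oW mw Wp) -(gauss_curvature_ext oW E Wp).
  rewrite (gauss_curvature_reparam oO oW (iso_smooth my) st Wt Wp (dt _ Wp)) tp.
  by rewrite (gauss_curvature_eq0 oO my zc).
have E3 : entropy_val Y z c' p l v = entropy_val Y w' c' p l v.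
  exact: (entropy_jets l2 oz oc' zp cp' oO zc my bY ow' oc' wp' cp' oW Wp mw bw (fun _ _ _ _ => erefl)).
exact: (etrans E1 (etrans E2 E3)).
Qed.

(** [del_z] of the real part of a holomorphic function is half its complex derivative, so [A] acts
    on [phi] as it acts on the lift. *)
Lemma lift_transform (M : surface R) (X : M -> E3) (Xt : M -> 'cV[C]_3) (A : 'M[C]_3) (c : C) :
  minimal_immersion X -> holomorphic_null_lift X Xt -> c != 0 -> A^T *m A = c%:M ->
  same_entropy_differentials X (fun p => map_mx (@complex.Re R) (A *m Xt p)).
Proof.
move=> minX [XRe Xhol _ _] c0 AA; apply: (transform_same minX) => z hz; exists A, c.
have oO := @chart_cod_open R M z.
have xE k : (fun v => in_chart X z v k 0) = (fun v => complex.Re (Xt (chart_inv z v) k 0)).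
  by apply/funext => v; rewrite /in_chart /= XRe mxE.
(* The real part of each component of the lift is a coordinate function of [X], hence smooth; with
   complex differentiability this makes the component holomorphic. *)
have hF k : hol (chart_cod z) (fun v => Xt (chart_inv z v) k 0).
  apply: (holomorphic_smooth oO); first by move=> u zu; exact: Xhol.
  by rewrite -xE; exact: (smooth_in_chart minX k hz.1).
have yE k : (fun v => in_chart (fun p => map_mx (@complex.Re R) (A *m Xt p)) z v k 0) =
    (fun v => complex.Re (\sum_j A k j * Xt (chart_inv z v) j 0)).
  by apply/funext => v; rewrite /in_chart /= mxE mxE.
have hG k := hol_lin (A k) oO hF.
split=> //.
  by move=> k; rewrite yE; exact: (hG k).1.1.1.
move=> u k zu; rewrite /phi yE (del_z_Re_hol oO (hG k).1 zu) (hG k).2 //.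
rewrite mulr_suml; apply: eq_bigr => j _; rewrite -mulrA; congr (_ * _).
by rewrite xE (del_z_Re_hol oO (hF j) zu).
Qed.

Lemma associated_same (M : surface R) (X : M -> E3) (Xt : M -> 'cV[C]_3) theta :
  minimal_immersion X -> holomorphic_null_lift X Xt -> same_entropy_differentials X (associated Xt theta).
Proof.
move=> minX lift; pose e := (cos theta +i* sin theta)%C : C.
have e0 : e != 0.
  rewrite eq_complex /= negb_and; have := cos2Dsin2 theta.
  have [->|//] := eqVneq (cos theta) 0; have [->|//] := eqVneq (sin theta) 0.
  by rewrite expr0n addr0 => /esym/eqP; rewrite oner_eq0.
have -> : associated Xt theta = (fun p => map_mx (@complex.Re R) (e%:M *m Xt p)).
  by apply/funext => p; rewrite mul_scalar_mx.
apply: (lift_transform minX lift (c := e * e)); first exact: mulf_neq0.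
by rewrite tr_scalar_mx -scalar_mxM.
Qed.

Lemma goursat_same (M : surface R) (X : M -> E3) (Xt : M -> 'cV[C]_3) (B : 'M[C]_3) :
  minimal_immersion X -> holomorphic_null_lift X Xt -> B *m B^T = 1%:M -> same_entropy_differentials X (goursat Xt B).
Proof.
move=> minX lift BB; apply: (lift_transform minX lift (c := 1)); first exact: oner_neq0.
exact: mulmx1C.
Qed.

Lemma scale_same (M : surface R) (X : M -> E3) (k : R) :
  minimal_immersion X -> k != 0 -> same_entropy_differentials X (fun p => k *: X p).
Proof.
move=> minX k0; apply: (transform_same minX) => z hz.
have oO := @chart_cod_open R M z; have sx j := smooth_in_chart minX j hz.1.
have yE j : (fun v => in_chart (fun p => k *: X p) z v j 0) = (fun v => k * in_chart X z v j 0).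
  by apply/funext => v; rewrite /in_chart /= mxE.
have kc : (k%:C)%C != 0 :> C by rewrite fmorph_eq0.
exists ((k%:C)%C)%:M, ((k%:C)%C * (k%:C)%C); split.
- exact: mulf_neq0.
- by rewrite tr_scalar_mx -scalar_mxM.
- by move=> j; rewrite yE; exact: (smoothM oO (smooth_cst oO k) (sx j)).
move=> u j zu; rewrite (bigD1 j) //= mxE eqxx mulr1n big1 ?addr0; last first.
  by move=> m mj; rewrite mxE eq_sym (negbTE mj) mulr0n mul0r.
rewrite /phi yE; have -> : real_fun (fun v => k * in_chart X z v j 0) =
    (fun v => (k%:C)%C * real_fun (fun v => in_chart X z v j 0) v).
  by apply/funext => v; rewrite /real_fun rmorphM.
have d := has_dz_self (diffC_real (smooth_diff oO (sx j) zu)).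
by rewrite (has_dz_val (has_dzM (has_dz_cst (k%:C)%C u) d)) mul0r add0r.
Qed.

End Surfaces.

Unset Implicit Arguments.
Set Strict Implicit.
Set Printing Implicit Defensive.

Theorem theorem1p1 (R : realType) (M : surface R) (X : M -> 'cV[R]_3)
  (minX : minimal_immersion X) (nonflatX : nonflat X) :
  (forall (l : nat) (z : chart R M) (p : M), (2 <= l)%N ->
     hol_coord X z -> chart_dom z p ->
     (~ umbilic X p ->
        holomorphic_at (entropy (in_chart X z) l) (chart_map z p)) /\
     (umbilic X p ->
        has_pole [set u | ~ umbilic X (chart_inv z u)]
          (entropy (in_chart X z) l) (chart_map z p) l)) /\
  ((forall (l : nat) (N : surface R) (Y : N -> 'cV[R]_3)
      (c : chart R M) (d : chart R N) (p : M) (q : N), (2 <= l)%N ->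
      minimal_immersion Y -> ~ umbilic X p -> ~ umbilic Y q ->
      oriented_chart c -> chart_dom c p -> oriented_chart d -> chart_dom d q ->
      same_metric_jet X Y c d p q (l + 4) ->
      entropy_agree X Y c d p q l) /\
   (forall Xt : M -> 'cV[R[i]]_3, holomorphic_null_lift X Xt ->
      forall theta : R,
        same_entropy_differentials X (associated Xt theta))) /\
  (forall Xt : M -> 'cV[R[i]]_3, holomorphic_null_lift X Xt ->
     forall B : 'M[R[i]]_3, B *m B^T = 1%:M -> \det B = 1 ->
       same_entropy_differentials X (goursat Xt B)) /\
  (forall k : R, k != 0 ->
     same_entropy_differentials X (fun p => k *: X p)).
Proof.
split; [move=> l z p l2 hz zp; split | split; [split | split]].
- exact: entropy_holomorphic.
- exact: entropy_has_pole.
- move=> l N Y c d p q l2 minY nuX nuY oc cp od dq J z w hz zp hw wq v.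
  have bX : beta (in_chart X z) (chart_map z p) != 0.
    by apply/eqP => b; apply: nuX; apply/(umbilic_beta minX hz zp).
  have bY : beta (in_chart Y w) (chart_map w q) != 0.
    by apply/eqP => b; apply: nuY; apply/(umbilic_beta minY hw wq).
  exact: (entropy_jets l2 hz.1 oc zp cp (@chart_cod_open R M z) (chart_cod_map zp) (hol_coord_iso_min minX hz) bX
    hw.1 od wq dq (@chart_cod_open R N w) (chart_cod_map wq) (hol_coord_iso_min minY hw) bY J).
- by move=> Xt lift theta; exact: associated_same.
- by move=> Xt lift B BB _; exact: (goursat_same minX lift BB).
- by move=> k k0; exact: scale_same.
Qed.
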